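(* There exist choices of $\pm\sqrt{\cdot}$ such that $$\overline{\mathsf V}^{\mathrm{DT}}_{\mu_1\mu_2\mu_3\mu_4}(q)=\overline{\mathsf V}^{\mathrm{PT}_0}_{\mu_1\mu_2\mu_3\mu_4}(q)\,\mathsf V^{\mathrm{DT}}_{\varnothing\varnothing\varnothing\varnothing}(q)$$ holds modulo $q^N$ in the following cases (in (1)--(10), unlisted $\lambda_{ab}$ are $\varnothing$ and $\boldsymbol\mu=\boldsymbol\mu^{\boldsymbol\lambda}$; in (11)--(13), unlisted $\mu_a$ are $\varnothing$): (1) $\lambda_{12}=1$, $N=4$; (2) $\lambda_{12}=1+t_3$, $N=3$; (3) $\lambda_{12}=1+t_3+t_4$, $N=3$; (4) $\lambda_{12}=\lambda_{13}=1$, $N=3$; (5) $\lambda_{12}=\lambda_{34}=1$, $N=3$; (6) $\lambda_{12}=\lambda_{13}=\lambda_{23}=1$, $N=3$; (7) $\lambda_{ab}=1$ for all $a<b$, $N=3$; (8) $\lambda_{12}=\lambda_{34}=\lambda_{23}=1$, $N=3$; (9) $\lambda_{12}=1+t_4$, $\lambda_{13}=\lambda_{34}=1$, $N=3$; (10) $\lambda_{12}=1+t_3$, $\lambda_{34}=1$, $N=3$; (11) $\mu_1=\frac1{1-t_2}+t_3$, $\mu_2=\frac1{1-t_1}$, $N=4$; (12) $\mu_1=\frac1{1-t_2}+t_3+t_2t_3$, $\mu_2=\frac1{1-t_1}$, $N=3$; (13) $\mu_1=\frac1{1-t_2}+t_3+t_3^2$, $\mu_2=\frac1{1-t_1}$,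 $N=3$; (14) $\mu_1=\frac1{1-t_2}$, $\mu_2=\frac1{1-t_1}$, $\mu_3=1$, $\mu_4=\varnothing$, $N=3$; (15) $\mu_1=\frac1{1-t_2}+t_3$, $\mu_2=\frac1{1-t_1}+t_4$, $\mu_3=1$, $\mu_4=\varnothing$, $N=2$.
   Context: **Box data on $\mathbb{C}^4$.** Solid (resp. plane, ordinary) partitions are subsets of $\mathbb{Z}^4_{\ge0}$ (resp. $\mathbb{Z}^3_{\ge0}$, $\mathbb{Z}^2_{\ge0}$) closed under decreasing coordinates. They are written as generating functions $\sum_{w}t^w$: a plane partition $\mu_a$ uses the variables $t_b$, $b\ne a$, and a finite partition $\lambda_{ab}$ uses $t_c,t_d$ with $\{a,b,c,d\}=\{1,2,3,4\}$. A solid partition $\pi$ corresponds to the monomial subscheme $Z_\pi\subset\mathbb{C}^4$ with basis $x^w$, $w\in\pi$, of $\mathcal{O}_{Z_\pi}$; similarly in other dimensions. Given finite partitions $\boldsymbol\lambda=\{\lambda_{ab}\}_{a<b}$ (with $\lambda_{ba}=\lambda_{ab}$), $\boldsymbol\mu^{\boldsymbol\lambda}=(\mu_1^{\boldsymbol\lambda},\dots,\mu_4^{\boldsymbol\lambda})$ is the minimal choice of plane partitions with these asymptotics: $\mu_a^{\boldsymbol\lambda}$ is the union over $b\ne a$ of $\{w:(w_c,w_d)\in\lambda_{ab},\ w_b\ge0\}$. Given compatible plane partitions $\boldsymbol\mu$ (each of dimension $\le1$), $Z_{\boldsymbol\mu}\subset\mathbb{C}^4$ is the unique $(\mathbb{C}^*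 )^4$-invariant closed subscheme of dimension $\le2$ without 0-dimensional (embedded or isolated) components with $\mathcal{O}_{Z_{\boldsymbol\mu}}|_{x_a\ne0}=\mathcal{O}_{Z_{\mu_a}}[x_a^{\pm1}]$ for all $a$. $\mathcal P_{\boldsymbol\mu}$ is the set of solid partitions $\pi$ such that the maximal subscheme of $Z_\pi$ without 0-dimensional components is $Z_{\boldsymbol\mu}$. $\mathcal B^{(0)}_{\boldsymbol\mu}$ is the set of finitely generated $(\mathbb{C}^* )^4$-invariant submodules $B\subset\varinjlim_r\mathcal{H}om(\mathfrak m^r,\mathcal{O}_{Z_{\boldsymbol\mu}})/\mathcal{O}_{Z_{\boldsymbol\mu}}$, $\mathfrak m\subset\mathcal O_{Z_{\boldsymbol\mu}}$ the ideal of the origin. **Vertex.** Characters are rational functions in $t_1,\dots,t_4$ (torus acting by $x_i\mapsto t_ix_i$), $\overline{(\cdot)}$ inverts $t_i$ and $y$, $P_I=\prod_{i\in I}(1-t_i)$, and $i,j,k,l$ are distinct. For $\pi\in\mathcal P_{\boldsymbol\mu}$ let $\mathsf Z$ be the character of $\mathcal{O}_{Z_\pi}$; for $B\in\mathcal B^{(0)}_{\boldsymbol\mu}$ let $\mathsf Z$ be the character of $\mathcal{O}_{Z_{\boldsymbol\mu}}$ plus that of $B$. In both cases $\mathsf Z_i$ is the character of the module $N_i$ with $\mathcal{O}_{Z_{\boldsymbol\mu}}|_{x_i\ne0}=N_i\otimes\mathbb{C}[x_i^{\pm1}]$, and $\mathsf Z_{ij}$ that of $N_{ij}$ with $\mathcal{O}_{Z_{\boldsymbol\mu}}|_{x_ix_j\ne0}=N_{ij}\otimes\mathbb{C}[x_i^{\pm1},x_j^{\pm1}]$.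 Put $$W=\mathsf Z-\sum_i\frac{\mathsf Z_i}{1-t_i}+\sum_{i<j}\frac{\mathsf Z_{ij}}{(1-t_i)(1-t_j)},\qquad|W|:=W|_{t=1},$$ $$\mathsf A_i=-\mathsf Z_i+\tfrac{\overline{\mathsf Z}_i}{t_jt_kt_l}-\tfrac{P_{jkl}}{t_jt_kt_l}\mathsf Z_i\overline{\mathsf Z}_i,\quad\mathsf A_{ij}=\mathsf Z_{ij}+\tfrac{\overline{\mathsf Z}_{ij}}{t_kt_l}-\tfrac{P_{kl}}{t_kt_l}\mathsf Z_{ij}\overline{\mathsf Z}_{ij},$$ $$\mathsf V=\mathsf Z+\tfrac{\overline{\mathsf Z}}{t_1t_2t_3t_4}-\tfrac{P_{1234}}{t_1t_2t_3t_4}\mathsf Z\overline{\mathsf Z}+\sum_i\tfrac{\mathsf A_i}{1-t_i}+\sum_{i<j}\tfrac{\mathsf A_{ij}}{(1-t_i)(1-t_j)},\qquad\widetilde{\mathsf V}=\mathsf V-y\overline W-y^{-1}W.$$ These are Laurent polynomials, considered modulo $t_1t_2t_3t_4=1$. With $[\cdot]$ the multiplicative extension to virtual characters of $[\chi]=\chi^{1/2}-\chi^{-1/2}$, $$\mathsf V^{\mathrm{DT}}_{\mu_1\mu_2\mu_3\mu_4}(q)=\sum_{\pi\in\mathcal P_{\boldsymbol\mu}}\pm\sqrt{(-1)^{\mathrm{rk}\widetilde{\mathsf V}/2}[-\widetilde{\mathsf V}]}\;q^{|W|},\qquad \mathsf V^{\mathrm{PT}_0}_{\mu_1\mu_2\mu_3\mu_4}(q)=\sum_{B\in\mathcal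 B^{(0)}_{\boldsymbol\mu}}\pm\sqrt{(-1)^{\mathrm{rk}\widetilde{\mathsf V}/2}[-\widetilde{\mathsf V}]}\;q^{|W|},$$ depending on a choice of square root with sign for each summand. $\overline{\mathsf V}^{\mathrm{DT}}$, $\overline{\mathsf V}^{\mathrm{PT}_0}$ denote these Laurent series in $q$ divided by their leading term (which is the same for both), so that they start with $1$. For $\boldsymbol\mu=\varnothing$ the choices are fixed so that $$\mathsf V^{\mathrm{DT}}_{\varnothing\varnothing\varnothing\varnothing}(q)=\mathrm{Exp}\left(\frac{[t_1t_2][t_1t_3][t_2t_3][y]}{[t_1][t_2][t_3][t_4][y^{1/2}q][y^{1/2}q^{-1}]}\right),$$ where $\mathrm{Exp}(f(p;q))=\exp(\sum_{n\ge1}\frac1nf(p^n;q^n))$ and the argument is expanded as a power series in $q$. *)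

(* Defs.v *)
From HB Require Import structures.
From mathcomp Require Import all_boot all_order all_algebra.
From mathcomp Require Import boolp classical_sets functions cardinality.
From mathcomp Require Import fsbigop reals.
From mathcomp Require Import complex mpoly.

Set Implicit Arguments.
Unset Strict Implicit.
Unset Printing Implicit Defensive.

Import Order.TTheory GRing.Theory Num.Theory.

Local Open Scope ring_scope.
Local Open Scope classical_set_scope.

(* The coordinates 1, ..., 4 of the text are 0, ..., 3 in 'I_4.               *)
Definition i1 : 'I_4 := @Ordinal 4 0 isT.
Definition i2 : 'I_4 := @Ordinal 4 1 isT.
Definition i3 : 'I_4 := @Ordinal 4 2 isT.
Definition i4 : 'I_4 := @Ordinal 4 3 isT.

(* A box is an exponent w : 'X_{1..4}.  A partition in the variables t_i,     *)
(* i \notin J, is a set of boxes w with w_i = 0 for i \in J.  Thus a solid    *)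
(* partition, a plane partition mu_a and a partition lambda_ab all have type  *)
(* [set box], with J = set0, [set a] and [set a; b] respectively.             *)
Notation box := 'X_{1..4}.

Definition mone : box := 0%MM.
Definition t1 : box := U_(i1)%MM.
Definition t2 : box := U_(i2)%MM.
Definition t3 : box := U_(i3)%MM.
Definition t4 : box := U_(i4)%MM.

Definition boxes (l : seq box) : set box := [set w | w \in l].

(* 1 / (1 - t_i) *)
Definition ray (i : 'I_4) : set box := [set w : box | exists n, w = (U_(i) *+ n)%MM].

Definition is_partition (p : set box) : Prop :=
  forall w v : box, p w -> (v <= w)%MM -> p v.

Definition erase (J : {set 'I_4}) (w : box) : box :=
  [multinom (if i \in J then 0%N else w i) | i < 4].

Definition cylinder (J : {set 'I_4}) (p : set box) : set box :=
  [set w | p (erase J w)].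

Definition legs (l12 l13 l14 l23 l24 l34 : seq box) (a b : 'I_4) : set box :=
  boxes (match minn a b, maxn a b with
         | 0, 1 => l12 | 0, 2 => l13 | 0, 3 => l14
         | 1, 2 => l23 | 1, 3 => l24 | 2, 3 => l34
         | _, _ => [::]
         end)%N.

Definition mu_min (lam : 'I_4 -> 'I_4 -> set box) (a : 'I_4) : set box :=
  [set w : box | w a = 0%N /\
           exists2 b, b != a & cylinder [set a; b]%SET (lam a b) w].

Definition planes (m1 m2 m3 m4 : set box) (a : 'I_4) : set box :=
  nth set0 [:: m1; m2; m3; m4] a.

Definition mu_empty (a : 'I_4) : set box := set0.

(* t^w, for a weight w and a point t of the torus over any field              *)
Definition tmon (F : fieldType) (t : 'I_4 -> F) (w : 'rV[int]_4) : F :=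
  \prod_i t i ^ w 0 i.

Section Schemes.
Variable R : realType.
Local Notation S := {mpoly R[i][4]}.

Definition is_ideal (I : set S) : Prop :=
  [/\ I 0, forall f g, I f -> I g -> I (f + g) & forall a f, I f -> I (a * f)].

(* The ideal of Z_p: O_{Z_p} has basis x^w, w \in p.                          *)
Definition mono_ideal (p : set box) : set S :=
  [set f | forall w, w \in msupp f -> ~ p w].

(* A 0-dimensional (isolated or embedded) component is an associated prime    *)
(* (I : f) of S/I which is the ideal of a closed point v of C^4.              *)
Definition no_point_component (I : set S) : Prop :=
  forall (f : S) (v : 'I_4 -> R[i]), ~ (forall g : S, I (g * f) <-> g.@[v] = 0).

(* J is the ideal of the maximal subscheme without 0-dimensional components   *)
(* of the scheme with ideal I; larger subschemes have smaller ideals.         *)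
Definition max_pure_subscheme (I J : set S) : Prop :=
  [/\ is_ideal J, I `<=` J, no_point_component J &
      forall J', is_ideal J' -> I `<=` J' -> no_point_component J' ->
                 J `<=` J'].

(* Contraction to S of the ideal I[x_i^-1, i \in J].  Ideals of the           *)
(* localization are determined by their contractions.                         *)
Definition localized_ideal (J : {set 'I_4}) (I : set S) : set S :=
  [set f | exists n, I ((\prod_(i in J) 'X_i) ^+ n * f)].

(* The partition of N_J, where O_{Z_p} restricted to the locus where x_i <> 0 *)
(* for i \in J is N_J (x) C[x_i^{+-1}, i \in J]: its boxes are the monomials  *)
(* in the remaining variables which do not vanish in the localization.        *)
Definition loc_part (J : {set 'I_4}) (p : set box) : set box :=
  [set w : box | (forall i, i \in J -> w i = 0%N) /\
           ~ localized_ideal J (mono_ideal p) 'X_[w]].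

(* The support of Z_p is the union of the coordinate subspaces C^J with       *)
(* C^J \subset Z_p.                                                           *)
Definition dim_le (d : nat) (p : set box) : Prop :=
  forall J : {set 'I_4},
    (forall w : box, (forall i, i \notin J -> w i = 0%N) -> p w) ->
    (#|J| <= d)%N.

Definition is_Zmu (mu : 'I_4 -> set box) (p : set box) : Prop :=
  [/\ is_partition p, dim_le 2 p, no_point_component (mono_ideal p) &
      forall a, localized_ideal [set a]%SET (mono_ideal p) =
                mono_ideal (cylinder [set a]%SET (mu a))].

(* The solid partition of Z_mu, which is unique if it exists, i.e. if mu is   *)
(* compatible.                                                                *)
Definition Zmu (mu : 'I_4 -> set box) : set box := xget set0 (is_Zmu mu).

Definition Imu (mu : 'I_4 -> set box) : set S := mono_ideal (Zmu mu).

Definition DTset (mu : 'I_4 -> set box) : set (set box) :=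
  [set p | is_partition p /\ max_pure_subscheme (mono_ideal p) (Imu mu)].

Section Module.
Variable I : set S.

Definition mpower (r : nat) : set S :=
  [set f | forall w, w \in msupp f -> (r <= mdeg w)%N].

(* phi represents an element of Hom(m^r, S/I), where m^r is an ideal of S/I;  *)
(* its values off m^r are irrelevant.                                         *)
Definition is_hom (r : nat) (phi : S -> S) : Prop :=
  (forall a f g, mpower r f -> mpower r g ->
     I (phi (a * f + g) - (a * phi f + phi g))) /\
  (forall f, mpower r f -> I f -> I (phi f)).

(* M := lim_r Hom(m^r, S/I) / (S/I) is presented as the quotient of [homs] by *)
(* [null_homs], the phi which agree modulo I on some m^r with multiplication  *)
(* by an element of S.                                                        *)
Definition homs : set (S -> S) := [set phi | exists r, is_hom r phi].

Definition null_homs : set (S -> S) :=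
  [set phi | exists r g, forall f, mpower r f -> I (phi f - g * f)].

Definition torus_poly (tau : 'I_4 -> R[i]) (f : S) : S :=
  f \mPo [tuple tau i *: 'X_i | i < 4].

Definition torus_hom (tau : 'I_4 -> R[i]) (phi : S -> S) : S -> S :=
  fun f => torus_poly tau (phi (torus_poly (fun i => (tau i)^-1) f)).

(* Submodules of M, as submodules of [homs] containing [null_homs].           *)
Definition is_submodule (B : set (S -> S)) : Prop :=
  [/\ B `<=` homs, null_homs `<=` B,
      forall phi psi, B phi -> B psi -> B (fun f => phi f + psi f) &
      forall a phi, B phi -> B (fun f => a * phi f)].

Definition torus_invariant (B : set (S -> S)) : Prop :=
  forall tau phi, (forall i, tau i != 0) -> B phi -> B (torus_hom tau phi).

Definition finitely_generated (B : set (S -> S)) : Prop :=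
  exists n (b : 'I_n -> S -> S), (forall k, B (b k)) /\
    forall phi, B phi -> exists a : 'I_n -> S,
      null_homs (fun f => phi f - \sum_k a k * b k f).

Definition weight_space (B : set (S -> S)) (w : 'rV[int]_4) : set (S -> S) :=
  [set phi | B phi /\ forall tau, (forall i, tau i != 0) ->
     null_homs (fun f => torus_hom tau phi f - tmon tau w *: phi f)].

(* The dimension of the weight space of the image of B in M.                  *)
Definition has_weight_dim (B : set (S -> S)) (w : 'rV[int]_4) (d : nat) :=
  exists b : 'I_d -> S -> S,
    [/\ forall k, weight_space B w (b k),
        forall c : 'I_d -> R[i],
          null_homs (fun f => \sum_k c k *: b k f) -> forall k, c k = 0 &
        forall phi, weight_space B w phi -> exists c : 'I_d -> R[i],
          null_homs (fun f => phi f - \sum_k c k *: b k f)].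

Definition weight_dim (B : set (S -> S)) (w : 'rV[int]_4) : nat :=
  xget 0%N (has_weight_dim B w).

End Module.

Definition PTset (mu : 'I_4 -> set box) : set (set (S -> S)) :=
  [set B | [/\ is_submodule (Imu mu) B, torus_invariant B &
               finitely_generated (Imu mu) B]].

End Schemes.

(* Q(t_1, ..., t_4, y); y is the last variable.                               *)
Notation ratfun := {fraction {mpoly rat[5]}}.
Definition tvar (i : 'I_4) : ratfun := tofrac 'X_(lshift 1 i).
Definition yvar : ratfun := tofrac 'X_(rshift 4 ord0).

(* Q(t_1^{1/2}, t_2^{1/2}, t_3^{1/2}, y^{1/2}), the field of the coefficients *)
(* of the vertices, where t_1^{1/2} t_2^{1/2} t_3^{1/2} t_4^{1/2} = 1; the    *)
(* last variable is y^{1/2}.                                                  *)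
Notation halffun := {fraction {mpoly rat[4]}}.
Definition thalf (i : 'I_4) : halffun :=
  if i == i4 then (tofrac ('X_i1 * 'X_i2 * 'X_i3))^-1 else tofrac 'X_i.
Definition yhalf : halffun := tofrac 'X_i4.

(* A character is kept as a function of t, so that its conjugate is obtained  *)
(* by evaluation at [tinv t].                                                 *)
Definition tinv (t : 'I_4 -> ratfun) (i : 'I_4) : ratfun := (t i)^-1.
Notation rchar := (('I_4 -> ratfun) -> ratfun).

(* Coefficients of (1 - t_1) ... (1 - t_4) \sum_w m(w) t^w.  For the modules  *)
(* considered here this is a Laurent polynomial.                              *)
Definition char_num (m : 'rV[int]_4 -> int) (w : 'rV[int]_4) : int :=
  \sum_(J : {set 'I_4}) (-1) ^+ #|J| * m (w - \row_i (i \in J)%:Z).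

(* The rational function with expansion \sum_w m(w) t^w.                      *)
Definition char_of (m : 'rV[int]_4 -> int) : rchar := fun t =>
  (\sum_(w \in [set: 'rV[int]_4]) (char_num m w)%:~R * tmon t w) /
  \prod_i (1 - t i).

Definition part_mult (p : set box) (w : 'rV[int]_4) : int :=
  `[< exists2 v : box, p v & w = \row_i (v i)%:Z >]%:Z.

(* zeta set0, zeta [set i] and zeta [set i; j] are Z, Z_i and Z_ij.           *)
Definition zetaDT (R : realType) (mu : 'I_4 -> set box) (p : set box)
    (J : {set 'I_4}) : rchar :=
  if J == finset.set0 then char_of (part_mult p)
  else char_of (part_mult (loc_part R J (Zmu R mu))).

Definition zetaPT (R : realType) (mu : 'I_4 -> set box)
    (B : set ({mpoly R[i][4]} -> {mpoly R[i][4]})) (J : {set 'I_4}) : rchar :=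
  if J == finset.set0 then fun t =>
    char_of (part_mult (Zmu R mu)) t +
    char_of (fun w => (weight_dim (Imu mu) B w)%:Z) t
  else char_of (part_mult (loc_part R J (Zmu R mu))).

Section Vertex.
Variable zeta : {set 'I_4} -> rchar.

Definition Wchar : rchar := fun t =>
  zeta finset.set0 t
  - \sum_i zeta [set i]%SET t / (1 - t i)
  + \sum_(i < 4) \sum_(j < 4 | (i < j)%N)
      zeta [set i; j]%SET t / ((1 - t i) * (1 - t j)).

(* A_i and A_ij for J = [set i] and J = [set i; j]; for J = set0 these are    *)
(* the first three terms of V.                                                *)
Definition Achar (J : {set 'I_4}) : rchar := fun t =>
  (-1) ^+ #|J| * zeta J t
  + zeta J (tinv t) / (\prod_(k in ~: J) t k)
  - (\prod_(k in ~: J) (1 - t k)) / (\prod_(k in ~: J) t k)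
    * zeta J t * zeta J (tinv t).

Definition Vchar : rchar := fun t =>
  Achar finset.set0 t
  + \sum_i Achar [set i]%SET t / (1 - t i)
  + \sum_(i < 4) \sum_(j < 4 | (i < j)%N)
      Achar [set i; j]%SET t / ((1 - t i) * (1 - t j)).

Definition Vtilde : ratfun :=
  Vchar tvar - yvar * Wchar (tinv tvar) - yvar^-1 * Wchar tvar.

End Vertex.

(* (w, e) stands for t^w y^e.                                                 *)
Notation laurent := ('rV[int]_4 * int -> int).

Definition is_laurent (f : ratfun) (c : laurent) : Prop :=
  finite_set [set x | c x != 0] /\
  f = \sum_(x \in [set: 'rV[int]_4 * int])
        (c x)%:~R * (tmon tvar x.1 * yvar ^ x.2).

(* The coefficients of a Laurent polynomial.                                  *)
Definition lcoef (f : ratfun) : laurent := xget (fun=> 0) (is_laurent f).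

(* The value at t = 1 and y = 1.                                              *)
Definition lrank (c : laurent) : int :=
  \sum_(x \in [set: 'rV[int]_4 * int]) c x.

Definition Wsize (zeta : {set 'I_4} -> rchar) : int :=
  lrank (lcoef (Wchar zeta tvar)).

(* [t^w y^e], with s_i = t_i^{1/2} and u = y^{1/2}                            *)
Definition br (s : 'I_4 -> halffun) (u : halffun) (x : 'rV[int]_4 * int) :
    halffun :=
  tmon s x.1 * u ^ x.2 - (tmon s x.1 * u ^ x.2)^-1.

(* Modulo t_1 t_2 t_3 t_4 = 1 each character has a unique representative t^w  *)
(* with w_4 = 0.  Multiplicities are collected over the classes before the    *)
(* bracket is applied.  Since [1] = 0, a negative multiplicity of the trivial *)
(* character, where the bracket is undefined, gives 0 here.                   *)
Definition bracket (c : laurent) : halffun :=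
  \big[*%R/1]_(x \in [set x : 'rV[int]_4 * int | x.1 0 i4 = 0])
    br thalf yhalf x ^
      (\sum_(k \in [set: int]) c (x.1 + const_mx 1 *~ k, x.2)).

Definition radicand (zeta : {set 'I_4} -> rchar) : halffun :=
  let c := lcoef (Vtilde zeta) in
  (-1) ^ (lrank c %/ 2)%Z * bracket (fun x => - c x).

Section Sums.
Variables (T : choiceType) (A : set T) (zeta : T -> {set 'I_4} -> rchar).

(* s is a choice of square root, with sign, for each summand.                 *)
Definition sqrt_choice (s : T -> halffun) : Prop :=
  forall x, A x -> s x ^+ 2 = radicand (zeta x).

(* The coefficient of q^n.  The sum is meant for finitely many nonzero terms  *)
(* (it is 0 otherwise).                                                       *)
Definition vertex (s : T -> halffun) (n : int) : halffun :=
  \sum_(x \in [set x | A x /\ Wsize (zeta x) = n]) s x.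

End Sums.

Definition lead_exp (v : int -> halffun) : int :=
  xget 0 [set n | v n != 0 /\ forall m, m < n -> v m = 0].

(* The quotient of a Laurent series in q by its leading term.                 *)
Definition normalized (v : int -> halffun) (n : nat) : halffun :=
  v (lead_exp v + n%:Z) / v (lead_exp v).

(* Power series in q are coefficient sequences.                               *)
Notation pseries := (nat -> halffun).

Definition smul (a b : pseries) : pseries :=
  fun n => \sum_(k < n.+1) a k * b (n - k)%N.
Definition sone : pseries := fun n => (n == 0%N)%:R.
Definition spow (a : pseries) (k : nat) : pseries := iter k (smul a) sone.

(* 1/a for a_0 <> 0, as the geometric series in 1 - a/a_0.                    *)
Definition sinv (a : pseries) : pseries := fun n =>
  (a 0%N)^-1 * \sum_(k < n.+1) spow (fun m => sone m - a m / a 0%N) k n.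

(* exp(a) for a_0 = 0                                                         *)
Definition sexp (a : pseries) : pseries := fun n =>
  \sum_(k < n.+1) spow a k n / (k`!)%:R.

(* Exp(f) for f(p^k; q) = f k, f k 0 = 0: the coefficient of q^n in           *)
(* \sum_k 1/k f(p^k; q^k) is the sum over k | n of 1/k f k (n/k).             *)
Definition plethystic_exp (f : nat -> pseries) : pseries :=
  sexp (fun n => \sum_(1 <= k < n.+1 | (k %| n)%N) k%:R^-1 * f k (n %/ k)%N).

(* The argument of Exp, with s_i = t_i^{1/2} and u = y^{1/2}, expanded in q.  *)
(* Here [y^{1/2} q] [y^{1/2} q^-1] = y^{1/2} + y^{-1/2} - q - q^-1, so that   *)
(* its inverse is q / (-1 + (y^{1/2} + y^{-1/2}) q - q^2).                    *)
Definition magnificent_arg (s : 'I_4 -> halffun) (u : halffun) : pseries :=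
  let e i : 'rV[int]_4 := delta_mx 0 i in
  let pref := br s u (e i1 + e i2, 0) * br s u (e i1 + e i3, 0)
              * br s u (e i2 + e i3, 0) * br s u (0, 1)
              / \prod_i br s u (e i, 0) in
  smul (fun n => pref * (n == 1%N)%:R)
       (sinv (nth 0 [:: -1; u + u^-1; -1])).

Definition magnificent_series : pseries :=
  plethystic_exp (fun k => magnificent_arg (fun i => thalf i ^+ k) (yhalf ^+ k)).

Section Correspondence.
Variable R : realType.

Definition VDT (mu : 'I_4 -> set box) (s : set box -> halffun) :
    int -> halffun :=
  vertex (DTset R mu) (zetaDT R mu) s.

Definition VPT (mu : 'I_4 -> set box)
    (s : set ({mpoly R[i][4]} -> {mpoly R[i][4]}) -> halffun) :
    int -> halffun :=
  vertex (PTset mu) (zetaPT (R := R) mu) s.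

(* The correspondence modulo q^N, where V0 is the DT vertex of mu_empty.      *)
Definition DT_PT0_mod (V0 : int -> halffun) (mu : 'I_4 -> set box) (N : nat) :
    Prop :=
  exists (sDT : set box -> halffun)
         (sPT : set ({mpoly R[i][4]} -> {mpoly R[i][4]}) -> halffun),
    [/\ sqrt_choice (DTset R mu) (zetaDT R mu) sDT,
        sqrt_choice (PTset mu) (zetaPT (R := R) mu) sPT &
        forall n : nat, (n < N)%N ->
          normalized (VDT mu sDT) n =
          smul (normalized (VPT mu sPT)) (fun k => V0 k%:Z) n].

End Correspondence.

(* Main.v *)
(* Z_mu is a disjoint union of coordinate orthants.  A point of P_mu is Z_mu
   with finitely many boxes added, and a point of B^(0)_mu is a finite set of
   weights of H^1_m(O_{Z_mu}) closed under the action of the x_i: the weight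
   spaces are read off from the connected components of the far part of Z_mu
   seen in a given weight, and here they have dimension at most 1.  Modulo q^N
   both vertices thus are sums over finite sets which can be enumerated.

   Each radicand is the square of a product of brackets [t^w y^e], so a summand
   is such a product up to sign, and for suitable signs the coefficient of q^n
   of the theorem becomes the vanishing of a sum of products of brackets.  Times
   y^{n/2} every term is a polynomial in y of degree at most n, so it suffices
   to take n + 1 values y = t^v; then many terms vanish, as [1] = 0.  The
   remaining rational functions of three variables are added up exactly, in an
   order in which cancellations keep the numerators small. *)
From Stdlib Require Import ZArith.
Require Import Defs.
From HB Require Import structures.
From mathcomp Require Import all_boot all_order all_algebra.
From mathcomp Require Import boolp classical_sets reals.
From mathcomp Require Import cardinality fsbigop functions.
From mathcomp Require Import complex mpoly.
From mathcomp Require Import ssrZ zify ring.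

Set Implicit Arguments.
Unset Strict Implicit.
Unset Printing Implicit Defensive.

Import Order.TTheory GRing.Theory Num.Theory.

Local Open Scope ring_scope.
Local Open Scope classical_set_scope.

(** Why a radicand is a square: with [Z_J] = q over the product of the 1 - t_i, i not in J, the term
    [A_J] becomes q + q' - q q' over the same product, up to sign, where q' is the conjugate of q.
    This is symmetric in q and q', so modulo t_1 t_2 t_3 t_4 = 1 [Vtilde] is invariant under
    conjugation, and the brackets of opposite characters, equal up to sign, pair up. Expanding the
    same expression shows that adding boxes to [Z_mu] changes V by an explicit Laurent polynomial.
    The characters of solid partitions and of submodules have one common shape, so this is done once
    for both.

    The obstacle is that the conditions on [Z_mu] and on the weights range over all of Z^4. They
    depend only on the weight clamped to [-1, K], where K exceeds all corners of the orthants, and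
    this leaves a finite computation.

    Signs, values of y, orders of summation and divisors are certificates. The computation only
    confirms them, and every division is confirmed by multiplying back, so the proof rests on these
    confirmations alone. *)

Notation zi := int_of_Z.

Lemma ziD a b : zi (Z.add a b) = zi a + zi b.
Proof. lia. Qed.
Lemma ziN a : zi (Z.opp a) = - zi a.
Proof. lia. Qed.
Lemma ziM a b : zi (Z.mul a b) = zi a * zi b.
Proof. lia. Qed.
Lemma zi_inj : injective zi.
Proof. exact: can_inj int_of_ZK. Qed.

(** * Laurent polynomials as lists, and sums over their terms *)

Notation key := (seq Z).
(* Laurent polynomials, as lists of exponents and coefficients in which exponents may be repeated. *)
Notation lau := (seq (key * Z)).

Fixpoint kadd (a b : key) : key :=
  match a, b with
  | x :: a', y :: b' => Z.add x y :: kadd a' b'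
  | [::], _ => b
  | _, [::] => a
  end.
Definition kneg (a : key) : key := map Z.opp a.
Definition kscale (n : Z) (a : key) : key := map (Z.mul n) a.

Fixpoint kcmp (a b : key) : comparison :=
  match a, b with
  | x :: a', y :: b' => match Z.compare x y with Eq => kcmp a' b' | r => r end
  | [::], [::] => Eq
  | [::], _ => Lt
  | _, [::] => Gt
  end.
Definition keqb (a b : key) : bool := match kcmp a b with Eq => true | _ => false end.

Lemma kcmpP a b : kcmp a b = Eq -> a = b.
Proof.
elim: a b => [|x a IH] [|y b] //=.
case: Z.compare (Z.compare_eq x y) => // /(_ erefl) -> /IH -> //.
Qed.

Lemma kcmpxx a : kcmp a a = Eq.
Proof. by elim: a => //= x a ->; rewrite Z.compare_refl. Qed.

Lemma keqbP a b : reflect (a = b) (keqb a b).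
Proof.
rewrite /keqb; case E: kcmp; constructor; first exact: kcmpP.
  by move=> eab; move: E; rewrite eab kcmpxx.
by move=> eab; move: E; rewrite eab kcmpxx.
Qed.

Fixpoint kmem (k : key) (l : seq key) : bool :=
  if l is k' :: l' then if keqb k k' then true else kmem k l' else false.

Lemma kmemE k l : kmem k l = (k \in l).
Proof.
elim: l => //= k' l ->; rewrite inE.
by case: keqbP => [->|/eqP/negPf ->]; rewrite ?eqxx.
Qed.

Definition lopp (l : lau) : lau := map (fun kc => (kc.1, Z.opp kc.2)) l.
Definition kshift (k : key) (l : lau) : lau := map (fun kc => (kadd k kc.1, kc.2)) l.
Definition lbar (l : lau) : lau := map (fun kc => (kneg kc.1, kc.2)) l.
Fixpoint lmul (a b : lau) : lau :=
  if a is (k, c) :: a' then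
    map (fun kc => (kadd k kc.1, Z.mul c kc.2)) b ++ lmul a' b
  else [::].

(** On lists with increasing keys this is addition with cancelled terms removed. The inner [fix]
    keeps the recursion structural although either list may shrink. *)
Fixpoint lmerge (a : lau) : lau -> lau :=
  fix aux (b : lau) : lau :=
  match a, b with
  | [::], _ => b
  | _, [::] => a
  | (k, c) :: a', (k', c') :: b' =>
    match kcmp k k' with
    | Lt => (k, c) :: lmerge a' b
    | Gt => (k', c') :: aux b'
    | Eq => match Z.add c c' with
            | Z0 => lmerge a' b'
            | d => (k, d) :: lmerge a' b'
            end
    end
  end.

Fixpoint lpairs (s : seq lau) : seq lau :=
  match s with
  | a :: b :: s' => lmerge a b :: lpairs s'
  | _ => s
  end.

(* A merge sort: 14 rounds suffice for 2^14 monomials; on longer lists the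
   result is still correct, but no longer collected. *)
Definition lnorm (l : lau) : lau :=
  flatten (ssrnat.iter 14 lpairs (map (fun x => [:: x]) l)).

Section Additive.
Variables (V : zmodType) (g : key -> V).

(** Values, single coefficients and the total of the coefficients all have this form for a suitable
    [g], so invariance under merging is proved once for all of them. *)
Definition suml (l : lau) : V := \sum_(kc <- l) g kc.1 *~ zi kc.2.

Lemma suml_nil : suml [::] = 0.
Proof. by rewrite /suml big_nil. Qed.
Lemma suml_cons k c l : suml ((k, c) :: l) = g k *~ zi c + suml l.
Proof. by rewrite /suml big_cons. Qed.
Lemma suml_cat a b : suml (a ++ b) = suml a + suml b.
Proof. by rewrite /suml big_cat. Qed.
Lemma suml_opp a : suml (lopp a) = - suml a.
Proof.
by elim: a => [|[k c] a IH]; rewrite /= ?suml_nil ?oppr0 // !suml_cons IH ziN mulrNz opprD.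
Qed.

Lemma suml_merge a b : suml (lmerge a b) = suml a + suml b.
Proof.
elim: a b => [|[k c] a IHa] b; first by case: b => [|[? ?] ?] /=; rewrite suml_nil ?add0r ?addr0.
elim: b => [|[k' c'] b IHb]; first by rewrite /= suml_nil addr0.
rewrite [lmerge _ _]/=; case E: (kcmp k k').
- have E' := kcmpP E; subst k'.
  have H d : d = Z.add c c' ->
    g k *~ zi d + (suml a + suml b) = suml ((k, c) :: a) + suml ((k, c') :: b).
    by move=> ->; rewrite ziD mulrzDr !suml_cons addrACA.
  case D: (Z.add c c') => [|p|p]; rewrite ?suml_cons IHa; last 2 first.
  + by rewrite -!suml_cons -(H (Z.pos p)).
  + by rewrite -!suml_cons -(H (Z.neg p)).
  by rewrite -!suml_cons -(H Z0) //= mulr0z add0r.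
- by rewrite suml_cons IHa (suml_cons k c) addrA.
rewrite suml_cons; move: IHb; rewrite [lmerge _ _]/= => ->.
by rewrite (suml_cons k' c') addrCA.
Qed.

Lemma suml_pairs s : suml (flatten (lpairs s)) = suml (flatten s).
Proof.
have [n] := ubnP (size s); elim: n s => // n IH [|a [|b s]] //= sz.
rewrite !suml_cat suml_merge IH ?addrA //; lia.
Qed.

Lemma suml_norm l : suml (lnorm l) = suml l.
Proof.
rewrite /lnorm; elim: 14%nat => [|n IH] /=; last by rewrite suml_pairs.
by elim: l => //= [[k c]] l IH; rewrite !suml_cons IH.
Qed.

Lemma suml_map (f : key -> key) l :
  suml (map (fun kc => (f kc.1, kc.2)) l) = \sum_(kc <- l) g (f kc.1) *~ zi kc.2.
Proof. by rewrite /suml big_map. Qed.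

End Additive.

Lemma suml_comp (V : zmodType) (g : key -> V) f l :
  suml g (map (fun kc => (f kc.1, kc.2)) l) = suml (g \o f) l.
Proof. by rewrite suml_map. Qed.

Lemma eq_suml (V : zmodType) (g g' : key -> V) l :
  g =1 g' -> suml g l = suml g' l.
Proof. by move=> e; apply: eq_bigr => kc _; rewrite e. Qed.

Definition coef (l : lau) (k : key) : int := suml (fun k' => (k' == k)%:R) l.
Definition total (l : lau) : int := suml (fun=> 1) l.

(** Collects repeated keys. The set [s] may be larger than the set of keys, for instance closed
    under negation. *)
Lemma suml_coef (V : zmodType) (g : key -> V) (l : lau) (s : seq key) :
  uniq s -> {subset map fst l <= s} ->
  suml g l = \sum_(k <- s) g k *~ coef l k.
Proof.
move=> us; elim: l => [|[k c] l IH] sub.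
  rewrite suml_nil big1 // => k _; rewrite /coef suml_nil mulr0z //.
rewrite suml_cons IH; last by move=> x xl; apply: sub; rewrite inE xl orbT.
have ks : k \in s by apply: sub; rewrite inE eqxx.
rewrite [RHS](eq_bigr (fun k' => (if k' == k then g k *~ zi c else 0) + g k' *~ coef l k')).
  rewrite big_split /=; congr (_ + _).
  rewrite (bigD1_seq k) //= eqxx big1 ?addr0 // => k' /negPf -> //.
move=> k' _; rewrite /coef suml_cons mulrzDr; congr (_ + _).
rewrite [k' == k]eq_sym; case: (eqVneq k k') => [<-|_]; first by rewrite intz.
by rewrite mul0rz mulr0z.
Qed.

Lemma coef0 l k : k \notin map fst l -> coef l k = 0.
Proof.
move=> nk; rewrite /coef /suml big_seq big1 // => kc kcl.
case: eqP => [e|]; last by rewrite mul0rz.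
by case/negP: nk; rewrite -e map_f.
Qed.

(** This turns an identity of Laurent polynomials into a computation: the normal form of the
    difference is empty. *)
Lemma norm0 (V : zmodType) (g : key -> V) l : lnorm l = [::] -> suml g l = 0.
Proof. by move=> e; rewrite -suml_norm e suml_nil. Qed.

Section Eval.
Variable F : fieldType.
Implicit Types (x : seq F) (k : key) (l : lau).

(** The shorter list decides, so a key of four exponents can be evaluated at five values and then is
    a monomial without y. *)
Fixpoint evk x k : F :=
  match x, k with
  | a :: x', z :: k' => a ^ zi z * evk x' k'
  | _, _ => 1
  end.

Definition evl x l : F := suml (evk x) l.

Lemma evkD x k k' : all (predC1 0) x -> evk x (kadd k k') = evk x k * evk x k'.
Proof.
elim: x k k' => [|a x IH] [|z k] [|z' k'] //= x0; rewrite ?mul1r ?mulr1 //.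
move: x0 => /andP[a0 x0].
by rewrite ziD expfzDr // IH // mulrACA.
Qed.

Lemma evkN x k : evk x (kneg k) = (evk x k)^-1.
Proof.
elim: x k => [|a x IH] [|z k] //=; rewrite ?invr1 // IH ziN invfM.
by rewrite invr_expz.
Qed.

Lemma evkV x k : evk (map GRing.inv x) k = (evk x k)^-1.
Proof.
elim: x k => [|a x IH] [|z k] //=; rewrite ?invr1 // IH invfM.
by rewrite exprz_inv invr_expz.
Qed.

Lemma evk_neq0 x k : all (predC1 0) x -> evk x k != 0.
Proof.
elim: x k => [|a x IH] [|z k] //=; rewrite ?oner_neq0 // => /andP[a0 x0].
by rewrite mulf_neq0 ?expfz_neq0 ?IH.
Qed.

Lemma evk_scale x n k : evk x (kscale n k) = evk x k ^ zi n.
Proof.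
elim: x k => [|a x IH] [|z k] //=; rewrite ?expr1z ?exp1rz // IH expfzMl ziM.
by rewrite exprz_exp [zi z * _]mulrC.
Qed.

Lemma evl_nil x : evl x [::] = 0. Proof. exact: suml_nil. Qed.
Lemma evl_cons x k c l : evl x ((k, c) :: l) = evk x k *~ zi c + evl x l.
Proof. exact: suml_cons. Qed.
Lemma evl_cat x a b : evl x (a ++ b) = evl x a + evl x b.
Proof. exact: suml_cat. Qed.
Lemma evl_opp x a : evl x (lopp a) = - evl x a.
Proof. exact: suml_opp. Qed.
Lemma evl_flatten x (s : seq lau) : evl x (flatten s) = \sum_(l <- s) evl x l.
Proof.
by elim: s => [|l s IH] /=; rewrite ?big_nil ?evl_nil // evl_cat IH big_cons.
Qed.

Lemma evl_shift x k l : all (predC1 0) x -> evl x (kshift k l) = evk x k * evl x l.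
Proof.
move=> x0; rewrite /evl /kshift (suml_comp _ (kadd k)) /suml big_distrr /=.
by apply: eq_bigr => kc _; rewrite evkD // mulrzAr.
Qed.

Lemma evl_mul x a b : all (predC1 0) x -> evl x (lmul a b) = evl x a * evl x b.
Proof.
move=> x0; elim: a => [|[k c] a IH] /=; first by rewrite !evl_nil mul0r.
rewrite evl_cat IH evl_cons mulrDl; congr (_ + _).
rewrite /evl /suml big_map big_distrr /=; apply: eq_bigr => kc _.
by rewrite evkD // ziM mulrzAr mulrzAl -mulrzA.
Qed.

Lemma evl_bar x l : evl x (lbar l) = evl (map GRing.inv x) l.
Proof.
rewrite /evl /lbar (suml_comp _ kneg).
by apply: eq_suml => k /=; rewrite evkN evkV.
Qed.

Lemma evl_eq x a b : lnorm (a ++ lopp b) = [::] -> evl x a = evl x b.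
Proof.
by move=> e; apply/eqP; rewrite -subr_eq0 -evl_opp -evl_cat /evl (norm0 _ e).
Qed.

End Eval.

(** * Uniqueness of the coefficients in the field of fractions *)

Section Unique.
Variable n : nat.
Local Notation P := {mpoly rat[n]}.
Local Notation K := {fraction P}.

Definition gens : seq K := [seq tofrac ('X_i : P) | i <- enum 'I_n].

Lemma gens_neq0 : all (predC1 0) gens.
Proof.
apply/allP => y /mapP[i _ ->] /=; rewrite tofrac_eq0.
by apply/eqP => /(congr1 (mcoeff U_(i)%MM)); rewrite mcoeffX eqxx mcoeff0.
Qed.

Lemma evk_gens (k : key) : size k = n ->
  evk gens k = \prod_(i < n) (tofrac ('X_i : P)) ^ zi (nth Z0 k i).
Proof.
move=> sk; rewrite -big_enum /=.
have -> : enum 'I_n = [seq i | i <- enum 'I_n] by rewrite map_id.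
rewrite /gens; have : k = [seq nth Z0 k (val i) | i <- enum 'I_n].
  apply: (@eq_from_nth _ Z0); first by rewrite size_map size_enum_ord.
  move=> j; rewrite sk => jn; rewrite (nth_map (Ordinal jn)) ?size_enum_ord //.
  by rewrite /= nth_enum_ord.
move=> {1}->; rewrite map_id.
elim: (enum _) => [|i s IH] /=; first by rewrite big_nil.
by rewrite big_cons IH.
Qed.

Lemma tofrac_mpolyX (m : 'X_{1..n}) :
  tofrac ('X_[m] : P) = \prod_(i < n) (tofrac ('X_i : P)) ^+ m i.
Proof. by rewrite mpolyXE_id rmorph_prod; apply: eq_bigr => i _; rewrite rmorphXn. Qed.

(** After multiplication by a high power of all variables the sum is a polynomial, and monomials of
    a polynomial ring are independent. *)
Lemma evl_gens_coef (l : lau) :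
  (forall k, k \in map fst l -> size k = n) -> evl gens l = 0 ->
  forall k, coef l k = 0.
Proof.
move=> szl l0 k.
have [kl|] := boolP (k \in map fst l); last exact: coef0.
pose N := \max_(k <- map fst l) \max_(z <- k) `|zi z|%N.
have NP k' z : k' \in map fst l -> z \in k' -> (`|zi z| <= N)%N.
  move=> kl' zk; rewrite /N (big_rem k') //=; apply: leq_trans (leq_maxl _ _).
  by rewrite (big_rem z) //= leq_maxl.
pose sh (k' : key) : 'X_{1..n} := [multinom `|(zi (nth Z0 k' i) + N%:Z)%R|%N | i < n].
have shP k' (i : 'I_n) : k' \in map fst l -> zi (nth Z0 k' i) + N%:Z = (sh k' i)%:Z.
  move=> kl'; rewrite mnmE; case: i => i ilt /=.
  by have := NP k' (nth Z0 k' i) kl'; rewrite mem_nth ?szl // => /(_ isT); lia.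
have shinj k' k'' : k' \in map fst l -> k'' \in map fst l -> sh k' = sh k'' -> k' = k''.
  move=> kl' kl'' e; apply: (@eq_from_nth _ Z0); first by rewrite !szl.
  move=> i; rewrite szl // => ilt; apply: zi_inj.
  by have := shP _ (Ordinal ilt) kl'; rewrite e -shP //= => /addIr.
pose M : K := \prod_(i < n) (tofrac ('X_i : P)) ^ N%:Z.
have X0 i : tofrac ('X_i : P) != 0 :> K.
  by have /allP := gens_neq0; apply; apply/mapP; exists i; rewrite ?mem_enum.
have evM k' : k' \in map fst l -> evk gens k' * M = tofrac ('X_[sh k'] : P).
  move=> kl'; rewrite evk_gens ?szl // -big_split /= tofrac_mpolyX.
  by apply: eq_bigr => i _; rewrite -expfzDr // shP.
have : evl gens l * M = tofrac (\sum_(kc <- l) 'X_[sh kc.1] *~ zi kc.2 : P).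
  rewrite /evl /suml big_distrl rmorph_sum /= big_seq [RHS]big_seq.
  apply: eq_bigr => kc kcl; rewrite mulrzAl evM ?map_f //.
  by rewrite rmorphMz.
rewrite l0 mul0r => /esym/eqP; rewrite tofrac_eq0 => /eqP /(congr1 (mcoeff (sh k))).
rewrite raddf_sum mcoeff0 /= => e.
apply/eqP; rewrite -(intr_eq0 rat) /coef /suml rmorph_sum /= -[X in _ == X]e.
apply/eqP; rewrite big_seq [RHS]big_seq; apply: eq_bigr => kc kcl.
rewrite [RHS](raddfMz (mcoeff (sh k))) /= mcoeffX rmorphMz /=; congr (_ *~ _).
have -> : (sh kc.1 == sh k) = (kc.1 == k).
  by apply/eqP/eqP => [/shinj|->] //; apply; rewrite ?map_f.
by case: eqP.
Qed.

Lemma evl_gens_inj (a b : lau) :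
  (forall k, k \in map fst a ++ map fst b -> size k = n) ->
  evl gens a = evl gens b -> forall k, coef a k = coef b k.
Proof.
move=> sz e k; apply/eqP; rewrite -subr_eq0 /coef -suml_opp -suml_cat; apply/eqP.
apply: (@evl_gens_coef (a ++ lopp b)); last by rewrite evl_cat evl_opp e subrr.
move=> k'; rewrite map_cat -map_comp => kab; apply: sz.
by move: kab; rewrite !mem_cat; congr (_ || _).
Qed.

End Unique.

(** * Monomial ideals and their point components *)

Lemma lepmDr (n : nat) (v w : 'X_{1..n}) : (v <= v + w)%MM.
Proof. by apply/mnm_lepP => i; rewrite mnmDE leq_addr. Qed.
Lemma lepmDl (n : nat) (v w : 'X_{1..n}) : (v <= w + v)%MM.
Proof. by rewrite addmC lepmDr. Qed.

(** Pigeonhole. With n = 4 it finds, for a monomial of high degree, a direction in which it lies far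
    out. *)
Lemma big_coord (n : nat) (w : 'X_{1..n}) (r : nat) :
  (n * r < mdeg w)%N -> exists i, (r < w i)%N.
Proof.
move=> wr; have [[i ri]|no] := pselect (exists i, (r < w i)%N); first by exists i.
have : (mdeg w <= n * r)%N; last by rewrite leqNgt wr.
rewrite mdegE -[n in (n * r)%N]card_ord -sum_nat_const; apply: leq_sum => i _.
by rewrite leqNgt; apply/negP => ri; apply: no; exists i.
Qed.

Section Mono.
Variable C : fieldType.
Local Notation S := {mpoly C[4]}.
Implicit Types (f g : S) (v w u : box) (p : set box).

Lemma mcoeffXM v f u :
  ('X_[v] * f)@_u = if (v <= u)%MM then f@_(u - v) else 0.
Proof.
rewrite mulrC; case: ifP => vu; first by rewrite -{1}(submK vu) addmC mcoeffMX.
rewrite [f]mpolyE mulr_suml raddf_sum /= big1 // => w _.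
rewrite -scalerAl -mpolyXD mcoeffZ mcoeffX; case: eqP => [e|]; last by rewrite mulr0.
by move: vu; rewrite -e lepmDl.
Qed.

Lemma mcoeffXM_add v f u : ('X_[v] * f)@_(v + u) = f@_u.
Proof. by rewrite mcoeffXM lepmDr addmC addmK. Qed.

End Mono.

Section Ideals.
Variable R : realType.
Local Notation C := R[i].
Local Notation S := {mpoly C[4]}.
Local Notation mono_ideal := (@mono_ideal R).
Implicit Types (f g : S) (v w u : box) (p : set box).

Lemma mono_idealP p f : mono_ideal p f <-> (forall w, p w -> f@_w = 0).
Proof.
split=> [If w pw|If w]; last by rewrite mcoeff_msupp => /eqP fw pw; apply: fw; exact: If.
by apply/eqP; rewrite mcoeff_eq0; apply/negP => /If.
Qed.

Lemma mono_idealX p w : mono_ideal p 'X_[w] <-> ~ p w.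
Proof.
split=> [H pw|npw]; first by apply: (H w) => //; rewrite msuppX inE.
by move=> w'; rewrite msuppX inE => /eqP ->.
Qed.

Lemma mono_idealS p q : q `<=` p -> mono_ideal p `<=` mono_ideal q.
Proof. by move=> qp f pf w /pf npw /qp. Qed.

Lemma mono_ideal_sub p q : mono_ideal p `<=` mono_ideal q -> q `<=` p.
Proof.
move=> pq w qw; apply: contrapT => npw.
by have /mono_idealX := pq 'X_[w] (proj2 (mono_idealX p w) npw).
Qed.

Lemma is_ideal_sum (I : set S) (T : eqType) (r : seq T) (F : T -> S) :
  is_ideal I -> (forall i, i \in r -> I (F i)) -> I (\sum_(i <- r) F i).
Proof.
case=> I0 ID _; elim: r => [|a r IH] H; first by rewrite big_nil.
by rewrite big_cons; apply: ID; [apply: H; rewrite inE eqxx|apply: IH => i ir; apply: H; rewrite inE ir orbT].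
Qed.

Lemma is_idealZ (I : set S) (c : C) f : is_ideal I -> I f -> I (c *: f).
Proof. by case=> _ _ IM If; rewrite -mul_mpolyC; apply: IM. Qed.

Lemma is_idealB (I : set S) f g : is_ideal I -> I f -> I g -> I (f - g).
Proof. by case=> _ ID IM If Ig; apply: ID => //; rewrite -mulN1r; apply: IM. Qed.

Lemma is_idealBC (I : set S) f g : is_ideal I -> I (f - g) -> I (g - f).
Proof. by case=> _ _ IM H; rewrite -opprB -mulN1r; apply: IM. Qed.

Lemma is_ideal_trans (I : set S) g f h : is_ideal I -> I (f - g) -> I (g - h) -> I (f - h).
Proof. by case=> _ ID _ H1 H2; have := ID _ _ H1 H2; rewrite addrA subrK. Qed.

Lemma mono_is_ideal p : is_partition p -> is_ideal (mono_ideal p).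
Proof.
move=> pp; split.
- by apply/mono_idealP => w _; rewrite mcoeff0.
- by move=> f g /mono_idealP If /mono_idealP Ig; apply/mono_idealP => w pw; rewrite mcoeffD If ?Ig ?addr0.
move=> a f /mono_idealP If; apply/mono_idealP => w pw.
rewrite [a]mpolyE mulr_suml raddf_sum /= big1 // => v _.
rewrite -scalerAl mcoeffZ mcoeffXM; case: ifP => vw; rewrite ?mulr0 // If ?mulr0 //.
by apply: pp pw _; apply/mnm_lepP => i; rewrite mnmBE leq_subr.
Qed.

(* A lex-minimal monomial in the direction of a nonzero coordinate of the
   point survives multiplication by [x_i - v_i]. *)
Lemma mono_no_point p : is_partition p ->
  (forall w, p w -> exists i, p (w + U_(i))%MM) -> no_point_component (mono_ideal p).
Proof.
move=> pp soc f v H.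
have H1 g : g.@[v] = 0 -> mono_ideal p (g * f) by move=> /H.
have nf : ~ mono_ideal p f.
  move=> If; have : (1 : S).@[v] = 0 by apply/H; rewrite mul1r.
  by rewrite meval1 => /eqP; rewrite oner_eq0.
have [w pw fw] : exists2 w, p w & f@_w != 0.
  apply: contrapT => no; apply: nf; apply/mono_idealP => w pw.
  by apply/eqP/negPn/negP => fw; apply: no; exists w.
have [[i vi]|v0] := pselect (exists i, v i != 0).
  pose Q m := `[< exists w, [/\ p w, f@_w != 0 & (w i = m)%N] >].
  have exQ : exists m, Q m by exists (w i); apply/asboolP; exists w.
  case: (ex_minnP exQ) => m /asboolP[u [pu fu um]] mmin.
  have : mono_ideal p (('X_i - (v i)%:MP) * f).
    by apply: H1; rewrite mevalB mevalXU mevalC subrr.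
  move/mono_idealP/(_ u pu); rewrite mulrBl mcoeffB mcoeffXM mcoeffCM.
  case: ifP => [iu|_]; last first.
    by move/eqP; rewrite sub0r oppr_eq0 mulf_eq0 (negPf vi) (negPf fu).
  have -> : f@_(u - U_(i)) = 0.
    apply/eqP/negPn/negP => fu'.
    have : Q (u i).-1.
      apply/asboolP; exists (u - U_(i))%MM; split=> //; last by rewrite mnmBE mnm1E eqxx subn1.
      by apply: pp pu _; apply/mnm_lepP => j; rewrite mnmBE leq_subr.
    move/mmin; rewrite -um; move/mnm_lepP: iu => /(_ i); rewrite mnm1E eqxx.
    by case: (u i) => // n _ /=; rewrite ltnn.
  by move/eqP; rewrite sub0r oppr_eq0 mulf_eq0 (negPf vi) (negPf fu).
have [i pwi] := soc w pw.
have : mono_ideal p ('X_i * f).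
  apply: H1; rewrite mevalXU; apply/eqP/negPn/negP => vi; apply: v0; by exists i.
move/mono_idealP/(_ _ pwi); rewrite addmC mcoeffXM_add => fw0.
by move: fw; rewrite fw0 eqxx.
Qed.

(** If x^u is a socle element modulo J, then g x^u depends only on g(0), since every nonconstant
    monomial of g contains some x_i. *)
Lemma ideal_meval0 (J : set S) (u : box) (g : S) : is_ideal J ->
  (forall i, J 'X_[u + U_(i)]) -> g@_0%MM = 0 -> J (g * 'X_[u]).
Proof.
move=> JI Ju g0; have [_ _ JM] := JI.
rewrite [g]mpolyE mulr_suml; apply: is_ideal_sum => // m; rewrite mcoeff_msupp => gm.
rewrite -scalerAl; apply: is_idealZ => //.
have m0 : m != 0%MM by apply: contraNneq gm => ->; rewrite g0.
have [i mi] : exists i, (0 < m i)%N.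
  apply: contrapT => no; case/eqP: m0; apply/mnmP => i; rewrite mnm0E.
  by apply/eqP; rewrite -leqn0 leqNgt; apply/negP => mi; apply: no; exists i.
have Um : (U_(i) <= m)%MM.
  by apply/mnm_lepP => j; rewrite mnm1E; case: eqP => [<-|].
by rewrite -mpolyXD -(submK Um) -addmA [(U_(i) + u)%MM]addmC mpolyXD; apply: JM.
Qed.

Lemma meval_at0 (g : S) : g.@[fun=> 0] = g@_0%MM.
Proof.
rewrite [in LHS](mpolyE g) [in RHS](mpolyE g) !raddf_sum /=.
apply: eq_bigr => m _; rewrite mevalZ mcoeffZ mevalX mcoeffX; congr (_ * _).
case: eqVneq => [->|m0]; first by rewrite big1 // => i _; rewrite mnm0E expr0.
have [i mi] : exists i, m i != 0%N.
  apply: contrapT => no; case/eqP: m0; apply/mnmP => i; rewrite mnm0E.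
  by apply/eqP/negPn/negP => mi; apply: no; exists i.
by rewrite (bigD1 i) //= expr0n (negPf mi) mul0r.
Qed.

(** If all x_i x^w were zero, the annihilator of x^w would be the maximal ideal of the origin. *)
Lemma no_point_socle p : is_partition p -> no_point_component (mono_ideal p) ->
  forall w, p w -> exists i, p (w + U_(i))%MM.
Proof.
move=> pp np w pw; apply: contrapT => no; apply: (np 'X_[w] (fun=> 0)) => g.
have pI := mono_is_ideal pp.
rewrite meval_at0; split=> [/mono_idealP/(_ w pw)|g0]; last first.
  by apply: ideal_meval0 => // i; apply/mono_idealX => pwi; apply: no; exists i.
by have := mcoeffXM_add w g 0%MM; rewrite addm0 mulrC => ->.
Qed.

(** There are boxes of [p] above [w] of every degree; one of high degree exceeds, in some direction,
    the length at which that ray was supposed to leave [p]. *)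
Lemma tail_exists p w : is_partition p ->
  (forall w, p w -> exists i, p (w + U_(i))%MM) -> p w ->
  exists a, forall n, p (w + U_(a) *+ n)%MM.
Proof.
move=> pp soc pw; apply: contrapT => no.
have /fin_all_exists[N HN] : forall a, exists n, ~ p (w + U_(a) *+ n)%MM.
  by move=> a; apply: contrapT => na; apply: no; exists a => n; apply: contrapT => q; apply: na; exists n.
have up k : exists v, [/\ p v, (w <= v)%MM & mdeg v = (mdeg w + k)%N].
  elim: k => [|k [v [pv wv dv]]]; first by exists w; rewrite addn0; split=> //; apply: lepm_refl.
  have [i pi] := soc v pv; exists (v + U_(i))%MM; split=> //.
    by apply: lepm_trans wv _; apply: lepmDr.
  by rewrite mdegD mdeg1 dv addn1 addnS.
pose M := \max_a N a.
have [v [pv wv dv]] := up (4 * M).+1.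
have [a Ma] : exists a, (M < (v - w)%MM a)%N.
  apply: big_coord; rewrite -[mdeg _](addnK (mdeg w)) -mdegD submK // dv.
  by rewrite addnC addnK.
apply: (HN a); apply: pp pv _; apply/mnm_lepP => j.
rewrite mnmDE mulmnE mnm1E; move/mnm_lepP: wv => /(_ j).
case: eqP => [<-|_]; last by rewrite mul0n addn0.
have : (N a <= M)%N by apply: leq_bigmax.
by move: Ma; rewrite mnmBE mul1n; lia.
Qed.

Lemma localized_monoP (J : {set 'I_4}) p f : is_partition p ->
  localized_ideal J (mono_ideal p) f <->
  (forall w, w \in msupp f -> exists n, ~ p (w + (\sum_(i in J) U_(i)) *+ n)%MM).
Proof.
move=> pp; have e n : (\prod_(i in J) 'X_i) ^+ n = 'X_[(\sum_(i in J) U_(i)) *+ n] :> S.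
  by rewrite -mpolyXn; congr (_ ^+ n); rewrite (big_morph _ (@mpolyXD 4 C) (@mpolyX0 4 C)).
split=> [[n]|H].
  rewrite e => /mono_idealP If w wf; exists n => pw; move: (If _ pw).
  by rewrite addmC mcoeffXM_add => /eqP; rewrite mcoeff_eq0 wf.
have /choice[N HN] : forall w, exists n, w \in msupp f -> ~ p (w + (\sum_(i in J) U_(i)) *+ n)%MM.
  by move=> w; have [/H[n Hn]|] := boolP (w \in msupp f); [exists n|exists 0%N].
exists (\max_(w <- msupp f) N w); rewrite e; apply/mono_idealP => u pu.
rewrite mcoeffXM; case: ifP => // le; apply/eqP; rewrite mcoeff_eq0; apply/negP => wf.
apply: (HN _ wf); apply: pp pu _; rewrite -[X in (_ <= X)%MM](submK le).
apply/mnm_lepP => i; rewrite !mnmDE !mulmnE leq_add2l leq_mul2l.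
by rewrite leq_bigmax_seq ?orbT.
Qed.

Lemma localized_mono1 (a : 'I_4) p w : is_partition p ->
  localized_ideal [set a]%SET (mono_ideal p) 'X_[w] <->
  exists n, ~ p (w + U_(a) *+ n)%MM.
Proof.
move=> pp; rewrite localized_monoP // big_set1; split=> [|[n Hn]].
  by move=> /(_ w); apply; rewrite msuppX inE.
by move=> w'; rewrite msuppX inE => /eqP ->; exists n.
Qed.

(** Without socle every box starts an infinite ray inside [p], and the rays in direction a are what
    the localization at x_a sees. So [mu] determines [p]. *)
Lemma is_Zmu_mem mu p : is_Zmu R mu p ->
  p = [set w | exists a, cylinder [set a]%SET (mu a) w].
Proof.
case=> pp _ np loc; apply/predeqP => w; have soc := no_point_socle pp np.
have locw a : (forall n, p (w + U_(a) *+ n)%MM) <-> cylinder [set a]%SET (mu a) w.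
  have := localized_mono1 a w pp; rewrite (loc a) mono_idealX => h.
  split=> [H|H n]; apply: contrapT.
    by move=> /h[n]; apply.
  by move=> Hn; apply: (proj2 h) => //; exists n.
split=> [pw|[a /locw/(_ 0%N)]]; last by rewrite mulm0n addm0.
by have [a /locw] := tail_exists pp soc pw; exists a.
Qed.

Lemma Zmu_unique mu p : is_Zmu R mu p -> Zmu R mu = p.
Proof.
by move=> H; apply: xget_unique => // q /is_Zmu_mem ->; rewrite (is_Zmu_mem H).
Qed.

(** * Solid partitions with a given pure part *)

(** Each time, proceed to a position whose value is minimal among all later ones. *)
Lemma nondecreasing_subseq (x : nat -> nat) :
  exists e : nat -> nat, (forall m, e m < e m.+1)%N /\ (forall m, x (e m) <= x (e m.+1))%N.
Proof.
have /choice[k Hk] : forall n, exists k, (n <= k)%N /\ forall j, (n <= j)%N -> (x k <= x j)%N.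
  move=> n; pose Q m := `[< exists k, (n <= k)%N /\ x k = m >].
  have exQ : exists m, Q m by exists (x n); apply/asboolP; exists n.
  case: (ex_minnP exQ) => m /asboolP[k [nk xk]] mmin; exists k; split=> // j nj.
  by rewrite xk; apply: mmin; apply/asboolP; exists j.
pose e := fix e m := if m is m'.+1 then k (e m').+1 else k 0%N.
exists e; split=> m /=; first by have [] := Hk (e m).+1.
have [h _] := Hk (e m).+1.
case: m h => [|m] /= h; apply: (proj2 (Hk _)) => //.
by have [h' _] := Hk (e m).+1; lia.
Qed.

Lemma nondecreasing_subseqs (n : nat) (u : nat -> 'X_{1..n}) (s : seq 'I_n) :
  exists e : nat -> nat, (forall m, e m < e m.+1)%N /\
    (forall i, i \in s -> forall m m', (m <= m')%N -> u (e m) i <= u (e m') i)%N.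
Proof.
elim: s => [|i s [e [einc eH]]]; first by exists id.
have [e' [e'inc e'H]] := nondecreasing_subseq (fun m => u (e m) i).
have emono m m' : (m <= m')%N -> (e m <= e m')%N.
  elim: m' => [|m' IH]; first by rewrite leqn0 => /eqP ->.
  by rewrite leq_eqVlt => /orP[/eqP -> //|/IH]; have := einc m'; lia.
have e'mono m m' : (m <= m')%N -> (e' m <= e' m')%N.
  elim: m' => [|m' IH]; first by rewrite leqn0 => /eqP ->.
  by rewrite leq_eqVlt => /orP[/eqP -> //|/IH]; have := e'inc m'; lia.
exists (e \o e'); split=> [m|j] /=.
  by apply: leq_trans (einc _) _; apply: emono.
rewrite inE => /orP[/eqP ->|js] m m' mm'; last by apply: eH => //; apply: e'mono.
elim: m' mm' => [|m' IH]; first by rewrite leqn0 => /eqP ->.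
by rewrite leq_eqVlt => /orP[/eqP -> //|/IH h]; apply: leq_trans h (e'H _).
Qed.

HB.instance Definition _ n := isPointed.Build 'X_{1..n} 0%MM.

(* Dickson's lemma: an infinite set of boxes contains an infinite chain, along
   which some coordinate is unbounded. *)
Lemma partition_finite (q : set box) (A : set box) : is_partition q -> A `<=` q ->
  (forall w, A w -> forall a, exists n, ~ q (w + U_(a) *+ n)%MM) -> finite_set A.
Proof.
move=> qp Aq no; apply: contrapT => /infiniteP/pcard_leP[u].
have uA m : A (u m) by have := 'funS_u; apply.
have uinj m m' : u m = u m' -> m = m' by apply: 'inj_u; rewrite inE.
have [e [einc eH]] := nondecreasing_subseqs u (enum 'I_4).
have eM m m' : (m <= m')%N -> (u (e m) <= u (e m'))%MM.
  by move=> mm; apply/mnm_lepP => i; apply: eH; rewrite ?mem_enum.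
have einj m : (m <= mdeg (u (e m)))%N.
  elim: m => // m IH; apply: leq_ltn_trans IH _.
  have le := eM _ _ (leqnSn m).
  rewrite -(submK le) mdegD addnC -[X in (X < _)%N]addn0 ltn_add2l lt0n mdeg_eq0.
  apply/eqP => e0; have := uinj (e m.+1) (e m); rewrite -(submK le) e0 add0m.
  by move=> /(_ erefl) ee; have := einc m; rewrite ee ltnn.
have /fin_all_exists[N HN] := no _ (uA (e 0%N)).
pose M := \max_a (u (e 0%N) a + N a).
have [a Ma] : exists a, (M < u (e (4 * M).+1) a)%N.
  by apply: big_coord; apply: einj.
apply: (HN a); apply: qp (Aq _ (uA (e (4 * M).+1))) _; apply/mnm_lepP => j.
rewrite mnmDE mulmnE mnm1E; case: eqP => [<-|_]; last first.
  by rewrite mul0n addn0; apply: (mnm_lepP (eM _ _ _)).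
by rewrite mul1n; apply: leq_trans (ltnW Ma); rewrite /M (bigD1 a) //= leq_maxl.
Qed.

(** The boxes of [q] that start an infinite ray form the pure part; the others are finitely many by
    Dickson's lemma. *)
Lemma DTsetP mu p q : is_Zmu R mu p ->
  DTset R mu q <-> [/\ is_partition q, p `<=` q & finite_set (q `\` p)].
Proof.
move=> Zp; have [pp _ np _] := Zp; rewrite /DTset /Imu (Zmu_unique Zp) /=.
have soc := no_point_socle pp np.
split=> [[qp [_ /mono_ideal_sub pq _ mini]]|[qp pq fin]].
  (* This defines a pure subscheme of the one of [q], hence it is contained in the maximal one. A
     box of [q] outside [p] thus starts no infinite ray. *)
  split=> //; pose p' := [set w | exists a, forall n, q (w + U_(a) *+ n)%MM].
  have p'p : is_partition p'.
    move=> w v [a Ha] vw; exists a => n; apply: qp (Ha n) _.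
    by apply/mnm_lepP => i; rewrite !mnmDE leq_add2r; apply: (mnm_lepP vw).
  have p'q : p' `<=` q by move=> w [a /(_ 0%N)]; rewrite mulm0n addm0.
  have : p' `<=` p.
    apply: mono_ideal_sub; apply: mini; [exact: mono_is_ideal|exact: mono_idealS|].
    apply: mono_no_point => // w [a Ha]; exists a, a => n.
    by rewrite -addmA -mulmS; apply: Ha.
  move=> p'sp; apply: (partition_finite qp) => [w [qw _] //|w [qw npw] a].
  apply: contrapT => no; apply: npw; apply: p'sp; exists a => n.
  by apply: contrapT => qn; apply: no; exists n.
split=> //; split; [exact: mono_is_ideal|exact: mono_idealS|by []|].
move=> J' JI qJ np' f /mono_idealP pf; have [_ _ JM] := JI.
(* Descending induction on the degree, which is bounded on the finite set of boxes in [q] and not in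
   [p]: if all x_i x^w lie in J' but x^w does not, then x^w gives a point component at the
   origin. *)
suff JX w : ~ p w -> J' 'X_[w].
  rewrite [f]mpolyE; apply: is_ideal_sum => // w wf; apply: is_idealZ => //.
  by apply: JX => /pf /eqP; rewrite mcoeff_eq0 wf.
have [D HD] : exists D, forall w, q w -> ~ p w -> (mdeg w <= D)%N.
  have [s es] := (proj1 (finite_seqP _)) fin; exists (\max_(w <- s) mdeg w) => x qx npx.
  apply: leq_bigmax_seq => //; have : (q `\` p) x by [].
  by rewrite es.
move=> npw; move: {2}(D.+1 - mdeg w)%N (leqnn (D.+1 - mdeg w)) => k.
elim: k w npw => [|k IH] w npw kw.
  apply: qJ; apply/mono_idealX => qw; have := HD _ qw npw; lia.
have [qw|nqw] := pselect (q w); last by apply: qJ; apply/mono_idealX.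
have up i : J' 'X_[w + U_(i)].
  apply: IH; last by rewrite mdegD mdeg1; lia.
  by move=> pwi; apply: npw; apply: pp pwi (lepmDr _ _).
apply: contrapT => nJ; apply: (np' 'X_[w] (fun=> 0)) => g; rewrite meval_at0.
split=> [Jg|g0]; last exact: ideal_meval0.
apply/eqP/negPn/negP => g0; apply: nJ.
have : J' ((g - (g@_0%MM)%:MP) * 'X_[w]).
  by apply: ideal_meval0 => //; rewrite mcoeffB mcoeffC eqxx mulr1 subrr.
rewrite mulrBl => h; have : J' ((g@_0%MM)^-1 *: (g * 'X_[w] - (g * 'X_[w] - (g@_0%MM)%:MP * 'X_[w]))).
  by apply: is_idealZ => //; apply: is_idealB.
by rewrite opprB addrC subrK mul_mpolyC scalerA mulVf // scale1r.
Qed.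

End Ideals.

(** * The local cohomology module *)

Section Weights.
Local Notation wt := 'rV[int]_4.
Implicit Types (w u : wt) (v : box).

Definition vb v : wt := \row_i (v i)%:Z.
(** Total by means of the absolute value; it is inverse to [vb] on nonnegative weights only. *)
Definition bx w : box := [multinom absz (w 0%R i) | i < 4].
Definition nn w : bool := [forall i, 0 <= w 0 i].
Definition dv (i : 'I_4) : wt := vb U_(i)%MM.
Definition setw w (a : 'I_4) (z : int) : wt := \row_j (if j == a then z else w 0 j).

Lemma nnP w : reflect (forall i, 0 <= w 0 i) (nn w).
Proof. exact: forallP. Qed.

Lemma wD w u i : (w + u) 0 i = w 0 i + u 0 i.
Proof. by rewrite mxE. Qed.
Lemma wB w u i : (w - u) 0 i = w 0 i - u 0 i.
Proof. by rewrite !mxE. Qed.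
Lemma setwE w a z i : setw w a z 0 i = if i == a then z else w 0 i.
Proof. by rewrite mxE. Qed.
Lemma bxE w i : bx w i = absz (w 0 i).
Proof. by rewrite mnmE. Qed.
Lemma vbE v i : vb v 0 i = (v i)%:Z.
Proof. by rewrite mxE. Qed.
Lemma dvE a i : dv a 0 i = (a == i)%:Z.
Proof. by rewrite vbE mnm1E. Qed.
Lemma vbK : cancel vb bx.
Proof. by move=> v; apply/mnmP => i; rewrite bxE vbE. Qed.
Lemma bxK w : nn w -> vb (bx w) = w.
Proof. by move=> /nnP w0; apply/rowP => i; rewrite vbE bxE gez0_abs. Qed.
Lemma vb_inj : injective vb.
Proof. exact: can_inj vbK. Qed.
Lemma nn_vb v : nn (vb v).
Proof. by apply/nnP => i; rewrite vbE. Qed.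
Lemma vbD v v' : vb (v + v')%MM = vb v + vb v'.
Proof. by apply/rowP => i; rewrite !mxE mnmDE PoszD. Qed.
Lemma vb0 : vb 0%MM = 0.
Proof. by apply/rowP => i; rewrite !mxE mnm0E. Qed.
Lemma vbMn a n : vb (U_(a) *+ n)%MM = dv a *+ n.
Proof.
apply/rowP => i; rewrite vbE mulmnE mnm1E.
have -> : (dv a *+ n) 0 i = (dv a 0 i) *+ n by rewrite mulmxnE.
rewrite dvE; case: eqP => _; first by rewrite mul1n -natz.
by rewrite mul0n mul0rn.
Qed.
Lemma dvMnE a n i : (dv a *+ n) 0 i = ((a == i) * n)%N%:Z.
Proof. by rewrite -vbMn vbE mulmnE mnm1E. Qed.
Lemma nnD v w : nn w -> nn (w + vb v).
Proof. by move=> /nnP H; apply/nnP => i; rewrite wD vbE; have := H i; lia. Qed.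
End Weights.

Section Tails.
Variable R : realType.
Local Notation C := R[i].
Local Notation S := {mpoly C[4]}.
Local Notation wt := 'rV[int]_4.
Implicit Types (f g h : S) (w u : wt) (v : box) (phi psi : S -> S).

(** Indexed by all weights and zero off the orthant, so that multiplication by a monomial is a mere
    shift, as in [cfXM]. *)
Definition cf f w : C := if nn w then f@_(bx w) else 0.

Lemma cf_vb f v : cf f (vb v) = f@_v.
Proof. by rewrite /cf nn_vb vbK. Qed.
Lemma cf_neq0 f w : cf f w != 0 -> exists2 v, v \in msupp f & w = vb v.
Proof.
rewrite /cf; case: ifP => [w0 fw|]; last by rewrite eqxx.
by exists (bx w); rewrite ?bxK // mcoeff_msupp.
Qed.
Lemma cfD f g w : cf (f + g) w = cf f w + cf g w.
Proof. by rewrite /cf; case: ifP; rewrite ?mcoeffD ?addr0. Qed.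
Lemma cfB f g w : cf (f - g) w = cf f w - cf g w.
Proof. by rewrite /cf; case: ifP; rewrite ?mcoeffB ?subr0. Qed.
Lemma cfZ c f w : cf (c *: f) w = c * cf f w.
Proof. by rewrite /cf; case: ifP; rewrite ?mcoeffZ ?mulr0. Qed.
Lemma cf_sum (T : Type) (r : seq T) (F : T -> S) w :
  cf (\sum_(i <- r) F i) w = \sum_(i <- r) cf (F i) w.
Proof. by rewrite /cf; case: ifP; rewrite ?raddf_sum // big1. Qed.
Lemma cfXM v f w : cf ('X_[v] * f) w = cf f (w - vb v).
Proof.
rewrite /cf; case: ifP => w0; last first.
  case: ifP => // /(nnD v); rewrite subrK w0 //.
rewrite mcoeffXM; case: ifP => vw.
  have e : w - vb v = vb (bx w - v)%MM.
    apply: (addIr (vb v)); rewrite subrK -vbD submK // bxK //.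
  by rewrite e nn_vb vbK.
case: ifP => // wv; case/negP: vw.
apply/mnm_lepP => i; move/nnP: wv => /(_ i); rewrite wB vbE bxE.
by move/nnP: w0 => /(_ i); lia.
Qed.
Lemma cfM g f w : cf (g * f) w = \sum_(m <- msupp g) g@_m * cf f (w - vb m).
Proof.
rewrite [g in LHS]mpolyE mulr_suml cf_sum; apply: eq_bigr => m _.
by rewrite -scalerAl cfZ cfXM.
Qed.
Lemma cfX v w : cf 'X_[v] w = (w == vb v)%:R.
Proof.
rewrite -[X in cf X]mulr1 cfXM -mpolyC1; case: eqP => [->|ne].
  by rewrite subrr -vb0 cf_vb mcoeffC eqxx mulr1.
rewrite /cf; case: ifP => // w0; rewrite mcoeffC mul1r; case: eqP => // e.
case: ne; apply: (addIr (- vb v)); rewrite subrr -(bxK w0) e vb0 //.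
Qed.

Lemma mpolyP_cf f g : (forall w, cf f w = cf g w) -> f = g.
Proof. by move=> H; apply/mpolyP => v; rewrite -!cf_vb. Qed.

Variables (p : set box) (K : nat).
Hypothesis pp : is_partition p.
Hypothesis K0 : (0 < K)%N.
Hypothesis pK : forall v a n, p v -> (K <= v a)%N -> p (v + U_(a) *+ n)%MM.
Hypothesis soc : forall v, p v -> exists i, p (v + U_(i))%MM.
Local Notation I := (@mono_ideal R p).

Definition pin w : bool := nn w && `[< p (bx w) >].

Lemma pinP w : reflect (nn w /\ p (bx w)) (pin w).
Proof. by apply: (iffP andP) => -[? /asboolP]. Qed.
Lemma pin_vb v : pin (vb v) <-> p v.
Proof. by split=> [/pinP[_]|pv]; rewrite ?vbK //; apply/pinP; rewrite nn_vb vbK. Qed.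
Lemma pin_le w u : pin w -> nn u -> (forall i, u 0 i <= w 0 i) -> pin u.
Proof.
move=> /pinP[w0 pw] u0 uw; apply/pinP; split=> //; apply: pp pw _.
by apply/mnm_lepP => i; rewrite !bxE; have := uw i; move/nnP: u0 => /(_ i); lia.
Qed.
Lemma pin_set w a z : pin w -> K%:Z <= w 0 a -> 0 <= z -> pin (setw w a z).
Proof.
move=> pw Kw z0; have /pinP[w0 pbw] := pw.
apply: (@pin_le (vb (bx w + U_(a) *+ absz z)%MM)).
- by apply/pin_vb; apply: pK => //; rewrite bxE; lia.
- by apply/nnP => i; rewrite mxE; case: ifP => // _; apply: (nnP _ w0).
move=> i; rewrite vbD vbMn wD setwE dvMnE vbE bxE eq_sym.
by have := nnP _ w0 i; case: eqP => _; lia.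
Qed.
Lemma mono_cfP f : I f <-> forall w, pin w -> cf f w = 0.
Proof.
rewrite mono_idealP; split=> H w; last by move=> /pin_vb/H; rewrite cf_vb.
by move=> /pinP[w0 pw]; rewrite /cf w0 H.
Qed.

(** Says that the ray from [w] in direction [a] ends up inside [p]. By [pK] membership no longer
    changes from [K] on, so the coordinate is set to [K]; in [w] itself it may be negative. *)
Definition inA w a : bool := pin (setw w a K%:Z).
Definition inE2 w a b : bool := pin (setw (setw w a K%:Z) b K%:Z).

Lemma inA_pin w a n : inA w a -> 0 <= w 0 a + n -> pin (w + \row_j (if j == a then n else 0)).
Proof.
move=> Aw wn; have -> : w + \row_j (if j == a then n else 0) = setw (setw w a K%:Z) a (w 0 a + n).
  by apply/rowP => i; rewrite !mxE; case: eqP => [->|]; rewrite ?addr0.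
by apply: pin_set => //; rewrite mxE eqxx.
Qed.
Lemma rowMn a n : \row_j (if j == a then n%:Z else 0) = dv a *+ n.
Proof. by apply/rowP => i; rewrite mxE dvMnE eq_sym; case: eqP => _; rewrite ?mul1n. Qed.
Lemma inA_dv w a n : inA w a -> 0 <= w 0 a + n%:Z -> pin (w + dv a *+ n).
Proof. by move=> Aw wn; rewrite -rowMn; apply: inA_pin. Qed.
Lemma inA_nn w a b : inA w a -> b != a -> 0 <= w 0 b.
Proof. by move=> /pinP[/nnP/(_ b) + _] /negPf ba; rewrite setwE ba. Qed.
Lemma pin_inA w a : pin w -> K%:Z <= w 0 a -> inA w a.
Proof. by move=> pw Kw; apply: pin_set. Qed.
Lemma inA_le w u a : inA u a -> (forall b, b != a -> 0 <= w 0 b <= u 0 b) -> inA w a.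
Proof.
move=> Au H; apply: (pin_le Au); first by apply/nnP => i; rewrite mxE; case: ifPn => // /H /andP[].
by move=> i; rewrite !mxE; case: ifPn => // /H /andP[].
Qed.
Lemma inA_pinn w a : inA w a -> 0 <= w 0 a -> pin w.
Proof. by move=> Aw w0; have := @inA_dv w a 0 Aw; rewrite mulr0n !addr0; apply. Qed.

Local Notation is_hom := (is_hom I).
Local Notation xa a s := ('X_[U_(a) *+ s] : S).

Lemma I_ideal : is_ideal I.
Proof. exact: mono_is_ideal. Qed.
Let ID : forall f g, I f -> I g -> I (f + g). Proof. by case: I_ideal. Qed.
Let IM : forall a f, I f -> I (a * f). Proof. by case: I_ideal. Qed.
Let I0 : I 0. Proof. by case: I_ideal. Qed.

Lemma mpower0 r : mpower r (0 : S).
Proof. by move=> w; rewrite msupp0. Qed.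
Lemma mpowerX r v : (r <= mdeg v)%N -> mpower r ('X_[v] : S).
Proof. by move=> rv w; rewrite msuppX inE => /eqP ->. Qed.
Lemma mpowerM r a f : mpower r f -> mpower r (a * f).
Proof.
move=> rf w; rewrite mcoeff_msupp -cf_vb cfM => nz.
have [m _ nzm] : exists2 m, m \in msupp a & cf f (vb w - vb m) != 0.
  apply: contrapT => no; case/eqP: nz; rewrite big_seq big1 // => m ma.
  by apply/eqP/negPn/negP; rewrite mulf_eq0 negb_or => /andP[_ nzm]; apply: no; exists m.
have [v vf e] := cf_neq0 nzm; apply: leq_trans (rf v vf) _.
have -> : w = (v + m)%MM by apply: vb_inj; rewrite vbD -e subrK.
by rewrite mdegD leq_addr.
Qed.
Lemma mpowerD r f g : mpower r f -> mpower r g -> mpower r (f + g).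
Proof. by move=> rf rg w /msuppD_le; rewrite mem_cat => /orP[/rf|/rg]. Qed.
Lemma mpower_le r s f : (r <= s)%N -> mpower s f -> mpower r f.
Proof. by move=> rs sf w /sf; apply: leq_trans. Qed.

Lemma is_hom_le r s phi : (r <= s)%N -> is_hom r phi -> is_hom s phi.
Proof.
move=> rs [H1 H2]; split=> [a f g /(mpower_le rs) fr /(mpower_le rs) gr|f /(mpower_le rs) fr].
  exact: H1.
exact: H2.
Qed.
Lemma is_hom0 r phi : is_hom r phi -> I (phi 0).
Proof. by move=> [_]; apply => //; apply: mpower0. Qed.
Lemma is_homM r phi a f : is_hom r phi -> mpower r f -> I (phi (a * f) - a * phi f).
Proof.
move=> rphi rf; have [H _] := rphi; have := H a f 0 rf (@mpower0 r); rewrite addr0 => h.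
have := ID h (is_hom0 rphi); rewrite opprD addrA subrK //.
Qed.

(** An arbitrary exponent from which phi is a homomorphism; [tlE] removes the choice. *)
Definition rk phi : nat := xget 0%N [set r | is_hom r phi].
Lemma rkP phi : homs I phi -> is_hom (rk phi) phi.
Proof. by move=> h; apply: (@xgetPex _ 0%N [set r | is_hom r phi]). Qed.

(** On the chart x_a <> 0 an element of the limit is the function phi(x_a^s) / x_a^s for large s;
    this is its coefficient of weight [w]. *)
Definition tl phi w a : C :=
  if inA w a then cf (phi (xa a (rk phi))) (w + dv a *+ rk phi) else 0.

Lemma mdeg_xa a s : mdeg (U_(a) *+ s : box)%MM = s.
Proof. by rewrite mdegMn mdeg1 mul1n. Qed.

Lemma tail_step s phi w a : is_hom s phi -> inA w a ->
  cf (phi (xa a s.+1)) (w + dv a *+ s.+1) = cf (phi (xa a s)) (w + dv a *+ s).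
Proof.
move=> hs Aw; have [neg|pos] := ltrP (w 0 a + s.+1%:Z) 0.
  rewrite /cf !ifF //.
    by apply/negP => /nnP/(_ a); rewrite wD dvMnE eqxx mul1n; lia.
  by apply/negP => /nnP/(_ a); rewrite wD dvMnE eqxx mul1n; lia.
have pw := inA_dv Aw pos.
have : I (phi ('X_[U_(a)] * xa a s) - 'X_[U_(a)] * phi (xa a s)).
  by apply: is_homM hs _; apply: mpowerX; rewrite mdeg_xa.
rewrite -mpolyXD -mulmS => /mono_cfP/(_ _ pw)/eqP; rewrite cfB subr_eq0 => /eqP ->.
by rewrite cfXM -/(dv a) mulrSr addrA addrK.
Qed.

Lemma tlE s phi w a : is_hom s phi ->
  tl phi w a = if inA w a then cf (phi (xa a s)) (w + dv a *+ s) else 0.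
Proof.
move=> hs; rewrite /tl; case: ifP => // Aw.
have H r n : is_hom r phi ->
    cf (phi (xa a (r + n))) (w + dv a *+ (r + n)) = cf (phi (xa a r)) (w + dv a *+ r).
  move=> hr; elim: n => [|n IH]; first by rewrite addn0.
  by rewrite addnS tail_step //; apply: is_hom_le hr; apply: leq_addr.
have hr : is_hom (rk phi) phi by apply: rkP; exists s.
by rewrite -(H _ s hr) addnC H.
Qed.

Lemma homs_common phi psi : homs I phi -> homs I psi ->
  exists s, is_hom s phi /\ is_hom s psi.
Proof.
move=> [r hr] [r' hr']; exists (maxn r r').
by split; [apply: is_hom_le hr|apply: is_hom_le hr']; rewrite ?leq_maxl ?leq_maxr.
Qed.

Lemma is_homD2 s phi psi : is_hom s phi -> is_hom s psi -> is_hom s (fun f => phi f + psi f).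
Proof.
move=> [H1 H2] [G1 G2]; split=> [a f g rf rg|f rf If]; last by apply: ID; [apply: H2|apply: G2].
have := ID (H1 a f g rf rg) (G1 a f g rf rg); congr I; ring.
Qed.

Lemma is_homM2 s phi b : is_hom s phi -> is_hom s (fun f => b * phi f).
Proof.
move=> [H1 H2]; split=> [a f g rf rg|f rf If]; last by apply: IM; apply: H2.
have := @IM b _ (H1 a f g rf rg); congr I; ring.
Qed.

Lemma homsD phi psi : homs I phi -> homs I psi -> homs I (fun f => phi f + psi f).
Proof. by move=> h1 h2; have [s [? ?]] := homs_common h1 h2; exists s; apply: is_homD2. Qed.
Lemma homsM b phi : homs I phi -> homs I (fun f => b * phi f).
Proof. by move=> [s hs]; exists s; apply: is_homM2. Qed.

Lemma tlD phi psi w a : homs I phi -> homs I psi ->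
  tl (fun f => phi f + psi f) w a = tl phi w a + tl psi w a.
Proof.
move=> h1 h2; have [s [hs1 hs2]] := homs_common h1 h2.
rewrite !(tlE _ _ hs1) !(tlE _ _ hs2) (tlE _ _ (is_homD2 hs1 hs2)).
by case: ifP; rewrite ?cfD ?addr0.
Qed.

(* Only shifts [w - m] with nonnegative coordinates off [a] contribute. *)
Lemma tlM b phi w a : homs I phi -> inA w a ->
  tl (fun f => b * phi f) w a = \sum_(m <- msupp b) b@_m * tl phi (w - vb m) a.
Proof.
move=> [s hs] Aw; rewrite (tlE _ _ (is_homM2 b hs)) Aw cfM.
apply: eq_bigr => m _; congr (_ * _); rewrite (tlE _ _ hs); case: ifP => [_|nA].
  by rewrite addrAC.
rewrite /cf ifF //; apply/negP => /nnP w0; case/negP: nA.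
apply: (inA_le Aw) => c ca; have := w0 c.
by rewrite !wB wD vbE dvMnE eq_sym (negPf ca); lia.
Qed.

Lemma tlZ (c : C) phi w a : homs I phi ->
  tl (fun f => c%:MP * phi f) w a = c * tl phi w a.
Proof.
move=> h; case Aw: (inA w a); last by rewrite /tl Aw mulr0.
rewrite tlM // msuppC; case: eqP => [->|_]; first by rewrite big_nil mul0r.
by rewrite big_seq1 mcoeffC eqxx mulr1 vb0 subr0.
Qed.

Lemma tlX i phi w a : homs I phi ->
  tl (fun f => 'X_i * phi f) (w + dv i) a = if inA (w + dv i) a then tl phi w a else 0.
Proof.
move=> h; case: ifP => Aw; last by rewrite /tl Aw.
by rewrite tlM // msuppX big_seq1 mcoeffX eqxx mul1r -/(dv i) addrK.
Qed.

(** The weight [w] part of a function on the complement of the origin: one number for each chart,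
    zero where the chart lacks this weight, and equal for two charts whose overlap sees it. *)
Definition adm w (c : 'I_4 -> C) : Prop :=
  (forall a, ~~ inA w a -> c a = 0) /\ (forall a b, inE2 w a b -> c a = c b).

(** Agreement on overlaps comes from computing phi(x_a^s x_b^s) in both orders, at a weight far out
    in both directions. *)
Lemma tl_adm phi w : homs I phi -> adm w (tl phi w).
Proof.
move=> [r hr]; split=> [a /negPf Aw|a b Eab]; first by rewrite /tl Aw.
have [->|ab] // := eqVneq a b.
(* Large enough for phi, and for both coordinates to pass [K] whatever their signs. *)
pose s := (r + K + absz (w 0%R a) + absz (w 0%R b))%N.
have hs : is_hom s phi by apply: is_hom_le hr; rewrite /s; lia.
have Enn c : c != a -> c != b -> 0 <= w 0 c.
  move=> ca cb; have /pinP[/nnP/(_ c)] := Eab.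
  by rewrite !setwE (negPf ca) (negPf cb).
pose u := w + dv a *+ s + dv b *+ s.
have uE c : u 0 c = w 0 c + ((a == c) * s)%N%:Z + ((b == c) * s)%N%:Z.
  by rewrite /u !wD !dvMnE.
have pu : pin u.
  have -> : u = setw (setw (setw (setw w a K) b K) a (u 0 a)) b (u 0 b).
    apply/rowP => c; rewrite !setwE; case: (eqVneq c b) => [->//|cb].
    case: (eqVneq c a) => [->//|ca].
    by rewrite uE !(eq_sym _ c) (negPf ca) (negPf cb) addr0 addr0.
  apply: pin_set; first apply: pin_set => //.
  - by rewrite !mxE eqxx; case: ifP.
  - by rewrite uE eqxx /s; lia.
  - by rewrite !mxE eqxx eq_sym (negPf ab).
  by rewrite uE eqxx /s; lia.
(* The tail in direction [c] may be read off after a further shift by x_d^s; if the ray in direction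
   [c] is not in the support, some coordinate is negative and both sides vanish. *)
have side c d : c != d -> (forall e, e != c -> e != d -> 0 <= w 0 e) ->
    pin (w + dv c *+ s + dv d *+ s) ->
    (absz (w 0%R c) + K <= s)%N -> (absz (w 0%R d) + K <= s)%N ->
    tl phi w c = cf ('X_[U_(d) *+ s] * phi (xa c s)) (w + dv c *+ s + dv d *+ s).
  move=> cd nne pcd wc wd; rewrite cfXM vbMn addrK (tlE _ _ hs).
  case: ifPn => // nA; rewrite /cf ifF //; apply/negP => /nnP w0.
  case/negP: nA; apply: (@inA_le w (w + dv c *+ s + dv d *+ s)).
    by apply: pin_inA => //; rewrite !wD !dvMnE eqxx; lia.
  move=> e ec; have := w0 e.
  by rewrite !wD !dvMnE (eq_sym c) (negPf ec); lia.
have sa : (absz (w 0%R a) + K <= s)%N by rewrite /s; lia.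
have sb : (absz (w 0%R b) + K <= s)%N by rewrite /s; lia.
have e' : w + dv a *+ s + dv b *+ s = w + dv b *+ s + dv a *+ s by rewrite addrAC.
rewrite (side a b ab Enn pu sa sb) (side b a) //; last 3 first.
- by rewrite eq_sym.
- by move=> e eb ea; apply: Enn.
- by rewrite -e'.
rewrite -e' -/u; have Ha : I (phi (xa b s * xa a s) - xa b s * phi (xa a s)).
  by apply: is_homM hs _; apply: mpowerX; rewrite mdeg_xa.
have Hb : I (phi (xa a s * xa b s) - xa a s * phi (xa b s)).
  by apply: is_homM hs _; apply: mpowerX; rewrite mdeg_xa.
have := is_ideal_trans I_ideal (is_idealBC I_ideal Ha).
rewrite [xa b s * xa a s]mulrC => /(_ _ Hb)/mono_cfP/(_ _ pu)/eqP.
by rewrite cfB subr_eq0 => /eqP.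
Qed.

(** The families that come from S / I: constants on the far directions if x^w is nonzero in S / I,
    and zero otherwise. *)
Definition trivial w (c : 'I_4 -> C) : Prop :=
  if pin w then forall a b, inA w a -> inA w b -> c a = c b else forall a, c a = 0.

Lemma null_hom r g phi : (forall f, mpower r f -> I (phi f - g * f)) -> is_hom r phi.
Proof.
move=> H; split=> [a f h rf rh|f rf If]; last first.
  by have := ID (H f rf) (@IM g f If); rewrite subrK.
have e1 := H _ (mpowerD (@mpowerM r a f rf) rh).
have e2 := @IM a _ (is_idealBC I_ideal (H f rf)).
have e3 := is_idealBC I_ideal (H h rh).
have := ID e1 (ID e2 e3); congr I; ring.
Qed.

Lemma null_homs_homs phi : null_homs I phi -> homs I phi.
Proof. by move=> [r [g H]]; exists r; apply: null_hom H. Qed.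

Lemma null_tl phi : null_homs I phi ->
  exists g, forall w a, inA w a -> tl phi w a = cf g w.
Proof.
move=> [r [g H]]; exists g => w a Aw; pose s := (r + absz (w 0%R a))%N.
have hs : is_hom s phi by apply: is_hom_le (null_hom H); apply: leq_addr.
have pw : pin (w + dv a *+ s) by apply: inA_dv => //; rewrite /s; lia.
have : I (phi (xa a s) - g * xa a s).
  by apply: H; apply: mpowerX; rewrite mdeg_xa leq_addr.
rewrite (tlE _ _ hs) Aw => /mono_cfP/(_ _ pw)/eqP; rewrite cfB subr_eq0 => /eqP ->.
by rewrite mulrC cfXM vbMn addrK.
Qed.

Lemma null_trivial phi w : null_homs I phi -> trivial w (tl phi w).
Proof.
move=> /null_tl[g H]; rewrite /trivial; case: ifP => [_ a b Aa Ab|npw a].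
  by rewrite !H.
case Aa: (inA w a); last by rewrite /tl Aa.
rewrite H // /cf ifF //; apply/negP => /nnP w0.
by move: npw; rewrite (inA_pinn Aa).
Qed.

Lemma is_hom_sum r phi f : is_hom r phi -> mpower r f ->
  I (phi f - \sum_(v <- msupp f) f@_v *: phi 'X_[v]).
Proof.
move=> hr rf; rewrite {1}[f]mpolyE.
have : forall v, v \in msupp f -> (r <= mdeg v)%N by [].
elim: (msupp f) => [|v s IH] H; first by rewrite !big_nil subr0; apply: is_hom0 hr.
have rv := H v (mem_head _ _); have H' (u : box) : u \in s -> (r <= mdeg u)%N by move=> us; apply: H; rewrite inE us orbT.
have {}IH := IH H'.
rewrite !big_cons -(mul_mpolyC _ 'X_[v]) -(mul_mpolyC _ (phi _)).
have rs : mpower r (\sum_(u <- s) f@_u *: 'X_[u]).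
  elim: (s) H => [|u s' IHs] H; first by rewrite big_nil; apply: mpower0.
  rewrite big_cons; apply: mpowerD.
    by rewrite -mul_mpolyC; apply/mpowerM/mpowerX/H; rewrite !inE eqxx orbT.
  apply: IHs => u'; rewrite inE => /orP[/eqP ->|us]; apply: H; rewrite !inE ?eqxx ?us ?orbT //.
have := ID (proj1 hr (f@_v)%:MP 'X_[v] _ (mpowerX rv) rs) IH; congr I; ring.
Qed.

(** The common values of the tails are the coefficients of an element of S which induces phi on a
    power of the maximal ideal. Their support is finite since the four phi(x_a^r) are
    polynomials. *)
Lemma trivial_null phi : homs I phi -> (forall w, trivial w (tl phi w)) -> null_homs I phi.
Proof.
move=> [r hr] triv.
(* The boxes at which some phi(x_a^r) / x_a^r has a nonzero coefficient. *)
pose s := undup (flatten [seq [seq (v - U_(a) *+ r)%MM | v <- msupp (phi (xa a r)) & (r <= v a)%N] | a <- enum 'I_4]).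
pose gv v := if [pick a | inA (vb v) a] is Some a then tl phi (vb v) a else 0.
pose g := \sum_(v <- s) gv v *: 'X_[v].
have gE v : g@_v = if v \in s then gv v else 0.
  rewrite /g raddf_sum /=; case: ifP => vs.
    rewrite (bigD1_seq v) ?undup_uniq //= mcoeffZ mcoeffX eqxx mulr1 big1 ?addr0 // => u uv.
    by rewrite mcoeffZ mcoeffX (negPf uv) mulr0.
  rewrite big_seq big1 // => u us; rewrite mcoeffZ mcoeffX; case: eqP => [e|]; last by rewrite mulr0.
  by rewrite -e us in vs.
have gA w a : inA w a -> cf g w = tl phi w a.
  move=> Aw; have := triv w; rewrite /trivial; case: ifP => [pw eqc|npw ->]; last first.
    rewrite /cf ifF //; apply/negP => /nnP w0; by move: npw; rewrite (inA_pinn Aw).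
  have /pinP[w0 _] := pw; rewrite -{1}(bxK w0) cf_vb gE; case: ifP => vs.
    rewrite /gv bxK //; case: pickP => [b Ab|/(_ a)]; last by rewrite Aw.
    exact: eqc.
  apply/esym/eqP/negPn/negP => nz; move: vs; rewrite mem_undup.
  rewrite (tlE _ _ hr) Aw in nz; have [u uphi ue] := cf_neq0 nz.
  have ue' : u = (bx w + U_(a) *+ r)%MM by apply: vb_inj; rewrite -ue vbD vbMn bxK.
  move=> /negP; apply; apply/flattenP.
  exists [seq (v - U_(a) *+ r)%MM | v <- msupp (phi (xa a r)) & (r <= v a)%N].
    by apply/mapP; exists a; rewrite ?mem_enum.
  apply/mapP; exists u; last by rewrite ue' addmK.
  by rewrite mem_filter uphi andbT ue' mnmDE mulmnE mnm1E eqxx mul1n leq_addl.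
(* A monomial of this degree has a coordinate above [r + K]: r pays for a factor x_a^r, to which phi
   applies, and K keeps the rest far out. *)
exists (4 * (r + K)).+1, g => f rf.
have rf' : mpower r f by apply: mpower_le rf; lia.
apply: is_ideal_trans I_ideal (is_hom_sum hr rf') _.
rewrite [f in _ * f]mpolyE mulr_sumr -sumrB; apply: is_ideal_sum I_ideal _ => v vf.
rewrite -scalerAr -scalerBr; apply: is_idealZ I_ideal _.
have [a va] := big_coord (rf v vf).
pose v' := (v - U_(a) *+ r)%MM.
have Uv : (U_(a) *+ r <= v)%MM.
  by apply/mnm_lepP => i; rewrite mulmnE mnm1E; case: eqP => [<-|]; lia.
have ve : v = (v' + U_(a) *+ r)%MM by rewrite submK.
have v'a : (K <= v' a)%N by rewrite mnmBE mulmnE mnm1E eqxx; lia.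
rewrite ve mpolyXD; apply: is_ideal_trans I_ideal (is_homM hr _) _.
  by apply: mpowerX; rewrite mdeg_xa.
apply/mono_cfP => u pu; rewrite cfB cfXM mulrCA cfXM [g * _]mulrC cfXM vbMn.
case nu: (nn (u - vb v')); last first.
  rewrite {1}/cf nu /cf ifF ?subrr //; apply/negP => /nnP h.
  move: nu => /negP; apply; apply/nnP => i; have := h i.
  by rewrite !wB dvMnE; lia.
have ua : K%:Z <= u 0 a.
  by move/nnP: nu => /(_ a); rewrite wB vbE; lia.
have Aw : inA (u - vb v' - dv a *+ r) a.
  apply: (inA_le (pin_inA pu ua)) => b ba; move/nnP: nu => /(_ b).
  by rewrite !wB dvMnE (eq_sym a) (negPf ba) vbE; lia.
by rewrite (gA _ _ Aw) (tlE _ _ hr) Aw subrK subrr.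
Qed.

Lemma tl_finite phi : homs I phi ->
  exists s : seq wt, forall w a, tl phi w a != 0 -> w \in s.
Proof.
move=> [r hr]; exists (flatten [seq [seq vb v - dv a *+ r | v <- msupp (phi (xa a r))] | a <- enum 'I_4]).
move=> w a; rewrite (tlE _ _ hr); case: ifP => [Aw nz|]; last by rewrite eqxx.
have [v vphi e] := cf_neq0 nz; apply/flattenP.
exists [seq vb v - dv a *+ r | v <- msupp (phi (xa a r))].
  by apply/mapP; exists a; rewrite ?mem_enum.
by apply/mapP; exists v => //; rewrite -e addrK.
Qed.

(** * Torus action *)

Lemma cf_torus (tau : 'I_4 -> C) f w : cf (torus_poly tau f) w = tmon tau w * cf f w.
Proof.
rewrite /torus_poly [f in LHS]mpolyE raddf_sum cf_sum /= [f in RHS]mpolyE cf_sum mulr_sumr.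
apply: eq_bigr => m _; rewrite comp_mpolyZ !cfZ mulrCA; congr (_ * _).
rewrite comp_mpolyX cfX.
have -> : \prod_(i < 4) tnth [tuple tau i *: 'X_i | i < 4] i ^+ m i =
    (\prod_(i < 4) tau i ^+ m i) *: 'X_[m] :> S.
  rewrite (eq_bigr (fun i => (tau i ^+ m i) *: ('X_i ^+ m i : S))); last first.
    by move=> i _; rewrite tnth_mktuple exprZn.
  by rewrite scaler_prod -mpolyXE_id.
rewrite cfZ cfX; case: eqP => [->|_]; last by rewrite !mulr0.
by congr (_ * _); apply: eq_bigr => i _; rewrite vbE.
Qed.

Lemma tmonD (tau : 'I_4 -> C) w u : (forall i, tau i != 0) ->
  tmon tau (w + u) = tmon tau w * tmon tau u.
Proof.
by move=> t0; rewrite /tmon -big_split; apply: eq_bigr => i _; rewrite wD expfzDr.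
Qed.
Lemma tmon_dv (tau : 'I_4 -> C) a s : tmon tau (dv a *+ s) = tau a ^+ s.
Proof.
rewrite /tmon (bigD1 a) //= dvMnE eqxx mul1n big1 ?mulr1 // => i ia.
by rewrite dvMnE eq_sym (negPf ia) mul0n.
Qed.
Lemma tmonV (tau : 'I_4 -> C) w : tmon (fun i => (tau i)^-1) w = (tmon tau w)^-1.
Proof. by rewrite /tmon -prodfV; apply: eq_bigr => i _; rewrite exprz_inv invr_expz. Qed.
Lemma tmon_neq0 (tau : 'I_4 -> C) w : (forall i, tau i != 0) -> tmon tau w != 0.
Proof. by move=> t0; apply/prodf_neq0 => i _; rewrite expfz_neq0. Qed.

Lemma torusD tau f g : torus_poly tau (f + g) = torus_poly tau f + torus_poly tau g :> S.
Proof. exact: comp_mpolyD. Qed.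
Lemma torusB tau f g : torus_poly tau (f - g) = torus_poly tau f - torus_poly tau g :> S.
Proof. exact: comp_mpolyB. Qed.
Lemma torusM tau f g : torus_poly tau (f * g) = torus_poly tau f * torus_poly tau g :> S.
Proof. exact: rmorphM. Qed.
Lemma torusK (tau : 'I_4 -> C) f : (forall i, tau i != 0) ->
  torus_poly tau (torus_poly (fun i => (tau i)^-1) f) = f.
Proof.
move=> t0; apply: mpolyP_cf => w; rewrite !cf_torus tmonV mulrA divff ?mul1r //.
exact: tmon_neq0.
Qed.
Lemma torusI (tau : 'I_4 -> C) f : I f -> I (torus_poly tau f).
Proof. by move=> /mono_cfP If; apply/mono_cfP => w pw; rewrite cf_torus If ?mulr0. Qed.
Lemma torus_mpower (tau : 'I_4 -> C) r f : mpower r f -> mpower r (torus_poly tau f).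
Proof.
move=> rf v; rewrite mcoeff_msupp -cf_vb cf_torus => nz; apply: rf.
by rewrite mcoeff_msupp -cf_vb; apply: contraNneq nz => ->; rewrite mulr0.
Qed.

Lemma torus_is_hom (tau : 'I_4 -> C) r phi : (forall i, tau i != 0) ->
  is_hom r phi -> is_hom r (torus_hom tau phi).
Proof.
move=> t0 [H1 H2]; rewrite /torus_hom; split=> [a f g rf rg|f rf If]; last first.
  by apply: torusI; apply: H2; [apply: torus_mpower|apply: torusI].
have := @torusI tau _ (H1 (torus_poly (fun i => (tau i)^-1) a) _ _
  (@torus_mpower (fun i => (tau i)^-1) _ _ rf) (@torus_mpower (fun i => (tau i)^-1) _ _ rg)).
rewrite (torusD _ (a * f)) (torusM _ a f); set af := (_ + _).
rewrite torusB torusD torusM (torusK a t0); exact: id.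
Qed.

Lemma torus_homs (tau : 'I_4 -> C) phi : (forall i, tau i != 0) ->
  homs I phi -> homs I (torus_hom tau phi).
Proof. by move=> t0 [r hr]; exists r; apply: torus_is_hom. Qed.

(** The factor tau_a^s from the shifted weight cancels against the inverse action on x_a^s. *)
Lemma tl_torus (tau : 'I_4 -> C) phi w a : (forall i, tau i != 0) -> homs I phi ->
  tl (torus_hom tau phi) w a = tmon tau w * tl phi w a.
Proof.
move=> t0 [r hr]; pose s := (r + absz (w 0%R a))%N.
have hs : is_hom s phi by apply: is_hom_le hr; apply: leq_addr.
rewrite (tlE _ _ (torus_is_hom t0 hs)) (tlE _ _ hs); case: ifP => Aw; last by rewrite mulr0.
have pw : pin (w + dv a *+ s) by apply: inA_dv => //; rewrite /s; lia.
rewrite cf_torus tmonD // tmon_dv -mulrA; congr (_ * _).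
have -> : torus_poly (fun i => (tau i)^-1) (xa a s) = (tau a ^- s)%:MP * xa a s.
  apply: mpolyP_cf => u; rewrite cf_torus mul_mpolyC cfZ !cfX vbMn.
  case: eqP => [->|_]; last by rewrite !mulr0.
  by rewrite tmonV tmon_dv.
have := @is_homM _ _ (tau a ^- s)%:MP _ hs (@mpowerX s (U_(a) *+ s) _).
rewrite mdeg_xa => /(_ (leqnn _))/mono_cfP/(_ _ pw)/eqP.
rewrite cfB subr_eq0 [_ %:MP * phi _]mul_mpolyC cfZ => /eqP ->.
by rewrite mulrA divff ?mul1r // expf_neq0.
Qed.

(** * Weight functionals and torus-invariant submodules *)

Variables (Wt : wt -> bool) (r0 r1 : wt -> 'I_4) (ind : wt -> 'I_4 -> bool).
(** A coordinate on admissible families modulo trivial ones: the value on the only component if [w]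
    is outside [p], the difference between two components inside, where constants are divided out.
    By [P1] and [P2] the quotient is a line if [Wt w] holds and zero otherwise. *)
Definition th w (c : 'I_4 -> C) : C := c (r0 w) - (if pin w then c (r1 w) else 0).
Definition indC w a : C := (ind w a)%:R.
Hypothesis P1 : forall w c, adm w c -> (Wt w -> th w c = 0) -> trivial w c.
Hypothesis P2 : forall w, Wt w ->
  [/\ adm w (indC w), th w (indC w) = 1, inA w (r0 w) & pin w -> inA w (r1 w)].

Definition theta phi w : C := th w (tl phi w).

Lemma eq_th w c d : c =1 d -> th w c = th w d.
Proof. by move=> e; rewrite /th !e. Qed.

Lemma trivial_th w c : Wt w -> trivial w c -> th w c = 0.
Proof.
move=> /P2[_ _ A0 A1]; rewrite /trivial /th; case: ifP => [pw H|_ H].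
  by rewrite (H _ (r1 w)) ?subrr //; apply: A1.
by rewrite H subr0.
Qed.

Lemma theta_null phi w : Wt w -> null_homs I phi -> theta phi w = 0.
Proof. by move=> Ww /null_trivial H; apply: trivial_th. Qed.

Lemma null_theta phi : homs I phi -> (forall w, Wt w -> theta phi w = 0) -> null_homs I phi.
Proof. by move=> h H; apply: trivial_null => // w; apply: P1; [apply: tl_adm|apply: H]. Qed.

Lemma thetaD phi psi w : homs I phi -> homs I psi ->
  theta (fun f => phi f + psi f) w = theta phi w + theta psi w.
Proof. by move=> h1 h2; rewrite /theta /th !tlD //; case: ifP => _; ring. Qed.
Lemma thetaZ (c : C) phi w : homs I phi -> theta (fun f => c%:MP * phi f) w = c * theta phi w.
Proof. by move=> h; rewrite /theta /th !tlZ //; case: ifP => _; ring. Qed.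
Lemma theta_torus (tau : 'I_4 -> C) phi w : (forall i, tau i != 0) -> homs I phi ->
  theta (torus_hom tau phi) w = tmon tau w * theta phi w.
Proof. by move=> t0 h; rewrite /theta /th !tl_torus //; case: ifP => _; ring. Qed.

Definition nz w i : bool := [&& Wt w, Wt (w + dv i) & th (w + dv i) (indC w) != 0].

(** As weight spaces are lines, x_i acts between them by a scalar, found on the generator
    [indC w]. *)
Lemma theta_X i phi w : homs I phi -> Wt (w + dv i) ->
  theta (fun f => 'X_i * phi f) (w + dv i) =
  if Wt w then theta phi w * th (w + dv i) (indC w) else 0.
Proof.
move=> h Wv; have [_ _ A0 A1] := P2 Wv.
have -> : theta (fun f => 'X_i * phi f) (w + dv i) = th (w + dv i) (tl phi w).
  by rewrite /theta /th !tlX // A0; case: ifP => // /A1 ->.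
(* What is trivial at [w] stays trivial after multiplication by x_i, so the functional at w + e_i
   factors through the one at [w]. *)
have key c : adm w c -> (Wt w -> th w c = 0) -> th (w + dv i) c = 0.
  move=> ac /(P1 ac); rewrite /trivial /th; case: ifP => [pw H|_ H]; last first.
    by rewrite !H; case: ifP => _; rewrite subrr.
  have /pinP[/nnP w0 _] := pw.
  have Ale a : inA (w + dv i) a -> inA w a.
    by move=> Aa; apply: (inA_le Aa) => b ba; have := w0 b; rewrite wD dvE; lia.
  have pv : pin (w + dv i).
    by apply: (inA_pinn A0); rewrite wD dvE; have := w0 (r0 (w + dv i)); lia.
  by rewrite pv (H _ (r1 (w + dv i))) ?subrr //; apply: Ale => //; apply: A1.
case: ifP => [Ww|nW]; last by apply: key; [apply: tl_adm|rewrite nW].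
have [[a1 a2] t1 _ _] := P2 Ww; have [b1 b2] := tl_adm w h.
pose c a := tl phi w a - theta phi w * indC w a.
have : th (w + dv i) c = 0.
  apply: key.
    split=> [a nA|a b E]; rewrite /c; first by rewrite b1 // a1 // mulr0 subr0.
    by rewrite (b2 _ _ E) (a2 _ _ E).
  move=> _; transitivity (theta phi w - theta phi w * th w (indC w)).
    by rewrite /c /theta /th; case: ifP => _; ring.
  by rewrite t1 mulr1 subrr.
move=> e; apply/eqP; rewrite -subr_eq0 -[X in _ == X]e; apply/eqP.
by rewrite /c /th; case: ifP => _; ring.
Qed.

(** * A homomorphism that generates the weight space *)

Section Ehom.
Variable w : wt.
Hypothesis Ww : Wt w.
(** A coordinate of this size is still at least [K] after the shift by [w]. *)
Definition Rw : nat := (K + \sum_i absz (w 0%R i))%N.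
(** Decides whether x^v lies far out on the distinguished component. Any far direction of [v] may be
    picked, by [ind_eq], as long as v + w is in [p]. *)
Definition chi v : bool := if [pick a | (Rw <= v a)%N] is Some a then ind w a else false.
Definition ehom_mon v : S := if nn (vb v + w) && chi v then 'X_[bx (vb v + w)] else 0.
(** Multiplication by x^w on the distinguished component and zero on the others. *)
Definition ehom f : S := \sum_(v <- msupp f) f@_v *: ehom_mon v.

Lemma Rw_le i : (absz (w 0%R i) + K <= Rw)%N.
Proof. by rewrite /Rw (bigD1 i) //=; lia. Qed.

Lemma cf_ehom f u : nn u ->
  cf (ehom f) u = if nn (u - w) && chi (bx (u - w)) then cf f (u - w) else 0.
Proof.
move=> u0; rewrite /ehom cf_sum.
have E v : cf (ehom_mon v) u = (chi v && (vb v == u - w))%:R.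
  rewrite /ehom_mon; have [e|ne] := eqVneq (vb v) (u - w).
    rewrite e subrK u0 andbT /=; case: ifP => _; last by rewrite /cf u0 mcoeff0.
    by rewrite cfX bxK // eqxx.
  rewrite andbF; case: ifP => [/andP[vw _]|_]; last by rewrite /cf u0 mcoeff0.
  rewrite cfX bxK //; case: eqP => // e; case/eqP: ne.
  by rewrite e addrK.
rewrite (eq_bigr (fun v => f@_v * (chi v && (vb v == u - w))%:R)); last first.
  by move=> v _; rewrite cfZ E.
case: ifP => [/andP[uw ch]|no]; last first.
  rewrite big1 // => v _; case: eqP => [e|]; last by rewrite andbF mulr0.
  by move: no; rewrite -e nn_vb vbK /= => ->; rewrite mulr0.
rewrite -(bxK uw) cf_vb; have [vf|vf] := boolP (bx (u - w) \in msupp f).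
  rewrite (bigD1_seq _ vf) ?msupp_uniq //= eqxx andbT ch mulr1 big1 ?addr0 // => v ne.
  case: eqP => [/vb_inj e|]; last by rewrite andbF mulr0.
  by rewrite e eqxx in ne.
rewrite (memN_msupp_eq0 vf) big_seq big1 // => v vf'.
case: eqP => [/vb_inj e|]; last by rewrite andbF mulr0.
by rewrite -e vf' in vf.
Qed.

Lemma indC_inA a : ~~ inA w a -> ind w a = false.
Proof.
have [[a1 _] _ _ _] := P2 Ww => /a1/eqP; rewrite /indC.
by case: (ind w a); rewrite // oner_eq0.
Qed.

(** Two far directions of a box of [p] overlap, unless a negative third coordinate of [w] excludes
    both of them from the support. *)
Lemma ind_eq v a b : (Rw <= v a)%N -> (Rw <= v b)%N -> pin (vb v + w) -> ind w a = ind w b.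
Proof.
move=> va vbb pv; have [[_ a2] _ _ _] := P2 Ww.
have [[j [ja jb wj]]|no] := pselect (exists j, [/\ j != a, j != b & w 0 j < 0]).
  have nA c : j != c -> ~~ inA w c.
    by move=> jc; apply/negP => Ac; have := inA_nn Ac jc; rewrite leNgt wj.
  by rewrite !indC_inA ?nA.
have nj j : j != a -> j != b -> 0 <= w 0 j.
  by move=> ja jb; rewrite leNgt; apply/negP => wj; apply: no; exists j.
have : indC w a = indC w b.
  apply: a2; apply: (@pin_le (setw (setw (vb v + w) a K) b K)).
  - apply: pin_set => //; first apply: pin_set => //.
      by have := Rw_le a; rewrite wD vbE; lia.
    rewrite setwE; case: ifP => _ //.
    by have := Rw_le b; rewrite wD vbE; lia.
  - apply/nnP => j; rewrite !setwE; case: eqP => // /eqP jb; case: eqP => // /eqP ja.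
    exact: nj.
  move=> j; rewrite !setwE; case: eqP => // _; case: eqP => // _.
  by rewrite wD vbE; lia.
by rewrite /indC; case: (ind w a); case: (ind w b) => // /eqP; rewrite ?oner_eq0 // eq_sym oner_eq0.
Qed.

Lemma chiE v a : (Rw <= v a)%N -> pin (vb v + w) -> chi v = ind w a.
Proof.
move=> va pv; rewrite /chi; case: pickP => [b vb'|/(_ a)]; last by rewrite va.
exact: (ind_eq vb' va pv).
Qed.

(** Multiplication by x^m stays on the component. If x + w has a negative coordinate, so does [w],
    away from the far direction, which therefore does not carry the weight [w]. *)
Lemma chiD x m : (4 * Rw < mdeg x)%N -> pin (vb (x + m)%MM + w) ->
  chi (x + m)%MM = nn (vb x + w) && chi x.
Proof.
move=> dx px; have [a xa'] := big_coord dx; have Ra := Rw_le a.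
rewrite (@chiE _ a) ?mnmDE //; last by lia.
have [nx|nx] := boolP (nn (vb x + w)); rewrite /=.
  rewrite (@chiE _ a) //; first by lia.
  by apply: (pin_le px) => // i; rewrite !wD vbD wD !vbE; lia.
have [j jneg] : exists j, (vb x + w) 0 j < 0.
  by move: nx; rewrite /nn negb_forall => /existsP[j]; rewrite -ltNge => jx; exists j.
apply: indC_inA; apply/negP => Aa; move: jneg; rewrite wD vbE.
have [->|ja] := eqVneq j a; first by lia.
by have := inA_nn Aa ja; lia.
Qed.

Lemma ehom_is_hom : is_hom (4 * Rw).+1 ehom.
Proof.
split=> [a f g rf rg|f rf /mono_cfP If]; apply/mono_cfP => u pu; have /pinP[u0 _] := pu.
  rewrite cfB !cfD !cf_ehom // cfM.
  rewrite (eq_bigr (fun m => a@_m * (if nn (u - w) && chi (bx (u - w)) then cf f (u - w - vb m) else 0))); last first.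
    move=> m _; congr (_ * _); have [z|nzf] := eqVneq (cf f (u - w - vb m)) 0.
      rewrite z if_same; case nu: (nn (u - vb m)); last by rewrite /cf nu.
      by rewrite cf_ehom // addrAC z if_same.
    have [x xf ex] := cf_neq0 nzf.
    have e1 : u - w = vb (x + m)%MM by rewrite vbD -ex subrK.
    have e2 : u - vb m = vb x + w by rewrite -ex addrAC subrK.
    rewrite ex e1 e2 nn_vb vbK /= chiD; last 2 first.
    - exact: rf.
    - by rewrite -e1 subrK.
    case nx: (nn (vb x + w)) => /=; last by rewrite /cf nx.
    by rewrite cf_ehom // addrK nn_vb vbK.
  case: ifP => _; rewrite ?cfD ?cfM ?subrr //.
  by rewrite big1 ?addr0 ?subrr // => m _; rewrite mulr0.
rewrite cf_ehom //; case: ifP => // /andP[ux ch]; apply/eqP/negPn/negP => nzf.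
have [x xf ex] := cf_neq0 nzf; move: ch; rewrite ex vbK => ch.
have eu : u = vb x + w by rewrite -ex subrK.
have [a xa'] := big_coord (rf x xf); have Ra := Rw_le a.
have pxw : pin (vb x + w) by rewrite -eu.
have Aa : inA w a.
  apply/negPn/negP => /indC_inA ia; move: ch; rewrite (@chiE _ a) ?ia //; lia.
move: nzf; rewrite If ?eqxx // ex; apply: (@pin_le (setw (vb x + w) a (x a)%:Z)).
- by apply: pin_set => //; rewrite wD vbE; lia.
- exact: nn_vb.
move=> b; rewrite setwE; case: eqP => [->|/eqP ba]; first by rewrite vbE.
by have := inA_nn Aa ba; rewrite wD vbE; lia.
Qed.

Lemma ehom_homs : homs I ehom.
Proof. by exists (4 * Rw).+1; apply: ehom_is_hom. Qed.

Lemma tl_ehom w' a : tl ehom w' a = if w' == w then indC w a else 0.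
Proof.
case Aa: (inA w' a); last first.
  rewrite /tl Aa; case: eqP => // e; subst w'.
  by rewrite /indC indC_inA ?Aa.
pose s := ((4 * Rw).+1 + absz (w' 0%R a))%N.
have hs : is_hom s ehom by apply: is_hom_le ehom_is_hom; apply: leq_addr.
have pu : pin (w' + dv a *+ s) by apply: inA_dv => //; rewrite /s; lia.
have /pinP[u0 _] := pu; rewrite (tlE _ _ hs) Aa cf_ehom // cfX vbMn.
have [e|ne] := eqVneq w' w.
  rewrite e addrAC subrr add0r eqxx -vbMn nn_vb vbK /=.
  rewrite (@chiE _ a); first by rewrite /indC; case: (ind w a).
    by rewrite mulmnE mnm1E eqxx mul1n /s; lia.
  by rewrite vbMn addrC -e.
rewrite (_ : (_ == _) = false) ?if_same //; apply/eqP => /eqP.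
by rewrite addrAC -subr_eq0 addrK subr_eq0 (negPf ne).
Qed.

Lemma theta_ehom w' : Wt w' -> theta ehom w' = (w' == w)%:R.
Proof.
move=> Ww'; have [e|ne] := eqVneq w' w; last first.
  by rewrite /theta /th !tl_ehom (negPf ne) if_same subrr.
by rewrite /theta (eq_th _ (tl_ehom w')) e eqxx; have [] := P2 Ww.
Qed.

End Ehom.

Section Submodules.
Variable B : set (S -> S).
Hypothesis Bsub : is_submodule I B.
Hypothesis Btor : torus_invariant B.

Let Bh phi : B phi -> homs I phi. Proof. by case: Bsub => H _ _ _ /H. Qed.
Let B0 phi : null_homs I phi -> B phi. Proof. by case: Bsub => _ H _ _ /H. Qed.
Let BD phi psi : B phi -> B psi -> B (fun f => phi f + psi f).
Proof. by case: Bsub => _ _ H _; apply: H. Qed.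
Let BM a phi : B phi -> B (fun f => a * phi f).
Proof. by case: Bsub => _ _ _ H; apply: H. Qed.

Lemma sub_sum (T : Type) (s : seq T) (F : T -> S -> S) :
  (forall t, B (F t)) -> B (fun f => \sum_(t <- s) F t f).
Proof.
move=> H; elim: s => [|t s IH].
  apply: B0; exists 0%N, 0 => f _; rewrite big_nil mul0r subrr; exact: I0.
by rewrite (_ : (fun f => _) = fun f => F t f + \sum_(t <- s) F t f);
  [apply: BD|apply/funext => f; rewrite big_cons].
Qed.

(** The value 2 in a coordinate where the weights differ separates them, since the powers of 2 are
    distinct. *)
Lemma separate (w w' : wt) : w != w' ->
  exists tau : 'I_4 -> C, (forall i, tau i != 0) /\ tmon tau w != tmon tau w'.
Proof.
move=> ne; have [i wi] : exists i, w 0 i != w' 0 i.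
  apply: contrapT => no; case/eqP: ne; apply/rowP => i.
  by apply/eqP/negPn/negP => wi; apply: no; exists i.
exists (fun j => if j == i then 2%:R else 1); split=> [j|].
  by case: ifP => _; rewrite ?oner_eq0 ?pnatr_eq0.
have E u : tmon (fun j => if j == i then 2%:R else 1) u = (2%:R : C) ^ u 0 i.
  rewrite /tmon (bigD1 i) //= eqxx big1 ?mulr1 // => j /negPf ->.
  by rewrite exp1rz.
have E2 z : (2%:R : C) ^ z = ratr ((2%:R : rat) ^ z) by rewrite -(ratr_nat C 2) fmorphXz.
rewrite !E !E2; apply/eqP => /(fmorph_inj _) e; case/eqP: wi.
by apply: ieexprIz e.
Qed.

(* Subtracting eigenvalues of torus elements isolates a single weight. *)
Lemma isolate_weight phi w0 : B phi -> Wt w0 -> theta phi w0 != 0 ->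
  exists2 e, B e & forall w, Wt w -> theta e w = (w == w0)%:R.
Proof.
move=> Bphi Ww0 nz0; have [s Hs] := tl_finite (Bh Bphi).
have : forall w, Wt w -> theta phi w != 0 -> w = w0 \/ w \in s.
  move=> w Ww nzw; right; have [z|/Hs//] := eqVneq (tl phi w (r0 w)) 0.
  have [z'|/Hs//] := eqVneq (tl phi w (r1 w)) 0.
  by case/eqP: nzw; rewrite /theta /th z z' if_same subrr.
move=> {Hs}; elim: s phi Bphi nz0 => [|w1 s IH] phi Bphi nz0 H.
  exists (fun f => ((theta phi w0)^-1)%:MP * phi f); first exact: BM.
  move=> w Ww; rewrite thetaZ; last exact: Bh.
  case: eqP => [->|ne]; first by rewrite mulVf.
  have [->|/(H w Ww)[]//] := eqVneq (theta phi w) 0; by rewrite mulr0.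
have [e1|ne] := eqVneq w1 w0.
  apply: (IH phi) => // w Ww /(H w Ww)[->|]; first by left.
  by rewrite inE e1 => /orP[/eqP ->|]; [left|right].
have [tau [t0 tw]] := separate ne.
pose psi f := torus_hom tau phi f + (- tmon tau w1)%:MP * phi f.
have Bt : B (torus_hom tau phi) by apply: Btor.
have thpsi w : theta psi w = (tmon tau w - tmon tau w1) * theta phi w.
  rewrite /psi thetaD; [|by apply: Bh|by apply: homsM; apply: Bh].
  by rewrite theta_torus ?thetaZ //; [ring|apply: Bh|apply: Bh].
apply: (IH psi).
- by apply: BD => //; apply: BM.
- by rewrite thpsi mulf_neq0 // subr_eq0 eq_sym.
move=> w Ww; rewrite thpsi mulf_eq0 negb_or subr_eq0 => /andP[ne1 /(H w Ww)[->|]]; first by left.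
by rewrite inE => /orP[/eqP e|]; [rewrite e eqxx in ne1|right].
Qed.

End Submodules.

Definition wclosed (l : seq wt) : Prop :=
  forall w, w \in l -> Wt w /\ forall i, nz w i -> w + dv i \in l.

Definition Bset (l : seq wt) : set (S -> S) :=
  [set phi | homs I phi /\ forall w, Wt w -> theta phi w != 0 -> w \in l].

(** By linearity x^m b(f) = f b(x^m), so x^m b is multiplication by b(x^m). Hence only finitely many
    monomials act nontrivially on the class of b. *)
Lemma torsion_null r b (m : box) : is_hom r b -> (r <= mdeg m)%N ->
  null_homs I (fun f => 'X_[m] * b f).
Proof.
move=> hb rm; exists r, (b 'X_[m]) => f rf.
have H1 := is_homM hb rf (a := 'X_[m]).
have H2 := is_homM hb (mpowerX rm) (a := f).
apply: is_ideal_trans I_ideal (is_idealBC I_ideal H1) _.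
by rewrite mulrC [b _ * f]mulrC.
Qed.

(** Torus elements split B into weight vectors, and a line has only two subspaces, so B is known
    from its set of weights. Its finiteness comes from the generators. *)
Lemma PT_shape B : is_submodule I B -> torus_invariant B -> finitely_generated I B ->
  exists l, [/\ uniq l, wclosed l & B = Bset l].
Proof.
move=> Bsub Btor [n [b [Bb gen]]]; have [Bh B0 BD BM] := Bsub.
have /choice[rb Hrb] : forall k, exists r, is_hom r (b k) by move=> k; apply: Bh.
have /choice[sb Hsb] : forall k, exists s : seq wt, forall w a, tl (b k) w a != 0 -> w \in s.
  by move=> k; apply: tl_finite; apply: Bh.
(* Monomials of degree at least [rb k] kill [b k], so the weights of B are among finitely many
   translates of those of the generators. *)
pose ms k : seq box := [seq bmnm m | m : 'X_{1..4 < rb k}].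
pose L := flatten [seq flatten [seq [seq w + vb m | w <- sb k] | m <- ms k] | k <- enum 'I_n].
have suppL phi w : B phi -> Wt w -> theta phi w != 0 -> w \in L.
  move=> Bphi Ww nzw; have [a Ha] := gen phi Bphi.
  have [_ _ A0 A1] := P2 Ww.
  have hsum : homs I (fun f => \sum_k a k * b k f).
    by apply: Bh; apply: (sub_sum Bsub) => k; exact: (BM _ _ (Bb k)).
  have hphi : homs I phi by apply: Bh.
  have hneg : homs I (fun f => (-1) * \sum_k a k * b k f) by apply: homsM.
  have : theta (fun f => phi f + (-1) * \sum_k a k * b k f) w = 0.
    apply: theta_null => //; congr (null_homs I _): Ha.
    by apply/funext => f; rewrite mulN1r.
  rewrite thetaD // (_ : (fun f => (-1) * \sum_k a k * b k f) = (fun f => (-1)%:MP * \sum_k a k * b k f)); last first.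
    by apply/funext => f; rewrite mpolyCN mpolyC1.
  rewrite thetaZ // mulN1r => /eqP; rewrite subr_eq0 => /eqP e.
  have [k nzk] : exists k, theta (fun f => a k * b k f) w != 0.
    apply: contrapT => no; case/eqP: nzw; rewrite e.
    have : forall k, theta (fun f => a k * b k f) w = 0.
      by move=> k; apply/eqP/negPn/negP => nk; apply: no; exists k.
    rewrite /index_enum; elim: (Finite.enum _) => [|k s IH] H.
      apply: theta_null => //; exists 0%N, 0 => f _; rewrite big_nil mul0r subrr; exact: I0.
    rewrite (_ : (fun f => _) = (fun f => a k * b k f + \sum_(k <- s) a k * b k f)); last first.
      by apply/funext => f; rewrite big_cons.
    rewrite thetaD ?H ?add0r; [exact: IH|by apply: homsM; apply: Bh|].
    by apply: Bh; apply: (sub_sum Bsub) => j; exact: (BM _ _ (Bb j)).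
  have bk := Bh _ (Bb k).
  have [m [ma nzm]] : exists m, m \in msupp (a k) /\ exists c, tl (b k) (w - vb m) c != 0 /\ theta (fun f => 'X_[m] * b k f) w != 0.
    apply: contrapT => no; case/eqP: nzk.
    have E : forall m, m \in msupp (a k) -> (a k)@_m * (tl (b k) (w - vb m) (r0 w) - if pin w then tl (b k) (w - vb m) (r1 w) else 0) = 0.
      move=> m ma; apply/eqP/negPn/negP; rewrite mulf_eq0 negb_or => /andP[_ nzm].
      apply: no; exists m; split=> //.
      have e2 : theta (fun f => 'X_[m] * b k f) w = tl (b k) (w - vb m) (r0 w) - (if pin w then tl (b k) (w - vb m) (r1 w) else 0).
        rewrite /theta /th tlM // msuppX big_seq1 mcoeffX eqxx mul1r; congr (_ - _).
        by case: ifP => // pw; rewrite tlM ?A1 // msuppX big_seq1 mcoeffX eqxx mul1r.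
      rewrite e2; have [z|nz0] := eqVneq (tl (b k) (w - vb m) (r0 w)) 0; last by exists (r0 w).
      exists (r1 w); split=> //; apply: contraNneq nzm => z1.
      by rewrite z z1 if_same subrr.
    rewrite /theta /th tlM //; case: ifP => pw.
      rewrite tlM ?A1 // -sumrB big_seq big1 // => m ma.
      by rewrite -mulrBr; have := E m ma; rewrite pw.
    by rewrite subr0 big_seq big1 // => m ma; have := E m ma; rewrite pw subr0.
  case: nzm => c [nzc nzt].
  have mr : (mdeg m < rb k)%N.
    rewrite ltnNge; apply/negP => rm; case/eqP: nzt; apply: theta_null => //.
    exact: torsion_null (Hrb k) rm.
  apply/flattenP; exists (flatten [seq [seq w + vb m | w <- sb k] | m <- ms k]).
    by apply/mapP; exists k; rewrite ?mem_enum.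
  apply/flattenP; exists [seq w + vb m | w <- sb k].
    apply/mapP; exists m => //; apply/mapP; exists (BMultinom mr) => //.
    by rewrite mem_enum.
  by apply/mapP; exists (w - vb m); [apply: Hsb nzc|rewrite subrK].
pose beta w := `[< Wt w /\ exists2 phi, B phi & theta phi w != 0 >].
pose l := undup [seq w <- L | beta w].
have lE w : w \in l <-> Wt w /\ exists2 phi, B phi & theta phi w != 0.
  rewrite mem_undup mem_filter; split=> [/andP[/asboolP]//|[Ww [phi Bphi nzw]]].
  by rewrite (suppL phi) // andbT; apply/asboolP; split=> //; exists phi.
have iso w : w \in l -> exists2 e, B e & forall w', Wt w' -> theta e w' = (w' == w)%:R.
  by move=> /lE[Ww [phi Bphi nzw]]; apply: (isolate_weight Bsub Btor Bphi).
exists l; split; first exact: undup_uniq.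
  move=> w wl; have [Ww _] := proj1 (lE w) wl; split=> // i /and3P[_ Wv nzv].
  have [e Be He] := iso w wl; apply/lE; split=> //.
  exists (fun f => 'X_i * e f); first exact: BM.
  rewrite theta_X //; last exact: Bh.
  by rewrite Ww He // eqxx mul1r.
apply/seteqP; split=> [phi Bphi|phi [hphi Hphi]].
  by split=> [|w Ww nzw]; [apply: Bh|apply/lE; split=> //; exists phi].
have /choice[e He] : forall w, exists e, B e /\ (w \in l -> forall w', Wt w' -> theta e w' = (w' == w)%:R).
  move=> w; have [/iso[e Be He]|nw] := boolP (w \in l); first by exists e.
  by exists (fun=> 0); split=> //; apply: B0; exists 0%N, 0 => f _; rewrite mul0r subrr; exact: I0.
(* The isolated weight vectors, combined with the coordinates of phi. All coordinates of the
   difference vanish, so it is null, and phi lies in B. *)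
pose psi f := \sum_(w <- l) (theta phi w)%:MP * e w f.
have Bpsi : B psi by apply: (sub_sum Bsub) => w; exact: (BM _ _ (proj1 (He w))).
have nullB : null_homs I (fun f => phi f + (-1)%:MP * psi f).
  apply: null_theta; first by apply: homsD => //; apply: homsM; apply: Bh.
  move=> w Ww; rewrite thetaD //; last by apply: homsM; apply: Bh.
  rewrite thetaZ ?mulN1r; last exact: Bh.
  have -> : theta psi w = \sum_(w' <- l) theta phi w' * (w == w')%:R.
    rewrite /psi; have : {subset l <= l} by []; elim: {1 3 4}l => [|w' s IH] sub.
      rewrite big_nil; apply: theta_null => //; exists 0%N, 0 => f _; rewrite big_nil mul0r subrr; exact: I0.
    rewrite (_ : (fun f => _) = (fun f => (theta phi w')%:MP * e w' f + \sum_(w <- s) (theta phi w)%:MP * e w f)); last first.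
      by apply/funext => f; rewrite big_cons.
    have hw' : homs I (e w') by apply: Bh; apply: (proj1 (He w')).
    rewrite thetaD; [|exact: homsM|]; last first.
      by apply: Bh; apply: (sub_sum Bsub) => u; exact: (BM _ _ (proj1 (He u))).
    rewrite big_cons thetaZ // (proj2 (He w')) ?sub ?mem_head //.
    by rewrite IH // => u us; apply: sub; rewrite inE us orbT.
  have [wl|wl] := boolP (w \in l).
    rewrite (bigD1_seq w) ?undup_uniq //= eqxx mulr1 big1 ?addr0 ?subrr // => u uw.
    by rewrite eq_sym (negPf uw) mulr0.
  rewrite big_seq big1 ?subr0 => [|u ul]; last first.
    by case: eqP => [e1|]; [rewrite e1 ul in wl|rewrite mulr0].
  by apply/eqP/negPn/negP => /(Hphi w Ww); rewrite (negPf wl).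
have := BD _ _ (B0 _ nullB) Bpsi; congr B; apply/funext => f.
by rewrite mpolyCN mpolyC1 mulN1r subrK.
Qed.

Lemma null0 : null_homs I (fun=> 0).
Proof. by exists 0%N, 0 => f _; rewrite mul0r subrr; exact: I0. Qed.

Lemma homs_sum (T : Type) (s : seq T) (F : T -> S -> S) :
  (forall t, homs I (F t)) -> homs I (fun f => \sum_(t <- s) F t f).
Proof.
move=> H; elim: s => [|t s IH].
  by rewrite (_ : (fun f => _) = fun=> 0); [apply/null_homs_homs/null0|apply/funext => f; rewrite big_nil].
by rewrite (_ : (fun f => _) = fun f => F t f + \sum_(t <- s) F t f);
  [apply: homsD|apply/funext => f; rewrite big_cons].
Qed.

Lemma theta_sum (T : Type) (s : seq T) (c : T -> C) (F : T -> S -> S) w : Wt w ->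
  (forall t, homs I (F t)) ->
  theta (fun f => \sum_(t <- s) c t *: F t f) w = \sum_(t <- s) c t * theta (F t) w.
Proof.
move=> Ww H; elim: s => [|t s IH].
  rewrite big_nil (_ : (fun f => _) = fun=> 0); first exact/theta_null/null0.
  by apply/funext => f; rewrite big_nil.
rewrite (_ : (fun f => _) = fun f => (c t)%:MP * F t f + \sum_(t <- s) c t *: F t f); last first.
  by apply/funext => f; rewrite big_cons mul_mpolyC.
rewrite thetaD ?thetaZ ?IH ?big_cons //; first exact: homsM.
rewrite (_ : (fun f => _) = fun f => \sum_(t <- s) (c t)%:MP * F t f).
  by apply: homs_sum => u; apply: homsM.
by apply/funext => f; apply: eq_bigr => u _; rewrite mul_mpolyC.
Qed.

Lemma thetaBZ phi psi (c : C) w : homs I phi -> homs I psi ->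
  theta (fun f => phi f - c *: psi f) w = theta phi w - c * theta psi w.
Proof.
move=> h1 h2; rewrite (_ : (fun f => _) = fun f => phi f + (- c)%:MP * psi f).
  by rewrite thetaD ?thetaZ ?mulNr //; apply: homsM.
by apply/funext => f; rewrite mul_mpolyC scaleNr.
Qed.

Lemma homsBZ phi psi (c : C) : homs I phi -> homs I psi -> homs I (fun f => phi f - c *: psi f).
Proof.
move=> h1 h2; rewrite (_ : (fun f => _) = fun f => phi f + (- c)%:MP * psi f).
  by apply: homsD => //; apply: homsM.
by apply/funext => f; rewrite mul_mpolyC scaleNr.
Qed.

(** * Submodules attached to finite closed sets of weights *)

Section ClosedSets.
Variable l : seq wt.
Hypothesis cl : wclosed l.

Lemma BsetD phi psi : Bset l phi -> Bset l psi -> Bset l (fun f => phi f + psi f).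
Proof.
move=> [h1 H1] [h2 H2]; split=> [|w Ww]; first exact: homsD.
rewrite thetaD //; have [e|nz1 _] := eqVneq (theta phi w) 0; last exact: H1.
by rewrite e add0r; apply: H2.
Qed.

Lemma BsetZ (c : C) phi : Bset l phi -> Bset l (fun f => c *: phi f).
Proof.
move=> [h1 H1]; have e : (fun f => c *: phi f) = (fun f => c%:MP * phi f).
  by apply/funext => f; rewrite mul_mpolyC.
rewrite e; split=> [|w Ww]; first exact: homsM.
by rewrite thetaZ // mulf_eq0 negb_or => /andP[_]; apply: H1.
Qed.

Lemma Bset0 phi : null_homs I phi -> Bset l phi.
Proof.
move=> H; split=> [|w Ww]; first exact: null_homs_homs.
by rewrite theta_null ?eqxx.
Qed.

Lemma BsetX i phi : Bset l phi -> Bset l (fun f => 'X_i * phi f).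
Proof.
move=> [h H]; split=> [|v Wv]; first exact: homsM.
have e : v = v - dv i + dv i by rewrite subrK.
rewrite e in Wv *; rewrite theta_X //; case: ifP => [Ww|]; last by rewrite eqxx.
rewrite mulf_eq0 negb_or => /andP[nzt nzv]; apply: (proj2 (cl (H _ Ww nzt))).
by rewrite /nz Ww Wv.
Qed.

Lemma BsetM a phi : Bset l phi -> Bset l (fun f => a * phi f).
Proof.
move=> Bphi.
have BX v : Bset l (fun f => 'X_[v] * phi f).
  have [n] := ubnP (mdeg v); elim: n v => // n IH v dv'.
  have [v0|v0] := eqVneq v 0%MM.
    by rewrite (_ : (fun f => _) = phi) //; apply/funext => f; rewrite v0 mpolyX0 mul1r.
  have [i vi] : exists i, (0 < v i)%N.
    apply: contrapT => no; case/eqP: v0; apply/mnmP => i; rewrite mnm0E.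
    by apply/eqP; rewrite -leqn0 leqNgt; apply/negP => vi; apply: no; exists i.
  have Uv : (U_(i) <= v)%MM by apply/mnm_lepP => j; rewrite mnm1E; case: eqP => [<-|].
  have e : v = (U_(i) + (v - U_(i)))%MM by rewrite addmC submK.
  rewrite (_ : (fun f => _) = fun f => 'X_i * ('X_[v - U_(i)] * phi f)).
    apply: BsetX; apply: IH; move: dv'; rewrite {1}e mdegD mdeg1; lia.
  by apply/funext => f; rewrite {1}e mpolyXD mulrA.
rewrite (_ : (fun f => _) = fun f => \sum_(v <- msupp a) a@_v *: ('X_[v] * phi f)); last first.
  apply/funext => f; rewrite {1}[a]mpolyE mulr_suml; apply: eq_bigr => v _.
  by rewrite scalerAl.
elim: (msupp a) => [|v s IH].
  rewrite (_ : (fun f => _) = fun=> 0); first exact/Bset0/null0.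
  by apply/funext => f; rewrite big_nil.
rewrite (_ : (fun f => _) = fun f => a@_v *: ('X_[v] * phi f) + \sum_(v <- s) a@_v *: ('X_[v] * phi f)).
  by apply: BsetD => //; apply: BsetZ.
by apply/funext => f; rewrite big_cons.
Qed.

Lemma Bset_submodule : is_submodule I (Bset l).
Proof.
split=> [phi []|phi||] //; first exact: Bset0.
- exact: BsetD.
exact: BsetM.
Qed.

Lemma Bset_torus : torus_invariant (Bset l).
Proof.
move=> tau phi t0 [h H]; split=> [|w Ww]; first exact: torus_homs.
by rewrite theta_torus // mulf_eq0 negb_or => /andP[_]; apply: H.
Qed.

Lemma Bset_ehom w : w \in l -> Bset l (ehom w).
Proof.
move=> wl; have [Ww _] := cl wl; split=> [|w' Ww']; first exact: ehom_homs.
rewrite theta_ehom //; have [->|_] := eqVneq w' w; first by [].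
by rewrite eqxx.
Qed.

Lemma Bset_fg : uniq l -> finitely_generated I (Bset l).
Proof.
move=> ul; exists (size l), (fun k => ehom (nth 0 l k)); split=> [k|phi [h H]].
  by apply: Bset_ehom; rewrite mem_nth.
exists (fun k => (theta phi (nth 0 l k))%:MP).
have hk (k : 'I_(size l)) : homs I (ehom (nth 0 l k)).
  by apply: ehom_homs; apply: (proj1 (cl _)); rewrite mem_nth.
have hs : homs I (fun f => \sum_(k < size l) theta phi (nth 0 l k) *: ehom (nth 0 l k) f).
  rewrite (_ : (fun f => _) = fun f => \sum_(k < size l) (theta phi (nth 0 l k))%:MP * ehom (nth 0 l k) f).
    by apply: homs_sum => k; apply: homsM.
  by apply/funext => f; apply: eq_bigr => k _; rewrite mul_mpolyC.
rewrite (_ : (fun f => _) = (fun f => phi f - 1 *: (\sum_(k < size l) theta phi (nth 0 l k) *: ehom (nth 0 l k) f))); last first.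
  apply/funext => f; rewrite scale1r; congr (_ - _).
  by apply: eq_bigr => k _; rewrite mul_mpolyC.
apply: null_theta => [|w Ww]; first exact: homsBZ.
rewrite thetaBZ // theta_sum // mul1r.
rewrite (eq_bigr (fun k : 'I_(size l) => theta phi (nth 0 l k) * (w == nth 0 l k)%:R)); last first.
  by move=> k _; rewrite theta_ehom //; apply: (proj1 (cl _)); rewrite mem_nth.
rewrite -(big_mkord xpredT (fun k => theta phi (nth 0 l k) * (w == nth 0 l k)%:R)).
rewrite -(big_nth 0 xpredT (fun w' => theta phi w' * (w == w')%:R)).
have [wl|wl] := boolP (w \in l).
  rewrite (bigD1_seq w) //= eqxx mulr1 big1 ?addr0 ?subrr // => u uw.
  by rewrite eq_sym (negPf uw) mulr0.
rewrite big_seq big1 ?subr0 => [|u ul']; last first.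
  by case: eqP => [e1|]; [rewrite e1 ul' in wl|rewrite mulr0].
by apply/eqP/negPn/negP => /(H w Ww); rewrite (negPf wl).
Qed.

Lemma wspace_theta phi w w' : weight_space I (Bset l) w phi -> Wt w' -> w' != w ->
  theta phi w' = 0.
Proof.
move=> [[h _] H] Ww' ne; have [tau [t0 tw]] := separate ne.
have := theta_null Ww' (H tau t0); rewrite thetaBZ ?theta_torus //; last exact: torus_homs.
by rewrite -mulrBl => /eqP; rewrite mulf_eq0 subr_eq0 (negPf tw) => /eqP.
Qed.

Lemma wspace_null phi w : weight_space I (Bset l) w phi ->
  (w \in l -> theta phi w = 0) -> null_homs I phi.
Proof.
move=> Hw H; have [[h Hl] _] := Hw; apply: null_theta => // w' Ww'.
have [e|ne] := eqVneq w' w; last exact: wspace_theta Hw Ww' ne.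
by subst w'; apply/eqP/negPn/negP => nzt; case/eqP: (nzt); apply: H; apply: Hl.
Qed.

(** Because of [xget] the dimension also has to be shown unique: [theta] is injective on a weight
    space, so two vectors of the same weight are dependent. *)
Lemma weight_dim_Bset w : weight_dim I (Bset l) w = (w \in l).
Proof.
rewrite /weight_dim; have wsh phi : weight_space I (Bset l) w phi -> homs I phi by case=> -[].
apply: xget_unique => [|d [b [bw ind_b span_b]]].
  have [wl|wl] := boolP (w \in l); last first.
    exists (fun _ _ => 0); split=> [[]|c _ []|phi Hphi] //; exists (fun=> 0).
    rewrite (_ : (fun f => _) = phi); last by apply/funext => f; rewrite big_ord0 subr0.
    by apply: wspace_null Hphi _; rewrite (negPf wl).
  have [Ww _] := cl wl; have he := ehom_homs Ww.
  exists (fun _ => ehom w); split=> [k|c nullc k|phi Hphi].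
  - split=> [|tau t0]; first exact: Bset_ehom.
    apply: null_theta; first by apply: homsBZ => //; apply: torus_homs.
    move=> w' Ww'; rewrite thetaBZ ?theta_torus // ?theta_ehom //; last exact: torus_homs.
    by case: eqP => [->|_]; rewrite ?mulr0 ?mulr1 subrr.
  - have := theta_null Ww nullc; rewrite theta_sum // (bigD1 k) //= big1 ?addr0.
      by rewrite theta_ehom // eqxx mulr1.
    by move=> j; rewrite (ord1 j) (ord1 k) eqxx.
  exists (fun=> theta phi w).
  rewrite (_ : (fun f => _) = fun f => phi f - theta phi w *: ehom w f); last first.
    by apply/funext => f; rewrite big_ord1.
  apply: null_theta => [|w' Ww']; first by apply: homsBZ => //; apply: wsh.
  rewrite thetaBZ ?theta_ehom //; last exact: wsh.
  case: eqP => [->|/eqP ne]; first by rewrite mulr1 subrr.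
  by rewrite (wspace_theta Hphi Ww' ne) mulr0 subrr.
have hb k : homs I (b k) by apply: wsh.
have nzb k : w \in l /\ theta (b k) w != 0.
  have key : ~ null_homs I (b k).
    move=> nb; suff H : null_homs I (fun f => \sum_j (j == k)%:R *: b j f).
      by have /eqP := ind_b (fun j => (j == k)%:R) H k; rewrite eqxx oner_eq0.
    congr (null_homs I _): nb; apply/funext => f.
    rewrite (bigD1 k) //= eqxx scale1r big1 ?addr0 // => j /negPf ->.
    by rewrite scale0r.
  have [wl|wl] := boolP (w \in l).
    by split=> //; apply/eqP => e; apply: key; apply: wspace_null (bw k) _.
  by case: key; apply: wspace_null (bw k) _; rewrite (negPf wl).
case: d b bw ind_b span_b hb nzb => [|[|d]] b bw ind_b span_b hb nzb.
- have [wl|//] := boolP (w \in l); have [Ww _] := cl wl.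
  have Hw : weight_space I (Bset l) w (ehom w).
    split=> [|tau t0]; first exact: Bset_ehom.
    have he := ehom_homs Ww.
    apply: null_theta; first by apply: homsBZ => //; apply: torus_homs.
    move=> w' Ww'; rewrite thetaBZ ?theta_torus // ?theta_ehom //; last exact: torus_homs.
    by case: eqP => [->|_]; rewrite ?mulr0 ?mulr1 subrr.
  have [c] := span_b _ Hw.
  rewrite (_ : (fun f => _) = ehom w); last by apply/funext => f; rewrite big_ord0 subr0.
  by move=> /(theta_null Ww)/eqP; rewrite theta_ehom // eqxx oner_eq0.
- by have [->] := nzb ord0.
have [wl nz0] := nzb ord0; have [_ nz1] := nzb ord_max; have [Ww _] := cl wl.
(* The linear relation between the first and the last of at least two vectors of a line. *)
pose c (k : 'I_d.+2) : C := if k == ord0 then theta (b ord_max) w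
  else if k == ord_max then - theta (b ord0) w else 0.
have c0 : c ord0 = 0.
  apply: ind_b; apply: null_theta => [|w' Ww'].
    rewrite (_ : (fun f => _) = fun f => \sum_k (c k)%:MP * b k f).
      by apply: homs_sum => k; apply: homsM.
    by apply/funext => f; apply: eq_bigr => k _; rewrite mul_mpolyC.
  rewrite theta_sum //; have [->|ne] := eqVneq w' w; last first.
    by rewrite big1 // => k _; rewrite (wspace_theta (bw k) Ww' ne) mulr0.
  rewrite (bigD1 ord0) //= (bigD1 ord_max) //= /c eqxx /= eqxx big1; first by ring.
  by move=> k /andP[/negPf -> /negPf ->]; rewrite mul0r.
by move: nz1; rewrite -[theta _ _]/(c ord0) c0 eqxx.
Qed.

End ClosedSets.

Lemma Bset_inj l l' : wclosed l -> wclosed l' -> Bset l = Bset l' -> l =i l'.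
Proof.
have sub m m' : wclosed m -> Bset m = Bset m' -> {subset m <= m'}.
  move=> cm e w wm; have [Ww _] := cm w wm.
  have [_] : Bset m' (ehom w) by rewrite -e; apply: Bset_ehom.
  by apply=> //; rewrite theta_ehom // eqxx oner_neq0.
by move=> c1 c2 e w; apply/idP/idP; apply: sub.
Qed.

End Tails.

(** * Unions of orthants *)

Definition kv (w : 'rV[int]_4) : key := [:: Z_of_int (w 0 i1); Z_of_int (w 0 i2); Z_of_int (w 0 i3); Z_of_int (w 0 i4)].
Definition vk (k : key) : 'rV[int]_4 := \row_(i < 4) zi (nth Z0 k i).

Lemma ord4P (P : 'I_4 -> Prop) : P i1 -> P i2 -> P i3 -> P i4 -> forall i, P i.
Proof.
move=> h1 h2 h3 h4 [[|[|[|[|j]]]] lt] //.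
- by rewrite (_ : Ordinal lt = i1) //; apply: val_inj.
- by rewrite (_ : Ordinal lt = i2) //; apply: val_inj.
- by rewrite (_ : Ordinal lt = i3) //; apply: val_inj.
by rewrite (_ : Ordinal lt = i4) //; apply: val_inj.
Qed.

Lemma kvE w (i : 'I_4) : zi (nth Z0 (kv w) i) = w 0 i.
Proof. by elim/ord4P: i => /=; rewrite Z_of_intK. Qed.
Lemma vkE k i : vk k 0 i = zi (nth Z0 k i).
Proof. by rewrite mxE. Qed.
Lemma kvK : cancel kv vk.
Proof. by move=> w; apply/rowP => i; rewrite vkE kvE. Qed.
Lemma kv_inj : injective kv.
Proof. exact: can_inj kvK. Qed.
Lemma vkK k : size k = 4%N -> kv (vk k) = k.
Proof.
case: k => [|a [|b [|c [|d [|e k]]]]] // _.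
by rewrite /kv !vkE /= !int_of_ZK.
Qed.
Lemma size_kv w : size (kv w) = 4%N. Proof. by []. Qed.

Fixpoint incell (c : seq (bool * Z)) (k : key) : bool :=
  match c, k with
  | (f, b) :: c', z :: k' =>
    if (if f then Z.leb b z else Z.eqb b z) then incell c' k' else false
  | _, _ => true
  end.

Fixpoint inp (O : seq (seq (bool * Z))) (k : key) : bool :=
  if O is c :: O' then if incell c k then true else inp O' k else false.

Fixpoint setk (k : key) (a : nat) (z : Z) : key :=
  match k, a with
  | x :: k', 0 => z :: k'
  | x :: k', a'.+1 => x :: setk k' a' z
  | [::], _ => [::]
  end.

Fixpoint stepk (k : key) (a : nat) (z : Z) : key :=
  match k, a with
  | x :: k', 0 => Z.add x z :: k'
  | x :: k', a'.+1 => x :: stepk k' a' z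
  | [::], _ => [::]
  end.

Definition krange (a : Z) (n : nat) : seq Z :=
  map (fun j => Z.add a (Z.of_nat j)) (iota 0%N n).
Definition kbox (r : seq Z) : seq key :=
  flatten (map (fun a => flatten (map (fun b => flatten (map (fun c =>
    map (fun d => [:: a; b; c; d]) r) r)) r)) r).

Lemma krangeP a n z : z \in krange a n <-> Z.le a z /\ Z.lt z (Z.add a (Z.of_nat n)).
Proof.
split=> [/mapP[j]|]; first by rewrite mem_iota => /andP[_ jn] ->; lia.
move=> H; apply/mapP; exists (Z.to_nat (Z.sub z a)); last by lia.
rewrite mem_iota; lia.
Qed.

Lemma kboxP r k : k \in kbox r <-> size k = 4%N /\ {subset k <= r}.
Proof.
split=> [/flattenP[s /mapP[a ar ->] /flattenP[s' /mapP[b br ->] /flattenP[s'' /mapP[c cr ->] /mapP[d dr ->]]]]|].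
  by split=> // x; rewrite !inE => /or4P[] /eqP ->.
case: k => [|a [|b [|c [|d [|e k]]]]] [] // _ sub.
have [ar br cr dr] : [/\ a \in r, b \in r, c \in r & d \in r].
  by split; apply: sub; rewrite !inE eqxx ?orbT.
apply/flattenP; exists (flatten (map (fun b => flatten (map (fun c => map (fun d => [:: a; b; c; d]) r) r)) r)).
  by apply/mapP; exists a.
apply/flattenP; exists (flatten (map (fun c => map (fun d => [:: a; b; c; d]) r) r)); first by apply/mapP; exists b.
apply/flattenP; exists (map (fun d => [:: a; b; c; d]) r); first by apply/mapP; exists c.
by apply/mapP; exists d.
Qed.

(** The corners of the cells lie in [0, K), so membership sees the clamped weight only; -1 stands
    for all negative coordinates. Quantifiers over Z^4 become finite checks in this way. *)
Definition kclamp (K : Z) (k : key) : key := map (fun z => Z.max (-1) (Z.min K z)) k.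

Definition ncell (c : seq (bool * Z)) : nat := foldr (fun x n => if x.1 then n.+1 else n) 0%N c.

Definition cdisj (c c' : seq (bool * Z)) : bool :=
  has (fun xy => match xy with
       | ((false, b), (false, b')) => ~~ Z.eqb b b'
       | ((false, b), (true, b')) => Z.ltb b b'
       | ((true, b), (false, b')) => Z.ltb b' b
       | _ => false end) (zip c c').

(** Disjoint cells have additive characters. A free direction in each cell excludes point
    components, and at most two of them bound the dimension. Closure under decreasing coordinates is
    tested on [0, K]^4. *)
Definition wf_cells (K : nat) (O : seq (seq (bool * Z))) : bool :=
  [&& all (fun c => [&& size c == 4%N, all (fun x => Z.leb 0 x.2 && Z.ltb x.2 (Z.of_nat K)) c &
                       (0 < ncell c <= 2)%N]) O,
      pairwise cdisj O, (0 < K)%N &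
      all (fun k => if inp O k then
        all (fun a => if Z.ltb 0 (nth Z0 k a) then inp O (stepk k a (-1)) else true) (iota 0%N 4%N)
        else true) (kbox (krange 0 K.+1))].

(* The components of the far part of [Z_mu] seen in weight [k]: direction [a]
   is labelled by the largest direction it is connected to, and by 4 if its
   component contains a direction leaving the support. *)
Section Labels.
Variables (K : nat) (O : seq (seq (bool * Z))).
Definition farA k a : bool := inp O (setk k a (Z.of_nat K)).
Definition farE k a b : bool := inp O (setk (setk k a (Z.of_nat K)) b (Z.of_nat K)).
Definition lab_step (E : nat -> nat -> bool) (l : seq nat) : seq nat :=
  map (fun a => foldr (fun b m => if E a b then maxn (nth 4%N l b) m else m) (nth 4%N l a) (iota 0%N 4%N)) (iota 0%N 4%N).
(** Three rounds, as paths in a graph on four vertices have at most three edges; [lab_check]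
    certifies the outcome. *)
Definition labels k : seq nat :=
  ssrnat.iter 3%N (lab_step (farE k)) (map (fun a => if farA k a then a else 4%N) (iota 0%N 4%N)).
Definition roots k : seq nat := let l := labels k in filter (fun a => nth 4%N l a == a) (iota 0%N 4%N).
(** Admissible families have one free value for each root; if [k] is in the support, the constants
    are divided out, so two roots are then required for a line. *)
Definition kWt k : bool := size (roots k) == (inp O k).+1.
Definition kr0 k : nat := nth 0%N (roots k) 0%N.
Definition kr1 k : nat := nth 0%N (roots k) 1%N.
Definition kind k a : bool := nth 4%N (labels k) a == kr0 k.

(** The first condition bounds the dimension of the weight space by 1. The others say that nonzero
    labels of families are honest components: labels are roots or 4, agree on overlaps, are 4 off
    the support, and are never 4 on a far direction if [k] is in the support. *)
Definition lab_check k : bool :=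
  let l := labels k in
  [&& (size (roots k) <= (inp O k).+1)%N,
      all (fun a => (nth 4%N l a == 4%N) || (nth 4%N l (nth 4%N l a) == nth 4%N l a)) (iota 0%N 4%N),
      all (fun a => all (fun b => farE k a b ==> (nth 4%N l a == nth 4%N l b)) (iota 0%N 4%N)) (iota 0%N 4%N),
      all (fun a => ~~ farA k a ==> (nth 4%N l a == 4%N)) (iota 0%N 4%N) &
      inp O k ==> all (fun a => farA k a ==> (nth 4%N l a != 4%N)) (iota 0%N 4%N)].

(** x_i is nonzero on the line of weight [k] if the generator differs on the two roots at the
    target, or is nonzero on the only root there. *)
Definition knz k i : bool :=
  let k' := stepk k i 1 in
  [&& kWt k, kWt k' & if inp O k' then kind k (kr0 k') != kind k (kr1 k') else kind k (kr0 k')].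

Definition dims_ok : bool := all lab_check (kbox (krange (-1) K.+2)).
End Labels.

Lemma Zbounds (b M : Z) : Z.leb 0 b && Z.ltb b M -> Z.le Z0 b /\ Z.lt b M.
Proof. lia. Qed.
Lemma Zclamp_bounds (y : Z) (K : nat) : Z.le Z0 y ->
  Z.le Z0 (Z.max (-1) (Z.min (Z.of_nat K) y)) /\
  Z.lt (Z.max (-1) (Z.min (Z.of_nat K) y)) (Z.add Z0 (Z.of_nat K.+1)).
Proof. lia. Qed.
Lemma Zclamp_bounds1 (y : Z) (K : nat) :
  Z.le (-1) (Z.max (-1) (Z.min (Z.of_nat K) y)) /\
  Z.lt (Z.max (-1) (Z.min (Z.of_nat K) y)) (Z.add (-1) (Z.of_nat K.+2)).
Proof. lia. Qed.

Lemma inpP (O : seq (seq (bool * Z))) k : reflect (exists2 c, c \in O & incell c k) (inp O k).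
Proof.
elim: O => [|c O' IH] /=; first by constructor => -[].
case E: (incell c k); first by constructor; exists c; rewrite ?mem_head.
apply: (iffP IH) => -[c' c'O Ec]; first by exists c'; rewrite ?inE ?c'O ?orbT.
by move: c'O; rewrite inE => /orP[/eqP e|]; [rewrite -e Ec in E|exists c'].
Qed.

Lemma incellP (c : seq (bool * Z)) k : size c = size k ->
  reflect (forall i, (i < size c)%N ->
     let x := nth (false, Z0) c i in if x.1 then Z.le x.2 (nth Z0 k i) else x.2 = nth Z0 k i)
   (incell c k).
Proof.
elim: c k => [|[f b] c IH] [|z k] //= => [_|[sc]]; first by constructor.
have {IH} := IH k sc => IH.
case E: (if f then _ else _); last first.
  constructor => /(_ 0%N isT) /=; move: E; case: (f) => /=; lia.
apply: (iffP IH) => H i; last by move=> ilt; apply: (H i.+1).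
by case: i => [_|i ilt] /=; [move: E; case: (f) => /=; lia|apply: H].
Qed.

Lemma nth_setk k a z i : (a < size k)%N -> nth Z0 (setk k a z) i = if i == a then z else nth Z0 k i.
Proof. by elim: k a i => [|x k IH] [|a] [|i] //= lt; rewrite IH. Qed.
Lemma size_setk k a z : size (setk k a z) = size k.
Proof. by elim: k a => [|x k IH] [|a] //=; rewrite IH. Qed.
Lemma setk_setk k a z z' : setk (setk k a z) a z' = setk k a z'.
Proof. by elim: k a => [|x k IH] [|a] //=; rewrite IH. Qed.
Lemma nth_stepk k a z i : (a < size k)%N -> nth Z0 (stepk k a z) i = if i == a then Z.add (nth Z0 k i) z else nth Z0 k i.
Proof. by elim: k a i => [|x k IH] [|a] [|i] //= lt; rewrite IH. Qed.
Lemma size_stepk k a z : size (stepk k a z) = size k.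
Proof. by elim: k a => [|x k IH] [|a] //=; rewrite IH. Qed.
Lemma size_kclamp M k : size (kclamp M k) = size k.
Proof. exact: size_map. Qed.
Lemma nth_kclamp M k i : (i < size k)%N -> nth Z0 (kclamp M k) i = Z.max (-1) (Z.min M (nth Z0 k i)).
Proof. by move=> ik; rewrite (nth_map Z0). Qed.

Definition bounded_cells (K : nat) (O : seq (seq (bool * Z))) : bool :=
  all (fun c => (size c == 4%N) && all (fun x => Z.leb 0 x.2 && Z.ltb x.2 (Z.of_nat K)) c) O.

Lemma inp_clampW K O k : bounded_cells K O -> size k = 4%N -> inp O (kclamp (Z.of_nat K) k) = inp O k.
Proof.
move=> /allP bO sk; apply/inpP/inpP => -[c cO Hc]; exists c => //.
all: have /andP[/eqP sc /allP bc'] := bO c cO.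
all: have bc x : x \in c -> Z.le Z0 x.2 /\ Z.lt x.2 (Z.of_nat K) by move=> /bc' /Zbounds.
all: apply/incellP; rewrite ?size_kclamp ?sc ?sk // => i i4 /=.
all: move/incellP: Hc; rewrite ?size_kclamp sc sk => /(_ erefl i i4) /=.
all: rewrite nth_kclamp ?sk //; have := bc (nth (false, Z0) c i).
all: rewrite mem_nth ?sc // => /(_ isT); case: (nth _ c i) => -[] b /=; lia.
Qed.

Section Cells.
Variables (K : nat) (O : seq (seq (bool * Z))).
Hypothesis wfO : wf_cells K O.
Local Notation wt := 'rV[int]_4.

Let cellP c : c \in O -> [/\ size c = 4%N, forall x, x \in c -> Z.le Z0 x.2 /\ Z.lt x.2 (Z.of_nat K) & (0 < ncell c <= 2)%N].
Proof.
move=> cO; have /and4P[/allP/(_ _ cO)/and3P[/eqP sc /allP H n] _ _ _] := wfO.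
by split=> // x /H /Zbounds.
Qed.
Lemma wfK0 : (0 < K)%N. Proof. by case/and4P: wfO. Qed.

Lemma inp_clamp k : size k = 4%N -> inp O (kclamp (Z.of_nat K) k) = inp O k.
Proof. by apply: inp_clampW; apply/allP => c cO; have /and4P[/allP/(_ _ cO)/and3P[-> ->]] := wfO. Qed.

Lemma inp_ge0 k i : size k = 4%N -> (i < 4)%N -> inp O k -> Z.le Z0 (nth Z0 k i).
Proof.
move=> sk i4 /inpP[c cO Hc]; have [sc bc _] := cellP cO.
move/incellP: Hc; rewrite sc sk => /(_ erefl i i4) /=.
have := bc (nth (false, Z0) c i); rewrite mem_nth ?sc // => /(_ isT).
by case: (nth _ c i) => -[] b /=; lia.
Qed.

(** A coordinate above [K] can be lowered without changing the clamped key; in all other cases the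
    finite test applies. *)
Lemma inp_pred k i : size k = 4%N -> (i < 4)%N -> inp O k -> Z.lt Z0 (nth Z0 k i) -> inp O (stepk k i (-1)).
Proof.
move=> sk i4 pk ki; have /and4P[_ _ _ /allP H] := wfO.
have szs : size (stepk k i (-1)) = 4%N by rewrite size_stepk.
have [Kk|kK] := Z_le_gt_dec (nth Z0 k i) (Z.of_nat K); last first.
  rewrite -inp_clamp // (_ : kclamp _ _ = kclamp (Z.of_nat K) k) ?inp_clamp //.
  apply: (@eq_from_nth _ Z0); rewrite !size_kclamp size_stepk ?sk // => j j4.
  rewrite !nth_kclamp ?szs ?sk // nth_stepk ?sk //; case: eqP => [->|//]; lia.
have := H (kclamp (Z.of_nat K) k); rewrite inp_clamp // pk.
have kb : kclamp (Z.of_nat K) k \in kbox (krange 0 K.+1).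
  apply/kboxP; rewrite size_kclamp sk; split=> // z /mapP[y yk ->]; apply/krangeP.
  apply: Zclamp_bounds; move: yk => /(nthP Z0)[j]; rewrite sk => j4 <-.
  exact: inp_ge0 sk j4 pk.
move=> /(_ kb)/allP/(_ i); rewrite mem_iota i4 => /(_ isT).
rewrite nth_kclamp ?sk //; case: ifP => [_|]; last by lia.
move=> ps; rewrite -inp_clamp ?size_stepk ?size_kclamp // in ps.
rewrite -inp_clamp //; move: ps; rewrite (_ : kclamp _ (stepk (kclamp _ _) _ _) = kclamp (Z.of_nat K) (stepk k i (-1))) //.
apply: (@eq_from_nth _ Z0); rewrite !size_kclamp !size_stepk ?size_kclamp ?sk // => j j4.
rewrite !nth_kclamp ?size_stepk ?size_kclamp ?sk // !nth_stepk ?size_kclamp ?sk //.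
by case: eqP => [->|_]; rewrite nth_kclamp ?sk //; lia.
Qed.

Definition pset : set box := [set v | inp O (kv (vb v))].

Lemma kv_nth w i : (i < 4)%N -> zi (nth Z0 (kv w) i) = w 0 (inord i).
Proof. by move=> i4; rewrite -kvE inordK. Qed.

Lemma pin_inp w : pin pset w = inp O (kv w).
Proof.
apply/pinP/idP => [[w0]|pw]; first by rewrite /pset /= bxK.
have w0 : nn w.
  apply/nnP => i; have := @inp_ge0 (kv w) i erefl (ltn_ord i) pw.
  by have := kvE w i; lia.
by split=> //; rewrite /pset /= bxK.
Qed.

Lemma kv_stepk w (i : 'I_4) z : kv (w + \row_j (if j == i then zi z else 0)) = stepk (kv w) i z.
Proof.
apply: (@eq_from_nth _ Z0); rewrite ?size_stepk // => j j4; rewrite nth_stepk ?size_kv //.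
apply: zi_inj; rewrite kv_nth // wD mxE -kv_nth // -val_eqE /= inordK //.
by case: eqP => _; rewrite ?ziD ?addr0.
Qed.
Lemma kv_dv w (i : 'I_4) : kv (w + dv i) = stepk (kv w) i 1.
Proof. by have := rowMn i 1; rewrite mulr1n => <-; exact: (kv_stepk w i 1). Qed.
Lemma kv_setw w (i : 'I_4) z : kv (setw w i (zi z)) = setk (kv w) i z.
Proof.
apply: (@eq_from_nth _ Z0); rewrite ?size_setk // => j j4; rewrite nth_setk ?size_kv //.
apply: zi_inj; rewrite kv_nth // setwE -val_eqE /= inordK //.
by case: eqP => _ //; rewrite -kv_nth.
Qed.

Lemma pset_partition : is_partition pset.
Proof.
have step w (i : 'I_4) : pset (w + U_(i))%MM -> pset w.
  rewrite /pset /= vbD -/(dv i) => pw.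
  have -> : kv (vb w) = stepk (kv (vb w + dv i)) i (-1).
    by rewrite -kv_stepk; congr kv; apply/rowP => j; rewrite !wD mxE dvE eq_sym; case: eqP => _ /=; lia.
  apply: inp_pred => //.
  by have := kvE (vb w + dv i) i; rewrite wD vbE dvE eqxx; lia.
move=> w v pw vw; rewrite -(submK vw) addmC in pw; move: pw.
have [n] := ubnP (mdeg (w - v)%MM); elim: n (w - v)%MM => // n IH u un.
have [->|u0] := eqVneq u 0%MM; first by rewrite addm0.
have [i ui] : exists i, (0 < u i)%N.
  apply: contrapT => no; case/eqP: u0; apply/mnmP => i; rewrite mnm0E.
  by apply/eqP; rewrite -leqn0 leqNgt; apply/negP => ui; apply: no; exists i.
have Uu : (U_(i) <= u)%MM by apply/mnm_lepP => j; rewrite mnm1E; case: eqP => [<-|].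
rewrite -(submK Uu) addmA => /step; apply: IH.
by move: un; rewrite -{1}(submK Uu) mdegD mdeg1 addn1.
Qed.

Lemma inp_set_le k a z : size k = 4%N -> (a < 4)%N -> inp O k -> Z.le (Z.of_nat K) (nth Z0 k a) ->
  Z.le (Z.of_nat K) z -> inp O (setk k a z).
Proof.
move=> sk a4 pk Ka Kz; rewrite -(inp_clamp sk) in pk; rewrite -inp_clamp ?size_setk //.
congr (inp O _): pk; apply: (@eq_from_nth _ Z0); rewrite !size_kclamp ?size_setk // => j; rewrite sk => j4.
rewrite !nth_kclamp ?size_setk ?sk // nth_setk ?sk //; case: eqP => [->|//]; lia.
Qed.

Lemma pset_far v a n : pset v -> (K <= v a)%N -> pset (v + U_(a) *+ n)%MM.
Proof.
move=> pv Kv; rewrite /pset /= vbD vbMn.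
have -> : vb v + dv a *+ n = setw (vb v) a (zi (Z.of_nat (v a + n))).
  apply/rowP => i; rewrite wD setwE dvMnE !vbE eq_sym; case: eqP => [->|_]; last by lia.
  by rewrite -[Z.of_nat _]/(Z_of_int (v a + n)%N%:Z) Z_of_intK; lia.
rewrite kv_setw; apply: inp_set_le => //; last by lia.
by have := kvE (vb v) a; rewrite vbE; lia.
Qed.

Lemma pset_soc v : pset v -> exists i, pset (v + U_(i))%MM.
Proof.
move=> /inpP[c cO Hc]; have [sc _ nc] := cellP cO.
have [i [i4 fi]] : exists i, (i < size c)%N /\ (nth (false, Z0) c i).1.
  move: nc; clear; elim: (c) => [//|[[] b] c' IH] /=; first by exists 0%N.
  by move=> /IH[i [ilt fi]]; exists i.+1.
rewrite sc in i4; exists (Ordinal i4); apply/inpP; exists c => //.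
rewrite /= vbD -/(dv _) kv_dv; apply/incellP; rewrite ?size_stepk ?sc // => j j4 /=.
move/incellP: Hc; rewrite sc => /(_ erefl j j4); cbv zeta; move: (nth_stepk 1 j (i4 : (i < size (kv (vb v)))%N)) => -> .
case: eqP => [->|//]; rewrite fi; lia.
Qed.

Lemma pset_tail w a : (forall n, pset (w + U_(a) *+ n)%MM) <-> farA K O (kv (vb w)) a.
Proof.
have e n : kv (vb (w + U_(a) *+ n)%MM) = setk (kv (vb w)) a (Z.of_nat (w a + n)).
  rewrite -kv_setw; congr kv; apply/rowP => i; rewrite setwE vbD vbMn wD dvMnE !vbE eq_sym.
  case: eqP => [->|_]; last by lia.
  by rewrite -[Z.of_nat _]/(Z_of_int (w a + n)%N%:Z) Z_of_intK; lia.
split=> [H|H n].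
  have := H K; rewrite /pset /= e => h; rewrite /farA.
  rewrite -(setk_setk _ a (Z.of_nat (w a + K))); apply: inp_set_le; rewrite ?size_setk ?nth_setk ?eqxx //; lia.
apply: (pset_partition (w := w + U_(a) *+ (n + K))%MM); last first.
  by apply/mnm_lepP => i; rewrite !mnmDE !mulmnE leq_add2l leq_mul2l leq_addr orbT.
rewrite /pset /= e -(setk_setk _ a (Z.of_nat K)); apply: inp_set_le; rewrite ?size_setk ?nth_setk ?eqxx //; lia.
Qed.

Lemma pset_dim : dim_le 2 pset.
Proof.
(* On J the coordinates [K] exceed all corners, so the cell containing this point is free in every
   direction of J. *)
move=> J H; pose w : box := [multinom (if i \in J then K else 0%N) | i < 4].
have /inpP[c cO Hc] : pset w by apply: H => i iJ; rewrite mnmE (negPf iJ).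
have [sc bc /andP[_ nc]] := cellP cO.
have JF i : i \in J -> (nth (false, Z0) c i).1.
  move=> iJ; move/incellP: Hc; rewrite sc => /(_ erefl i (ltn_ord i)) /=.
  have := bc (nth (false, Z0) c i); rewrite mem_nth ?sc // => /(_ isT).
  have := kvE (vb w) i; rewrite vbE mnmE iJ; move: (nth Z0 _ i) => z.
  case: (nth _ c i) => -[] b //=; lia.
apply: leq_trans nc; rewrite -sum1_card big_mkcond /=.
have -> : ncell c = (\sum_(i < 4) (nth (false, Z0) c i).1)%N.
  move: sc; clear; case: c => [|[a ?] [|[b ?] [|[d ?] [|[e ?] [|]]]]] // _.
  by rewrite !big_ord_recl big_ord0 /=; case: a; case: b; case: d; case: e.
by apply: leq_sum => i _; case: ifP => // /JF ->.
Qed.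

Lemma is_Zmu_pset (R : realType) mu :
  (forall (a : 'I_4) w, farA K O (kv (vb w)) a <-> cylinder [set a]%SET (mu a) w) ->
  is_Zmu R mu pset.
Proof.
move=> Hmu; split; [exact: pset_partition|exact: pset_dim|apply: mono_no_point; [exact: pset_partition|exact: pset_soc]|].
move=> a; apply/seteqP; split=> f.
  move=> /(localized_monoP _ _ pset_partition) H w wf /Hmu/pset_tail pw.
  by have [n] := H w wf; rewrite big_set1; apply; apply: pw.
move=> H; apply/(localized_monoP _ _ pset_partition) => w wf; rewrite big_set1.
apply: contrapT => no; apply: (H w wf); apply/Hmu/pset_tail => n.
by apply: contrapT => np; apply: no; exists n.
Qed.

(** * The labels describe the weight spaces *)

Lemma nth_labstep E l a : (a < 4)%N -> nth 4%N (lab_step E l) a =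
  foldr (fun b m => if E a b then maxn (nth 4%N l b) m else m) (nth 4%N l a) (iota 0%N 4%N).
Proof. by move=> a4; rewrite (nth_map 0) ?size_iota // nth_iota. Qed.

Section Dims.
Variable R : realType.
Local Notation C := R[i].
Hypothesis dims : dims_ok K O.

Definition wWt (w : wt) : bool := kWt K O (kv w).
Definition wr0 (w : wt) : 'I_4 := inord (kr0 K O (kv w)).
Definition wr1 (w : wt) : 'I_4 := inord (kr1 K O (kv w)).
Definition wind (w : wt) (a : 'I_4) : bool := kind K O (kv w) a.

Lemma inA_far w a : inA pset K w a = farA K O (kv w) a.
Proof. by rewrite /inA pin_inp -(Z_of_intK K%:Z) kv_setw. Qed.
Lemma inE2_far w a b : inE2 pset K w a b = farE K O (kv w) a b.
Proof. by rewrite /inE2 pin_inp -(Z_of_intK K%:Z) !kv_setw. Qed.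

Lemma clamp_setk k a : size k = 4%N -> (a < 4)%N ->
  kclamp (Z.of_nat K) (setk k a (Z.of_nat K)) = setk (kclamp (Z.of_nat K) k) a (Z.of_nat K).
Proof.
move=> sk a4; apply: (@eq_from_nth _ Z0); rewrite !size_kclamp !size_setk ?size_kclamp // sk => j j4.
rewrite nth_kclamp ?size_setk ?sk // !nth_setk ?size_kclamp ?sk // nth_kclamp ?sk //.
by case: eqP => // _; lia.
Qed.

Lemma farA_clamp k a : size k = 4%N -> (a < 4)%N -> farA K O (kclamp (Z.of_nat K) k) a = farA K O k a.
Proof. by move=> sk a4; rewrite /farA -clamp_setk // inp_clamp ?size_setk. Qed.
Lemma farE_clamp k a b : size k = 4%N -> (a < 4)%N -> (b < 4)%N ->
  farE K O (kclamp (Z.of_nat K) k) a b = farE K O k a b.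
Proof. by move=> sk a4 b4; rewrite /farE -!clamp_setk ?size_setk // inp_clamp ?size_setk. Qed.

Lemma labels_clamp k : size k = 4%N -> labels K O (kclamp (Z.of_nat K) k) = labels K O k.
Proof.
move=> sk; rewrite /labels; set E := farE K O k.
have -> : lab_step (farE K O (kclamp (Z.of_nat K) k)) = lab_step E.
  apply/funext => l; rewrite /lab_step /E; apply/eq_in_map => a; rewrite mem_iota => /andP[_ a4].
  by rewrite /= !farE_clamp.
congr (ssrnat.iter _ _ _); apply/eq_in_map => a; rewrite mem_iota => /andP[_ a4].
by rewrite farA_clamp.
Qed.

Lemma lab_ok k : size k = 4%N -> lab_check K O k.
Proof.
move=> sk; have := allP dims (kclamp (Z.of_nat K) k).
have -> : lab_check K O (kclamp (Z.of_nat K) k) = lab_check K O k.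
  rewrite /lab_check /roots labels_clamp // inp_clamp //; congr [&& _, _, _, _ & _].
  - apply: eq_in_all => a; rewrite mem_iota => /andP[_ a4].
    by apply: eq_in_all => b; rewrite mem_iota => /andP[_ b4]; rewrite farE_clamp.
  - by apply: eq_in_all => a; rewrite mem_iota => /andP[_ a4]; rewrite farA_clamp.
  by congr (_ ==> _); apply: eq_in_all => a; rewrite mem_iota => /andP[_ a4]; rewrite farA_clamp.
apply; apply/kboxP; rewrite size_kclamp sk; split=> // z /mapP[y _ ->]; apply/krangeP.
exact: Zclamp_bounds1.
Qed.

Definition cval (c : 'I_4 -> C) (a : nat) : C := if (a < 4)%N then c (inord a) else 0.

(** Each relabelling passes to an overlapping direction, where the family has the same value. The
    label 4 stands for the value zero, and [cval] is zero there. *)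
Lemma labels_sound w (c : 'I_4 -> C) a : adm pset K w c -> (a < 4)%N ->
  cval c (nth 4%N (labels K O (kv w)) a) = cval c a.
Proof.
move=> [c0 cE]; rewrite /labels.
have base b : (b < 4)%N -> cval c (nth 4%N (map (fun a => if farA K O (kv w) a then a else 4%N) (iota 0%N 4%N)) b) = cval c b.
  move=> b4; rewrite (nth_map 0) ?size_iota // nth_iota // add0n; case: ifPn => // nA.
  rewrite {2}/cval b4; have -> // : c (inord b) = 0 by apply: c0; rewrite inA_far inordK.
suff gen n : forall a, (a < 4)%N -> cval c (nth 4%N (ssrnat.iter n (lab_step (farE K O (kv w)))
    (map (fun a => if farA K O (kv w) a then a else 4%N) (iota 0%N 4%N))) a) = cval c a by exact: gen.
elim: n => [|n IH] {}a a4; first exact: base.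
rewrite [ssrnat.iter _ _ _]/= nth_labstep //; set l := ssrnat.iter n _ _ in IH *.
have : {subset iota 0%N 4%N <= iota 0%N 4%N} by [].
elim: {1 3}(iota 0%N 4%N) => [|b s IHs] sub /=; first exact: IH.
have {}IHs := IHs (fun x xs => sub x (mem_behead (s := b :: s) xs)).
case: ifP => // Eab; have b4 : (b < 4)%N by have := sub b (mem_head _ _); rewrite mem_iota.
rewrite /maxn; case: ifP => // _; rewrite IH // /cval a4 b4.
by apply/esym/cE; rewrite inE2_far !inordK.
Qed.

Lemma rootsP k a : a \in roots K O k -> (a < 4)%N /\ nth 4%N (labels K O k) a = a.
Proof. by rewrite mem_filter mem_iota => /andP[/eqP -> /andP[_ ->]]. Qed.

Lemma roots_uniq k : uniq (roots K O k).
Proof. by rewrite filter_uniq // iota_uniq. Qed.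

Lemma labels_le4 k a : (a < 4)%N -> (nth 4%N (labels K O k) a <= 4%N)%N.
Proof.
rewrite /labels; set l0 := map _ _; have : forall a, (a < 4)%N -> (nth 4%N l0 a <= 4%N)%N.
  move=> b b4; rewrite /l0 (nth_map 0) ?size_iota // nth_iota // add0n.
  by case: ifP => // _; apply: ltnW.
move=> H; suff gen n : forall a, (a < 4)%N -> (nth 4%N (ssrnat.iter n (lab_step (farE K O k)) l0) a <= 4%N)%N by exact: gen.
elim: n => [|n IH] {}a a4; first exact: H.
rewrite [ssrnat.iter _ _ _]/= nth_labstep //; set l := ssrnat.iter n _ _ in IH *.
have : {subset iota 0%N 4%N <= iota 0%N 4%N} by [].
elim: {1 3}(iota 0%N 4%N) => [|b s IHs] sub /=; first exact: IH.
have {}IHs := IHs (fun x xs => sub x (mem_behead (s := b :: s) xs)).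
have b4 : (b < 4)%N by have := sub b (mem_head _ _); rewrite mem_iota.
by case: ifP => // _; rewrite geq_max IHs IH.
Qed.

Lemma labelsP k a : size k = 4%N -> (a < 4)%N ->
  nth 4%N (labels K O k) a = 4%N \/ nth 4%N (labels K O k) a \in roots K O k.
Proof.
move=> sk a4; have /and5P[_ /allP/(_ a) H _ _ _] := lab_ok sk.
have [->|ne] := eqVneq (nth 4%N (labels K O k) a) 4%N; [by left|right].
move: H; rewrite mem_iota a4 (negPf ne) => /(_ isT) /= e.
rewrite mem_filter e mem_iota add0n /=; move: (labels_le4 k a4).
by rewrite leq_eqVlt (negPf ne).
Qed.

Lemma lab_E k a b : size k = 4%N -> (a < 4)%N -> (b < 4)%N -> farE K O k a b ->
  nth 4%N (labels K O k) a = nth 4%N (labels K O k) b.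
Proof.
move=> sk a4 b4 E; have /and5P[_ _ /allP/(_ a) H _ _] := lab_ok sk.
move: H; rewrite mem_iota a4 => /(_ isT)/allP/(_ b); rewrite mem_iota b4 => /(_ isT).
by rewrite E => /eqP.
Qed.
Lemma lab_A k a : size k = 4%N -> (a < 4)%N -> ~~ farA K O k a -> nth 4%N (labels K O k) a = 4%N.
Proof.
move=> sk a4 nA; have /and5P[_ _ _ /allP/(_ a) H _] := lab_ok sk.
by move: H; rewrite mem_iota a4 nA => /(_ isT)/eqP.
Qed.
Lemma lab_A4 k a : size k = 4%N -> (a < 4)%N -> inp O k -> farA K O k a -> nth 4%N (labels K O k) a != 4%N.
Proof.
move=> sk a4 pk A; have /and5P[_ _ _ _] := lab_ok sk.
by rewrite pk => /allP/(_ a); rewrite mem_iota a4 A => /(_ isT).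
Qed.
Lemma roots_le k : size k = 4%N -> (size (roots K O k) <= (inp O k).+1)%N.
Proof. by move=> sk; have /and5P[] := lab_ok sk. Qed.

(** Inside [p] at most two components carry values, and these are equal; outside at most one does,
    and its value is zero. *)
Lemma wP1 w (c : 'I_4 -> C) : adm pset K w c ->
  (wWt w -> th pset wr0 wr1 w c = 0) -> trivial pset K w c.
Proof.
move=> ac; have sk := size_kv w; have snd a := @labels_sound w c a ac.
rewrite /wWt /kWt /th /trivial pin_inp /wr0 /wr1 /kr0 /kr1.
have cv (a : 'I_4) : c a = cval c a by rewrite /cval ltn_ord inord_val.
have cr a : (a < 4)%N -> c (inord a) = cval c a by move=> a4; rewrite /cval a4.
have lp a := @labelsP (kv w) a sk; have rp a := @rootsP (kv w) a.
have := roots_le sk; case: ifP => pw.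
  have l4 (a : 'I_4) : inA pset K w a -> nth 4%N (labels K O (kv w)) a \in roots K O (kv w).
    rewrite inA_far => A; have [e|//] := lp a (ltn_ord a).
    by have := lab_A4 sk (ltn_ord a) pw A; rewrite e.
  move: l4; case: (roots K O (kv w)) rp => [|a0 [|a1 [|? ?]]] //= rp l4 _ H a b Aa Ab.
  - by have := l4 a Aa.
  - have := l4 a Aa; have := l4 b Ab; rewrite !inE => /eqP e /eqP e'.
    by rewrite !cv -(snd a) // -(snd b) // e e'.
  have [a04 _] := rp a0 (mem_head _ _).
  have [a14 _] : (a1 < 4)%N /\ nth 4%N (labels K O (kv w)) a1 = a1 by apply: rp; rewrite !inE eqxx orbT.
  have e01 : cval c a0 = cval c a1.
    by apply/eqP; rewrite -subr_eq0 -!cr // H.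
  have E d : inA pset K w d -> cval c d = cval c a0.
    by move=> /l4; rewrite !inE -(snd d) // => /orP[] /eqP ->.
  by rewrite !cv !E.
move: lp; case: (roots K O (kv w)) rp => [|a0 [|? ?]] //= rp lp _ H a.
  by rewrite cv -(snd a) //; have [->|] := lp a (ltn_ord a).
have [a04 _] := rp a0 (mem_head _ _).
have e0 : cval c a0 = 0 by have := H (eqxx _); rewrite subr0 cr.
rewrite cv -(snd a) //; have [->//|] := lp a (ltn_ord a).
by rewrite inE => /eqP ->.
Qed.

Lemma wP2 w : wWt w -> [/\ adm pset K w (indC R wind w), th pset wr0 wr1 w (indC R wind w) = 1,
  inA pset K w (wr0 w) & pin pset w -> inA pset K w (wr1 w)].
Proof.
have sk := size_kv w; rewrite /wWt /kWt => /eqP Ww.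
have r0in : kr0 K O (kv w) \in roots K O (kv w) by rewrite mem_nth // Ww.
have [r04 r0l] := rootsP r0in.
have Aroot a : a \in roots K O (kv w) -> farA K O (kv w) a.
  move=> /rootsP[a4 e]; apply/negPn/negP => /(lab_A sk a4); rewrite e => e4.
  by rewrite e4 in a4.
have r1in : inp O (kv w) -> kr1 K O (kv w) \in roots K O (kv w).
  by move=> pw; rewrite mem_nth // Ww pw.
split.
- split=> [a|a b]; rewrite ?inA_far ?inE2_far /indC /wind /kind.
    move=> /(lab_A sk (ltn_ord a)) ->; case: eqP => // e.
    by rewrite -e in r04.
  by move=> /(lab_E sk (ltn_ord a) (ltn_ord b)) ->.
- rewrite /th pin_inp /indC /wind /kind /wr0 /wr1 !inordK //; last first.
    case pw: (inp O (kv w)); first by have [] := rootsP (r1in pw).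
    by rewrite /kr1 nth_default // Ww pw.
  rewrite r0l eqxx; case: ifP => pw; last by rewrite subr0.
  have [_ ->] := rootsP (r1in pw).
  have /eqP : kr1 K O (kv w) != kr0 K O (kv w).
    by rewrite /kr1 /kr0 nth_uniq ?Ww ?pw ?roots_uniq.
  by case: eqP => // _ _; rewrite subr0.
- by rewrite inA_far inordK // Aroot.
rewrite pin_inp => pw; have [r14 _] := rootsP (r1in pw).
by rewrite inA_far inordK // Aroot // r1in.
Qed.

Lemma wnz w (i : 'I_4) : nz R pset wWt wr0 wr1 wind w i = knz K O (kv w) i.
Proof.
rewrite /nz /knz -kv_dv -/(wWt w) -/(wWt (w + dv i)).
case Ww: (wWt w) => //=; case Wv: (wWt (w + dv i)) => //=.
have [_ _ A0 A1] := wP2 Wv.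
have r04 : (kr0 K O (kv (w + dv i)) < 4)%N.
  by move/eqP: Wv => Wv; have [] := @rootsP (kv (w + dv i)) (kr0 K O (kv (w + dv i))); rewrite ?mem_nth ?Wv.
rewrite /th pin_inp /indC /wind /wr0 /wr1 inordK //; case: ifP => pw; last first.
  by rewrite subr0; case: kind; rewrite ?oner_eq0 ?eqxx.
have r14 : (kr1 K O (kv (w + dv i)) < 4)%N.
  by move/eqP: Wv => Wv; have [] := @rootsP (kv (w + dv i)) (kr1 K O (kv (w + dv i))); rewrite ?mem_nth ?Wv ?pw.
by rewrite inordK //; case: kind; case: kind; rewrite ?subrr ?subr0 ?sub0r ?oppr_eq0 ?oner_eq0 ?eqxx.
Qed.

End Dims.

End Cells.

(** * Characters *)

Lemma fsum_seq (T : choiceType) (V : nmodType) (g : T -> V) (s : seq T) :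
  uniq s -> (forall x, x \notin s -> g x = 0) ->
  \sum_(x \in [set: T]) g x = \sum_(x <- s) g x.
Proof. move=> us H; rewrite (@fsbigE _ _ _ _ _ s) // => [|x _]; last exact: H.
by rewrite big_mkcond; apply: eq_bigr => x _; rewrite in_setT. Qed.

Lemma big_ord4 (V : Type) (idx : V) (op : Monoid.law idx) (g : 'I_4 -> V) :
  \big[op/idx]_(i < 4) g i = op (g i1) (op (g i2) (op (g i3) (g i4))).
Proof.
rewrite !big_ord_recl big_ord0 Monoid.mulm1.
by congr (op (g _) (op (g _) (op (g _) (g _)))); apply: val_inj.
Qed.

(** The character of the cell times the product of all 1 - t_i. *)
Fixpoint cellnum (c : seq (bool * Z)) : lau :=
  if c is (f, b) :: c' then
    let r := cellnum c' in
    map (fun kc => (b :: kc.1, kc.2)) r ++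
    (if f then [::] else map (fun kc => (Z.succ b :: kc.1, Z.opp kc.2)) r)
  else [:: ([::], Zpos xH)].

Definition cind (x : bool * Z) (z : int) : int := (if x.1 then zi x.2 <= z else zi x.2 == z)%:Z.

Lemma incell_prod (c : seq (bool * Z)) w : size c = 4%N ->
  (incell c (kv w))%:Z = \prod_(i < 4) cind (nth (false, Z0) c i) (w 0 i).
Proof.
case: c => [|[f1 b1] [|[f2 b2] [|[f3 b3] [|[f4 b4] [|]]]]] // _.
rewrite big_ord4 /= /cind /=.
have E (f : bool) b (z : int) : (if f then Z.leb b (Z_of_int z) else Z.eqb b (Z_of_int z)) =
   (if f then zi b <= z else zi b == z).
  by case: f; apply/idP/idP; lia.
rewrite !E.
by case: (if f1 then _ else _); case: (if f2 then _ else _); case: (if f3 then _ else _); case: (if f4 then _ else _); rewrite ?mul0r ?mulr0 ?mul1r.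
Qed.

Lemma coef_cons b l z k : coef (map (fun kc => (b :: kc.1, kc.2)) l) (z :: k) =
  (zi b == zi z)%:Z * coef l k.
Proof.
rewrite /coef (suml_comp _ (cons b)) /suml big_distrr /=; apply: eq_bigr => kc _.
rewrite eqseq_cons (inj_eq zi_inj); case: eqP => _; first by rewrite mul1r.
by rewrite mul0r mul0rz.
Qed.

Lemma coef_cellnum c w : size c = 4%N -> coef (cellnum c) (kv w) =
  \prod_(i < 4) (cind (nth (false, Z0) c i) (w 0 i) - cind (nth (false, Z0) c i) (w 0 i - 1)).
Proof.
have step f b c' z k : coef (cellnum ((f, b) :: c')) (z :: k) =
    (cind (f, b) (zi z) - cind (f, b) (zi z - 1)) * coef (cellnum c') k.
  rewrite /coef /= suml_cat -!/(coef _ _) coef_cons /cind /=; case: f.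
    rewrite /coef suml_nil addr0; congr (_ * _).
    by case: eqP; case: lerP; case: lerP => //=; lia.
  have -> : [seq (Z.succ b :: kc.1, Z.opp kc.2) | kc <- cellnum c'] =
     lopp [seq (Z.succ b :: kc.1, kc.2) | kc <- cellnum c'] by rewrite /lopp -map_comp.
  rewrite {2}/coef suml_opp -/(coef _ _) coef_cons -mulrBl; congr ((_ - _%:Z) * _).
  by congr nat_of_bool; apply/eqP/eqP; lia.
case: c => [|[f1 b1] [|[f2 b2] [|[f3 b3] [|[f4 b4] [|]]]]] // _.
rewrite /kv !step !Z_of_intK big_ord4 /=.
by rewrite /coef suml_cons suml_nil addr0 mulr1.
Qed.

(** Expanding the product of the four one-variable differences over subsets of the directions gives
    the alternating sum in [char_num]. *)
Lemma char_num_cell c w : size c = 4%N ->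
  Defs.char_num (fun w => (incell c (kv w))%:Z) w = coef (cellnum c) (kv w).
Proof.
move=> sc; rewrite coef_cellnum // /Defs.char_num.
under [RHS]eq_bigr do rewrite addrC.
rewrite bigA_distr /=; apply: eq_big => [J|J _]; first by rewrite ?inE.
rewrite incell_prod // -prodr_const big_mkcond -big_split /=; apply: eq_bigr => i _.
by rewrite !mxE; case: ifP => _ /=; rewrite ?mulN1r // mul1r subr0.
Qed.

Lemma char_num_sum (L : seq (seq (bool * Z))) m w :
  (forall w, m w = \sum_(c <- L) (incell c (kv w))%:Z) -> all (fun c => size c == 4%N) L ->
  Defs.char_num m w = coef (flatten (map cellnum L)) (kv w).
Proof.
move=> Hm; have -> : m = fun w => \sum_(c <- L) (incell c (kv w))%:Z by apply/funext.
elim: L {Hm} => [|c L IH] /=.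
  by move=> _; rewrite /coef suml_nil /Defs.char_num big1 // => J _; rewrite big_nil mulr0.
move=> /andP[/eqP sc sL]; rewrite /coef suml_cat -!/(coef _ _) -IH // -char_num_cell //.
rewrite /Defs.char_num -big_split; apply: eq_bigr => J _ /=.
by rewrite big_cons mulrDr.
Qed.

Section Eval4.
Variable F : fieldType.
Variables (t : 'I_4 -> F) (y : F).
Definition tup : seq F := [:: t i1; t i2; t i3; t i4; y].

Lemma evk_tup w : evk tup (kv w) = tmon t w.
Proof.
by rewrite /tmon big_ord4 /= !Z_of_intK mulr1.
Qed.

Lemma size_cellnum c k : k \in map fst (cellnum c) -> size k = size c.
Proof.
elim: c k => [|[f b] c IH] k /=; first by rewrite inE => /eqP ->.
rewrite map_cat mem_cat -map_comp => /orP[/mapP[kc kcl ->] /=|].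
  by rewrite IH // map_f.
by case: f; rewrite //= -map_comp => /mapP[kc kcl ->] /=; rewrite IH // map_f.
Qed.

Lemma evl_cells c : size c = 4%N -> all (predC1 0) tup ->
  evl tup (cellnum c) = \prod_(i < 4) (t i ^ zi (nth (false, Z0) c i).2 *
    (if (nth (false, Z0) c i).1 then 1 else 1 - t i)).
Proof.
move=> sc t0; have step f b c' a x : a != 0 -> evl (a :: x) (cellnum ((f, b) :: c')) =
    a ^ zi b * (if f then 1 else 1 - a) * evl x (cellnum c').
  move=> a0; rewrite /= evl_cat; have E d l : evl (a :: x) (map (fun kc => (d :: kc.1, kc.2)) l) = a ^ zi d * evl x l.
    rewrite /evl (suml_comp _ (cons d)) /suml big_distrr /=; apply: eq_bigr => kc _.
    by rewrite mulrzAr.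
  rewrite E; case: f; first by rewrite evl_nil addr0 mulr1.
  have -> : [seq (Z.succ b :: kc.1, Z.opp kc.2) | kc <- cellnum c'] =
     lopp [seq (Z.succ b :: kc.1, kc.2) | kc <- cellnum c'] by rewrite /lopp -map_comp.
  rewrite evl_opp E (_ : zi (Z.succ b) = zi b + 1); last by lia.
  by rewrite expfzDr // expr1z; ring.
move: t0; rewrite /= => /and5P[a1 a2 a3 a4 _].
case: c sc => [|[f1 b1] [|[f2 b2] [|[f3 b3] [|[f4 b4] [|]]]]] // _.
rewrite /tup !step // big_ord4 /=.
rewrite /evl suml_cons suml_nil /=.
by rewrite addr0 !mulr1 -!mulrA.
Qed.
End Eval4.

Lemma char_cells (L : seq (seq (bool * Z))) m t y :
  (forall w, m w = \sum_(c <- L) (incell c (kv w))%:Z) -> all (fun c => size c == 4%N) L ->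
  char_of m t = evl (tup t y) (flatten (map cellnum L)) / \prod_i (1 - t i).
Proof.
move=> Hm sL; rewrite /char_of; congr (_ / _).
set l := flatten _.
have szl k : k \in map fst l -> size k = 4%N.
  rewrite /l => /mapP[kc /flattenP[s /mapP[c cL ->] kcs] ->].
  by rewrite (@size_cellnum c) ?map_f //; apply/eqP; move/allP: sL; apply.
rewrite /evl (@suml_coef _ _ l (undup (map fst l))) ?undup_uniq //; last first.
  by move=> x; rewrite mem_undup.
rewrite (@fsum_seq _ _ _ (map vk (undup (map fst l)))).
- rewrite big_map big_seq [RHS]big_seq; apply: eq_bigr => k; rewrite mem_undup => kl.
  rewrite (char_num_sum _ Hm sL) vkK ?szl // -(evk_tup t y) vkK ?szl //.
  by rewrite -/l mulrC mulrzr.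
- rewrite map_inj_in_uniq ?undup_uniq // => k k'; rewrite !mem_undup => kl kl' e.
  by rewrite -(vkK (szl _ kl)) e vkK ?szl.
move=> w wn; rewrite (char_num_sum _ Hm sL) coef0 ?mul0r // -/l.
apply: contra wn => kl; apply/mapP; exists (kv w); rewrite ?kvK //.
by rewrite mem_undup.
Qed.

(** * The characters of Z_mu and of its modifications *)

Definition T5 : seq ratfun := tup tvar yvar.

Lemma gens5 : gens 5 = T5.
Proof.
rewrite /gens !enum_ordSl (_ : enum 'I_0 = [::]) /=; last by apply: size0nil; rewrite size_enum_ord.
by congr [:: tofrac 'X_ _; tofrac 'X_ _; tofrac 'X_ _; tofrac 'X_ _; tofrac 'X_ _]; apply: val_inj.
Qed.

Lemma T5_neq0 : all (predC1 0) T5.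
Proof. by rewrite -gens5 gens_neq0. Qed.

Lemma tvar_neq0 i : tvar i != 0.
Proof. by rewrite /tvar tofrac_eq0; apply/eqP => /(congr1 (mcoeff U_(lshift 1 i))); rewrite mcoeffX eqxx mcoeff0. Qed.

Lemma tvar_neq1 i : 1 - tvar i != 0.
Proof.
rewrite /tvar -tofrac1 -tofracB tofrac_eq0 subr_eq0 eq_sym; apply/eqP => /(congr1 (mcoeff 0%MM)).
rewrite mcoeffX mcoeff1 eqxx; case: eqP => // /mnmP/(_ (lshift 1 i)).
by rewrite mnm1E eqxx mnm0E.
Qed.

Lemma inv_neq1 (F : fieldType) (a : F) : a != 0 -> 1 - a != 0 -> 1 - a^-1 != 0.
Proof.
move=> a0 a1; have -> : 1 - a^-1 = - ((1 - a) / a).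
  by rewrite mulrBl mul1r divff // opprB.
by rewrite oppr_eq0 mulf_neq0 ?invr_neq0.
Qed.

Definition locT (J : seq bool) (c : seq (bool * Z)) := map (fun x => if x.1 then (true, Z0) else x.2) (zip J c).
Definition locF (J : seq bool) (c : seq (bool * Z)) := map (fun x => if x.1 then (false, Z0) else x.2) (zip J c).
Definition subfree (J : seq bool) (c : seq (bool * Z)) := all (fun x => x.1 ==> x.2.1) (zip J c).
(** The character of [N_J] times the product of the 1 - t_i with i not in J. Boxes of [N_J] have
    coordinates 0 in J; treating these directions as free, in [locT], cancels their factors 1 -
    t_i. *)
Definition QJ (O : seq (seq (bool * Z))) (J : seq bool) : lau :=
  flatten (map (fun c => cellnum (locT J c)) (filter (subfree J) O)).
Definition maskof (J : {set 'I_4}) : seq bool := [:: i1 \in J; i2 \in J; i3 \in J; i4 \in J].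
Definition fixcell (u : key) : seq (bool * Z) := map (pair false) u.
Definition mono (l : seq key) : lau := map (fun k => (k, Zpos xH)) l.
Definition setkJ (J : seq bool) (k : key) (z : Z) : key := map (fun x => if x.1 then z else x.2) (zip J k).

Lemma size4P (T : Type) (s : seq T) : size s = 4%N -> exists a b c d, s = [:: a; b; c; d].
Proof. by case: s => [|a [|b [|c [|d [|]]]]] // _; exists a, b, c, d. Qed.

Lemma nth_maskof J (i : 'I_4) : nth false (maskof J) i = (i \in J).
Proof. by elim/ord4P: i. Qed.

Lemma fix1 (F : fieldType) (a : F) : a ^ zi Z0 * (1 - a) = (1 - a) * (a ^ zi Z0 * 1).
Proof. by rewrite mulr1 mulrC. Qed.

Lemma evl_locF (F : fieldType) J c (t : 'I_4 -> F) y : size c = 4%N -> (forall i, t i != 0) -> y != 0 ->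
  evl (tup t y) (cellnum (locF (maskof J) c)) =
  (\prod_(i in J) (1 - t i)) * evl (tup t y) (cellnum (locT (maskof J) c)).
Proof.
move=> sc t0 y0; have T0 : all (predC1 0) (tup t y) by rewrite /= !t0 y0.
have [a [b [d [e ->]]]] := size4P sc.
rewrite (@evl_cells _ t y (locF (maskof J) [:: a; b; d; e])) // (@evl_cells _ t y (locT (maskof J) [:: a; b; d; e])) // [X in _ = X * _]big_mkcond -big_split; apply: eq_bigr => i _.
rewrite /locF /locT /maskof; elim/ord4P: i; [case: (i1 \in J)|case: (i2 \in J)|case: (i3 \in J)|case: (i4 \in J)]; by [exact: fix1|exact/esym/mul1r].
Qed.

Lemma incell_fix u w : size u = 4%N -> incell (fixcell u) (kv w) = (u == kv w).
Proof.
move=> /size4P[a [b [c [d ->]]]]; rewrite /kv !eqseq_cons /= andbT.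
have E (x y : Z) : (x == y) = Z.eqb x y by [].
by rewrite !E; case: Z.eqb => //=; case: Z.eqb => //=; case: Z.eqb => //=; case: Z.eqb.
Qed.

Lemma evl_fix (F : fieldType) u (t : 'I_4 -> F) y : size u = 4%N -> (forall i, t i != 0) -> y != 0 ->
  evl (tup t y) (cellnum (fixcell u)) = evk (tup t y) u * \prod_i (1 - t i).
Proof.
move=> su t0 y0; have T0 : all (predC1 0) (tup t y) by rewrite /= !t0 y0.
have [a [b [c [d ->]]]] := size4P su.
rewrite evl_cells // big_split /=; congr (_ * _); last first.
  by apply: eq_bigr => i _; elim/ord4P: i.
by rewrite big_ord4 /= mulr1.
Qed.

Lemma evl_fixs (F : fieldType) l (t : 'I_4 -> F) y : all (fun u => size u == 4%N) l -> (forall i, t i != 0) -> y != 0 ->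
  evl (tup t y) (flatten (map cellnum (map fixcell l))) =
  evl (tup t y) (mono l) * \prod_i (1 - t i).
Proof.
move=> + t0 y0; elim: l => [|u l IH] /=; first by rewrite !evl_nil mul0r.
move=> /andP[/eqP su sl]; rewrite evl_cat evl_fix // IH // evl_cons.
by rewrite mulrDl /= mulr1z.
Qed.

Lemma cancel_fact (F : fieldType) (a b c : F) : a != 0 -> a * b / (a * c) = b / c.
Proof. by move=> a0; rewrite invfM mulrACA divff ?mul1r. Qed.

Section Characters.
Variables (K : nat) (O : seq (seq (bool * Z))).
Hypothesis wfO : wf_cells K O.
Variables (R : realType) (mu : 'I_4 -> set box).
Hypothesis HZ : is_Zmu R mu (pset O).

Lemma wf_size : all (fun c => size c == 4%N) O.
Proof. by have /and4P[/allP H _ _ _] := wfO; apply/allP => c /H /and3P[]. Qed.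

Lemma Zmu_eq : Zmu R mu = pset O.
Proof. exact: Zmu_unique. Qed.

Lemma inp_sum k : size k = 4%N -> (inp O k)%:Z = \sum_(c <- O) (incell c k)%:Z.
Proof.
move=> sk; have /and4P[_ + _ _] := wfO; elim: O wf_size => [|c O' IH] /=; first by rewrite big_nil.
move=> /andP[/eqP sc sO] /andP[dc dO]; rewrite big_cons; case: ifP => ck; last by rewrite add0r IH.
rewrite big_seq big1 ?addr0 // => c' c'O; case c'k: (incell c' k) => //.
have := allP dc c' c'O; have sc' : size c' = 4%N by apply/eqP/(allP sO).
have [x1 [x2 [x3 [x4 ek]]]] := size4P sk.
move: ck c'k; rewrite ek; have [[f1 b1] [[f2 b2] [[f3 b3] [[f4 b4] ->]]]] := size4P sc.
have [[g1 d1] [[g2 d2] [[g3 d3] [[g4 d4] ->]]]] := size4P sc'.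
rewrite /cdisj /=.
have E (f g : bool) (b d x : Z) : (if f then Z.leb b x else Z.eqb b x) ->
   (if g then Z.leb d x else Z.eqb d x) ->
   ~~ match f, g with false, false => ~~ Z.eqb b d | false, true => Z.ltb b d | true, false => Z.ltb d b | _, _ => false end.
  by case: f; case: g; lia.
case h1: (if f1 then _ else _) => //; case h2: (if f2 then _ else _) => //.
case h3: (if f3 then _ else _) => //; case h4: (if f4 then _ else _) => // _.
case h1': (if g1 then _ else _) => //; case h2': (if g2 then _ else _) => //.
case h3': (if g3 then _ else _) => //; case h4': (if g4 then _ else _) => // _.
move: (E _ _ _ _ _ h1 h1') (E _ _ _ _ _ h2 h2') (E _ _ _ _ _ h3 h3') (E _ _ _ _ _ h4 h4').
by rewrite orbF => /negPf -> /negPf -> /negPf -> /negPf ->.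
Qed.

Lemma part_mult_pin (p : set box) w : part_mult p w = (pin p w)%:Z.
Proof.
rewrite /part_mult; congr (nat_of_bool _)%:Z; apply/asboolP/idP => [[v pv ->]|/pinP[w0 pw]].
  by apply/pin_vb.
by exists (bx w) => //; rewrite -[LHS](bxK w0).
Qed.

Lemma incell_far (n : Z) J c k : size J = size c -> size k = size c ->
  (forall x, x \in c -> Z.le Z0 x.2 /\ Z.lt x.2 (Z.of_nat K)) -> Z.le (Z.of_nat K) n ->
  setkJ J k Z0 = k -> incell c (setkJ J k n) = subfree J c && incell (locF J c) k.
Proof.
move=> + + + Kn; elim: c J k => [|[f b] c IH] [|j J] [|z k] //= [sJ] [sk] H [ez ek].
have := H (f, b); rewrite mem_head => /(_ isT) /= bK.
have {}IH := IH J k sJ sk (fun x xc => H x (mem_behead (s := (f, b) :: c) xc)) ek.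
rewrite /subfree /= -/(subfree J c) IH; case: j ez => ez /=; last first.
  by case: (if f then _ else _); rewrite ?andbF.
rewrite -ez /=.
by case: (f) => /=; [have -> : Z.leb b n by lia|have -> : Z.eqb b n = false by lia].
Qed.

Let cellP c : c \in O -> size c = 4%N /\ forall x, x \in c -> Z.le Z0 x.2 /\ Z.lt x.2 (Z.of_nat K).
Proof.
move=> cO; have /and4P[/allP/(_ _ cO)/and3P[/eqP sc /allP H n] _ _ _] := wfO.
by split=> // x /H /Zbounds.
Qed.

Lemma inp_far (n : Z) J k : size J = 4%N -> size k = 4%N -> Z.le (Z.of_nat K) n -> setkJ J k Z0 = k ->
  (inp O (setkJ J k n))%:Z = \sum_(c <- map (locF J) (filter (subfree J) O)) (incell c k)%:Z.
Proof.
move=> sJ sk Kn k0; rewrite inp_sum ?size_map ?size_zip ?sJ ?sk // big_map big_filter [RHS]big_mkcond /=.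
rewrite big_seq [RHS]big_seq; apply: eq_bigr => c cO; have [sc bc] := cellP cO.
by rewrite incell_far ?sc //; case: subfree.
Qed.

Lemma kv_addJ (J : {set 'I_4}) (v : box) n : (forall i, i \in J -> v i = 0%N) ->
  kv (vb (v + (\sum_(i in J) U_(i)) *+ n)%MM) = setkJ (maskof J) (kv (vb v)) (Z.of_nat n).
Proof.
move=> v0; have E (i : 'I_4) : ((v + (\sum_(i in J) U_(i)) *+ n)%MM i = if i \in J then n else v i).
  rewrite mnmDE mulmnE mnm_sumE; case: ifP => iJ.
    rewrite v0 // (bigD1 i) //= mnm1E eqxx big1 ?addn0 ?mul1n // => j /andP[_ ji].
    by rewrite mnm1E (negPf ji).
  by rewrite big1 ?addn0 // => j jJ; rewrite mnm1E; case: eqP => // e; rewrite -e jJ in iJ.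
rewrite /kv !vbE !E /setkJ /=.
by congr [:: _; _; _; _]; case: ifP.
Qed.

(** A monomial survives the localization exactly if its translate far out along J is in the support,
    and there only the cells free along J remain. *)
Lemma part_mult_loc (J : {set 'I_4}) w : part_mult (loc_part R J (pset O)) w =
  \sum_(c <- map (locF (maskof J)) (filter (subfree (maskof J)) O)) (incell c (kv w))%:Z.
Proof.
rewrite part_mult_pin; have [k0|k0] := eqVneq (setkJ (maskof J) (kv w) Z0) (kv w); last first.
  have ex : exists2 i, i \in J & w 0 i != 0.
    apply: contrapT => no; case/eqP: k0; rewrite /setkJ /kv /=.
    have E i : (if i \in J then Z0 else Z_of_int (w 0 i)) = Z_of_int (w 0 i).
      by case: ifP => // iJ; case: (eqVneq (w 0 i) 0) => [->//|wi]; case: no; exists i.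
    by rewrite !E.
  have [i iJ wi] := ex; rewrite big_map big1_seq; last first.
    move=> c /andP[_]; rewrite mem_filter => /andP[_ cO]; have [sc _] := cellP cO.
    case: (boolP (incell _ _)) => // /(incellP); rewrite size_map size_zip sc => /(_ erefl i (ltn_ord i)).
    rewrite (nth_map (false, (false, Z0))) ?size_zip ?sc // nth_zip ?sc // nth_maskof iJ /= => e.
    by case/eqP: wi; rewrite -kvE -e.
  case: pinP => // -[w0 [H _]]; case/eqP: wi.
  by have := H i iJ; rewrite bxE; have /nnP/(_ i) := w0; lia.
rewrite -(inp_far (n := Z.of_nat K)) //; last exact: Z.le_refl.
congr (nat_of_bool _)%:Z; apply/pinP/idP.
  move=> [w0 [w1 H]]; apply: contrapT => pn; apply: H; apply/(localized_monoP _ _ (pset_partition wfO)).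
  move=> v; rewrite msuppX inE => /eqP ->; exists K; rewrite /pset /= kv_addJ // bxK //.
move=> pk; have w1 i : i \in J -> w 0 i = 0.
  move=> iJ; rewrite -kvE -k0 (nth_map (false, Z0)) ?size_zip // nth_zip // nth_maskof iJ //.
have w0 : nn w.
  apply/nnP => i; have [iJ|iJ] := boolP (i \in J); first by rewrite w1.
  have := @inp_ge0 _ _ wfO (setkJ (maskof J) (kv w) (Z.of_nat K)) i erefl (ltn_ord i) pk.
  rewrite (nth_map (false, Z0)) ?size_zip // nth_zip // nth_maskof (negPf iJ) /=.
  by have := kvE w i; lia.
split=> //; have b0 i : i \in J -> bx w i = 0%N by move=> iJ; rewrite bxE w1.
split=> // /(localized_monoP _ _ (pset_partition wfO))/(_ (bx w)).
rewrite msuppX inE eqxx => /(_ isT)[n]; apply.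
apply: (pset_partition wfO) (_ : pset O (bx w + (\sum_(i in J) U_(i)) *+ (n + K))%MM) _.
  rewrite /pset /= kv_addJ // bxK //; have := inp_far (n := Z.of_nat (n + K)) (erefl : size (maskof J) = 4%N) (size_kv w) _ k0.
  rewrite -(inp_far (n := Z.of_nat K)) //; last exact: Z.le_refl.
  rewrite pk => H; have := H ltac:(lia); by case: inp.
apply/mnm_lepP => i; rewrite !mnmDE !mulmnE leq_add2l leq_mul2l; lia.
Qed.

Lemma char_loc (J : {set 'I_4}) t y : (forall i, t i != 0) -> y != 0 -> (forall i, 1 - t i != 0) ->
  char_of (part_mult (loc_part R J (pset O))) t =
  evl (tup t y) (QJ O (maskof J)) / \prod_(i in ~: J) (1 - t i).
Proof.
move=> t0 y0 t1; have sz c : c \in filter (subfree (maskof J)) O -> size c = 4%N.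
  by rewrite mem_filter => /andP[_ /cellP[]].
rewrite (@char_cells (map (locF (maskof J)) (filter (subfree (maskof J)) O)) _ t y (part_mult_loc J)); last first.
  by apply/allP => c /mapP[c' c'O ->]; rewrite size_map size_zip (sz c').
have -> : \prod_i (1 - t i) = \prod_(i in J) (1 - t i) * \prod_(i in ~: J) (1 - t i).
  by rewrite (bigID (fun i => i \in J)) /=; congr (_ * _); apply: eq_bigl => i; rewrite inE.
have -> : evl (tup t y) (flatten (map cellnum (map (locF (maskof J)) (filter (subfree (maskof J)) O)))) =
  (\prod_(i in J) (1 - t i)) * evl (tup t y) (QJ O (maskof J)).
  rewrite /QJ !evl_flatten !big_map big_distrr /= big_seq [RHS]big_seq; apply: eq_bigr => c cO.
  exact: evl_locF (sz c cO) t0 y0.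
apply: cancel_fact; apply/prodf_neq0 => i _; exact: t1.
Qed.

Lemma char_box (l : seq key) (m : 'rV[int]_4 -> int) t y : (forall i, t i != 0) -> y != 0 -> (forall i, 1 - t i != 0) ->
  uniq l -> all (fun u => size u == 4%N) l -> (forall w, m w = (inp O (kv w))%:Z + (kv w \in l)%:Z) ->
  char_of m t = evl (tup t y) (QJ O (maskof finset.set0)) / \prod_i (1 - t i) + evl (tup t y) (mono l).
Proof.
move=> t0 y0 t1 ul sl Hm.
rewrite (@char_cells (O ++ map fixcell l) _ t y); first last.
- rewrite all_cat wf_size all_map; apply: sub_all sl => u /= /eqP su.
  by rewrite size_map su.
- move=> w; rewrite Hm big_cat -inp_sum //=; congr (_ + _).
  rewrite big_map; elim: l ul sl {Hm} => [|u l IH] /=; first by rewrite big_nil.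
  move=> /andP[ul /IH{}IH] /andP[/eqP su /IH{}IH]; rewrite big_cons -IH incell_fix // inE [u == _]eq_sym.
  by case: eqP => // ->; rewrite (negPf ul).
rewrite map_cat flatten_cat evl_cat (evl_fixs sl t0 y0) mulrDl mulfK; last by apply/prodf_neq0 => i _; exact: t1.
congr (evl _ _ / _ + _); rewrite /QJ (eq_in_filter (a2 := predT)) ?filter_predT.
  by congr flatten; apply/eq_in_map => c /cellP[/size4P[a [b [d [e ->]]]] _]; rewrite /locT /maskof !inE.
by move=> c /cellP[/size4P[a [b [d [e ->]]]] _]; rewrite /subfree /maskof !inE.
Qed.

End Characters.

(** * The Laurent polynomials V and W *)

Section Abstract.
Variables (F : fieldType) (t : 'I_4 -> F).
Hypotheses (t0 : forall i, t i != 0) (t1 : forall i, 1 - t i != 0).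

Lemma prod_tinv (J : {set 'I_4}) : \prod_(k in ~: J) (1 - (t k)^-1) =
  (-1) ^+ #|J| * (\prod_(k in ~: J) (1 - t k)) / \prod_(k in ~: J) t k.
Proof.
have -> : (-1) ^+ #|J| = (-1) ^+ #|~: J| :> F.
  have := cardsC J; rewrite card_ord => e; rewrite -signr_odd -[RHS]signr_odd.
  by have := congr1 odd e; rewrite oddD => /=; case: (odd #|J|); case: (odd #|~: J|).
rewrite -prodr_const -big_split -prodf_div; apply: eq_bigr => k _ /=.
by rewrite mulN1r opprB mulrBl divff // mul1r.
Qed.

(** Conjugation reproduces the denominator of [Z_J] up to sign and a monomial, so the three terms of
    [A_J] become q, q' and q q' over one denominator. *)
Lemma A_abstract (J : {set 'I_4}) q q' :
  (-1) ^+ #|J| * (q / \prod_(k in ~: J) (1 - t k))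
  + (q' / \prod_(k in ~: J) (1 - (t k)^-1)) / \prod_(k in ~: J) t k
  - (\prod_(k in ~: J) (1 - t k)) / (\prod_(k in ~: J) t k)
    * (q / \prod_(k in ~: J) (1 - t k)) * (q' / \prod_(k in ~: J) (1 - (t k)^-1))
  = (-1) ^+ #|J| * (q + q' - q * q') / \prod_(k in ~: J) (1 - t k).
Proof.
rewrite prod_tinv.
have p0 : \prod_(k in ~: J) (1 - t k) != 0 by apply/prodf_neq0 => k _; exact: t1.
have r0 : \prod_(k in ~: J) t k != 0 by apply/prodf_neq0 => k _; exact: t0.
move: (\prod_(k in ~: J) (1 - t k)) (\prod_(k in ~: J) t k) p0 r0 => p r p0 r0.
have [-> | ->] : (-1) ^+ #|J| = 1 :> F \/ (-1) ^+ #|J| = -1 :> F.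
- by rewrite -signr_odd; case: odd; [right|left]; rewrite ?expr1 ?expr0.
- by field; rewrite p0 r0.
by field; rewrite p0 r0 oppr_eq0 oner_neq0.
Qed.

Lemma prod_setC1 (i : 'I_4) : (1 - t i) * \prod_(k in ~: [set i]%SET) (1 - t k) = \prod_k (1 - t k).
Proof. by rewrite [RHS](bigD1 i) //=; congr (_ * _); apply: eq_bigl => k; rewrite !inE. Qed.

Lemma prod_setC2 (i j : 'I_4) : (i < j)%N ->
  (1 - t i) * (1 - t j) * \prod_(k in ~: [set i; j]%SET) (1 - t k) = \prod_k (1 - t k).
Proof.
move=> ij; have ji : j != i by rewrite -val_eqE /= gtn_eqF.
rewrite [RHS](bigD1 i) //= [in RHS](bigD1 j) //=.
by rewrite mulrA; congr (_ * _); apply: eq_bigl => k; rewrite !inE negb_or.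
Qed.

End Abstract.

Definition pairs4 : seq (seq bool) :=
  [:: [:: true; true; false; false]; [:: true; false; true; false]; [:: true; false; false; true];
      [:: false; true; true; false]; [:: false; true; false; true]; [:: false; false; true; true]].
Definition singles4 : seq (seq bool) :=
  [:: [:: true; false; false; false]; [:: false; true; false; false];
      [:: false; false; true; false]; [:: false; false; false; true]].
Definition none4 : seq bool := [:: false; false; false; false].
Definition lN (q : lau) : lau := q ++ lbar q ++ lopp (lmul q (lbar q)).
Definition P4 : lau := cellnum (nseq 4 (false, Z0)).
Definition t1234 : key := nseq 4 (Zpos xH).

(* Numerators of V and W of Z_mu over (1 - t_1) ... (1 - t_4). *)
Definition numV (O : seq (seq (bool * Z))) : lau :=
  lN (QJ O none4) ++ lopp (flatten (map (fun J => lN (QJ O J)) singles4)) ++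
  flatten (map (fun J => lN (QJ O J)) pairs4).
Definition numW (O : seq (seq (bool * Z))) : lau :=
  QJ O none4 ++ lopp (flatten (map (QJ O) singles4)) ++ flatten (map (QJ O) pairs4).

(** What V gains when boxes with character c are added to [Z_mu]: q + q' - q q' is expanded at q =
    q_0 + P c and divided by P, the product of the 1 - t_i. The division is carried out
    symbolically, so none has to be computed for each [l]. *)
Definition dV (q0 : lau) (l : seq key) : lau :=
  mono l ++ kshift (kneg t1234) (lbar (mono l)) ++
  lopp (kshift (kneg t1234) (lmul q0 (lbar (mono l)))) ++
  lopp (lmul (lbar q0) (mono l)) ++
  lopp (kshift (kneg t1234) (lmul P4 (lmul (mono l) (lbar (mono l))))).

Definition addy (e : Z) (l : lau) : lau := map (fun kc => (rcons kc.1 e, kc.2)) l.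

Definition vt (v0 w0 q0 : lau) (l : seq key) : lau :=
  addy Z0 (v0 ++ dV q0 l) ++
  lopp (addy (Zpos xH) (lbar (w0 ++ mono l)) ++ addy (Zneg xH) (w0 ++ mono l)).

Section AbstractVertex.
Variables (F : fieldType) (t : 'I_4 -> F) (y : F).
Hypotheses (t0 : forall i, t i != 0) (t1 : forall i, 1 - t i != 0) (y0 : y != 0).
Variables (O : seq (seq (bool * Z))) (l : seq key) (v0 w0 : lau).
Hypothesis Hv : lnorm (lmul P4 v0 ++ lopp (numV O)) = [::].
Hypothesis Hw : lnorm (lmul P4 w0 ++ lopp (numW O)) = [::].
Local Notation T := (tup t y).
Local Notation P := (\prod_i (1 - t i)).
Local Notation e := (evl T).
Local Notation eb := (fun l => evl T (lbar l)).

Let T0 : all (predC1 0) T.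
Proof. by rewrite /= !t0 y0. Qed.

(** Only Z itself sees the finitely many boxes [l]; Z_i and Z_ij belong to [Z_mu]. *)
Definition qf J : F := e (QJ O J) + (if J == none4 then P * e (mono l) else 0).
Definition qb J : F := eb (QJ O J) + (if J == none4 then \prod_i (1 - (t i)^-1) * eb (mono l) else 0).

Lemma evl_P4 : e P4 = P.
Proof. by rewrite evl_cells //; apply: eq_bigr => i _; elim/ord4P: i; rewrite /= mul1r. Qed.

Lemma P_neq0 : P != 0.
Proof. by apply/prodf_neq0 => i _; exact: t1. Qed.

Lemma P_inv : \prod_i (1 - (t i)^-1) = P * (evk T t1234)^-1.
Proof.
rewrite /= !expr1z mulr1; have := prod_tinv t0 finset.set0; rewrite cards0 expr0 mul1r finset.setC0.
have E (f : 'I_4 -> F) : \prod_(k in [set: 'I_4]%SET) f k = \prod_k f k.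
  by apply: eq_bigl => k; rewrite inE.
rewrite !E => ->; congr (_ / _); exact: big_ord4.
Qed.

Lemma evl_lN q : e (lN q) = e q + eb q - e q * eb q.
Proof. by rewrite /lN !evl_cat evl_opp evl_mul // addrA. Qed.

Lemma big_seq4 (f : seq bool -> F) : \sum_(i : 'I_4) f (maskof [set i]%SET) = \sum_(J <- singles4) f J.
Proof.
rewrite big_ord4 /singles4 !big_cons big_nil addr0.
by congr (f _ + (f _ + (f _ + f _))); rewrite /maskof !inE.
Qed.

Lemma big_pairs4 (f : seq bool -> F) :
  \sum_(i < 4) \sum_(j < 4 | (i < j)%N) f (maskof [set i; j]%SET) = \sum_(J <- pairs4) f J.
Proof.
under eq_bigr do rewrite big_mkcond.
rewrite big_ord4 !big_ord4 /= !add0r ?addr0 /pairs4 !big_cons big_nil addr0 !addrA.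
by congr (f _ + f _ + f _ + f _ + f _ + f _); rewrite /maskof !inE.
Qed.

Lemma V_abstract :
  ((qf none4 + qb none4 - qf none4 * qb none4)
   - \sum_(J <- singles4) (qf J + qb J - qf J * qb J)
   + \sum_(J <- pairs4) (qf J + qb J - qf J * qb J)) / P = e (v0 ++ dV (QJ O none4) l).
Proof.
have Hnone J : J \in singles4 ++ pairs4 -> (qf J = e (QJ O J)) * (qb J = eb (QJ O J)).
  by rewrite /qf /qb; case: eqP => [->//|_]; rewrite !addr0.
have -> : \sum_(J <- singles4) (qf J + qb J - qf J * qb J) = e (flatten (map (fun J => lN (QJ O J)) singles4)).
  rewrite evl_flatten big_map big_seq [RHS]big_seq; apply: eq_bigr => J Js.
  by rewrite evl_lN !Hnone ?mem_cat ?Js.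
have -> : \sum_(J <- pairs4) (qf J + qb J - qf J * qb J) = e (flatten (map (fun J => lN (QJ O J)) pairs4)).
  rewrite evl_flatten big_map big_seq [RHS]big_seq; apply: eq_bigr => J Js.
  by rewrite evl_lN !Hnone ?mem_cat ?Js ?orbT.
have Hv' := evl_eq T Hv; move: Hv'; rewrite evl_mul // evl_P4 /numV (evl_cat _ (lN _)) (evl_cat _ (lopp _)) evl_opp evl_lN => Hv'.
have -> : e (v0 ++ dV (QJ O none4) l) = e v0 + (e (mono l) + (evk T t1234)^-1 * eb (mono l)
   - (evk T t1234)^-1 * (e (QJ O none4) * eb (mono l)) - eb (QJ O none4) * e (mono l)
   - (evk T t1234)^-1 * (P * (e (mono l) * eb (mono l)))).
  rewrite /dV (evl_cat _ v0) (evl_cat _ (mono l)) (evl_cat _ (kshift _ _)) !(evl_cat _ (lopp _)) !evl_opp.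
  by rewrite !evl_shift // !evl_mul // evl_P4 evkN !addrA.
rewrite /qf /qb eqxx P_inv.
have P0 := P_neq0; have E0 : evk T t1234 != 0 by apply: evk_neq0.
move: P0 E0 Hv'; set p := P; set E := evk T t1234; set q := e (QJ O _); set q' := evl T (lbar (QJ O none4)).
set a := evl T (flatten _); set b := evl T (flatten _).
set c := e (mono l); set c' := evl T (lbar _); set V := e v0 => p0 E0 Hv'.
have -> : V = (q + q' - q * q' + (- a + b)) / p by rewrite -Hv' mulrAC divff // mul1r.
by field; rewrite p0 E0.
Qed.

Lemma W_abstract :
  (qf none4 - \sum_(J <- singles4) qf J + \sum_(J <- pairs4) qf J) / P = e (w0 ++ mono l).
Proof.
have Hnone J : J \in singles4 ++ pairs4 -> qf J = e (QJ O J).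
  by rewrite /qf; case: eqP => [->//|_]; rewrite addr0.
have -> : \sum_(J <- singles4) qf J = e (flatten (map (QJ O) singles4)).
  rewrite evl_flatten big_map big_seq [RHS]big_seq; apply: eq_bigr => J Js.
  by rewrite Hnone ?mem_cat ?Js.
have -> : \sum_(J <- pairs4) qf J = e (flatten (map (QJ O) pairs4)).
  rewrite evl_flatten big_map big_seq [RHS]big_seq; apply: eq_bigr => J Js.
  by rewrite Hnone ?mem_cat ?Js ?orbT.
have Hw' := evl_eq T Hw; move: Hw'; rewrite evl_mul // evl_P4 /numW (evl_cat _ (QJ _ _)) (evl_cat _ (lopp _)) evl_opp => Hw'.
rewrite /qf eqxx (evl_cat _ w0).
have P0 := P_neq0; move: P0 Hw'; set p := P; set q := e (QJ O _).
set a := evl T (flatten _); set b := evl T (flatten _); set c := e (mono l); set W := e w0 => p0 Hw'.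
have -> : W = (q + (- a + b)) / p by rewrite -Hw' mulrAC divff // mul1r.
by field; rewrite p0.
Qed.

End AbstractVertex.

(** * The vertex of an enlargement of Z_mu *)

Lemma coef_norm l k : coef (lnorm l) k = coef l k.
Proof. exact: suml_norm. Qed.

Section Vertex.
Variables (O : seq (seq (bool * Z))) (l : seq key) (v0 w0 : lau).
Hypothesis Hv : lnorm (lmul P4 v0 ++ lopp (numV O)) = [::].
Hypothesis Hw : lnorm (lmul P4 w0 ++ lopp (numW O)) = [::].
Variable zeta : {set 'I_4} -> rchar.

(** The common shape of the characters of solid partitions and of submodules. It is required at all
    points t, since conjugates are values at the inverse point. *)
Definition zeta_ok : Prop :=
  forall t y, (forall i, t i != 0) -> y != 0 -> (forall i, 1 - t i != 0) -> forall J : {set 'I_4}, (#|J| <= 2)%N ->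
   zeta J t = qf t y O l (maskof J) / \prod_(i in ~: J) (1 - t i).
Hypothesis Hz : zeta_ok.

Lemma tinv_inv t : tinv t = fun i => (t i)^-1. Proof. by []. Qed.

Lemma tup_inv (F : fieldType) (t : 'I_4 -> F) y : tup (fun i => (t i)^-1) y^-1 = map GRing.inv (tup t y).
Proof. by []. Qed.

Lemma qf_inv (F : fieldType) (t : 'I_4 -> F) y J : qf (fun i => (t i)^-1) y^-1 O l J = qb t y O l J.
Proof. by rewrite /qf /qb !evl_bar !tup_inv. Qed.

Let y0 : yvar != 0.
Proof. by have := T5_neq0; rewrite /T5 /tup => /and5P[_ _ _ _ /andP[]]. Qed.

Lemma Achar_tvar (J : {set 'I_4}) : (#|J| <= 2)%N ->
  Achar zeta J tvar = (-1) ^+ #|J| * (qf tvar yvar O l (maskof J) + qb tvar yvar O l (maskof J)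
     - qf tvar yvar O l (maskof J) * qb tvar yvar O l (maskof J)) / \prod_(i in ~: J) (1 - tvar i).
Proof.
move=> J2; rewrite /Achar (Hz tvar_neq0 y0 tvar_neq1 J2) tinv_inv.
have y0' : yvar^-1 != 0 by exact: (invr_neq0 y0).
have i0 i : (tvar i)^-1 != 0 by exact: (invr_neq0 (tvar_neq0 i)).
have i1 i : 1 - (tvar i)^-1 != 0 := inv_neq1 (tvar_neq0 i) (tvar_neq1 i).
rewrite (Hz i0 y0' i1 J2) qf_inv.
exact: A_abstract tvar_neq0 tvar_neq1 J _ _.
Qed.

Lemma sum_pairs_div (F : fieldType) (t : 'I_4 -> F) (t1 : forall i, 1 - t i != 0) (f : seq bool -> F) (g : {set 'I_4} -> F) :
  (forall J : {set 'I_4}, (#|J| <= 2)%N -> g J = (-1) ^+ #|J| * f (maskof J) / \prod_(i in ~: J) (1 - t i)) ->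
  g finset.set0 + \sum_i g [set i]%SET / (1 - t i) + 
   \sum_(i < 4) \sum_(j < 4 | (i < j)%N) g [set i; j]%SET / ((1 - t i) * (1 - t j)) =
  (f none4 - \sum_(J <- singles4) f J + \sum_(J <- pairs4) f J) / \prod_i (1 - t i).
Proof.
move=> H; have m0 : maskof finset.set0 = none4 by rewrite /maskof !inE.
rewrite H ?cards0 // expr0 mul1r m0 !mulrDl mulNr -big_seq4 -big_pairs4 mulr_suml -sumrN; congr (_ + _ + _).
- by congr (_ / _); apply: eq_bigl => i; rewrite !inE.
- apply: eq_bigr => i _; rewrite H ?cards1 // expr1 -(prod_setC1 _ i).
  by rewrite mulN1r !mulNr -mulrA -invfM [(1 - t i) * _]mulrC.
rewrite mulr_suml; apply: eq_bigr => i _; rewrite mulr_suml; apply: eq_bigr => j ij.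
have c2 : #|[set i; j]%SET| = 2%N by rewrite cards2 -val_eqE /= (ltn_eqF ij).
by rewrite H ?c2 // sqrrN expr1n mul1r -(prod_setC2 _ ij) -[LHS]mulrA -invfM [(1 - t i) * _ * _]mulrC.
Qed.

Lemma Vchar_tvar : Vchar zeta tvar = evl T5 (v0 ++ dV (QJ O none4) l).
Proof.
rewrite -(V_abstract tvar_neq0 tvar_neq1 y0 l Hv).
exact: (sum_pairs_div tvar_neq1 (f := fun J => qf tvar yvar O l J + qb tvar yvar O l J - qf tvar yvar O l J * qb tvar yvar O l J) Achar_tvar).
Qed.

Lemma Wchar_gen t y : (forall i, t i != 0) -> y != 0 -> (forall i, 1 - t i != 0) ->
  Wchar zeta t = evl (tup t y) (w0 ++ mono l).
Proof.
move=> t0 y00 t1; rewrite -(W_abstract t0 t1 y00 l Hw).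
rewrite -(sum_pairs_div t1 (f := qf t y O l) (g := fun J => (-1) ^+ #|J| * zeta J t)).
  rewrite cards0 expr0 mul1r /Wchar -sumrN; congr (_ + _ + _).
    by apply: eq_bigr => i _; rewrite cards1 expr1 mulN1r mulNr.
  apply: eq_bigr => i _; apply: eq_bigr => j ij.
  have c2 : #|[set i; j]%SET| = 2%N by rewrite cards2 -val_eqE /= (ltn_eqF ij).
  by rewrite c2 sqrrN expr1n mul1r.
by move=> J J2; rewrite (Hz t0 y00 t1 J2) mulrA.
Qed.

Lemma evl_addy (F : fieldType) (x1 x2 x3 x4 y : F) e a : all (fun kc => size kc.1 == 4%N) a ->
  evl [:: x1; x2; x3; x4; y] (addy e a) = y ^ zi e * evl [:: x1; x2; x3; x4; y] a.
Proof.
elim: a => [|[k c] a IH] /=; first by rewrite !evl_nil mulr0.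
move=> /andP[/eqP/size4P[k1 [k2 [k3 [k4 ->]]]] /IH{}IH]; rewrite !evl_cons IH mulrDr; congr (_ + _).
by rewrite mulrzAr /= !mulr1; congr (_ *~ _); rewrite !mulrA mulrC !mulrA.
Qed.

Definition size4 (a : lau) := all (fun kc => size kc.1 == 4%N) a.

Lemma Vtilde_vt : size4 (v0 ++ dV (QJ O none4) l) -> size4 (w0 ++ mono l) ->
  Vtilde zeta = evl T5 (vt v0 w0 (QJ O none4) l).
Proof.
move=> s1 s2; rewrite /Vtilde Vchar_tvar tinv_inv.
have y0' : yvar^-1 != 0 by exact: (invr_neq0 y0).
have i0 i : (tvar i)^-1 != 0 by exact: (invr_neq0 (tvar_neq0 i)).
have i1 i : 1 - (tvar i)^-1 != 0 := inv_neq1 (tvar_neq0 i) (tvar_neq1 i).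
rewrite (Wchar_gen i0 y0' i1) (Wchar_gen tvar_neq0 y0 tvar_neq1) tup_inv -evl_bar.
rewrite /vt (evl_cat _ (addy _ _)) evl_opp (evl_cat _ (addy _ _)) !evl_addy //; last first.
  by move: s2; rewrite /size4 /lbar all_map; apply: sub_all => kc /=; rewrite size_map.
by rewrite expr0z mul1r expr1z exprN1 opprD addrA.
Qed.

End Vertex.

Section Zeta.
Variables (K : nat) (O : seq (seq (bool * Z))).
Hypothesis wfO : wf_cells K O.
Variables (R : realType) (mu : 'I_4 -> set box).
Hypothesis HZ : is_Zmu R mu (pset O).
Variable l : seq key.
Hypotheses (ul : uniq l) (sl : all (fun u => size u == 4%N) l).

Lemma qf_div (F : fieldType) (t : 'I_4 -> F) y : (forall i, 1 - t i != 0) ->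
  qf t y O l (maskof finset.set0) / \prod_(i in ~: (finset.set0 : {set 'I_4})) (1 - t i) =
  evl (tup t y) (QJ O (maskof finset.set0)) / \prod_i (1 - t i) + evl (tup t y) (mono l).
Proof.
move=> t1; have m0 : maskof finset.set0 = none4 by rewrite /maskof !inE.
have -> : \prod_(i in ~: (finset.set0 : {set 'I_4})) (1 - t i) = \prod_i (1 - t i) by apply: eq_bigl => i; rewrite !inE.
rewrite /qf m0 eqxx mulrDl; congr (_ + _).
by rewrite mulrAC divff ?mul1r //; apply/prodf_neq0.
Qed.

Lemma qf_loc (F : fieldType) (t : 'I_4 -> F) y (J : {set 'I_4}) : J != finset.set0 ->
  qf t y O l (maskof J) = evl (tup t y) (QJ O (maskof J)).
Proof.
move=> J0; rewrite /qf; case: eqP => [e|]; last by rewrite addr0.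
case/negP: J0; apply/eqP/setP => i; rewrite inE; have := nth_maskof J i.
by rewrite e; case: i => -[|[|[|[|]]]].
Qed.

Lemma zetaDT_ok (q : set box) :
  (forall w, part_mult q w = (inp O (kv w))%:Z + (kv w \in l)%:Z) -> zeta_ok O l (zetaDT R mu q).
Proof.
move=> Hq t y t0 y0 t1 J J2; rewrite /zetaDT; case: eqP => [->|/eqP J0].
  rewrite (qf_div y t1); exact: (char_box wfO t0 y0 t1 ul sl Hq).
rewrite (qf_loc _ _ J0) (Zmu_eq HZ); exact: (char_loc wfO R J t0 y0 t1).
Qed.

Lemma char_keys (m : 'rV[int]_4 -> int) t y : (forall i, t i != 0) -> y != 0 -> (forall i, 1 - t i != 0) ->
  (forall w, m w = (kv w \in l)%:Z) -> char_of m t = evl (tup t y) (mono l).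
Proof.
move=> t0 y0 t1 Hm; rewrite (@char_cells (map fixcell l) _ t y).
- rewrite (evl_fixs sl t0 y0); apply: mulfK; apply/prodf_neq0 => i _; exact: t1.
- move=> w; rewrite Hm big_map; elim: (l) ul sl => [|u l' IH] /=; first by rewrite big_nil.
  move=> /andP[ul' /IH{}IH] /andP[/eqP su /IH{}IH]; rewrite big_cons -IH incell_fix // inE [u == _]eq_sym.
  by case: eqP => // ->; rewrite (negPf ul').
by rewrite all_map; apply: sub_all sl => u /= /eqP su; rewrite size_map su.
Qed.

Lemma zetaPT_ok B : (forall w, (weight_dim (Imu mu) B w)%:Z = (kv w \in l)%:Z :> int) ->
  zeta_ok O l (zetaPT (R := R) mu B).
Proof.
move=> HB t y t0 y0 t1 J J2; rewrite /zetaPT; case: eqP => [->|/eqP J0]; last first.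
  rewrite (qf_loc _ _ J0) (Zmu_eq HZ); exact: (char_loc wfO R J t0 y0 t1).
rewrite (qf_div y t1) (Zmu_eq HZ); congr (_ + _); last exact: (char_keys t0 y0 t1 HB).
have H w : part_mult (pset O) w = (inp O (kv w))%:Z + (kv w \in [::])%:Z.
  by rewrite part_mult_pin (pin_inp wfO) addr0.
rewrite (char_box wfO t0 y0 t1 (isT : uniq [::]) (isT : all _ [::]) H).
by rewrite (evl_nil (tup t y)) addr0.
Qed.

End Zeta.

(** * Coefficients, sizes and ranks *)

Definition kv5 (x : 'rV[int]_4 * int) : key := rcons (kv x.1) (Z_of_int x.2).
Definition vk5 (k : key) : 'rV[int]_4 * int := (vk k, zi (nth Z0 k 4)).

Lemma kv5K : cancel kv5 vk5.
Proof.
move=> [w e]; rewrite /kv5 /vk5 /= Z_of_intK; congr pair.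
by apply/rowP => i; rewrite vkE -[RHS]kvE; elim/ord4P: i.
Qed.
Lemma vk5K k : size k = 5%N -> kv5 (vk5 k) = k.
Proof.
case: k => [|a [|b [|c [|d [|e [|f k]]]]]] // _.
by rewrite /kv5 /vk5 /kv !vkE /= !int_of_ZK.
Qed.

Lemma evk_kv5 (F : fieldType) (t : 'I_4 -> F) y x : evk (tup t y) (kv5 x) = tmon t x.1 * y ^ x.2.
Proof. by rewrite /tmon big_ord4 /kv5 /= !Z_of_intK mulr1 !mulrA. Qed.

Definition size5 (a : lau) := all (fun kc => size kc.1 == 5%N) a.

Lemma fsum_kv5 (V : zmodType) (a : lau) (g : key -> V) : size5 a ->
  \sum_(x \in [set: 'rV[int]_4 * int]) g (kv5 x) *~ coef a (kv5 x) = suml g a.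
Proof.
move=> /allP sa; have sk k : k \in undup (map fst a) -> size k = 5%N.
  by rewrite mem_undup => /mapP[kc /sa/eqP + ->].
rewrite (suml_coef _ (undup_uniq (map fst a))); last by move=> x; rewrite mem_undup.
rewrite (@fsum_seq _ _ _ (map vk5 (undup (map fst a)))).
- by rewrite big_map big_seq [RHS]big_seq; apply: eq_bigr => k /sk kk; rewrite vk5K.
- rewrite map_inj_in_uniq ?undup_uniq // => k k' /sk k5 /sk k5' e.
  by rewrite -(vk5K k5) e vk5K.
move=> x xn; rewrite coef0 ?mulr0z //; apply: contra xn => xa.
by apply/mapP; exists (kv5 x); rewrite ?kv5K // mem_undup.
Qed.

Lemma coef_fin (a : lau) : finite_set [set x | coef a (kv5 x) != 0].
Proof.
apply: (@sub_finite_set _ _ [set` map vk5 (undup (map fst a))]) => [x /= xa|]; last exact: finite_seq.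
apply/mapP; exists (kv5 x); rewrite ?kv5K // mem_undup; apply: contraNT xa => /coef0 ->.
by rewrite eqxx.
Qed.

Lemma mulr_intz (F : fieldType) (z : int) (a b : F) : a = b -> z%:~R * a = b *~ z.
Proof. by move=> ->; rewrite mulrC mulrzr. Qed.

Lemma is_laurent_evl (a : lau) : size5 a -> is_laurent (evl T5 a) (fun x => coef a (kv5 x)).
Proof.
move=> sa; split; first exact: coef_fin.
rewrite /evl -(fsum_kv5 _ sa); apply: eq_fsbigr => x _; apply/esym/mulr_intz/esym.
exact: (evk_kv5 tvar yvar x).
Qed.

(** [lcoef] is a choice, so uniqueness is needed: any other finitely supported coefficient function
    is put into a list and compared by [evl_gens_inj]. *)
Lemma lcoef_evl (a : lau) : size5 a -> lcoef (evl T5 a) = (fun x => coef a (kv5 x)).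
Proof.
move=> sa; apply: xget_unique; first exact: is_laurent_evl.
move=> c [cfin ec]; apply/funext => x.
have /finite_seqP[s es] := cfin.
pose b : lau := map (fun x => (kv5 x, Z_of_int (c x))) (undup s).
have sb : size5 b by apply/allP => kc /mapP[z _ ->].
have coefb z : coef b (kv5 z) = c z.
  rewrite /coef /suml big_map; have [cz|cz] := eqVneq (c z) 0.
    rewrite cz big1_seq // => z' /andP[_]; rewrite mem_undup => z's /=.
    have : c z' != 0 by have : [set x | c x != 0] z' by rewrite es.
    by rewrite (inj_eq (can_inj kv5K)); case: (eqVneq z' z) => [->|_]; rewrite ?cz ?eqxx // mul0rz.
  have zs : z \in undup s by rewrite mem_undup; have : [set` s] z by rewrite -es.
  rewrite (bigD1_seq z) ?undup_uniq //= eqxx big1 ?addr0 ?Z_of_intK ?intz // => z' z'z.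
  by rewrite (inj_eq (can_inj kv5K)) (negPf z'z) mul0rz.
rewrite -coefb; apply/esym; apply: evl_gens_inj.
  move=> k; rewrite mem_cat => /orP[] /mapP[kc kca ->]; apply/eqP; [exact: (allP sa)|exact: (allP sb)].
rewrite gens5 ec /evl -(fsum_kv5 _ sb); apply: eq_fsbigr => z _.
by rewrite coefb; apply/mulr_intz/esym/(evk_kv5 tvar yvar z).
Qed.

Lemma lrank_coef (a : lau) : size5 a -> lrank (fun x => coef a (kv5 x)) = total a.
Proof.
move=> sa; rewrite /lrank /total -(fsum_kv5 (fun=> 1) sa).
by apply: eq_fsbigr => x _; rewrite intz.
Qed.

Section SizeRank.
Variables (O : seq (seq (bool * Z))) (l : seq key) (v0 w0 : lau).
Hypothesis Hv : lnorm (lmul P4 v0 ++ lopp (numV O)) = [::].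
Hypothesis Hw : lnorm (lmul P4 w0 ++ lopp (numW O)) = [::].
Variable zeta : {set 'I_4} -> rchar.
Hypothesis Hz : zeta_ok O l zeta.
Hypotheses (s1 : size4 (v0 ++ dV (QJ O none4) l)) (s2 : size4 (w0 ++ mono l)).
Local Notation VT := (vt v0 w0 (QJ O none4) l).

Lemma size5_addy e a : size4 a -> size5 (addy e a).
Proof. by rewrite /size4 /size5 all_map; apply: sub_all => kc /= /eqP; rewrite size_rcons => ->. Qed.

Lemma size5_vt : size5 VT.
Proof.
rewrite /size5 /vt all_cat [all _ (lopp _)]all_map all_cat.
have h := size5_addy _ s1; have h' := size5_addy _ s2; rewrite /size5 in h h'.
rewrite h h' andbT /=; apply: size5_addy.
by move: s2; rewrite /size4 /lbar all_map; apply: sub_all => kc /=; rewrite size_map.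
Qed.

Lemma lcoef_vt : lcoef (Vtilde zeta) = fun x => coef VT (kv5 x).
Proof. by rewrite (Vtilde_vt Hv Hw Hz s1 s2); apply: lcoef_evl; exact: size5_vt. Qed.

Lemma Wsize_vt : Wsize zeta = total (w0 ++ mono l).
Proof.
have y0 : yvar != 0 by have := T5_neq0; rewrite /T5 /tup => /and5P[_ _ _ _ /andP[]].
rewrite /Wsize (Wchar_gen Hw Hz tvar_neq0 y0 tvar_neq1) -/T5.
(* The coefficients are indexed by exponents of y as well, here 0. *)
have -> : evl T5 (w0 ++ mono l) = evl T5 (addy Z0 (w0 ++ mono l)).
  by rewrite /T5 /tup evl_addy // expr0z mul1r.
rewrite lcoef_evl ?size5_addy // lrank_coef ?size5_addy //.
by rewrite /total /suml big_map.
Qed.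

End SizeRank.

(* Exponents modulo t_1 t_2 t_3 t_4, with y last. *)
Definition redk (k : key) : key :=
  match k with
  | [:: a; b; c; d; e] => [:: Z.sub a d; Z.sub b d; Z.sub c d; e]
  | _ => k
  end.
Definition redl (a : lau) : lau := map (fun kc => (redk kc.1, kc.2)) a.

Definition H4 : seq halffun := [:: thalf i1; thalf i2; thalf i3; yhalf].

Definition bra (F : fieldType) (x : seq F) (k : key) : F := evk x k - (evk x k)^-1.

Lemma gens4 : gens 4 = H4.
Proof.
rewrite /gens !enum_ordSl (_ : enum 'I_0 = [::]) /=; last by apply: size0nil; rewrite size_enum_ord.
rewrite /H4 /thalf /yhalf.
by congr [:: tofrac 'X_ _; tofrac 'X_ _; tofrac 'X_ _; tofrac 'X_ _]; apply: val_inj.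
Qed.

Lemma H4_neq0 : all (predC1 0) H4.
Proof. by rewrite -gens4 gens_neq0. Qed.

Lemma thalf4 : thalf i4 = (thalf i1 * thalf i2 * thalf i3)^-1.
Proof. by rewrite /thalf /= !rmorphM. Qed.

(** * The square root of the radicand *)

Fixpoint lexpos (k : key) : bool :=
  if k is z :: k' then
    match z with Z0 => lexpos k' | Zpos _ => true | Zneg _ => false end
  else false.
(* One of [k], [-k] is positive for each k <> 0; the exponent of y counts first. *)
Definition kpos (k : key) : bool := lexpos (rotr 1 k).
Definition kzero (n : nat) : key := nseq n Z0.

Lemma knegK : involutive kneg.
Proof. by move=> k; rewrite /kneg -map_comp map_id_in // => z _ /=; lia. Qed.

Lemma lexpos_neg k : k != kzero (size k) -> lexpos (kneg k) = ~~ lexpos k.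
Proof.
elim: k => [|z k IH] //=; rewrite eqseq_cons; by case: z.
Qed.

Lemma kpos_neg k : size k = 4%N -> k != kzero 4 -> kpos (kneg k) = ~~ kpos k.
Proof.
move=> /size4P[a [b [c [d ->]]]] k0; rewrite /kpos.
have -> : rotr 1 (kneg [:: a; b; c; d]) = kneg [:: d; a; b; c] by [].
have -> : rotr 1 [:: a; b; c; d] = [:: d; a; b; c] by [].
apply: lexpos_neg; apply: contra k0 => /eqP[-> -> -> ->]; exact: eqxx.
Qed.

Section Product.
Variables (F : fieldType) (x : seq F).
Hypothesis x0 : all (predC1 0) x.
Hypothesis bra_neq0 : forall k, size k = 4%N -> k != kzero 4 -> bra x k != 0.

Lemma bra_neg k : bra x (kneg k) = - bra x k.
Proof. by rewrite /bra evkN invrK opprB. Qed.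

Lemma bra0 : bra x (kzero 4) = 0.
Proof.
rewrite /bra; have -> : evk x (kzero 4) = 1; last by rewrite invr1 subrr.
by rewrite /kzero; elim: 4%N (x) => [|n IH] [|a y] //=; rewrite IH mulr1 expr0z.
Qed.

Definition rootf (h : lau) : F := \prod_(kc <- h) bra x kc.1 ^ (- zi kc.2).

Lemma prod_coef (l : lau) (s : seq key) (p : pred key) : uniq s -> {subset map fst l <= s} ->
  (forall k, k \in s -> p k -> bra x k != 0) ->
  \prod_(k <- s | p k) bra x k ^ (- coef l k) = \prod_(kc <- l | p kc.1) bra x kc.1 ^ (- zi kc.2).
Proof.
move=> us + nz; elim: l => [|[k c] l IH] sub.
  by rewrite big_nil big1 // => k _; rewrite /coef suml_nil oppr0 expr0z.
have ks : k \in s by apply: sub; rewrite inE eqxx.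
rewrite big_cons /= -IH; last by move=> y yl; apply: sub; rewrite inE yl orbT.
have E k' : k' \in s -> p k' -> bra x k' ^ (- coef ((k, c) :: l) k') =
   (if k' == k then bra x k ^ (- zi c) else 1) * bra x k' ^ (- coef l k').
  move=> k's pk'; rewrite /coef suml_cons opprD expfzDr ?nz // [k' == k]eq_sym.
  by case: (eqVneq k k') => [->|_]; rewrite ?intz // mul0rz oppr0 expr0z.
rewrite big_seq_cond (eq_bigr (fun k' => (if k' == k then bra x k ^ (- zi c) else 1) * bra x k' ^ (- coef l k'))); last first.
  by move=> k' /andP[k's pk']; apply: E.
rewrite -big_seq_cond big_split /=; case: ifP => pk; last first.
  by rewrite big1 ?mul1r // => k' pk'; case: eqP => // e; rewrite e pk in pk'.
congr (_ * _); rewrite -big_filter (bigD1_seq k) ?filter_uniq ?mem_filter ?pk //= eqxx.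
by rewrite big1 ?mulr1 // => k' /negPf ->.
Qed.

Section Symmetric.
Variables (c : key -> int) (s : seq key).
Hypotheses (us : uniq s) (s4 : forall k, k \in s -> size k = 4%N).
Hypotheses (sn : forall k, k \in s -> kneg k \in s) (cn : forall k, k \in s -> c (kneg k) = c k).

Lemma perm_pos (P : key -> F) : 
  \prod_(k <- s | (k != kzero 4) && ~~ kpos k) P k = \prod_(k <- s | kpos k) P (kneg k).
Proof.
rewrite -big_filter -[RHS]big_filter -(big_map kneg predT).
apply: perm_big; apply: uniq_perm; rewrite ?filter_uniq //.
  by rewrite map_inj_uniq ?filter_uniq //; exact: inv_inj knegK.
move=> k; rewrite mem_filter; apply/idP/mapP => [/andP[/andP[k0 kp] ks]|[k']].
  by exists (kneg k); rewrite ?knegK // mem_filter sn // kpos_neg ?s4 ?k0 ?kp.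
rewrite mem_filter => /andP[kp k's] ->; rewrite sn // andbT.
have k'0 : k' != kzero 4 by apply: contraTneq kp => ->.
rewrite kpos_neg ?s4 // kp andbT; apply: contra k'0 => /eqP e.
by rewrite -(knegK k') e.
Qed.

(** The brackets of opposite characters differ by a sign, so with equal multiplicities they
    contribute a square up to sign. *)
Lemma prod_square : c (kzero 4) = 0 ->
  \prod_(k <- s) bra x k ^ (- c k) =
  (-1) ^ (\sum_(k <- s | kpos k) c k) * (\prod_(k <- s | kpos k) bra x k ^ (- c k)) ^+ 2.
Proof.
move=> c0; rewrite (bigID (fun k => k == kzero 4)) /= big1 ?mul1r; last first.
  by move=> k /eqP ->; rewrite c0 oppr0 expr0z.
rewrite (bigID kpos) /= perm_pos.
have -> : \prod_(k <- s | (k != kzero 4) && kpos k) bra x k ^ (- c k) = \prod_(k <- s | kpos k) bra x k ^ (- c k).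
  by apply: eq_bigl => k; case: eqP => // ->.
have -> : \prod_(k <- s | kpos k) bra x (kneg k) ^ (- c (kneg k)) =
   (-1) ^ (\sum_(k <- s | kpos k) c k) * \prod_(k <- s | kpos k) bra x k ^ (- c k).
  have -> : (-1) ^ (\sum_(k <- s | kpos k) c k) = \prod_(k <- s | kpos k) ((-1) ^ c k) :> F.
    elim/big_rec2: _ => [|k a b _ <-]; first by rewrite expr0z.
    by rewrite expfzDr ?oppr_eq0 ?oner_neq0.
  rewrite -big_split /= big_seq_cond [RHS]big_seq_cond; apply: eq_bigr => k /andP[ks kp].
  rewrite bra_neg cn // -(mulN1r (bra x k)) expfzMl; congr (_ * _).
  by rewrite -exprz_inv invrN1.
by rewrite mulrCA expr2.
Qed.

Lemma sum_pos : c (kzero 4) = 0 -> \sum_(k <- s) c k = (\sum_(k <- s | kpos k) c k) * 2.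
Proof.
move=> c0; rewrite (bigID (fun k => k == kzero 4)) /= big1 ?add0r; last by move=> k /eqP ->.
rewrite (bigID kpos) /=.
have -> : \sum_(k <- s | (k != kzero 4) && kpos k) c k = \sum_(k <- s | kpos k) c k.
  by apply: eq_bigl => k; case: eqP => // ->.
have -> : \sum_(k <- s | (k != kzero 4) && ~~ kpos k) c k = \sum_(k <- s | kpos k) c k; last by rewrite mulr2n mulrDr mulr1.
rewrite -big_filter -[RHS]big_filter.
have -> : \sum_(k <- [seq k <- s | kpos k]) c k = \sum_(k <- map kneg [seq k <- s | kpos k]) c k.
  rewrite big_map big_seq [RHS]big_seq; apply: eq_bigr => k; rewrite mem_filter => /andP[_ /cn ->] //.
apply: perm_big; apply: uniq_perm; rewrite ?filter_uniq //.
  by rewrite map_inj_uniq ?filter_uniq //; exact: inv_inj knegK.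
move=> k; rewrite mem_filter; apply/idP/mapP => [/andP[/andP[k0 kp] ks]|[k']].
  by exists (kneg k); rewrite ?knegK // mem_filter sn // kpos_neg ?s4 ?k0 ?kp.
rewrite mem_filter => /andP[kp k's] ->; rewrite sn // andbT.
have k'0 : k' != kzero 4 by apply: contraTneq kp => ->.
rewrite kpos_neg ?s4 // kp andbT; apply: contra k'0 => /eqP e.
by rewrite -(knegK k') e.
Qed.

(** The bracket of the trivial character is 0, and in a field here every nonzero power of 0 is 0,
    negative ones included. *)
Lemma prod_degenerate : c (kzero 4) != 0 -> kzero 4 \in s -> \prod_(k <- s) bra x k ^ (- c k) = 0.
Proof.
move=> c0 zs; rewrite (big_rem (kzero 4)) //= bra0 exp0rz oppr_eq0 (negPf c0) mul0r //.
Qed.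

End Symmetric.
End Product.

Lemma bra_neq0 k : size k = 4%N -> k != kzero 4 -> bra H4 k != 0.
Proof.
move=> sk k0; apply/negP => /eqP b0.
have H : evl (gens 4) [:: (k, Zpos xH); (kneg k, Zneg xH)] = 0.
  by rewrite gens4 !evl_cons evl_nil addr0 evkN /= mulr1z mulrN1z; exact: b0.
have := evl_gens_coef _ H k; rewrite /coef !suml_cons suml_nil eqxx addr0 /=.
have -> : (kneg k == k) = false; last first.
  rewrite mul0rz addr0 => /(_ _) e; have : (1 : int) *~ 1 = 0 by apply: e => k'; rewrite !inE => /orP[] /eqP ->; rewrite /= ?size_map.
  by [].
apply/negP => /eqP e; case/negP: k0; move: sk e => /size4P[a [b [c [d ->]]]] [? ? ? ?].
have Z0E (z : Z) : Z.opp z = z -> z = Z0 by lia.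
by rewrite (Z0E a) // (Z0E b) // (Z0E c) // (Z0E d).
Qed.

Lemma mul4A (F : fieldType) (a b c d : F) : a * (b * (c * 1)) * d = a * (b * (c * (d * 1))).
Proof. by rewrite !mulr1 !mulrA. Qed.

Definition kr (w : 'rV[int]_4 * int) : key := redk (kv5 w).

Lemma kr4 (w : 'rV[int]_4 * int) : w.1 0 i4 = 0 -> kr w = [:: Z_of_int (w.1 0 i1); Z_of_int (w.1 0 i2); Z_of_int (w.1 0 i3); Z_of_int w.2].
Proof. by move=> w0; rewrite /kr /kv5 /= w0 !Z.sub_0_r. Qed.

Lemma br_bra (w : 'rV[int]_4 * int) : w.1 0 i4 = 0 -> br thalf yhalf w = bra H4 (kr w).
Proof.
move=> w0; rewrite kr4 // /br /bra; suff -> : tmon thalf w.1 * yhalf ^ w.2 =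
  evk H4 [:: Z_of_int (w.1 0 i1); Z_of_int (w.1 0 i2); Z_of_int (w.1 0 i3); Z_of_int w.2] by [].
rewrite /tmon big_ord4 w0 expr0z /= !Z_of_intK.
exact: mul4A.
Qed.

Lemma cmE (z : int) i : ((const_mx 1 : 'rV[int]_4) *~ z) 0 i = z.
Proof.
case: z => n; rewrite ?NegzE ?mulrNz ?mxE -pmulrn mulmxnE mxE; lia.
Qed.

Lemma coef_opp a k : coef (lopp a) k = - coef a k.
Proof. exact: suml_opp. Qed.

(** A class modulo t_1 t_2 t_3 t_4 is a line of exponents; [redk] takes its point with t_4-exponent
    0 and drops that coordinate. *)
Lemma coef_redl (a : lau) (w : 'rV[int]_4 * int) : size5 a -> w.1 0 i4 = 0 ->
  \sum_(k \in [set: int]) coef a (kv5 (w.1 + const_mx 1 *~ k, w.2)) = coef (redl a) (kr w).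
Proof.
move=> sa w0; have E (z : int) k : size k = 5%N -> (k == kv5 (w.1 + const_mx 1 *~ z, w.2)) =
    (zi (nth Z0 k 3) == z) && (redk k == kr w).
  case: k => [|a1 [|a2 [|a3 [|a4 [|a5 [|]]]]]] // _; rewrite kr4 // /kv5 /=.
  have mE (i : 'I_4) : (w.1 + const_mx 1 *~ z) 0 i = w.1 0 i + z.
    by rewrite mxE cmE.
  rewrite !mE w0 add0r.
  apply/eqP/andP => [[-> -> -> -> ->]|[/eqP e /eqP[e1 e2 e3 e4]]].
    by rewrite Z_of_intK; split=> //; apply/eqP; congr [:: _; _; _; _]; lia.
  congr [:: _; _; _; _; _]; lia.
rewrite (@fsum_seq _ _ _ (undup (map (fun kc => zi (nth Z0 kc.1 3)) a))) ?undup_uniq //; last first.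
  move=> z; rewrite mem_undup => za; rewrite /coef /suml big_seq big1 // => kc kca.
  rewrite E; last by apply/eqP/(allP sa).
  case: eqP => [e|]; last by rewrite mul0rz.
  by case/negP: za; apply/mapP; exists kc.
have sub : {subset map (fun kc => zi (nth Z0 kc.1 3)) a <= undup (map (fun kc => zi (nth Z0 kc.1 3)) a)}.
  by move=> z; rewrite mem_undup.
have us := undup_uniq (map (fun kc => zi (nth Z0 kc.1 3)) a).
move: (undup _) us sub => s us; elim: (a) sa => [_ _|[k c] a' IH /= /andP[/eqP sk /IH{}IH] sub].
  by rewrite big1 => [|z _]; rewrite /coef /redl suml_nil.
rewrite [RHS]/coef /redl /= suml_cons -/(redl _) -/(coef _ _) -IH; last by move=> z zs; apply: sub; rewrite inE zs orbT.
rewrite (eq_bigr (fun z => ((zi (nth Z0 k 3) == z) && (redk k == kr w))%:R *~ zi c + coef a' (kv5 (w.1 + const_mx 1 *~ z, w.2)))).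
  rewrite big_split /=; congr (_ + _).
  rewrite (bigD1_seq (zi (nth Z0 k 3))) ?eqxx //=; last by apply: sub; rewrite inE eqxx.
  by rewrite big1 ?addr0 // => z; rewrite eq_sym => /negPf ->; rewrite mul0rz.
by move=> z _; rewrite /coef suml_cons E.
Qed.

Definition kr_inv (k : key) : 'rV[int]_4 * int :=
  (vk [:: nth Z0 k 0; nth Z0 k 1; nth Z0 k 2; Z0], zi (nth Z0 k 3)).

Lemma kr_invK k : size k = 4%N -> kr (kr_inv k) = k /\ (kr_inv k).1 0 i4 = 0.
Proof.
move=> /size4P[a [b [c [d ->]]]]; split; last by rewrite /kr_inv vkE.
by rewrite kr4 /kr_inv ?vkE //= !int_of_ZK.
Qed.

Lemma krK (w : 'rV[int]_4 * int) : w.1 0 i4 = 0 -> kr_inv (kr w) = w.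
Proof.
move: w => [w e] /= w0; rewrite kr4 // /kr_inv /= Z_of_intK; congr pair.
by apply/rowP => i; rewrite vkE; elim/ord4P: i; rewrite /= ?Z_of_intK // w0.
Qed.

Lemma bracket_coef (a : lau) (s : seq key) : size5 a -> uniq s -> (forall k, k \in s -> size k = 4%N) ->
  {subset map fst (redl a) <= s} ->
  bracket (fun x => - coef a (kv5 x)) = \prod_(k <- s) bra H4 k ^ (- coef (redl a) k).
Proof.
move=> sa us s4 sub; rewrite /bracket.
have e (x : 'rV[int]_4 * int) : x.1 0 i4 = 0 ->
   \sum_(k \in [set: int]) - coef a (kv5 (x.1 + const_mx 1 *~ k, x.2)) = - coef (redl a) (kr x).
  move=> x0; have sa' : size5 (lopp a) by rewrite /size5 all_map.
  have -> : - coef (redl a) (kr x) = coef (redl (lopp a)) (kr x) by rewrite -coef_opp /redl /lopp -!map_comp.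
  by rewrite -(coef_redl sa' x0); apply: eq_fsbigr => k _; rewrite coef_opp.
have H (x : 'rV[int]_4 * int) : x.1 0 i4 = 0 -> br thalf yhalf x ^ (\sum_(k \in [set: int]) - coef a (kv5 (x.1 + const_mx 1 *~ k, x.2))) =
   bra H4 (kr x) ^ (- coef (redl a) (kr x)).
  by move=> x0; rewrite (e _ x0) (br_bra x0).
rewrite (@fsbigE _ _ _ _ _ (map kr_inv s)).
- rewrite big_map big_seq_cond [RHS]big_seq; apply: eq_big => k.
    case ks: (k \in s) => //=; apply/asboolP; exact: (kr_invK (s4 _ ks)).2.
  by move=> /andP[ks _]; have [kk k0] := kr_invK (s4 _ ks); rewrite (H _ k0) kk.
- by rewrite map_inj_in_uniq // => k k' /s4/kr_invK[kk _] /s4/kr_invK[kk' _] ekk; rewrite -kk ekk kk'.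
- by move=> x /mapP[k /s4/kr_invK[_ k0] ->].
move=> x x0 xs; rewrite (H _ x0) coef0 ?oppr0 ?expr0z //.
apply: contra xs => /sub xs; apply/mapP; exists (kr x) => //; exact/esym/krK.
Qed.

(** * Invariance under conjugation where t_1 t_2 t_3 t_4 = 1 *)

Section CY.
Variables (F : fieldType) (t : 'I_4 -> F) (y : F).
Hypotheses (t0 : forall i, t i != 0) (t1 : forall i, 1 - t i != 0) (y0 : y != 0).
Hypothesis cy : t i4 = (t i1 * t i2 * t i3)^-1.

Lemma evk_redk k : size k = 5%N -> evk (tup t y) k = evk [:: t i1; t i2; t i3; y] (redk k).
Proof.
case: k => [|a [|b [|c [|d [|e [|]]]]]] // _ /=.
have -> : t i4 ^ zi d = t i1 ^ (- zi d) * t i2 ^ (- zi d) * t i3 ^ (- zi d) by rewrite cy exprz_inv !expfzMl.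
have E z z' : zi (Z.sub z z') = zi z - zi z' by lia.
by rewrite !E !expfzDr //; ring.
Qed.

Lemma evl_redl a : size5 a -> evl (tup t y) a = evl [:: t i1; t i2; t i3; y] (redl a).
Proof.
elim: a => [|[k c] a IH] /=; first by rewrite !evl_nil.
by move=> /andP[/eqP sk /IH{}IH]; rewrite !evl_cons IH evk_redk.
Qed.

Variables (O : seq (seq (bool * Z))) (l : seq key) (v0 w0 : lau).
Hypothesis Hv : lnorm (lmul P4 v0 ++ lopp (numV O)) = [::].
Hypothesis Hw : lnorm (lmul P4 w0 ++ lopp (numW O)) = [::].
Hypotheses (s1 : size4 (v0 ++ dV (QJ O none4) l)) (s2 : size4 (w0 ++ mono l)).

Let i0 i : (t i)^-1 != 0 := invr_neq0 (t0 i).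
Let i1' i : 1 - (t i)^-1 != 0 := inv_neq1 (t0 i) (t1 i).

Lemma qb_inv J : qb (fun i => (t i)^-1) y^-1 O l J = qf t y O l J.
Proof.
rewrite -qf_inv; congr (qf _ _ _ _ _); rewrite ?invrK //.
by apply/funext => i; rewrite invrK.
Qed.

(** The numerator is built from the symmetric expressions q + q' - q q', and its denominator changes
    only by the factor t_1 t_2 t_3 t_4 = 1. *)
Lemma V_sym : evl (map GRing.inv (tup t y)) (v0 ++ dV (QJ O none4) l) = evl (tup t y) (v0 ++ dV (QJ O none4) l).
Proof.
rewrite -tup_inv -(V_abstract i0 i1' (invr_neq0 y0) l Hv) -(V_abstract t0 t1 y0 l Hv).
have E J : qf (fun i => (t i)^-1) y^-1 O l J + qb (fun i => (t i)^-1) y^-1 O l J -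
   qf (fun i => (t i)^-1) y^-1 O l J * qb (fun i => (t i)^-1) y^-1 O l J =
   qf t y O l J + qb t y O l J - qf t y O l J * qb t y O l J.
  by rewrite qf_inv qb_inv [X in X - _]addrC [X in _ - X]mulrC.
rewrite E (eq_bigr _ (fun J _ => E J)) [X in _ + X](eq_bigr _ (fun J _ => E J)) (P_inv y t0).
have -> : evk (tup t y) t1234 = 1; last by rewrite invr1 mulr1.
rewrite /= cy !expr1z; have := mulf_neq0 (mulf_neq0 (t0 i1) (t0 i2)) (t0 i3) => tn0.
by rewrite mulr1 !mulrA divff.
Qed.

Lemma vt_sym : evl (map GRing.inv (tup t y)) (vt v0 w0 (QJ O none4) l) = evl (tup t y) (vt v0 w0 (QJ O none4) l).
Proof.
have s3 : size4 (lbar (w0 ++ mono l)).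
  by move: s2; rewrite /size4 /lbar all_map; apply: sub_all => kc /=; rewrite size_map.
rewrite /vt !(evl_cat _ (addy _ _)) !evl_opp !(evl_cat _ (addy _ _)) /= !evl_addy //.
rewrite !evl_bar /= !invrK -![[:: (t _)^-1; _; _; _; _]]/(map GRing.inv (tup t y)) V_sym.
by rewrite !expr0z !expr1z !exprN1 invrK [X in _ - X]addrC.
Qed.

End CY.

(** * The square root of the radicand of an enlargement of Z_mu *)

Lemma coefD a b k : coef (a ++ b) k = coef a k + coef b k.
Proof. exact: suml_cat. Qed.

Lemma redk_neg k : redk (kneg k) = kneg (redk k).
Proof.
case: k => [|a [|b [|c [|d [|e [|]]]]]] //=; congr [:: _; _; _; _]; lia.
Qed.

Lemma inv3 (F : fieldType) (a b c : F) : a != 0 -> b != 0 -> c != 0 -> (a * b * c)^-1 != 0.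
Proof. by move=> a0 b0 c0; rewrite invr_neq0 // !mulf_neq0. Qed.

Lemma degen (F : fieldType) (z : int) : (0 : F) ^+ 2 = (-1) ^ z * 0.
Proof. by rewrite mulr0 expr0n. Qed.

Lemma sgn_sq (F : fieldType) (z : int) (a : F) : a ^+ 2 = (-1) ^ z * ((-1) ^ z * a ^+ 2).
Proof. by rewrite mulrA -expfzMl mulrNN mulr1 exp1rz mul1r. Qed.

Lemma thalf_neq0 i : thalf i != 0.
Proof.
have := H4_neq0; rewrite /H4 => /and5P[a1 a2 a3 _ _].
elim/ord4P: i; [exact: a1|exact: a2|exact: a3|rewrite thalf4; exact: (inv3 a1 a2 a3)].
Qed.

Lemma evk_neq1 k : size k = 4%N -> k != kzero 4 -> 1 - evk H4 k != 0.
Proof.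
move=> sk k0; apply/negP => /eqP b0.
have H : evl (gens 4) [:: (kzero 4, Zpos xH); (k, Zneg xH)] = 0.
  rewrite gens4 !evl_cons evl_nil addr0 mulr1z mulrN1z -[RHS]b0; congr (_ - _).
  by rewrite /= !expr0z !mulr1.
have := evl_gens_coef _ H (kzero 4); rewrite /coef !suml_cons suml_nil eqxx addr0 (negPf k0) mul0rz addr0 => /(_ _) e.
by have : (1 : int) *~ 1 = 0 by apply: e => k'; rewrite !inE => /orP[] /eqP ->.
Qed.

Lemma thalf_neq1 i : 1 - thalf i != 0.
Proof.
have ek (k : key) z : size k = 4%N -> k != kzero 4 -> z = evk H4 k -> 1 - z != 0.
  by move=> sk k0 ->; apply: evk_neq1.
elim/ord4P: i.
- by apply: (ek [:: Zpos xH; Z0; Z0; Z0]) => //; rewrite /= expr1z !expr0z !mulr1.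
- by apply: (ek [:: Z0; Zpos xH; Z0; Z0]) => //; rewrite /= expr1z !expr0z !mulr1 mul1r.
- by apply: (ek [:: Z0; Z0; Zpos xH; Z0]) => //; rewrite /= expr1z !expr0z !mulr1 !mul1r.
- by apply: (ek [:: Zneg xH; Zneg xH; Zneg xH; Z0]) => //; rewrite thalf4 /= exprN1 expr0z !mulr1 -!invfM mulrA.
Qed.

Section Root.
Variables (O : seq (seq (bool * Z))) (v0 w0 : lau).
Hypothesis Hv : lnorm (lmul P4 v0 ++ lopp (numV O)) = [::].
Hypothesis Hw : lnorm (lmul P4 w0 ++ lopp (numW O)) = [::].

(* Vtilde modulo t1 t2 t3 t4 = 1. *)
Definition rvt l : lau := redl (vt v0 w0 (QJ O none4) l).
Definition rkeys l : seq key := let s := map fst (rvt l) in undup (s ++ map kneg s).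
(** If the trivial character has nonzero multiplicity, the radicand is 0, and so is the root. *)
Definition vroot l : halffun :=
  if coef (rvt l) (kzero 4) == 0 then
    \prod_(k <- rkeys l | kpos k) bra H4 k ^ (- coef (rvt l) k)
  else 0.

Variable l : seq key.
Hypotheses (s1 : size4 (v0 ++ dV (QJ O none4) l)) (s2 : size4 (w0 ++ mono l)).

Lemma rvt_size k : k \in map fst (rvt l) -> size k = 4%N.
Proof.
move=> /mapP[kc /mapP[kc' + ->] ->] /=; move: (size5_vt s1 s2) => /allP H /H /eqP.
by move: (kc'.1) => [|? [|? [|? [|? [|? [|]]]]]].
Qed.

Lemma rkeys_size k : k \in rkeys l -> size k = 4%N.
Proof.
by rewrite mem_undup mem_cat => /orP[/rvt_size|/mapP[k' /rvt_size s4 ->]]; rewrite ?size_map.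
Qed.

Lemma rkeys_neg k : k \in rkeys l -> kneg k \in rkeys l.
Proof.
rewrite !mem_undup !mem_cat => /orP[kl|/mapP[k' k'l ->]]; last by rewrite knegK k'l.
by apply/orP; right; apply/mapP; exists k.
Qed.

(** The entries of [H4] are independent variables, so equal values there mean equal coefficients. *)
Lemma rvt_sym k : coef (rvt l) (kneg k) = coef (rvt l) k.
Proof.
have y0 : yhalf != 0 by have := H4_neq0; rewrite /H4 => /and5P[_ _ _ ? _].
have s5 := size5_vt s1 s2.
have s5' : size5 (lbar (vt v0 w0 (QJ O none4) l)).
  by move: s5; rewrite /size5 /lbar all_map; apply: sub_all => kc /=; rewrite size_map.
have e := vt_sym thalf_neq0 thalf_neq1 y0 thalf4 Hv s1 s2.
rewrite -evl_bar (evl_redl thalf_neq0 y0 thalf4 s5') (evl_redl thalf_neq0 y0 thalf4 s5) in e.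
have -> : coef (rvt l) (kneg k) = coef (lbar (rvt l)) k.
  rewrite /lbar /coef (suml_comp _ kneg) /=; apply: eq_suml => k' /=.
  by rewrite -(inj_eq (inv_inj knegK)) knegK.
have eb : redl (lbar (vt v0 w0 (QJ O none4) l)) = lbar (rvt l).
  by rewrite /lbar /rvt /redl -!map_comp; apply: eq_map => kc /=; rewrite redk_neg.
rewrite eb -/H4 -gens4 in e; apply: (evl_gens_inj _ e) => k'.
rewrite mem_cat => /orP[|/rvt_size //].
by rewrite -map_comp => /mapP[kc kcl ->] /=; rewrite size_map; apply: rvt_size; exact: map_f.
Qed.

(** The sign from [prod_square] is -1 to half the rank, by [sum_pos], and the sign in the radicand
    cancels it. *)
Lemma radicand_vroot zeta : zeta_ok O l zeta -> vroot l ^+ 2 = radicand zeta.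
Proof.
move=> Hz; have s5 := size5_vt s1 s2.
have sub : {subset map fst (rvt l) <= rkeys l} by move=> k kl; rewrite mem_undup mem_cat kl.
have us := undup_uniq (map fst (rvt l) ++ map kneg (map fst (rvt l))).
rewrite /radicand (lcoef_vt Hv Hw Hz s1 s2) lrank_coef // (bracket_coef s5 us rkeys_size sub) -/(rvt l).
have -> : total (vt v0 w0 (QJ O none4) l) = \sum_(k <- rkeys l) coef (rvt l) k.
  have -> : total (vt v0 w0 (QJ O none4) l) = total (rvt l) by rewrite /total /rvt /suml big_map.
  rewrite /total (suml_coef _ us sub); apply: eq_bigr => k _; exact: intz.
have cn k : k \in rkeys l -> coef (rvt l) (kneg k) = coef (rvt l) k by move=> _; exact: rvt_sym.
rewrite /vroot; case: eqP => [c0|/eqP c0]; last first.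
  have zs : kzero 4 \in rkeys l by apply: sub; apply: contraNT c0 => /coef0 ->.
  rewrite (prod_degenerate H4 c0 zs); exact: degen.
rewrite (sum_pos us rkeys_size rkeys_neg cn c0) mulzK //.
rewrite (prod_square H4 us rkeys_size rkeys_neg cn c0).
exact: sgn_sq.
Qed.

Lemma vroot_list h : (forall k, coef h k = if kpos k then coef (rvt l) k else 0) ->
  coef (rvt l) (kzero 4) = 0 -> (forall k, k \in map fst h -> kpos k && (size k == 4%N)) -> vroot l = rootf H4 h.
Proof.
move=> Hh c0 hp; rewrite /vroot c0 eqxx /rootf.
have us := undup_uniq (rkeys l ++ map fst h).
have nz k : k \in undup (rkeys l ++ map fst h) -> kpos k -> bra H4 k != 0.
  move=> + kp; have k0 : k != kzero 4 by apply: contraTneq kp => ->.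
  by rewrite mem_undup mem_cat => /orP[/rkeys_size s4|/hp/andP[_ /eqP s4]]; apply: bra_neq0.
have us' : uniq (rkeys l) by exact: undup_uniq.
rewrite (@prod_coef _ _ (rvt l) (rkeys l) kpos) //; first last.
- by move=> k kl kp; apply: nz => //; rewrite mem_undup mem_cat kl.
- by move=> k kl; rewrite mem_undup mem_cat kl.
rewrite -(@prod_coef _ _ _ _ _ us _ nz); last by move=> k kl; rewrite mem_undup mem_cat; apply/orP; left; rewrite mem_undup mem_cat kl.
rewrite [RHS]big_seq (eq_bigl (fun kc => (kc \in h) && kpos kc.1)); last first.
  by move=> kc /=; case kch: (kc \in h) => //=; case/andP: (hp kc.1 (map_f _ kch)) => ->.
rewrite -big_seq_cond -(@prod_coef _ _ _ _ _ us _ nz); last by move=> k kl; rewrite mem_undup mem_cat kl orbT.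
by apply: eq_bigr => k kp; rewrite Hh kp.
Qed.
End Root.

(** * Enumeration of the finite closed sets *)

Section Enum.
Variables (good : pred key) (nb : key -> seq key) (rank : key -> Z).
Hypothesis rank_nb : forall u v, good u -> v \in nb u -> Z.lt (rank v) (rank u).

Definition kclosed (l : seq key) : bool :=
  all (fun u => good u && all (fun v => kmem v l) (nb u)) l.

(** An element may be added once all its neighbours are present. The same set is reached in several
    orders and must be kept only once. *)
Definition klevel_step (U : seq key) (s : seq (seq key)) : seq (seq key) :=
  foldr (fun l r => if has (fun l' => all (fun u => kmem u l') l) r then r else l :: r) [::]
    (flatten (map (fun l => map (fun u => u :: l)
       (filter (fun u => if kmem u l then false else all (fun v => kmem v l) (nb u)) U)) s)).

Fixpoint klevel (U : seq key) (n : nat) : seq (seq key) :=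
  if n is n'.+1 then klevel_step U (klevel U n') else [:: [::]].

Variable U : seq key.
Hypothesis U_good : {subset U <= good}.

Let dedup := foldr (fun (l : seq key) r => if has (fun l' => all (fun u => kmem u l') l) r then r else l :: r) [::].

Lemma dedup_sub s : {subset dedup s <= s}.
Proof.
elim: s => //= l s IH x; case: ifP => _; rewrite ?inE => H; first by rewrite IH ?orbT.
by case/orP: H => [->//|/IH ->]; rewrite orbT.
Qed.

Lemma dedup_all s l : l \in s -> exists2 l', l' \in dedup s & {subset l <= l'}.
Proof.
elim: s => //= l0 s IH; rewrite inE => /orP[/eqP ->|/IH[l' l's sub]]; last first.
  by exists l' => //; case: ifP => _ //; rewrite inE l's orbT.
case: ifP => [/hasP[l' l's /allP sub]|_]; last by exists l0; rewrite ?mem_head.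
by exists l' => // x /sub; rewrite kmemE.
Qed.

Lemma dedup_pair s : pairwise (fun l l' => ~~ all (fun u => kmem u l') l) (dedup s).
Proof.
elim: s => //= l s IH; case: ifP => //= h; rewrite IH andbT.
by rewrite -[all _ _]negbK -has_predC (eq_has (a2 := fun l' => all (fun u => kmem u l') l)) ?h // => x /=; rewrite negbK.
Qed.

Lemma klevel_sound n l : l \in klevel U n -> [/\ uniq l, size l = n & kclosed l].
Proof.
elim: n l => [|n IH] l; first by rewrite inE => /eqP ->.
move=> /dedup_sub/flattenP[s /mapP[l' l'n ->] /mapP[u]].
rewrite mem_filter => /andP[]; case: ifP => //; rewrite kmemE => ul' nbu uU ->.
have [ul sl cl] := IH _ l'n; split=> /=; rewrite ?ul' ?sl //.
have gu : good u := U_good uU.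
rewrite /kclosed /= gu /=; apply/andP; split.
  by apply/allP => v vu; have /= -> := allP nbu v vu; case: ifP.
apply/allP => x xl; have /andP[-> /allP H] := allP cl x xl; apply/allP => v vx.
by have /= -> := H v vx; case: ifP.
Qed.

Lemma max_rank (l : seq key) : l != [::] -> exists2 u, u \in l & forall v, v \in l -> Z.le (rank v) (rank u).
Proof.
elim: l => //= a l IH _; have [->|/IH[u ul H]] := eqVneq l [::].
  by exists a; rewrite ?mem_head // => v; rewrite inE => /eqP ->; lia.
have [le|gt] := Z_le_gt_dec (rank a) (rank u).
  by exists u; rewrite ?inE ?ul ?orbT // => v; rewrite inE => /orP[/eqP ->//|/H].
exists a; rewrite ?mem_head // => v; rewrite inE => /orP[/eqP ->|/H h]; first exact: Z.le_refl.
by apply: Z.le_trans h _; lia.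
Qed.

(** Neighbours have smaller rank, so an element of maximal rank is a neighbour of none; without it
    the set is still closed, and induction applies. *)
Lemma klevel_complete n l : uniq l -> size l = n -> kclosed l -> {subset l <= U} ->
  exists2 l', l' \in klevel U n & l' =i l.
Proof.
elim: n l => [|n IH] l ul sl cl lU; first by exists [::] => //; case: l sl {ul cl lU}.
have l0 : l != [::] by case: l sl {ul cl lU}.
have [u ul' umax] := max_rank l0.
have memr v : (v \in rem u l) = (v != u) && (v \in l) by rewrite mem_rem_uniq // inE.
have [||||l' l'n e] := IH (rem u l); rewrite ?rem_uniq ?size_rem ?sl //.
- apply/allP => x; rewrite memr => /andP[xu xl]; have /andP[gx /allP H] := allP cl x xl; rewrite gx /=.
  apply/allP => v vx; rewrite kmemE memr; have := H v vx; rewrite kmemE => ->; rewrite andbT.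
  apply/eqP => vu; have h1 := rank_nb gx vx; have h2 := umax x xl; rewrite vu in h1.
  exact: Z.lt_irrefl (Z.lt_le_trans _ _ _ h1 h2).
- by move=> x; rewrite memr => /andP[_]; apply: lU.
have ul'' : u \notin l' by rewrite e memr eqxx.
have [|l2 l2n sub] := @dedup_all (flatten (map (fun l => map (fun u => u :: l)
       (filter (fun u => if kmem u l then false else all (fun v => kmem v l) (nb u)) U)) (klevel U n))) (u :: l').
  apply/flattenP; exists (map (fun u => u :: l') (filter (fun u => if kmem u l' then false else all (fun v => kmem v l') (nb u)) U)).
    by apply/mapP; exists l'.
  apply: map_f; rewrite mem_filter lU // andbT kmemE (negPf ul'').
  have /andP[gu /allP H] := allP cl u ul'; apply/allP => v vu; rewrite kmemE e memr.
  have := H v vu; rewrite kmemE => ->; rewrite andbT; apply/eqP => vu'.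
  by have := rank_nb gu vu; rewrite vu'; apply: Z.lt_irrefl.
exists l2 => //; have [u2 s2 _] := @klevel_sound n.+1 l2 l2n.
have [u1 s1 _] := klevel_sound l'n.
have uu : uniq (u :: l') by rewrite /= ul''.
have ss : (size l2 <= size (u :: l'))%N by rewrite /= s2 s1.
have [_ e2] := uniq_min_size uu sub ss.
by move=> x; rewrite -e2 inE e memr; case: eqP => // ->.
Qed.

Lemma klevel_pair n : pairwise (fun l l' => ~~ all (fun u => kmem u l') l) (klevel U n).
Proof. by case: n => // n; apply: dedup_pair. Qed.

Lemma uniq_klevel (T : eqType) (f : seq key -> T) n :
  (forall l l', l \in klevel U n -> l' \in klevel U n -> f l = f l' -> l =i l') -> uniq (map f (klevel U n)).
Proof.
elim: (klevel U n) (klevel_pair n) => //= l s IH /andP[/allP pl ps] H; rewrite IH //; last first.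
  by move=> a b as' bs; apply: H; rewrite inE ?as' ?bs orbT.
rewrite andbT; apply/negP => /mapP[l' l's e]; have := pl l' l's; case/negP.
apply/allP => u ul; rewrite kmemE -(H l l' _ _ e) ?mem_head // inE l's orbT //.
Qed.

End Enum.

(** * Ranges of the coordinates of closed sets *)

Definition krank (k : key) : Z := foldr Z.add Z0 k.

Section Ranges.
Variables (K : nat) (O : seq (seq (bool * Z))).
Hypothesis wfO : wf_cells K O.

Definition goodDT (k : key) : bool := [&& size k == 4%N, all (Z.leb Z0) k & ~~ inp O k].
Definition nbDT (k : key) : seq key :=
  filter (fun v => ~~ inp O v) (map (fun a => stepk k a (-1)) (filter (fun a => Z.ltb Z0 (nth Z0 k a)) (iota 0%N 4%N))).

Definition goodPT (k : key) : bool := (size k == 4%N) && kWt K O k.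
Definition nbPT (k : key) : seq key := map (fun a => stepk k a 1) (filter (knz K O k) (iota 0%N 4%N)).

Definition UDT (n : nat) : seq key := filter goodDT (kbox (krange 0 (K + n))).
Definition UPT (n : nat) : seq key := filter goodPT (kbox (krange (- Z.of_nat n) (K + n))).

Lemma krank_step k a z : (a < size k)%N -> krank (stepk k a z) = Z.add (krank k) z.
Proof. by elim: k a => [|x k IH] [|a] //=; [lia|move=> /IH; rewrite /krank /= => ->; lia]. Qed.

Lemma rankDT u v : size u = 4%N -> v \in nbDT u -> Z.lt (krank v) (krank u).
Proof.
move=> su; rewrite mem_filter => /andP[_ /mapP[a]]; rewrite mem_filter mem_iota => /andP[_ /andP[_ a4]] ->.
rewrite krank_step ?su //; lia.
Qed.

Lemma rankPT u v : size u = 4%N -> v \in nbPT u -> Z.lt (Z.opp (krank v)) (Z.opp (krank u)).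
Proof.
move=> su /mapP[a]; rewrite mem_filter mem_iota => /andP[_ /andP[_ a4]] ->.
rewrite krank_step ?su //; lia.
Qed.

Lemma stepk_setk k a z z' : (a < size k)%N -> stepk (setk k a z) a z' = setk k a (Z.add z z').
Proof. by elim: k a => [|x k IH] [|a] //= lt; rewrite IH. Qed.
Lemma setk_nth k a : (a < size k)%N -> setk k a (nth Z0 k a) = k.
Proof. by elim: k a => [|x k IH] [|a] //= lt; rewrite IH. Qed.

Lemma chain_size (l : seq key) u a (f : nat -> Z) n : (a < size u)%N -> injective f ->
  (forall j, (j < n)%N -> setk u a (f j) \in l) -> (n <= size l)%N.
Proof.
move=> au fi H; rewrite -(size_iota 0 n) -(size_map (fun j => setk u a (f j))).
apply: uniq_leq_size.
  rewrite map_inj_uniq ?iota_uniq // => i j e; apply: fi.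
  by have := congr1 (fun k => nth Z0 k a) e; rewrite !nth_setk // eqxx.
by move=> x /mapP[j]; rewrite mem_iota => /andP[_ jn] ->; apply: H.
Qed.

(** From [K] on, lowering a coordinate does not lead into the support, so a box with coordinate z
    forces those with coordinates z - 1, ..., K. *)
Lemma rangeDT l : kclosed goodDT nbDT l -> {subset l <= UDT (size l)}.
Proof.
move=> cl u ul; have /andP[gu _] := allP cl u ul; have /and3P[/eqP su /allP u0 _] := gu.
rewrite mem_filter gu; apply/kboxP; split=> // z zu; apply/krangeP; split; first by have := u0 z zu; lia.
move: zu => /(nthP Z0)[a]; rewrite su => a4 ea.
suff : (Z.to_nat (Z.sub (Z.add z 1) (Z.of_nat K)) <= size l)%N by lia.
apply: (@chain_size l u a (fun j => Z.sub z (Z.of_nat j))); rewrite ?su //; first by move=> i j; lia.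
elim=> [|j IH] jz; first by rewrite Z.sub_0_r -ea setk_nth ?su.
have vl := IH (ltnW jz); set v := setk u a _ in vl.
have sv : size v = 4%N by rewrite size_setk.
have /andP[/and3P[_ _ nv] /allP H] := allP cl v vl.
have -> : setk u a (Z.sub z (Z.of_nat j.+1)) = stepk v a (-1).
  by rewrite stepk_setk ?su //; congr setk; lia.
rewrite -kmemE; apply: H; rewrite mem_filter; apply/andP; split; last first.
  apply/mapP; exists a => //; rewrite mem_filter mem_iota a4 nth_setk ?su // eqxx; lia.
apply: contra nv => pv; have -> : v = setk (stepk v a (-1)) a (Z.sub z (Z.of_nat j)).
  by rewrite stepk_setk ?su // setk_setk.
apply: (inp_set_le wfO); rewrite ?size_stepk ?stepk_setk ?nth_setk ?su ?eqxx //.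
- by rewrite stepk_setk ?su // in pv.
- lia.
- lia.

Qed.

Hypothesis dims : dims_ok K O.

(* Weights with a coordinate at least [K] do not occur. *)
Definition top_ok : bool :=
  all (fun k => if has (Z.eqb (Z.of_nat K)) k then ~~ kWt K O k else true) (kbox (krange (-1) K.+2)).
Hypothesis top : top_ok.

Lemma kWt_clamp k : size k = 4%N -> kWt K O (kclamp (Z.of_nat K) k) = kWt K O k.
Proof. by move=> sk; rewrite /kWt /roots (labels_clamp wfO dims sk) (inp_clamp wfO sk). Qed.

Lemma kWt_top k a : size k = 4%N -> (a < 4)%N -> Z.le (Z.of_nat K) (nth Z0 k a) -> kWt K O k = false.
Proof.
move=> sk a4 Ka; rewrite -kWt_clamp //; have := allP top (kclamp (Z.of_nat K) k).
have -> : kclamp (Z.of_nat K) k \in kbox (krange (-1) K.+2).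
  apply/kboxP; rewrite size_kclamp sk; split=> // z /mapP[y _ ->]; apply/krangeP; exact: Zclamp_bounds1.
move=> /(_ isT); case: ifPn => [_ /negPf //|/hasPn/(_ (Z.of_nat K))].
have -> : Z.of_nat K \in kclamp (Z.of_nat K) k.
  apply/(nthP Z0); exists a; rewrite ?size_kclamp ?sk // nth_kclamp ?sk //; lia.
move=> /(_ isT); lia.
Qed.

Lemma clamp_low k a : size k = 4%N -> (a < 4)%N -> Z.lt (nth Z0 k a) (-1) ->
  kclamp (Z.of_nat K) (stepk k a 1) = kclamp (Z.of_nat K) k.
Proof.
move=> sk a4 ka; apply: (@eq_from_nth _ Z0); rewrite !size_kclamp size_stepk // sk => j j4.
rewrite !nth_kclamp ?size_stepk ?sk // nth_stepk ?sk //; case: eqP => [->|//]; lia.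
Qed.

(** Below -1 the step does not change the clamped weight, so x_a maps the line isomorphically to the
    next one. *)
Lemma knz_low k a : size k = 4%N -> (a < 4)%N -> Z.lt (nth Z0 k a) (-1) -> kWt K O k -> knz K O k a.
Proof.
move=> sk a4 ka Wk; have ss : size (stepk k a 1) = 4%N by rewrite size_stepk.
rewrite /knz Wk -(kWt_clamp ss) clamp_low // kWt_clamp // Wk /=.
case: ifP => [pk|_].
  by have := inp_ge0 wfO ss a4 pk; rewrite nth_stepk ?sk // eqxx; lia.
have el : labels K O (stepk k a 1) = labels K O k.
  by rewrite -(labels_clamp wfO dims ss) clamp_low // (labels_clamp wfO dims sk).
have e0 : kr0 K O (stepk k a 1) = kr0 K O k by rewrite /kr0 /roots el.
rewrite e0 /kind; have : kr0 K O k \in roots K O k.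
  by rewrite mem_nth //; move: Wk; rewrite /kWt => /eqP ->.
by rewrite mem_filter => /andP[].
Qed.

(** A weight with coordinate z < 0 forces those with coordinates z + 1, ..., -1; the upper bound
    comes from [top_ok]. *)
Lemma rangePT l : kclosed goodPT nbPT l -> {subset l <= UPT (size l)}.
Proof.
move=> cl u ul; have /andP[gu _] := allP cl u ul; have /andP[/eqP su Wu] := gu.
rewrite mem_filter gu; apply/kboxP; split=> // z zu; apply/krangeP.
move: zu => /(nthP Z0)[a]; rewrite su => a4 ea; split; last first.
  have [zK|] := Z_lt_ge_dec z (Z.of_nat K); first by lia.
  by move=> zK; rewrite (@kWt_top u a) // ?ea // in Wu; lia.
suff : (Z.to_nat (Z.opp z) <= size l)%N by lia.
apply: (@chain_size l u a (fun j => Z.add z (Z.of_nat j))); rewrite ?su //; first by move=> i j; lia.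
elim=> [|j IH] jz; first by rewrite Z.add_0_r -ea setk_nth ?su.
have vl := IH (ltnW jz); set v := setk u a _ in vl.
have sv : size v = 4%N by rewrite size_setk.
have /andP[/andP[_ Wv] /allP H] := allP cl v vl.
have -> : setk u a (Z.add z (Z.of_nat j.+1)) = stepk v a 1.
  by rewrite stepk_setk ?su //; congr setk; lia.
rewrite -kmemE; apply: H; apply/mapP; exists a => //; rewrite mem_filter mem_iota /= a4 andbT.
apply: knz_low => //; rewrite nth_setk ?su // eqxx; lia.
Qed.

End Ranges.

(** * Vertices as finite sums *)

Section VertexEnum.
Variables (T : choiceType) (A : set T) (zeta : T -> {set 'I_4} -> rchar) (w0 : int) (N : nat).
Variables (d : T -> halffun) (L : nat -> seq (T * halffun)).
Hypothesis Hd : forall x, A x -> d x ^+ 2 = radicand (zeta x).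
Hypothesis Lu : forall n, (n < N)%N -> uniq (map fst (L n)).
Hypothesis Ls : forall n x r, (n < N)%N -> (x, r) \in L n ->
  [/\ A x, Wsize (zeta x) = w0 + n%:Z & r ^+ 2 = radicand (zeta x)].
Hypothesis Lc : forall n x, (n < N)%N -> A x -> Wsize (zeta x) = w0 + n%:Z -> x \in map fst (L n).

(** The enumerated roots below q^N, and for all other summands some root [d], since [sqrt_choice]
    asks for one everywhere. *)
Definition pick_root (x : T) : halffun :=
  let n := absz (Wsize (zeta x) - w0) in
  if (Wsize (zeta x) == w0 + n%:Z) && (n < N)%N && (x \in map fst (L n)) then
    nth 0 (map snd (L n)) (index x (map fst (L n))) else d x.

Lemma pick_root_L n x r : (n < N)%N -> (x, r) \in L n -> pick_root x = r.
Proof.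
move=> nN xr; have [Ax Wx rr] := Ls nN xr; rewrite /pick_root Wx.
have -> : `|(w0 + n%:Z - w0)%R|%N = n by rewrite addrC addKr.
rewrite eqxx nN (map_f fst xr) /=.
have := Lu nN; elim: (L n) xr => [//|[x' r'] s IH] /=; rewrite inE => /orP[/eqP[-> ->]|xr /andP[x's us]].
  by rewrite eqxx.
case: eqP => [e|_]; last exact: IH.
by rewrite e in x's; case/negP: x's; apply: (map_f fst xr).
Qed.

Lemma pick_root_choice : sqrt_choice A zeta pick_root.
Proof.
move=> x Ax; rewrite /pick_root; case: ifP => [/andP[/andP[_ nN] xL]|_]; last exact: Hd.
have /mapP[[y r] yr e] := xL; rewrite /= in e; subst y.
have [_ Wx rr] := Ls nN yr; have := pick_root_L nN yr; rewrite /pick_root xL nN.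
by rewrite {1}Wx eqxx /= => ->.
Qed.

Lemma vertex_pick n : (n < N)%N -> vertex A zeta pick_root (w0 + n%:Z) = \sum_(p <- L n) p.2.
Proof.
move=> nN; rewrite /vertex (@fsbigE _ _ _ _ _ (map fst (L n)) _ (Lu nN)).
- rewrite big_map big_seq_cond [RHS]big_seq; apply: eq_big => [[x r]|[x r] /andP[xr _]] /=.
    case xr: (_ \in _) => //=; apply/asboolP; have [Ax Wx _] := Ls nN xr; split=> //.
  exact: pick_root_L nN xr.
- by move=> x /mapP[[y r] yr ->] /=; have [Ay Wy _] := Ls nN yr.
by move=> x [Ax Wx]; rewrite (Lc nN Ax Wx).
Qed.

Lemma vertex_below s m : (forall x, A x -> w0 <= Wsize (zeta x)) -> m < w0 -> vertex A zeta s m = 0.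
Proof.
move=> H mw; rewrite /vertex (_ : [set x | _] = set0) ?fsbig_set0 //.
by apply/seteqP; split=> // x [/H h e]; rewrite e leNgt mw in h.
Qed.

End VertexEnum.

Lemma lead_expE (v : int -> halffun) n : v n != 0 -> (forall m, m < n -> v m = 0) -> lead_exp v = n.
Proof.
move=> vn H; apply: xget_unique => // m [vm Hm]; apply/eqP; case: ltgtP => // h.
  by rewrite H ?eqxx // in vm.
by rewrite Hm ?eqxx // in vn.
Qed.

Lemma total_cat a b : total (a ++ b) = total a + total b.
Proof. exact: suml_cat. Qed.
Lemma total_mono l : total (mono l) = (size l)%:Z.
Proof.
elim: l => [|k l IH]; first by rewrite /total suml_nil.
rewrite /total /= suml_cons -/(total _) IH /= mulr1z; lia.
Qed.

Lemma size4_cat a b : size4 (a ++ b) = size4 a && size4 b.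
Proof. exact: all_cat. Qed.
Lemma size4_opp a : size4 (lopp a) = size4 a.
Proof. by rewrite /size4 all_map. Qed.
Lemma size4_bar a : size4 (lbar a) = size4 a.
Proof. by rewrite /size4 all_map; apply: eq_all => kc /=; rewrite size_map. Qed.
Lemma size4_mono l : size4 (mono l) = all (fun u => size u == 4%N) l.
Proof. by rewrite /size4 all_map; apply: eq_all. Qed.
Lemma size_kadd k k' : size k = 4%N -> size k' = 4%N -> size (kadd k k') = 4%N.
Proof. by move=> /size4P[? [? [? [? ->]]]] /size4P[? [? [? [? ->]]]]. Qed.
Lemma size4_shift k a : size k = 4%N -> size4 a -> size4 (kshift k a).
Proof. by move=> sk; rewrite /size4 all_map; apply: sub_all => kc /= /eqP s; rewrite size_kadd. Qed.
Lemma size4_mul a b : size4 a -> size4 b -> size4 (lmul a b).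
Proof.
move=> + sb; elim: a => //= -[k c] a IH /andP[/= /eqP sk /IH{}IH].
rewrite size4_cat IH andbT /size4 all_map; apply: sub_all sb => kc /= /eqP s; rewrite size_kadd //.
Qed.
Lemma size4_dV q l : size4 q -> all (fun u => size u == 4%N) l -> size4 (dV q l).
Proof.
move=> sq sl; rewrite -size4_mono in sl; have sb : size4 (lbar (mono l)) by rewrite size4_bar.
have s1 : size (kneg t1234) = 4%N by [].
have h1 := size4_shift s1 sb; have h2 := size4_shift s1 (size4_mul sq sb).
have sqb : size4 (lbar q) by rewrite size4_bar.
have h3 := size4_mul sqb sl; have h4 := size4_shift s1 (size4_mul (isT : size4 P4) (size4_mul sl sb)).
by rewrite /dV 4!size4_cat !size4_opp sl h1 h2 h3 h4.
Qed.

Lemma sign_sq (F : fieldType) (b : bool) (a : F) : ((-1) ^+ b * a) ^+ 2 = a ^+ 2.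
Proof. by rewrite exprMn sqrr_sign mul1r. Qed.

Section Family.
Variables (O : seq (seq (bool * Z))) (v0 w0 : lau).
Hypothesis Hv : lnorm (lmul P4 v0 ++ lopp (numV O)) = [::].
Hypothesis Hw : lnorm (lmul P4 w0 ++ lopp (numW O)) = [::].
Hypotheses (sv : size4 v0) (sw : size4 w0) (sq : size4 (QJ O none4)).
Variables (T : choiceType) (A : set T) (zeta : T -> {set 'I_4} -> rchar).
Variables (good : pred key) (nb : key -> seq key) (rank : key -> Z) (f : seq key -> T) (U : nat -> seq key).
Hypothesis rank_nb : forall u v, good u -> v \in nb u -> Z.lt (rank v) (rank u).
Hypothesis good4 : forall u, good u -> size u = 4%N.
Hypothesis U_good : forall n, {subset U n <= good}.
Hypothesis U_range : forall l, kclosed good nb l -> {subset l <= U (size l)}.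
Hypothesis f_onto : forall x, A x -> exists l, [/\ uniq l, kclosed good nb l & x = f l].
Hypothesis f_in : forall l, uniq l -> kclosed good nb l -> A (f l).
Hypothesis f_zeta : forall l, uniq l -> kclosed good nb l -> zeta_ok O l (zeta (f l)).
Hypothesis f_inj : forall l l', kclosed good nb l -> kclosed good nb l' -> f l = f l' -> l =i l'.
Hypothesis f_ext : forall l l', l =i l' -> f l = f l'.
Variables (N : nat) (sg : nat -> seq bool).
Hypothesis sg_size : forall n, (n < N)%N -> size (sg n) = size (klevel nb (U n) n).

Let closed4 l : kclosed good nb l -> all (fun u => size u == 4%N) l.
Proof. by apply: sub_all => u /andP[/good4 ->]. Qed.

Let root_zeta l : uniq l -> kclosed good nb l ->
  vroot O v0 w0 l ^+ 2 = radicand (zeta (f l)) /\ Wsize (zeta (f l)) = total w0 + (size l)%:Z.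
Proof.
move=> ul cl; have s4 := closed4 cl.
have s1 : size4 (v0 ++ dV (QJ O none4) l) by rewrite size4_cat sv size4_dV.
have s2 : size4 (w0 ++ mono l) by rewrite size4_cat sw size4_mono.
have Hz := f_zeta ul cl; have e1 := radicand_vroot Hv Hw s1 s2 Hz; split; first by rewrite e1.
by rewrite (Wsize_vt Hw Hz s2) total_cat total_mono.
Qed.

Definition summand (lb : seq key * bool) : halffun := (-1) ^+ lb.2 * vroot O v0 w0 lb.1.
Definition enum_level n := zip (klevel nb (U n) n) (sg n).

(** Serves solid partitions and submodules alike: [f] makes the summands correspond to the closed
    sets of keys, and the size of the set is the exponent of q relative to [Z_mu]. *)
Lemma family_vertex : exists s, [/\ sqrt_choice A zeta s,
  forall n, (n < N)%N -> vertex A zeta s (total w0 + n%:Z) = \sum_(p <- enum_level n) summand p &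
  forall m, m < total w0 -> vertex A zeta s m = 0].
Proof.
have /choice[rep Hrep] : forall x, exists l, A x -> [/\ uniq l, kclosed good nb l & x = f l].
  move=> x; have [/f_onto[l Hl]|nA] := pselect (A x); first by exists l.
  by exists [::].
pose L n := [seq (f p.1, summand p) | p <- enum_level n].
have fstL n : (n < N)%N -> map fst (L n) = map f (klevel nb (U n) n).
  move=> nN; rewrite /L -map_comp (eq_map (g := f \o fst)) // map_comp; congr map.
  by apply: unzip1_zip; rewrite sg_size.
have snd' n l : l \in klevel nb (U n) n -> [/\ uniq l, size l = n & kclosed good nb l].
  by apply: klevel_sound; apply: U_good.
exists (pick_root zeta (total w0) N (fun x => vroot O v0 w0 (rep x)) L).
have Hd x : A x -> vroot O v0 w0 (rep x) ^+ 2 = radicand (zeta x).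
  by move=> /Hrep[ul cl e]; rewrite [in RHS]e; have [] := root_zeta ul cl.
have Lu n : (n < N)%N -> uniq (map fst (L n)).
  move=> nN; rewrite fstL //; apply: (@uniq_klevel nb) => l l' /snd'[_ _ cl] /snd'[_ _ cl'].
  exact: f_inj.
have Ls n x r : (n < N)%N -> (x, r) \in L n -> [/\ A x, Wsize (zeta x) = total w0 + n%:Z & r ^+ 2 = radicand (zeta x)].
  move=> nN /mapP[[l b] lb [-> ->]]; have ll : l \in klevel nb (U n) n.
    by rewrite -(unzip1_zip (s := klevel nb (U n) n) (t := sg n)) ?sg_size // (map_f fst lb).
  have [ul sl cl] := snd' _ _ ll; have [e1 e2] := root_zeta ul cl; split=> /=.
  - exact: f_in.
  - by rewrite e2 sl.
  by rewrite /summand /= -e1; exact: sign_sq.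
have Lc n x : (n < N)%N -> A x -> Wsize (zeta x) = total w0 + n%:Z -> x \in map fst (L n).
  move=> nN /Hrep[ul cl e] Wx; rewrite fstL //.
  have sz : size (rep x) = n by have [_] := root_zeta ul cl; rewrite -e Wx => /addrI[].
  have sub := U_range cl; rewrite sz in sub.
  have [l' l'n el] := klevel_complete rank_nb (U_good (n := n)) ul sz cl sub.
  by rewrite e -(f_ext el) map_f.
split.
- exact: (pick_root_choice Hd Lu Ls).
- move=> n nN; rewrite (vertex_pick _ Lu Ls Lc nN) big_map //.
move=> m mw; apply: (vertex_below _ (w0 := total w0)) => // x /Hrep[ul cl e].
by rewrite e; have [_ ->] := root_zeta ul cl; rewrite lerDl.
Qed.

End Family.

(** * The DT and PT vertices of a union of orthants *)

Section Case.
Variables (K : nat) (O : seq (seq (bool * Z))) (v0 w0 : lau).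
Hypotheses (wfO : wf_cells K O) (dims : dims_ok K O) (top : top_ok K O).
Hypothesis Hv : lnorm (lmul P4 v0 ++ lopp (numV O)) = [::].
Hypothesis Hw : lnorm (lmul P4 w0 ++ lopp (numW O)) = [::].
Hypotheses (sv : size4 v0) (sw : size4 w0).
Variables (R : realType) (mu : 'I_4 -> set box).
Hypothesis HZ : is_Zmu R mu (pset O).

Lemma size4_cellnum c : size c = 4%N -> size4 (cellnum c).
Proof. by move=> sc; apply/allP => kc kcl; rewrite (size_cellnum (map_f _ kcl)) sc. Qed.

Lemma size4_Q : size4 (QJ O none4).
Proof.
apply/allP => kc /flattenP[a /mapP[c]]; rewrite mem_filter => /andP[_ cO] -> kca.
have /eqP sc := allP (wf_size wfO) c cO.
by apply: (allP (size4_cellnum _)) kca; rewrite size_map size_zip sc.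
Qed.

Definition dtset (l : seq key) : set box := [set v | inp O (kv (vb v)) || (kv (vb v) \in l)].

Lemma kcl_nonneg l u : kclosed (goodDT O) (nbDT O) l -> u \in l -> exists v : box, u = kv (vb v).
Proof.
move=> cl ul; have /andP[/and3P[/eqP su /allP u0 _] _] := allP cl u ul.
exists (bx (vk u)); rewrite bxK ?vkK //; apply/nnP => i; rewrite vkE.
have := u0 (nth Z0 u i); rewrite mem_nth ?su // => /(_ isT); lia.
Qed.

Lemma dt_mult l w : kclosed (goodDT O) (nbDT O) l ->
  part_mult (dtset l) w = (inp O (kv w))%:Z + (kv w \in l)%:Z.
Proof.
move=> cl; rewrite part_mult_pin -(pin_inp wfO).
have nin : kv w \in l -> pin (pset O) w = false.
  by move=> wl; rewrite (pin_inp wfO); have /andP[/and3P[_ _ /negPf]] := allP cl _ wl.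
have -> : pin (dtset l) w = pin (pset O) w || (kv w \in l).
  apply/idP/idP => [/pinP[w0' /=]|/orP[/pinP[w0' pw]|wl]].
  - by rewrite /dtset /= bxK // (pin_inp wfO).
  - by apply/pinP; split=> //; rewrite /dtset /=; apply/orP; left.
  have [v e] := kcl_nonneg cl wl; have {}e := kv_inj e; subst w.
  by apply/pin_vb; rewrite /dtset /= wl orbT.
by case: (kv w \in l) nin => [/(_ isT) ->|_]; rewrite ?orbF ?addr0.
Qed.

Lemma kv_sub (w : box) (i : 'I_4) : (0 < w i)%N -> kv (vb (w - U_(i))%MM) = stepk (kv (vb w)) i (-1).
Proof.
move=> wi; have -> : vb w = vb (w - U_(i))%MM + dv i.
  by rewrite -vbD submK //; apply/mnm_lepP => j; rewrite mnm1E; case: eqP => [<-|].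
rewrite kv_dv; set k := kv _; have sk : size k = 4%N by [].
have s2 : size (stepk (stepk k i 1) i (-1)) = 4%N by rewrite !size_stepk.
apply: (@eq_from_nth _ Z0); rewrite ?s2 sk // => j j4.
by rewrite !nth_stepk ?size_stepk ?sk //; case: eqP => // _; rewrite -Z.add_assoc Z.add_0_r.
Qed.

Lemma dt_partition l : kclosed (goodDT O) (nbDT O) l -> is_partition (dtset l).
Proof.
move=> cl; have step (w : box) (i : 'I_4) : (0 < w i)%N -> dtset l w -> dtset l (w - U_(i))%MM.
  move=> wi; rewrite /dtset /= kv_sub // => /orP[pw|wl].
    apply/orP; left; apply: (inp_pred wfO) => //; have := kvE (vb w) i; rewrite vbE; lia.
  have /andP[_ /allP H] := allP cl _ wl; case p: (inp O _) => //=.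
  rewrite -kmemE; apply: H; rewrite mem_filter p; apply/mapP; exists (val i) => //.
  by rewrite mem_filter mem_iota /= ltn_ord andbT; have := kvE (vb w) i; rewrite vbE; lia.
move=> w v pw vw; rewrite -(submK vw) addmC in pw; move: pw.
have [n] := ubnP (mdeg (w - v)%MM); elim: n (w - v)%MM => // n IH u un.
have [->|u0] := eqVneq u 0%MM; first by rewrite addm0.
have [i ui] : exists i, (0 < u i)%N.
  apply: contrapT => no; case/eqP: u0; apply/mnmP => i; rewrite mnm0E.
  by apply/eqP; rewrite -leqn0 leqNgt; apply/negP => ui; apply: no; exists i.
have Uu : (U_(i) <= u)%MM by apply/mnm_lepP => j; rewrite mnm1E; case: eqP => [<-|].
move=> /(step _ i); rewrite mnmDE (leq_trans ui (leq_addl _ _)) => /(_ isT).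
have -> : (v + u - U_(i))%MM = (v + (u - U_(i)))%MM.
  by apply/mnmP => j; rewrite !(mnmBE, mnmDE) addnBA //; move/mnm_lepP: Uu.
apply: IH; move: un; rewrite -{1}(submK Uu) mdegD mdeg1 addn1 ltnS //.
Qed.

Lemma dt_in l : kclosed (goodDT O) (nbDT O) l -> DTset R mu (dtset l).
Proof.
move=> cl; apply/(DTsetP _ HZ); split; first exact: dt_partition.
  by move=> v pv; rewrite /dtset /=; apply/orP; left.
apply: (@sub_finite_set _ _ [set` map (bx \o vk) l]); last exact: finite_seq.
move=> v [/orP[//|vl] _] /=; apply/mapP; exists (kv (vb v)) => //=.
by rewrite kvK vbK.
Qed.

Lemma dt_onto q : DTset R mu q ->
  exists l, [/\ uniq l, kclosed (goodDT O) (nbDT O) l & q = dtset l].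
Proof.
move=> /(DTsetP _ HZ)[qp pq /finite_seqP[s es]].
pose l := undup (map (fun v => kv (vb v)) s).
have lP v : (kv (vb v) \in l) <-> q v /\ ~ pset O v.
  have ij : injective (fun v : box => kv (vb v)) by move=> x y /kv_inj/vb_inj.
  rewrite mem_undup (mem_map ij).
  by split=> [vs|qv]; [have : [set` s] v by []; rewrite -es|have : (q `\` pset O) v by []; rewrite es].
exists l; split; first exact: undup_uniq.
  apply/allP => u; rewrite mem_undup => /mapP[v vs ->].
  have [qv npv] : q v /\ ~ pset O v by have : [set` s] v by []; rewrite -es.
  apply/andP; split.
    apply/and3P; split=> //; last exact/negP.
    rewrite /kv /= !vbE; lia.
  apply/allP => x; rewrite mem_filter => /andP[nx /mapP[a]].
  rewrite mem_filter mem_iota => /andP[av /andP[_ a4]] e; pose i := Ordinal a4.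
  have vi : (0 < v i)%N by have := kvE (vb v) i; rewrite vbE /=; lia.
  rewrite kmemE; have ex : x = kv (vb (v - U_(i))%MM) by rewrite kv_sub.
  rewrite ex; apply/lP; split; last by move: nx; rewrite ex => /negP.
  apply: qp qv _; apply/mnm_lepP => j; rewrite mnmBE; exact: leq_subr.
apply/seteqP; split=> v; rewrite /dtset /=.
  move=> qv; have [pv|npv] := pselect (pset O v); first by apply/orP; left.
  by apply/orP; right; apply/lP.
by move=> /orP[pv|/lP[]//]; apply: pq.
Qed.

Lemma dt_inj l l' : kclosed (goodDT O) (nbDT O) l -> kclosed (goodDT O) (nbDT O) l' ->
  dtset l = dtset l' -> l =i l'.
Proof.
have sub m m' : kclosed (goodDT O) (nbDT O) m -> dtset m = dtset m' -> {subset m <= m'}.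
  move=> cm e u um; have [v ev] := kcl_nonneg cm um.
  have : dtset m' v by rewrite -e /dtset /= -ev um orbT.
  have /andP[/and3P[_ _ /negPf nu] _] := allP cm _ um.
  by rewrite /dtset /= -ev nu.
by move=> c c' e u; apply/idP/idP; apply: sub.
Qed.

Local Notation wt := 'rV[int]_4.
Let pp := pset_partition wfO.
Let K0 := wfK0 wfO.
Let pK := pset_far wfO.
Let P1 := @wP1 K O wfO R dims.
Let P2 := @wP2 K O wfO R dims.

Definition ptset (l : seq key) := Bset (R := R) (pset O) K (wWt K O) (wr0 K O) (wr1 K O) (map vk l).

Lemma pt_wclosed l : kclosed (goodPT K O) (nbPT K O) l ->
  wclosed R (pset O) (wWt K O) (wr0 K O) (wr1 K O) (wind K O) (map vk l).
Proof.
move=> cl w /mapP[u ul ->]; have /andP[/andP[/eqP su Wu] /allP H] := allP cl u ul.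
rewrite /wWt vkK //; split=> // i; rewrite (wnz wfO R dims) vkK // => nzi.
apply/mapP; exists (stepk u i 1); last by rewrite -[LHS]kvK kv_dv vkK.
rewrite -kmemE; apply: H; apply/mapP; exists (val i) => //.
by rewrite mem_filter nzi mem_iota ltn_ord.
Qed.

Lemma pt_in l : uniq l -> kclosed (goodPT K O) (nbPT K O) l -> PTset mu (ptset l).
Proof.
move=> ul cl; have wc := pt_wclosed cl; rewrite /PTset /Imu /= (Zmu_eq HZ); split.
- exact: (Bset_submodule pp K0 pK P1 P2 wc).
- exact: (Bset_torus pp K0 pK).
apply: (Bset_fg pp K0 pK P1 P2 wc).
rewrite map_inj_in_uniq // => k k' kl k'l e.
have /andP[/andP[/eqP sk _] _] := allP cl _ kl; have /andP[/andP[/eqP sk' _] _] := allP cl _ k'l.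
by rewrite -(vkK sk) e vkK.
Qed.

Lemma pt_onto B : PTset (R := R) mu B ->
  exists l, [/\ uniq l, kclosed (goodPT K O) (nbPT K O) l & B = ptset l].
Proof.
rewrite /PTset /Imu /= (Zmu_eq HZ) => -[B1 B2 B3].
have [m [um cm ->]] := PT_shape pp K0 pK P1 P2 B1 B2 B3.
exists (map kv m); split.
- by rewrite map_inj_uniq //; exact: kv_inj.
- apply/allP => u /mapP[w wm ->]; have [Ww nzw] := cm w wm; rewrite /goodPT size_kv -/(wWt K O w) Ww /=.
  apply/allP => x /mapP[a]; rewrite mem_filter mem_iota => /andP[nza /andP[_ a4]] ->.
  pose i := Ordinal a4; rewrite kmemE -[a]/(val i) -kv_dv; apply: map_f; apply: nzw.
  by rewrite (wnz wfO R dims).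
by rewrite /ptset -map_comp (eq_map kvK) map_id.
Qed.

Lemma pt_dim l w : kclosed (goodPT K O) (nbPT K O) l ->
  (weight_dim (Imu mu) (ptset l) w)%:Z = (kv w \in l)%:Z :> int.
Proof.
move=> cl; rewrite /Imu (Zmu_eq HZ) (weight_dim_Bset pp K0 pK P1 P2 (pt_wclosed cl)).
congr (nat_of_bool _)%:Z; apply/mapP/idP => [[u ul ->]|wl]; last by exists (kv w); rewrite ?kvK.
by have /andP[/andP[/eqP su _] _] := allP cl _ ul; rewrite vkK.
Qed.

Lemma pt_inj l l' : kclosed (goodPT K O) (nbPT K O) l -> kclosed (goodPT K O) (nbPT K O) l' ->
  ptset l = ptset l' -> l =i l'.
Proof.
have sub m m' : kclosed (goodPT K O) (nbPT K O) m -> kclosed (goodPT K O) (nbPT K O) m' ->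
    map vk m =i map vk m' -> {subset m <= m'}.
  move=> cm cm' e u um; have /andP[/andP[/eqP su _] _] := allP cm _ um.
  have /mapP[u' um' e'] : vk u \in map vk m' by rewrite -e map_f.
  have /andP[/andP[/eqP su' _] _] := allP cm' _ um'.
  by rewrite -(vkK su) e' vkK.
move=> c c' /(Bset_inj pp K0 pK P2 (pt_wclosed c) (pt_wclosed c')) e u.
by apply/idP/idP; apply: sub => // w; rewrite e.
Qed.

Lemma pt_ext l l' : l =i l' -> ptset l = ptset l'.
Proof.
have E m m' w : m =i m' -> (w \in map vk m) -> (w \in map vk m').
  by move=> e /mapP[u um ->]; apply: map_f; rewrite -e.
move=> e; apply/seteqP; split=> phi [h H]; split=> // w Ww nz; have := H w Ww nz; apply: E => //.
Qed.

Lemma dt_ext l l' : l =i l' -> dtset l = dtset l'.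
Proof. by move=> e; apply/funext => v; rewrite /dtset /= e. Qed.

Variables (N : nat) (sgD sgP : nat -> seq bool).
Local Notation levD n := (klevel (nbDT O) (UDT K O n) n).
Local Notation levP n := (klevel (nbPT K O) (UPT K O n) n).
Hypothesis szD : forall n, (n < N)%N -> size (sgD n) = size (levD n).
Hypothesis szP : forall n, (n < N)%N -> size (sgP n) = size (levP n).

Definition sumDT n : halffun := \sum_(p <- zip (levD n) (sgD n)) summand O v0 w0 p.
Definition sumPT n : halffun := \sum_(p <- zip (levP n) (sgP n)) summand O v0 w0 p.

(** Both series start at the exponent of [Z_mu] with the same root, by which normalizing divides
    both sides. *)
Lemma case_correspondence (V0 : int -> halffun) :
  sumDT 0 = vroot O v0 w0 [::] -> sumPT 0 = vroot O v0 w0 [::] -> vroot O v0 w0 [::] != 0 ->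
  (forall n, (n < N)%N -> sumDT n = \sum_(k < n.+1) sumPT k * V0 (n - k)%N%:Z) ->
  DT_PT0_mod R V0 mu N.
Proof.
move=> D0 P0 r0 id.
have gD4 u : goodDT O u -> size u = 4%N by case/and3P => /eqP.
have gP4 u : goodPT K O u -> size u = 4%N by case/andP => /eqP.
have rD u v : goodDT O u -> v \in nbDT O u -> Z.lt (krank v) (krank u) by move=> gu; apply: (rankDT wfO (gD4 u gu)).
have rP u v : goodPT K O u -> v \in nbPT K O u -> Z.lt (Z.opp (krank v)) (Z.opp (krank u)) by move=> gu; apply: (rankPT wfO (gP4 u gu)).
have gUD n : {subset UDT K O n <= goodDT O} by move=> u; rewrite mem_filter => /andP[].
have gUP n : {subset UPT K O n <= goodPT K O} by move=> u; rewrite mem_filter => /andP[].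
have s4 (good : pred key) nb l : (forall u, good u -> size u = 4%N) -> kclosed good nb l -> all (fun u => size u == 4%N) l.
  by move=> g4; apply: sub_all => u /andP[/g4 ->].
have zD l : uniq l -> kclosed (goodDT O) (nbDT O) l -> zeta_ok O l (zetaDT R mu (dtset l)).
  by move=> ul cl; apply: (zetaDT_ok wfO HZ ul (s4 _ _ _ gD4 cl)) => w; apply: dt_mult.
have zP l : uniq l -> kclosed (goodPT K O) (nbPT K O) l -> zeta_ok O l (zetaPT (R := R) mu (ptset l)).
  by move=> ul cl; apply: (zetaPT_ok wfO HZ ul (s4 _ _ _ gP4 cl)) => w; apply: pt_dim.
have [sD [sD1 sD2 sD3]] := family_vertex Hv Hw sv sw size4_Q rD gD4 gUD (rangeDT wfO) dt_onto
  (fun l _ => @dt_in l) zD dt_inj dt_ext szD.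
have [sP [sP1 sP2 sP3]] := family_vertex Hv Hw sv sw size4_Q rP gP4 gUP (rangePT wfO dims top) pt_onto
  pt_in zP pt_inj pt_ext szP.
exists sD, sP; split=> // n nN; have N0 : (0 < N)%N by apply: leq_trans nN.
have e0 : total w0 = total w0 + 0%N%:Z by rewrite addr0.
have vD0 : VDT R mu sD (total w0) = vroot O v0 w0 [::] by rewrite [in LHS]e0 -D0; apply: sD2.
have vP0 : VPT mu sP (total w0) = vroot O v0 w0 [::] by rewrite [in LHS]e0 -P0; apply: sP2.
have nD : VDT R mu sD (total w0) != 0 by rewrite vD0.
have lD : lead_exp (VDT R mu sD) = total w0 := lead_expE nD sD3.
have nP : VPT mu sP (total w0) != 0 := eq_ind_r (fun z => z != 0) r0 vP0.
have lP : lead_exp (VPT mu sP) = total w0 := lead_expE nP sP3.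
rewrite /normalized lD vD0 (_ : VDT R mu sD _ = sumDT n); last exact: sD2.
rewrite (id n nN) /smul mulr_suml; apply: eq_bigr => k _.
rewrite lP vP0 (_ : VPT mu sP _ = sumPT k); last by apply: sP2; apply: leq_ltn_trans nN; rewrite -ltnS.
exact: mulrAC.
Qed.

End Case.

Delimit Scope Z_scope with zz.

(** * Sums of products of brackets *)

Lemma sign_odd (F : fieldType) (e : Z) : (-1) ^ zi e = if Z.odd e then -1 else 1 :> F.
Proof.
have E (p : int) : (-1) ^ (2 * p) = 1 :> F by rewrite -exprz_exp -exprnP sqrrN expr1n exp1rz.
have -> : zi e = 2 * zi (Z.div2 e) + zi (Z.b2z (Z.odd e)) by have := Z.div2_odd e; lia.
rewrite expfzDr ?oppr_eq0 ?oner_neq0 // E mul1r; by case: Z.odd.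
Qed.

Section Terms.
Variables (F : fieldType) (x : seq F).

Definition pval (f : lau) : F := \prod_(kc <- f) bra x kc.1 ^ zi kc.2.
Definition tval (t : Z * lau) : F := (zi t.1)%:~R * pval t.2.
Definition tsum (ts : seq (Z * lau)) : F := \sum_(t <- ts) tval t.

Lemma pval_nil : pval [::] = 1. Proof. exact: big_nil. Qed.
Lemma pval_cons k c f : pval ((k, c) :: f) = bra x k ^ zi c * pval f. Proof. exact: big_cons. Qed.
Lemma pval_cat f g : pval (f ++ g) = pval f * pval g. Proof. exact: big_cat. Qed.
Lemma pval_opp f : pval (lopp f) = (pval f)^-1.
Proof.
elim: f => [|[k c] f IH] /=; first by rewrite pval_nil invr1.
by rewrite !pval_cons invfM IH ziN invr_expz.
Qed.
Lemma pval_neq0 f : (forall k, k \in map fst f -> bra x k != 0) -> pval f != 0.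
Proof.
elim: f => [|[k c] f IH] nz; first by rewrite pval_nil oner_neq0.
rewrite pval_cons mulf_neq0 ?expfz_neq0 ?nz ?mem_head ?IH // => k' kf.
by rewrite nz // inE kf orbT.
Qed.
Lemma rootf_pval h : rootf x h = pval (lopp h).
Proof. by rewrite /rootf /pval big_map; apply: eq_bigr => kc _; rewrite ziN. Qed.

Lemma tsum_nil : tsum [::] = 0. Proof. exact: big_nil. Qed.
Lemma tsum_cons t ts : tsum (t :: ts) = tval t + tsum ts. Proof. exact: big_cons. Qed.
Lemma tsum_cat s t : tsum (s ++ t) = tsum s + tsum t. Proof. exact: big_cat. Qed.

Definition tmul (s t : seq (Z * lau)) : seq (Z * lau) :=
  flatten (map (fun a => map (fun b => (Z.mul a.1 b.1, a.2 ++ b.2)) t) s).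
Definition tscale (c : Z) (s : seq (Z * lau)) : seq (Z * lau) := map (fun a => (Z.mul c a.1, a.2)) s.

Lemma tsum_scale c s : tsum (tscale c s) = (zi c)%:~R * tsum s.
Proof.
rewrite /tsum big_map big_distrr; apply: eq_bigr => t _.
by rewrite /tval /= ziM intrM mulrA.
Qed.
Lemma tsum_mul s t : tsum (tmul s t) = tsum s * tsum t.
Proof.
elim: s => [|a s IH]; first by rewrite /tmul tsum_nil mul0r.
rewrite /tmul /= tsum_cat -/(tmul s t) IH tsum_cons mulrDl; congr (_ + _).
rewrite /tsum big_map big_distrr; apply: eq_bigr => b _.
by rewrite /tval /= ziM intrM pval_cat mulrACA.
Qed.

(* Makes the exponents of the brackets positive with respect to [p]. *)
Definition canon (p : pred key) (t : Z * lau) : Z * lau :=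
  (foldr (fun kc c => if p kc.1 then c else if Z.odd kc.2 then Z.opp c else c) t.1 t.2,
   lnorm (map (fun kc => (if p kc.1 then kc.1 else kneg kc.1, kc.2)) t.2)).

Lemma pval_coef (f g : lau) : (forall k, k \in map fst f ++ map fst g -> bra x k != 0) ->
  (forall k, coef f k = coef g k) -> pval f = pval g.
Proof.
move=> nz e; have us := undup_uniq (map fst f ++ map fst g).
have E h : {subset map fst h <= map fst f ++ map fst g} ->
    pval h = \prod_(k <- undup (map fst f ++ map fst g)) bra x k ^ coef h k.
  move=> sub; have := @prod_coef _ x (lopp h) (undup (map fst f ++ map fst g)) predT us.
  rewrite (eq_bigr (fun k => bra x k ^ coef h k)) => [->|k _]; last by rewrite coef_opp opprK.
  - by rewrite /pval big_map; apply: eq_bigr => kc _; rewrite ziN opprK.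
  - by rewrite -map_comp => k kh; rewrite mem_undup; apply: sub.
  by move=> k; rewrite mem_undup => /nz.
rewrite (E f) => [|k kf]; last by rewrite mem_cat kf.
rewrite (E g) => [|k kg]; last by rewrite mem_cat kg orbT.
by apply: eq_bigr => k _; rewrite e.
Qed.

Lemma lmerge_keys (a b : lau) : {subset map fst (lmerge a b) <= map fst (a ++ b)}.
Proof.
elim: a b => [|[k c] a IHa] b; first by case: b => [|[? ?] ?].
elim: b => [|[k' c'] b IHb]; first by rewrite cats0.
have eb : lmerge ((k, c) :: a) ((k', c') :: b) = match kcmp k k' with
  | Lt => (k, c) :: lmerge a ((k', c') :: b)
  | Gt => (k', c') :: lmerge ((k, c) :: a) b
  | Eq => match Z.add c c' with Z0 => lmerge a b | d => (k, d) :: lmerge a b end end by [].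
move=> y; rewrite eb; case: kcmp.
- case: Z.add => [|q|q] /=; rewrite ?inE; [|case/orP => [->//|]..] => /IHa; rewrite !map_cat !mem_cat /= !inE => /orP[->|->]; rewrite ?orbT //.
- rewrite [map _ _]/= inE => /orP[/eqP ->|/IHa]; first by rewrite map_cat mem_cat /= inE eqxx.
  by rewrite !map_cat !mem_cat /= !inE => /orP[->|->]; rewrite ?orbT.
rewrite [map _ _]/= inE => /orP[/eqP ->|/IHb]; first by rewrite map_cat mem_cat /= !inE eqxx !orbT.
by rewrite !map_cat !mem_cat /= !inE => /orP[->|->]; rewrite ?orbT.
Qed.

Lemma lnorm_keys (f : lau) : {subset map fst (lnorm f) <= map fst f}.
Proof.
have pp s : {subset map fst (flatten (lpairs s)) <= map fst (flatten s)}.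
  have [n] := ubnP (size s); elim: n s => // n IH [|a [|b s]] //= sz y; first by [].
  rewrite !map_cat !mem_cat => /orP[/lmerge_keys|/IH H]; first by rewrite map_cat mem_cat => /orP[->|->]; rewrite ?orbT.
  by rewrite H ?orbT //; lia.
rewrite /lnorm; elim: 14%nat => [|n IH] y /=; last by move=> /pp/IH.
by rewrite (_ : flatten _ = f) //; elim: (f) => //= kc f' ->.
Qed.

Lemma canon_val p t : (forall k, k \in map fst t.2 -> bra x k != 0) -> tval (canon p t) = tval t.
Proof.
move: t => [c f] /= nz; rewrite /tval /canon /=.
set g := map _ f; have -> : pval (lnorm g) = pval g.
  have gz k : k \in map fst g -> bra x k != 0.
    rewrite /g -map_comp => /mapP[kc kcf ->] /=; case: ifP => _; first by apply: nz; exact: map_f.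
    by rewrite bra_neg oppr_eq0; apply: nz; exact: map_f.
  apply: pval_coef => [k|k]; last exact: coef_norm.
  by rewrite mem_cat => /orP[/lnorm_keys|]; exact: gz.
rewrite /g {g}; elim: f nz => [|[k e] f IH] nz //=; rewrite !pval_cons /=.
have {IH} := IH (fun k' kf => nz k' (mem_behead (s := k :: map fst f) kf)).
set d := foldr _ _ _; set h := map _ f => IH.
case: (p k) => /=; first by rewrite mulrCA IH mulrCA.
rewrite bra_neg -mulN1r expfzMl.
have -> : (zi (if Z.odd e then Z.opp d else d))%:~R = (-1) ^ zi e * (zi d)%:~R :> F.
  by rewrite sign_odd; case: Z.odd; rewrite ?ziN ?mulN1r ?mul1r ?rmorphN.
have -> : (-1) ^ zi e * (zi d)%:~R * ((-1) ^ zi e * bra x k ^ zi e * pval h) =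
   ((-1) ^ zi e * (-1) ^ zi e) * (bra x k ^ zi e * ((zi d)%:~R * pval h)) by ring.
by rewrite IH -expfzMl mulrNN mulr1 exp1rz mul1r mulrCA.
Qed.

End Terms.

(* Roots of Vtilde as products of brackets, relative to the root for Z_mu. *)
Definition fexp (q0 : lau) (l : seq key) : lau :=
  map (fun u => (redk (rcons (kneg u) (Zpos xH)), Zpos xH)) l ++
  lopp (filter (fun kc => kpos kc.1) (lnorm (redl (addy Z0 (dV q0 l))))).

Definition keys_ok (f : lau) : bool := all (fun kc => (size kc.1 == 4%N) && ~~ keqb kc.1 (kzero 4)) f.
(** The trivial character does not occur, so the root is a product of powers of nonzero brackets. *)
Definition fexp_ok (q0 : lau) (l : seq key) : bool := keys_ok (lnorm (redl (addy Z0 (dV q0 l)))).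
Definition root_ok (O : seq (seq (bool * Z))) (v0 w0 : lau) : bool := keys_ok (lnorm (rvt O v0 w0 [::])).

Lemma coef_filter (p : pred key) (a : lau) k : coef (filter (fun kc => p kc.1) a) k = if p k then coef a k else 0.
Proof.
elim: a => [|[k' c] a IH] /=; first by rewrite /coef suml_nil if_same.
rewrite [in RHS]/coef suml_cons -/(coef a k); case pk': (p k').
  rewrite /coef suml_cons -!/(coef _ k) IH; case: ifP => // pk.
  by case: eqP => [e|_]; rewrite ?mul0rz ?addr0 //; rewrite -e pk' in pk.
by rewrite IH; case: ifP => // pk; case: eqP => [e|_]; rewrite ?mul0rz ?add0r //; rewrite -e pk' in pk.
Qed.

Lemma dV_nil q0 : dV q0 [::] = [::].
Proof.
have E a : lmul a [::] = [::] by elim: a => [|[k c] a /= ->].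
by rewrite /dV /= !E.
Qed.

Lemma fexp_nil q0 : fexp q0 [::] = [::].
Proof. by rewrite /fexp dV_nil. Qed.

Lemma keys_ok_coef0 f : keys_ok (lnorm f) -> coef f (kzero 4) = 0.
Proof.
move=> ok; rewrite -coef_norm coef0 //; apply/negP => /mapP[kc kcf e].
by have /andP[_ /keqbP] := allP ok kc kcf; rewrite -e.
Qed.

Section FExp.
Variables (O : seq (seq (bool * Z))) (v0 w0 : lau).
Hypothesis Hv : lnorm (lmul P4 v0 ++ lopp (numV O)) = [::].
Hypothesis Hw : lnorm (lmul P4 w0 ++ lopp (numW O)) = [::].
Hypotheses (sv : size4 v0) (sw : size4 w0) (sq : size4 (QJ O none4)).
Hypothesis rok : root_ok O v0 w0.

Definition root0 : halffun := pval H4 (lopp (filter (fun kc => kpos kc.1) (lnorm (rvt O v0 w0 [::])))).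

Lemma coef_redl_cat a b k : coef (redl (a ++ b)) k = coef (redl a) k + coef (redl b) k.
Proof. by rewrite /redl map_cat coefD. Qed.

(** Multiplicities are additive in [Z_mu] and the change caused by [l]. As [kpos] looks at y first,
    the new terms of y times the conjugate of W are positive and those of y^-1 W are not. *)
Lemma vroot_fexp l : all (fun u => size u == 4%N) l -> fexp_ok (QJ O none4) l ->
  vroot O v0 w0 l = root0 * pval H4 (fexp (QJ O none4) l).
Proof.
move=> sl ok; set q0 := QJ O none4.
pose hy : lau := map (fun u => (redk (rcons (kneg u) (Zpos xH)), Zneg xH)) l.
pose h := filter (fun kc => kpos kc.1) (lnorm (rvt O v0 w0 [::])) ++
   (hy ++ filter (fun kc => kpos kc.1) (lnorm (redl (addy Z0 (dV q0 l))))).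
have s1 : size4 (v0 ++ dV q0 l) by rewrite size4_cat sv size4_dV.
have s2 : size4 (w0 ++ mono l) by rewrite size4_cat sw size4_mono.
have coefv k : coef (rvt O v0 w0 l) k = coef (rvt O v0 w0 [::]) k + coef (redl (addy Z0 (dV q0 l))) k
    + coef hy k + coef (redl (lopp (addy (Zneg xH) (mono l)))) k.
  have addyc e a b : addy e (a ++ b) = addy e a ++ addy e b by exact: map_cat.
  have oppc a b : lopp (a ++ b) = lopp a ++ lopp b by exact: map_cat.
  have hyE : redl (lopp (addy (Zpos xH) (lbar (mono l)))) = hy.
    by rewrite /hy /redl /lopp /addy /lbar /mono -!map_comp.
  have barc a b : lbar (a ++ b) = lbar a ++ lbar b by exact: map_cat.
  rewrite /rvt /vt -/q0 dV_nil !cats0 addyc barc !addyc !oppc !coef_redl_cat hyE; ring.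
have yk (u : key) : size u = 4%N -> kpos (redk (rcons (kneg u) (Zpos xH))) /\ ~~ kpos (redk (rcons u (Zneg xH))).
  by move=> /size4P[a [b [c [d ->]]]].
have hyP k : k \in map fst hy -> kpos k && (size k == 4%N).
  rewrite /hy -map_comp => /mapP[u ul ->] /=; have /eqP su := allP sl u ul.
  by have [-> _] := yk u su; have [a [b [c [d ->]]]] := size4P su.
have hnP k : k \in map fst (redl (lopp (addy (Zneg xH) (mono l)))) -> ~~ kpos k && (k != kzero 4).
  rewrite /redl /lopp /addy /mono -!map_comp => /mapP[u ul ->] /=; have /eqP su := allP sl u ul.
  have [_ ->] := yk u su; have [a [b [c [d ->]]]] := size4P su; apply/eqP => -[].
  by move=> _ _ _.
have filP f : keys_ok f -> forall k, k \in map fst (filter (fun kc => kpos kc.1) f) -> kpos k && (size k == 4%N).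
  move=> okf k /mapP[kc]; rewrite mem_filter => /andP[kp kcf] ->.
  by rewrite kp; have /andP[-> _] := allP okf kc kcf.
rewrite (@vroot_list O v0 w0 l s1 s2 h).
- by rewrite rootf_pval /h /root0 /fexp /lopp !map_cat !pval_cat /hy -map_comp.
- move=> k; rewrite /h !coefD !coef_filter !coef_norm coefv.
  have -> : coef hy k = if kpos k then coef hy k else 0.
    by case: ifPn => // kp; rewrite coef0 //; apply: contra kp => /hyP/andP[].
  case: ifPn => kp; last by rewrite !addr0.
  rewrite [coef (redl (lopp _)) k]coef0; first by ring.
  by apply/negP => /hnP; rewrite kp.
- rewrite coefv (keys_ok_coef0 rok) (keys_ok_coef0 ok) !add0r !coef0 ?addr0 //.
    by apply/negP => /hnP; rewrite eqxx andbF.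
  by apply/negP => /hyP.
move=> k; rewrite /h !map_cat !mem_cat => /or3P[|/hyP|]; [exact: filP rok k|by []|exact: filP ok k].
Qed.

Lemma root0_neq0 : root0 != 0.
Proof.
rewrite /root0 pval_opp invr_neq0 //; apply: pval_neq0 => k /mapP[kc].
rewrite mem_filter => /andP[_ kcf] ->; have /andP[/eqP s4 /keqbP k0] := allP rok kc kcf.
by apply: bra_neq0 => //; apply/eqP.
Qed.

Lemma vroot_nil : vroot O v0 w0 [::] = root0.
Proof.
rewrite vroot_fexp //; last by rewrite /fexp_ok dV_nil.
by rewrite fexp_nil pval_nil mulr1.
Qed.

End FExp.

(** * The coefficients of the series M *)

(* [pref k] are the brackets in the factor of Exp's argument at (t^k, y^k). *)
Definition pref (k : Z) : lau :=
  map (fun kc => (kscale k kc.1, kc.2))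
   [:: ([:: 1; 1; 0; 0], 1); ([:: 1; 0; 1; 0], 1); ([:: 0; 1; 1; 0], 1); ([:: 0; 0; 0; 1], 1);
       ([:: 1; 0; 0; 0], -1); ([:: 0; 1; 0; 0], -1); ([:: 0; 0; 1; 0], -1); ([:: -1; -1; -1; 0], -1)]%zz.
(** [y^n] / [y] is the coefficient of q^{n-1} in 1 / (1 - (y^{1/2} + y^{-1/2}) q + q^2). *)
Definition pref1y (n : Z) : lau := pref 1 ++ [:: ([:: 0; 0; 0; n]%zz, Zpos xH); ([:: 0; 0; 0; 1]%zz, Zneg xH)].

(* n! times the coefficient of q^n, for n <= 3. *)
Definition mterms (n : nat) : seq (Z * lau) :=
  match n with
  | 0 => [:: (1%zz, [::])]
  | 1 => [:: ((-1)%zz, pref 1)]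
  | 2 => [:: ((-2)%zz, pref1y 2); ((-1)%zz, pref 2); (1%zz, pref 1 ++ pref 1)]
  | 3 => [:: ((-6)%zz, pref1y 3); ((-2)%zz, pref 3); (6%zz, pref 1 ++ pref1y 2); (3%zz, pref 1 ++ pref 2);
             ((-1)%zz, pref 1 ++ pref 1 ++ pref 1)]
  | _ => [::]
  end.

Section Mag.
Variable F : fieldType.
Hypotheses (F2 : 2%:R != 0 :> F) (F3 : 3%:R != 0 :> F).

(** The operations on series over an arbitrary field, where low coefficients are computed with
    symbolic entries; [halffun] enters through [smul_g] and its companions. *)
Definition gmul (a b : nat -> F) : nat -> F := fun n => \sum_(k < n.+1) a k * b (n - k)%N.
Definition gone : nat -> F := fun n => (n == 0%N)%:R.
Definition gpow (a : nat -> F) (k : nat) : nat -> F := ssrnat.iter k (gmul a) gone.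
Arguments gpow : simpl never.
Definition ginv (a : nat -> F) : nat -> F := fun n =>
  (a 0%N)^-1 * \sum_(k < n.+1) gpow (fun m => gone m - a m / a 0%N) k n.
Definition gexp (a : nat -> F) : nat -> F := fun n => \sum_(k < n.+1) gpow a k n / (k`!)%:R.
Definition gpleth (f : nat -> nat -> F) : nat -> F :=
  gexp (fun n => \sum_(1 <= k < n.+1 | (k %| n)%N) k%:R^-1 * f k (n %/ k)%N).

Lemma gmul0E a b : gmul a b 0 = a 0%N * b 0%N.
Proof. by rewrite /gmul big_ord_recr big_ord0 /= add0r. Qed.
Lemma gmul1E a b : gmul a b 1 = a 0%N * b 1%N + a 1%N * b 0%N.
Proof. by rewrite /gmul !big_ord_recr big_ord0 /= add0r. Qed.
Lemma gmul2E a b : gmul a b 2 = a 0%N * b 2%N + a 1%N * b 1%N + a 2%N * b 0%N.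
Proof. by rewrite /gmul !big_ord_recr big_ord0 /= add0r. Qed.
Lemma gmul3E a b : gmul a b 3 = a 0%N * b 3%N + a 1%N * b 2%N + a 2%N * b 1%N + a 3%N * b 0%N.
Proof. by rewrite /gmul !big_ord_recr big_ord0 /= add0r. Qed.
Definition gmulE := (gmul0E, gmul1E, gmul2E, gmul3E).

Lemma gpow_low (b : nat -> F) : b 0%N = 0 ->
  (gpow b 0 0 = 1) * (gpow b 0 1 = 0) * (gpow b 0 2 = 0) * (gpow b 0 3 = 0) *
  (gpow b 1 1 = b 1%N) * (gpow b 1 2 = b 2%N) * (gpow b 1 3 = b 3%N) *
  (gpow b 2 2 = b 1%N ^+ 2) * (gpow b 2 3 = 2 * b 1%N * b 2%N) * (gpow b 3 3 = b 1%N ^+ 3).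
Proof.
move=> b0; rewrite /gpow /= !gmulE !b0 /gone /=.
by do !split; ring.
Qed.

Lemma ginv_low (c : F) (a := nth 0 [:: -1; c; -1]) :
  [/\ ginv a 0 = -1, ginv a 1 = - c & ginv a 2 = - (c ^+ 2 - 1)].
Proof.
pose b m := gone m - a m / a 0%N; have n1 : -1 != 0 :> F by rewrite oppr_eq0 oner_neq0.
have b0 : b 0%N = 0 by rewrite /b /a /gone /= divff ?subrr.
have b1 : b 1%N = c by rewrite /b /a /gone /= invrN1 mulrN1 opprK add0r.
have b2 : b 2%N = -1 by rewrite /b /a /gone /= divff // add0r.
split; rewrite /ginv -/b !big_ord_recr big_ord0 /= !(gpow_low b0) ?b1 ?b2 /a /= invrN1; ring.
Qed.

Lemma ginv_arg (P c : F) (a := gmul (fun n => P * (n == 1%N)%:R) (ginv (nth 0 [:: -1; c; -1]))) :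
  [/\ a 0%N = 0, a 1%N = - P, a 2%N = - P * c & a 3%N = - P * (c ^+ 2 - 1)].
Proof.
have [i0 i1' i2'] := ginv_low c.
by split; rewrite /a !gmulE /= ?i0 ?i1' ?i2'; ring.
Qed.

Lemma gpleth_low (f : nat -> nat -> F) : (forall k, f k 0%N = 0) ->
  [/\ gpleth f 0 = 1, gpleth f 1 = f 1%N 1%N,
      gpleth f 2 = f 1%N 2%N + 2^-1 * f 2%N 1%N + f 1%N 1%N ^+ 2 / 2 &
      gpleth f 3 = f 1%N 3%N + 3^-1 * f 3%N 1%N + f 1%N 1%N * (f 1%N 2%N + 2^-1 * f 2%N 1%N) + f 1%N 1%N ^+ 3 / 6].
Proof.
move=> f0; rewrite /gpleth; set a := fun n => _.
have a0 : a 0%N = 0 by rewrite /a big_geq.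
have a1 : a 1%N = f 1%N 1%N by rewrite /a unlock /= divn1 addr0 invr1 mul1r.
have a2 : a 2%N = f 1%N 2%N + 2^-1 * f 2%N 1%N.
  by rewrite /a unlock /= divn1 divnn /= addr0 invr1 mul1r.
have a3 : a 3%N = f 1%N 3%N + 3^-1 * f 3%N 1%N.
  by rewrite /a unlock /= divn1 divnn /= addr0 invr1 mul1r.
have F6 : 6%:R != 0 :> F by rewrite (natrM _ 2 3) mulf_neq0.
split; rewrite /gexp !big_ord_recr big_ord0 /= !(gpow_low a0) ?a1 ?a2 ?a3 /= ?factS ?fact0 ?muln1 ?divr1 ?addr0 ?add0r //.
- change (3 * 2)%N with 6%N.
  by field; rewrite ?F6 ?F2 ?F3 .
Qed.
End Mag.

Lemma char_halffun n : n.+1%:R != 0 :> halffun.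
Proof.
apply/negP => /eqP e; have H : evl (gens 4) [:: (kzero 4, Z.of_nat n.+1)] = 0.
  rewrite gens4 evl_cons evl_nil addr0 -[RHS]e.
  have -> : evk H4 (kzero 4) = 1 by rewrite /= !expr0z !mulr1.
  have -> : zi (Z.of_nat n.+1) = n.+1%:Z by lia.
  exact/esym/pmulrn.
have := evl_gens_coef _ H (kzero 4); rewrite /coef suml_cons suml_nil eqxx addr0 => /(_ _) c0.
have : (1 : int) *~ zi (Z.of_nat n.+1) = 0 by apply: c0 => k; rewrite !inE => /eqP ->.
by rewrite intz; lia.
Qed.

Lemma smul_g : smul = gmul (F := halffun). Proof. reflexivity. Qed.
Lemma spow_g : spow = gpow (F := halffun). Proof. by rewrite /spow smul_g. Qed.
Lemma sinv_g : sinv = ginv (F := halffun). Proof. by rewrite /sinv spow_g. Qed.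
Lemma sexp_g : sexp = gexp (F := halffun).
Proof. by rewrite /sexp spow_g. Qed.
Lemma pleth_g : plethystic_exp = gpleth (F := halffun).
Proof. by rewrite /plethystic_exp sexp_g. Qed.

Definition prefh (k : nat) : halffun :=
  let s := fun i => thalf i ^+ k in let u := yhalf ^+ k in
  br s u (delta_mx 0 i1 + delta_mx 0 i2, 0) * br s u (delta_mx 0 i1 + delta_mx 0 i3, 0)
  * br s u (delta_mx 0 i2 + delta_mx 0 i3, 0) * br s u (0, 1) / \prod_i br s u (delta_mx 0 i, 0).

Lemma arg_g k : magnificent_arg (fun i => thalf i ^+ k) (yhalf ^+ k) =
  gmul (fun n => prefh k * (n == 1%N)%:R) (ginv (nth 0 [:: -1; yhalf ^+ k + (yhalf ^+ k)^-1; -1])).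
Proof. by rewrite /magnificent_arg smul_g sinv_g. Qed.

Lemma tmon_pow (F : fieldType) (t : 'I_4 -> F) y (x : 'rV[int]_4 * int) k :
  tmon (fun i => t i ^+ k) x.1 * (y ^+ k) ^ x.2 = evk (tup t y) (kv5 x) ^ k%:Z.
Proof.
rewrite (evk_kv5 t y x) expfzMl /tmon; congr (_ * _); last by rewrite exprnP exprzAC.
elim/big_rec2: _ => [|i a b _ ->]; first by rewrite exp1rz.
by rewrite expfzMl exprnP exprzAC.
Qed.

Lemma br_pow k x : br (fun i => thalf i ^+ k) (yhalf ^+ k) x = bra H4 (kscale (Z.of_nat k) (redk (kv5 x))).
Proof.
have y0 : yhalf != 0 by have := H4_neq0; rewrite /H4 => /and5P[_ _ _ ? _].
rewrite /br /bra tmon_pow evk_scale (evk_redk thalf_neq0 y0 thalf4); last by rewrite /kv5 size_rcons.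
by have -> : zi (Z.of_nat k) = k%:Z by lia.
Qed.

Lemma pref_abs (F : fieldType) (x : seq F) k : let b := fun key => bra x (kscale k key) in
  b [:: 1; 1; 0; 0]%zz * b [:: 1; 0; 1; 0]%zz * b [:: 0; 1; 1; 0]%zz * b [:: 0; 0; 0; 1]%zz /
  (b [:: 1; 0; 0; 0]%zz * (b [:: 0; 1; 0; 0]%zz * (b [:: 0; 0; 1; 0]%zz * b [:: -1; -1; -1; 0]%zz)))
  = pval x (pref k).
Proof.
rewrite /pref /= !pval_cons pval_nil /= !expr1z !exprN1 !invfM !mulr1; ring.
Qed.

Lemma prefh_pval k : prefh k = pval H4 (pref (Z.of_nat k)).
Proof.
rewrite /prefh !br_pow big_ord4 !br_pow.
have E (w : 'rV[int]_4) e a b c d : w 0 i1 = zi a -> w 0 i2 = zi b -> w 0 i3 = zi c -> w 0 i4 = zi d ->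
   kv5 (w, zi e) = [:: a; b; c; d; e].
  by move=> h1 h2 h3 h4; rewrite /kv5 /kv /= h1 h2 h3 h4 !int_of_ZK.
rewrite (E _ Z0 1 1 0 0)%zz ?mxE // (E _ Z0 1 0 1 0)%zz ?mxE // (E _ Z0 0 1 1 0)%zz ?mxE //.
rewrite (E _ 1 0 0 0 0)%zz ?mxE // (E _ Z0 1 0 0 0)%zz ?mxE // (E _ Z0 0 1 0 0)%zz ?mxE //.
rewrite (E _ Z0 0 0 1 0)%zz ?mxE // (E _ Z0 0 0 0 1)%zz ?mxE //.
exact: pref_abs.
Qed.

Lemma arg_low k : magnificent_arg (fun i => thalf i ^+ k) (yhalf ^+ k) 0 = 0.
Proof. by rewrite arg_g; have [-> _ _ _] := ginv_arg (prefh k) (yhalf ^+ k + (yhalf ^+ k)^-1). Qed.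

(** For u = y^{1/2} the polynomials in u + u^-1 from the inverse series become quotients [y^n] /
    [y], so that only products of brackets remain. *)
Lemma mterms_abs (F : fieldType) (x : seq F) (P2 P3 : F) (u : F) (P1 := pval x (pref 1)) :
  2%:R != 0 :> F -> 3%:R != 0 :> F -> 
  bra x [:: 0; 0; 0; 1]%zz = u - u^-1 -> bra x [:: 0; 0; 0; 2]%zz = u ^+ 2 - u ^- 2 ->
  bra x [:: 0; 0; 0; 3]%zz = u ^+ 3 - u ^- 3 -> u != 0 -> u - u^-1 != 0 ->
  P2 = pval x (pref 2) -> P3 = pval x (pref 3) ->
  let f1 := - P1 in let f2 := - P1 * (u + u^-1) in let f3 := - P1 * ((u + u^-1) ^+ 2 - 1) in
  [/\ f1 = tsum x (mterms 1) / 1, f2 + 2^-1 * (- P2) + f1 ^+ 2 / 2 = tsum x (mterms 2) / 2 &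
   f3 + 3^-1 * - P3 + f1 * (f2 + 2^-1 * - P2) + f1 ^+ 3 / 6 = tsum x (mterms 3) / 6].
Proof.
move=> F2 F3 b1 b2 b3 u0 b0 e2 e3 f1 f2 f3.
have F6 : 6%:R != 0 :> F by rewrite (natrM _ 2 3) mulf_neq0.
have z1 : zi (Zpos xH) = 1 by [].
have zN1 : zi (Zneg xH) = -1 by [].
have y2 : pval x (pref1y 2) = P1 * (u + u^-1).
  rewrite /pref1y pval_cat -/P1; congr (_ * _); rewrite !pval_cons pval_nil b2 b1 z1 zN1 expr1z exprN1 mulr1.
  have -> : u ^+ 2 - u ^- 2 = (u - u^-1) * (u + u^-1) by rewrite -exprVn -subr_sqr.
  by rewrite mulrAC divff // mul1r.
have y3 : pval x (pref1y 3) = P1 * ((u + u^-1) ^+ 2 - 1).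
  rewrite /pref1y pval_cat -/P1; congr (_ * _); rewrite !pval_cons pval_nil b3 b1 z1 zN1 expr1z exprN1 mulr1.
  have -> : u ^+ 3 - u ^- 3 = (u - u^-1) * ((u + u^-1) ^+ 2 - 1) by rewrite -exprVn; field.
  by rewrite mulrAC divff // mul1r.
have tE c f : tval x (c, f) = (zi c)%:~R * pval x f by [].
have [z2 z3 z6] : [/\ zi (Zpos 2) = 2, zi (Zpos 3) = 3 & zi (Zpos 6) = 6] by [].
have [n2 n6] : zi (Zneg 2) = - 2 /\ zi (Zneg 6) = - 6 by [].
have c2 := pval_cat x (pref 1) (pref 1); have c3 := pval_cat x (pref 1) (pref 1 ++ pref 1).
have c12 := pval_cat x (pref 1) (pref 2); have c1y := pval_cat x (pref 1) (pref1y 2).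
rewrite -/P1 in c2 c3 c12 c1y; rewrite c2 in c3; rewrite -e2 in c12; rewrite y2 in c1y.
rewrite /f1 /f2 /f3 /mterms; split; rewrite !tsum_cons tsum_nil !tE.
- by rewrite zN1 -/P1; field; rewrite oner_neq0.
- by rewrite zN1 n2 z1 y2 c2 -e2; field; rewrite F2.
by rewrite n6 n2 z6 z3 zN1 c3 c12 c1y y3 -e3; field; rewrite ?F6 ?F2 ?F3 ?u0.
Qed.

Lemma mterms_series n : (n <= 3)%N -> magnificent_series n = tsum H4 (mterms n) / (n`!)%:R.
Proof.
pose f k := magnificent_arg (fun i => thalf i ^+ k) (yhalf ^+ k).
have y0 : yhalf != 0 by have := H4_neq0; rewrite /H4 => /and5P[_ _ _ ? _].
have [g0 g1 g2 g3] := gpleth_low (char_halffun 1) (char_halffun 2) (f := f) arg_low.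
have fE k : [/\ f k 1%N = - prefh k, f k 2%N = - prefh k * (yhalf ^+ k + (yhalf ^+ k)^-1) &
   f k 3%N = - prefh k * ((yhalf ^+ k + (yhalf ^+ k)^-1) ^+ 2 - 1)].
  by rewrite /f arg_g; have [_ ? ? ?] := ginv_arg (prefh k) (yhalf ^+ k + (yhalf ^+ k)^-1).
have [f11 f12 f13] := fE 1%N; have [f21 _ _] := fE 2%N; have [f31 _ _] := fE 3%N.
rewrite expr1 in f12 f13; rewrite !prefh_pval in f11 f12 f13 f21 f31.
rewrite f11 in g1 g2 g3; rewrite f12 f21 in g2 g3; rewrite f13 f31 in g3.
have yb (z : Z) : bra H4 [:: Z0; Z0; Z0; z] = yhalf ^ zi z - (yhalf ^ zi z)^-1.
  by rewrite /bra /= !expr0z !mul1r mulr1.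
have b0 : yhalf - yhalf^-1 != 0.
  by have := @bra_neq0 [:: Z0; Z0; Z0; Zpos xH] erefl; rewrite yb; apply.
have y1 := yb 1%zz; have y2 := yb 2%zz; have y3 := yb 3%zz.
have [z1 z2 z3] : [/\ zi 1%zz = 1, zi 2%zz = 2%N & zi 3%zz = 3%N] by [].
rewrite z1 expr1z in y1; rewrite z2 -exprnP in y2; rewrite z3 -exprnP in y3.
have [m1 m2 m3] := mterms_abs (char_halffun 1) (char_halffun 2) y1 y2 y3 y0 b0 erefl erefl.
rewrite /magnificent_series pleth_g -/f; case: n => [|[|[|[|]]]] // _.
- by rewrite g0 /= tsum_cons tsum_nil /tval /= pval_nil divr1 addr0 mulr1.
- by rewrite g1 m1.
- by rewrite g2 m2.
by rewrite g3 m3.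
Qed.

(** * Elimination of y *)

Definition kspec (v k : key) : key :=
  match k, v with
  | [:: a; b; c; z], [:: v1; v2; v3] => [:: Z.add a (Z.mul z v1); Z.add b (Z.mul z v2); Z.add c (Z.mul z v3)]
  | _, _ => k
  end.

(* The term at y^{1/2} = t^{v/2}; it vanishes if a bracket becomes [1]. *)
Definition tspec (v : key) (t : Z * lau) : seq (Z * lau) :=
  let f := map (fun kc => (kspec v kc.1, kc.2)) t.2 in
  if has (fun kc => keqb kc.1 (kzero 3)) f then [::] else [:: canon lexpos (t.1, f)].

(** Brackets containing y occur with positive exponents only, so there are no poles in y away from
    0. *)
Definition ykey_ok (kc : key * Z) : bool :=
  match kc.1 with
  | [:: a; b; c; Z0] => ~~ Z.eqb kc.2 Z0
  | [:: a; b; c; Zpos _] => Z.ltb Z0 kc.2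
  | _ => false
  end.
Definition ydeg (f : lau) : Z := foldr (fun kc n => Z.add (Z.mul (nth Z0 kc.1 3) kc.2) n) Z0 f.
Definition yterm_ok (n : nat) (t : Z * lau) : bool := all ykey_ok t.2 && Z.eqb (ydeg t.2) (Z.of_nat n).

Section YPoly.
Variables (F : fieldType) (a b c u : F).
Hypotheses (a0 : a != 0) (b0 : b != 0) (c0 : c != 0) (u0 : u != 0).
Local Notation x3 := [:: a; b; c].
Local Notation x4 w := [:: a; b; c; w].
Hypothesis nz3 : forall k, size k = 3%N -> k != kzero 3 -> bra x3 k != 0.
Hypothesis inj3 : forall v v', size v = 3%N -> size v' = 3%N -> evk x3 v ^+ 2 = evk x3 v' ^+ 2 -> v = v'.

(** The power of a bracket of t^k y^p as a polynomial in y, after multiplication by y^{p/2} for each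
    factor. *)
Definition kpoly (kc : key * Z) : {poly F} :=
  match kc.1 with
  | [:: k1; k2; k3; Zpos p] =>
     ((evk x3 [:: k1; k2; k3])%:P * 'X^(Pos.to_nat p) - ((evk x3 [:: k1; k2; k3])^-1)%:P) ^+ Z.to_nat kc.2
  | [:: k1; k2; k3; _] => (bra x3 [:: k1; k2; k3] ^ zi kc.2)%:P
  | _ => 1
  end.
Definition tpoly (t : Z * lau) : {poly F} := ((zi t.1)%:~R)%:P * \prod_(kc <- t.2) kpoly kc.

Lemma kpoly_size kc : ykey_ok kc -> (size (kpoly kc) <= (Z.to_nat (Z.mul (nth Z0 kc.1 3) kc.2)).+1)%N.
Proof.
case: kc => [[|k1 [|k2 [|k3 [|[|p|p] [|]]]]] e] //; rewrite /ykey_ok /kpoly /=.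
  by move=> _; rewrite size_polyC; case: eqP.
move=> e0; set q := _ - _.
have sq : (size q <= (Pos.to_nat p).+1)%N.
  rewrite /q; apply: leq_trans (size_polyD _ _) _; rewrite geq_max size_polyN.
  apply/andP; split; last by rewrite size_polyC; case: eqP.
  apply: leq_trans (size_polyMleq _ _) _; rewrite size_polyXn size_polyC.
  by case: eqP => _ /=; rewrite ?addn0 //= leqnSn.
have -> : Z.to_nat (Z.mul (Zpos p) e) = (Pos.to_nat p * Z.to_nat e)%N by lia.
elim: (Z.to_nat e) => [|m IH]; first by rewrite expr0 size_poly1.
rewrite exprS; apply: leq_trans (size_polyMleq _ _) _.
apply: (@leq_trans ((Pos.to_nat p).+1 + (Pos.to_nat p * m).+1).-1); last by lia.
by rewrite -!subn1; apply: leq_sub2r; apply: leq_add.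
Qed.

Lemma tpoly_size n t : yterm_ok n t -> (size (tpoly t) <= n.+1)%N.
Proof.
case: t => [d f] /andP[/= okf /Z.eqb_eq deg]; rewrite /tpoly /=.
apply: leq_trans (size_polyMleq _ _) _.
have H : (size (\prod_(kc <- f) kpoly kc)%R <= (Z.to_nat (ydeg f)).+1)%N /\ Z.le Z0 (ydeg f).
  elim: f okf {deg} => [|kc f IH] /=; first by rewrite big_nil size_poly1.
  move=> /andP[okk /IH[s1 s2]]; rewrite big_cons.
  have k0 : Z.le Z0 (Z.mul (nth Z0 kc.1 3) kc.2).
    case: kc okk => [[|k1 [|k2 [|k3 [|[|p|p] [|]]]]] e] //; rewrite /ykey_ok /= => h.
    by case: e h => // q _; exact: Pos2Z.is_nonneg.
  split; last by lia.
  apply: leq_trans (size_polyMleq _ _) _; have := kpoly_size okk; move: s1; rewrite Z2Nat.inj_add //.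
  move: (size (kpoly kc)) (size _) (Z.to_nat _) (Z.to_nat _) => p q r m; lia.
move: H => [H _]; rewrite deg Nat2Z.id in H.
move: H (size_polyC_leq1 ((zi d)%:~R : F)); move: (size _%:P) (size _) => p q; lia.
Qed.

Lemma evk4 w k1 k2 k3 z : evk (x4 w) [:: k1; k2; k3; z] = evk x3 [:: k1; k2; k3] * w ^ zi z.
Proof. by rewrite /= !mulr1 !mulrA. Qed.

Lemma kpoly_eval w kc : w != 0 -> ykey_ok kc ->
  (kpoly kc).[w ^+ 2] = w ^ zi (Z.mul (nth Z0 kc.1 3) kc.2) * bra (x4 w) kc.1 ^ zi kc.2.
Proof.
move=> w0; case: kc => [[|k1 [|k2 [|k3 [|[|p|p] [|]]]]] e] //.
  move=> _; have -> : kpoly ([:: k1; k2; k3; Z0], e) = (bra x3 [:: k1; k2; k3] ^ zi e)%:P by [].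
  by rewrite hornerC [nth _ _ _]/= expr0z mul1r /bra evk4 expr0z mulr1.
have -> : ykey_ok ([:: k1; k2; k3; Zpos p], e) = Z.ltb Z0 e by [].
set m := evk x3 [:: k1; k2; k3] => e0.
have -> : kpoly ([:: k1; k2; k3; Zpos p], e) = (m%:P * 'X^(Pos.to_nat p) - (m^-1)%:P) ^+ Z.to_nat e by [].
rewrite [nth _ _ _]/= [_.2]/=.
rewrite horner_exp hornerD hornerN hornerM hornerXn !hornerC /bra evk4 -/m.
have -> : zi (Zpos p) = Pos.to_nat p by lia.
have -> : zi (Z.mul (Zpos p) e) = (Pos.to_nat p * Z.to_nat e)%N%:Z by lia.
have -> : zi e = (Z.to_nat e)%:Z by lia.
rewrite -!exprnP exprM -exprMn; congr (_ ^+ _).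
have m0 : m != 0 by apply: evk_neq0; rewrite /= a0 b0 c0.
have wp0 : w ^+ Pos.to_nat p != 0 by rewrite expf_neq0.
rewrite -exprM mulnC exprM; move: (w ^+ _) wp0 => W W0; rewrite expr2; field; rewrite m0 W0 //.
Qed.

Lemma tpoly_eval w n t : w != 0 -> yterm_ok n t -> (tpoly t).[w ^+ 2] = w ^+ n * tval (x4 w) t.
Proof.
move=> w0; case: t => [d f] /andP[/= okf /Z.eqb_eq deg]; rewrite /tpoly /tval hornerM hornerC /= mulrCA; congr (_ * _).
have -> : w ^+ n = w ^ zi (ydeg f) by rewrite deg (_ : zi _ = n%:Z) //; lia.
elim: f okf {deg} => [|[k e] f IH] /=; first by rewrite big_nil pval_nil hornerC expr0z mulr1.
move=> /andP[okk /IH{}IH]; rewrite big_cons pval_cons hornerM IH kpoly_eval // ziD expfzDr //.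
by rewrite mulrACA.
Qed.

Lemma bra_kspec v k : size k = 4%N -> size v = 3%N -> bra (x4 (evk x3 v)) k = bra x3 (kspec v k).
Proof.
move=> /size4P[k1 [k2 [k3 [k4 ->]]]]; case: v => [|v1 [|v2 [|v3 [|]]]] // _.
rewrite /bra evk4; suff -> : evk x3 [:: k1; k2; k3] * evk x3 [:: v1; v2; v3] ^ zi k4 = evk x3 (kspec [:: v1; v2; v3] [:: k1; k2; k3; k4]) by [].
rewrite /= !mulr1 !ziD !ziM !expfzDr // ![zi k4 * _]mulrC -!exprz_exp !expfzMl.
ring.
Qed.

Lemma tspec_val v n t : size v = 3%N -> yterm_ok n t -> tsum x3 (tspec v t) = tval (x4 (evk x3 v)) t.
Proof.
move=> sv; case: t => [d f] /andP[/= okf _]; rewrite /tspec /=.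
have s4 kc : kc \in f -> size kc.1 = 4%N /\ kc.2 != Z0.
  move=> /(allP okf); case: kc => [[|k1 [|k2 [|k3 [|[|p|p] [|]]]]] e] //; rewrite /ykey_ok /= => h; split=> //; by apply/eqP => e0; move: h; rewrite e0.
have E : pval (x4 (evk x3 v)) f = pval x3 (map (fun kc => (kspec v kc.1, kc.2)) f).
  rewrite /pval big_map big_seq [RHS]big_seq; apply: eq_bigr => kc /s4[k4 _].
  by rewrite bra_kspec.
have sp kc : kc \in f -> size (kspec v kc.1) = 3%N.
  move=> /s4[/size4P[k1 [k2 [k3 [k4 ->]]]] _]; case: (v) sv => [|v1 [|v2 [|v3 [|]]]] //.
rewrite /tval /= E; case: ifP => [/hasP[kc /mapP[kc' kcf ->] /= /keqbP k0]|/negbT/hasPn no].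
  rewrite tsum_nil /pval (big_rem (kspec v kc'.1, kc'.2)) /=; last by apply/mapP; exists kc'.
  have b00 : bra x3 (kzero 3) = 0 by rewrite /bra /= !expr0z !mulr1 invr1 subrr.
  rewrite k0 b00 exp0rz; have [_ e0] := s4 _ kcf; have -> : (zi kc'.2 == 0) = false by apply/negP => /eqP ez; case/eqP: e0; exact: zi_inj.
  by rewrite mul0r mulr0.
rewrite tsum_cons tsum_nil addr0 canon_val // => k /mapP[kc kcf ->].
have [kc' kcf' e] := mapP kcf; apply: nz3; first by rewrite e /= sp.
by have := no kc kcf; case: keqbP => // /eqP.
Qed.

(** A polynomial of degree at most n with n + 1 different roots vanishes. Its variable is the square
    of the last value, hence the squares in [inj3]. *)
Lemma eliminate_y n ts vs : all (yterm_ok n) ts -> uniq vs -> size vs = n.+1 ->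
  all (fun v => size v == 3%N) vs ->
  (forall v, v \in vs -> tsum x3 (flatten (map (tspec v) ts)) = 0) -> tsum (x4 u) ts = 0.
Proof.
move=> /allP okt uvs svs /allP v3 H; pose P := \sum_(t <- ts) tpoly t.
have eP w : w != 0 -> P.[w ^+ 2] = w ^+ n * tsum (x4 w) ts.
  move=> w0; rewrite /P horner_sum /tsum big_distrr big_seq [RHS]big_seq.
  by apply: eq_bigr => t /okt; apply: tpoly_eval.
have P0 : P = 0.
  apply/eqP/negPn/negP => nz.
  have := max_poly_roots nz (rs := map (fun v => evk x3 v ^+ 2) vs).
  have -> : all (root P) (map (fun v => evk x3 v ^+ 2) vs).
    apply/allP => y /mapP[v vvs ->]; have v0 : evk x3 v != 0 by apply: evk_neq0; rewrite /= a0 b0 c0.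
    rewrite rootE eP //; have := H v vvs.
    have -> : tsum x3 (flatten (map (tspec v) ts)) = tsum (x4 (evk x3 v)) ts.
      have sv : size v = 3%N by apply/eqP/v3.
      elim: (ts) okt => [|t ts' IH] okt' /=; first by rewrite !tsum_nil.
      rewrite tsum_cat (@tspec_val v n) ?okt' ?mem_head // IH ?tsum_cons // => t' tt'.
      by apply: okt'; rewrite inE tt' orbT.
    by move=> ->; rewrite mulr0.
  rewrite map_inj_in_uniq //; last by move=> v v' /v3/eqP s /v3/eqP s'; apply: inj3.
  rewrite size_map svs => /(_ isT uvs); apply/negP; rewrite -leqNgt.
  rewrite /P big_seq; apply: (big_ind (fun p : {poly F} => size p <= n.+1)%N) => [|p q sp sq|t /okt]; first by rewrite size_poly0.
    by apply: leq_trans (size_polyD _ _) _; rewrite geq_max sp.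
  exact: tpoly_size.
have := eP u u0; rewrite P0 horner0 => /esym/eqP.
by rewrite mulf_eq0 expf_eq0 (negPf u0) andbF => /eqP.
Qed.
End YPoly.

Definition H3 : seq halffun := [:: thalf i1; thalf i2; thalf i3].

Lemma evk3 (F : fieldType) (a b c u : F) (v : key) : size v = 3%N -> evk [:: a; b; c; u] (rcons v Z0) = evk [:: a; b; c] v.
Proof. by case: v => [|v1 [|v2 [|v3 [|]]]] // _ /=; rewrite expr0z !mulr1. Qed.

Lemma bra_neq03 k : size k = 3%N -> k != kzero 3 -> bra H3 k != 0.
Proof.
move=> sk k0; have := @bra_neq0 (rcons k Z0); rewrite /bra size_rcons sk (evk3 _ _ _ _ sk); apply => //.
by apply: contra k0; move: sk; case: (k) => [|v1 [|v2 [|v3 [|]]]] // _ /eqP[-> -> ->].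
Qed.

Lemma H3_neq0 : [/\ thalf i1 != 0, thalf i2 != 0, thalf i3 != 0 & yhalf != 0].
Proof. have := H4_neq0; rewrite /H4 => /and5P[h1 h2 h3 h4 _].
by split; [exact: h1|exact: h2|exact: h3|exact: h4]. Qed.

Lemma sq_eq1 (F : fieldType) (p q : F) : p != 0 -> q != 0 -> p ^+ 2 = q ^+ 2 -> p / q - (p / q)^-1 = 0.
Proof.
move=> p0 q0 e; have -> : p / q - (p / q)^-1 = (p ^+ 2 - q ^+ 2) / (p * q) by field; rewrite p0 q0.
by rewrite e subrr mul0r.
Qed.

(** Equal squares make the bracket of the difference of the exponents vanish. *)
Lemma evk_sq_inj v v' : size v = 3%N -> size v' = 3%N -> evk H3 v ^+ 2 = evk H3 v' ^+ 2 -> v = v'.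
Proof.
move=> sv sv' e; pose k := kadd v (kneg v').
have x0 : all (predC1 0) H3 by have [a b c _] := H3_neq0; apply/and4P; split; [exact: a|exact: b|exact: c|exact: isT].
have sk : size k = 3%N.
  by rewrite /k; move: sv sv'; case: (v) => [|? [|? [|? [|]]]] //; case: (v') => [|? [|? [|? [|]]]].
have [k0|k0] := eqVneq k (kzero 3); last first.
  have /eqP := bra_neq03 sk k0; rewrite /bra evkD // evkN.
  by move: (sq_eq1 (evk_neq0 v x0) (evk_neq0 v' x0) e).
move: k0 sv sv'; rewrite /k; case: (v) => [|v1 [|v2 [|v3 [|]]]] //; case: (v') => [|w1 [|w2 [|w3 [|]]]] //= [e1 e2 e3] _ _.
have E (p q : Z) : Z.add p (Z.opp q) = Z0 -> p = q by lia.
by rewrite (E _ _ e1) (E _ _ e2) (E _ _ e3).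
Qed.

Lemma eliminate_yhalf n ts vs : all (yterm_ok n) ts -> uniq vs -> size vs = n.+1 ->
  all (fun v => size v == 3%N) vs ->
  (forall v, v \in vs -> tsum H3 (flatten (map (tspec v) ts)) = 0) -> tsum H4 ts = 0.
Proof.
have [a b c u] := H3_neq0; exact: (eliminate_y a b c u bra_neq03 evk_sq_inj).
Qed.

(** * The identity to be checked *)

Definition signed (q0 : lau) (lb : seq key * bool) : Z * lau := ((if lb.2 then Zneg xH else Zpos xH), fexp q0 lb.1).

(** n! clears the denominators of the series. [mterms] of order n - k already contains (n - k)!,
    which leaves the factor n! / (n - k)!. *)
Definition idraw (q0 : lau) (D : seq (seq key * bool)) (P : nat -> seq (seq key * bool)) (n : nat) : seq (Z * lau) :=
  tscale (Z.of_nat n`!) (map (signed q0) D) ++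
    flatten (map (fun k => tscale (Z.opp (Z.of_nat (n`! %/ (n - k)`!)))
       (tmul (map (signed q0) (P k)) (mterms (n - k)))) (iota 0%N n.+1)).
Definition idterms q0 D P n := map (canon kpos) (idraw q0 D P n).

Lemma keys_ok_bra f : keys_ok f -> forall k, k \in map fst f -> bra H4 k != 0.
Proof.
move=> ok k /mapP[kc kcf ->]; have /andP[/eqP s4 /keqbP k0] := allP ok kc kcf.
by apply: bra_neq0 => //; apply/eqP.
Qed.

Lemma idterms_idraw q0 D P n : all (fun t => keys_ok t.2) (idraw q0 D P n) ->
  tsum H4 (idterms q0 D P n) = tsum H4 (idraw q0 D P n).
Proof.
rewrite /idterms; elim: (idraw _ _ _ _) => [//|t ts IH] /= /andP[ok /IH{}IH].
rewrite !tsum_cons IH canon_val //; exact: keys_ok_bra.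
Qed.

Lemma ffact_div (F : fieldType) n k : (forall m, m.+1%:R != 0 :> F) -> (k <= n)%N ->
  (n`! %/ k`!)%:R = n`!%:R / k`!%:R :> F.
Proof.
move=> ch kn; have k0 : k`!%:R != 0 :> F by rewrite -(prednK (fact_gt0 k)).
apply/eqP; rewrite -(inj_eq (mulIf k0)) divfK // -natrM divnK //.
by rewrite -(subnKC kn); elim: (n - k)%N => [|m IH]; rewrite ?addn0 // addnS factS dvdn_mull.
Qed.

Lemma tsum_flatten (F : fieldType) (x : seq F) ss : tsum x (flatten ss) = \sum_(s <- ss) tsum x s.
Proof. by elim: ss => [|s ss IH] /=; rewrite ?tsum_nil ?big_nil // tsum_cat IH big_cons. Qed.

Lemma idraw_abs (F : fieldType) (x : seq F) (M : nat -> F) (r : F) q0 D P n :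
  (forall m, m.+1%:R != 0 :> F) -> (forall k, (k <= n)%N -> M k = tsum x (mterms k) / k`!%:R) ->
  tsum x (idraw q0 D P n) = 0 ->
  r * tsum x (map (signed q0) D) = \sum_(k < n.+1) r * tsum x (map (signed q0) (P k)) * M (n - k)%N.
Proof.
move=> ch HM; rewrite /idraw tsum_cat tsum_scale tsum_flatten big_map.
have zn (m : nat) : (zi (Z.of_nat m))%:~R = m%:R :> F.
  by have -> : zi (Z.of_nat m) = m%:Z by lia.
have n0 : n`!%:R != 0 :> F by rewrite -(prednK (fact_gt0 n)).
rewrite zn => /eqP; rewrite addr_eq0 => /eqP e.
apply: (mulfI n0); rewrite mulrCA e -sumrN !big_distrr -(big_mkord xpredT (fun k => n`!%:R * (r * tsum x [seq signed q0 i | i <- P k] * M (n - k)%N))) /index_iota subn0.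
apply: eq_big_seq => k; rewrite mem_iota => /andP[_ kn].
rewrite tsum_scale tsum_mul ziN rmorphN /= zn ffact_div //; last exact: leq_subr.
rewrite HM ?leq_subr // mulNr opprK.
have m0 : (n - k)`!%:R != 0 :> F by rewrite -(prednK (fact_gt0 _)).
by field.
Qed.

Section Identity.
Variables (O : seq (seq (bool * Z))) (v0 w0 : lau).
Hypotheses (sv : size4 v0) (sw : size4 w0) (sq : size4 (QJ O none4)).
Hypothesis rok : root_ok O v0 w0.
Local Notation q0 := (QJ O none4).

Definition cfg_ok (s : seq (seq key * bool)) : bool :=
  all (fun lb => all (fun u => size u == 4%N) lb.1 && fexp_ok q0 lb.1) s.

Lemma summand_tval (F : fieldType) (x : seq F) (r : F) (b : bool) f :
  (-1) ^+ b * (r * pval x f) = r * tval x ((if b then Zneg xH else Zpos xH), f).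
Proof. by rewrite /tval mulrCA; congr (_ * (_ * _)); case: b. Qed.

Lemma summand_sum s : cfg_ok s ->
  \sum_(p <- s) summand O v0 w0 p = root0 O v0 w0 * tsum H4 (map (signed q0) s).
Proof.
elim: s => [|[l b] s IH] /=; first by rewrite big_nil tsum_nil mulr0.
move=> /andP[/andP[sl ok] /IH{}IH]; rewrite big_cons IH tsum_cons mulrDr; congr (_ + _).
rewrite /summand [(l, b).1]/= [(l, b).2]/= (vroot_fexp sv sw sq rok sl ok).
exact: summand_tval.
Qed.

Lemma sum_identity n D P : (n <= 3)%N -> cfg_ok D -> (forall k, (k <= n)%N -> cfg_ok (P k)) ->
  all (fun t => keys_ok t.2) (idraw q0 D P n) -> tsum H4 (idterms q0 D P n) = 0 ->
  \sum_(p <- D) summand O v0 w0 p =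
  \sum_(k < n.+1) (\sum_(p <- P k) summand O v0 w0 p) * magnificent_series (n - k)%N.
Proof.
move=> n3 okD okP oki; rewrite idterms_idraw // => id0.
have Hm k : (k <= n)%N -> magnificent_series k = tsum H4 (mterms k) / k`!%:R.
  by move=> kn; apply: mterms_series; apply: leq_trans n3.
rewrite (summand_sum okD) (idraw_abs (root0 O v0 w0) char_halffun Hm id0).
by apply: eq_bigr => k _; rewrite summand_sum // okP // -ltnS.
Qed.

End Identity.

(** * Sums of products of brackets in three variables *)

(* Polynomials in the T_i = x_i^2, as nested lists of coefficients; the brackets of T^k are x^k - x^-k. *)
Notation poly3 := (seq (seq (seq Z))).

Fixpoint zipadd (A : Type) (f : A -> A -> A) (s t : seq A) : seq A :=
  match s, t with
  | a :: s', b :: t' => f a b :: zipadd f s' t'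
  | [::], _ => t
  | _, [::] => s
  end.
Fixpoint zipsub (A : Type) (f : A -> A -> A) (o : A -> A) (s t : seq A) : seq A :=
  match s, t with
  | a :: s', b :: t' => f a b :: zipsub f o s' t'
  | [::], _ => map o t
  | _, [::] => s
  end.
Definition add3 : poly3 -> poly3 -> poly3 := zipadd (zipadd (zipadd Z.add)).
Definition opp1 := map Z.opp.
Definition opp2 := map opp1.
Definition sub1 := zipsub Z.sub Z.opp.
Definition sub2 := zipsub sub1 opp1.
Definition sub3 : poly3 -> poly3 -> poly3 := zipsub sub2 opp2.
Definition shift (A : Type) (z : A) (n : nat) (s : seq A) : seq A := if s is [::] then [::] else nseq n z ++ s.
Definition shift2 (j k : nat) (p : seq (seq Z)) := shift [::] j (map (shift Z0 k) p).
Definition shift3 (i j k : nat) (p : poly3) : poly3 := shift [::] i (map (shift2 j k) p).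
Definition iszero (p : poly3) := all (all (all (Z.eqb Z0))) p.

Definition npos (z : Z) : nat := match z with Zpos p => Pos.to_nat p | _ => 0%N end.
Definition nneg (z : Z) : nat := match z with Zneg p => Pos.to_nat p | _ => 0%N end.
Definition kabs (k : key) : key := map Z.abs k.

(* The bracket of k is x^{-|k|} (T^{k+} - T^{k-}). *)
Definition mulbr (k : key) (p : poly3) : poly3 :=
  match k with
  | [:: a; b; c] => sub3 (shift3 (npos a) (npos b) (npos c) p) (shift3 (nneg a) (nneg b) (nneg c) p)
  | _ => p
  end.

(* The recursion q_j = q_{j-p} - s_j for a quotient; its outcome is only used after multiplying back. *)
Fixpoint divrec (A : Type) (z : A) (f : A -> A -> A) (hist s : seq A) : seq A :=
  if s is a :: s' then
    let q := f (head z hist) a in q :: divrec z f (rcons (behead hist) q) s'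
  else [::].
Definition divlevel (A : Type) (z : A) (f : A -> A -> A) (p : nat) (s : seq A) : seq A :=
  take (size s - p) (divrec z f (nseq p z) s).
Definition divbr (k : key) (p : poly3) : poly3 :=
  match k with
  | [:: Z0; Z0; c] => map (map (divlevel Z0 Z.sub (npos c))) p
  | [:: Z0; b; c] =>
    map (divlevel [::] (fun q a => drop (nneg c) (sub1 (shift Z0 (npos c) q) a)) (npos b)) p
  | [:: a; b; c] =>
    divlevel [::] (fun q a => map (drop (nneg c)) (drop (nneg b) (sub2 (shift2 (npos b) (npos c) q) a))) (npos a) p
  | _ => p
  end.

(* pval ffac * x^fmon * fnum(T) *)
Record frac := Frac { ffac : lau; fmon : key; fnum : poly3 }.

Definition keys3_ok (f : lau) : bool := all (fun kc => (size kc.1 == 3%N) && ~~ keqb kc.1 (kzero 3)) f.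

(** Smaller exponent of each bracket, a missing one counting as 0. Whether it is a common factor is
    checked in [rebase]. *)
Fixpoint fmin (a : lau) : lau -> lau :=
  fix aux (b : lau) : lau :=
  match a, b with
  | [::], [::] => [::]
  | [::], (k', c') :: b' => if Z.ltb c' 0 then (k', c') :: aux b' else aux b'
  | (k, c) :: a', [::] => if Z.ltb c 0 then (k, c) :: fmin a' [::] else fmin a' [::]
  | (k, c) :: a', (k', c') :: b' =>
    match kcmp k k' with
    | Lt => if Z.ltb c 0 then (k, c) :: fmin a' b else fmin a' b
    | Gt => if Z.ltb c' 0 then (k', c') :: aux b' else aux b'
    | Eq => match Z.min c c' with Z0 => fmin a' b' | d => (k, d) :: fmin a' b' end
    end
  end.

Fixpoint mulpow (k : key) (n : nat) (mn : key * poly3) : key * poly3 :=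
  if n is n'.+1 then mulpow k n' (kadd mn.1 (kneg (kabs k)), mulbr k mn.2) else mn.
Fixpoint mulfac (g : lau) (mn : key * poly3) : key * poly3 :=
  if g is (k, e) :: g' then mulfac g' (mulpow k (Z.to_nat e) mn) else mn.

(** The quotient by the common factor is multiplied out into the numerator, hence the nonnegative
    exponents; the conditions on the keys exclude zero brackets. *)
Definition rebase (f : lau) (r : frac) : option (key * poly3) :=
  let g := lmerge (ffac r) (lopp f) in
  if [&& keys3_ok g, keys3_ok (ffac r), keys3_ok f & all (fun kc => Z.leb Z0 kc.2) g]
  then Some (mulfac g (fmon r, fnum r)) else None.

Definition kmin (a b : key) : key := map (fun xy => Z.min xy.1 xy.2) (zip a b).
Definition halfdiff (m m0 : key) : key := map (fun xy => Z.div2 (Z.sub xy.1 xy.2)) (zip m m0).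
(** Numerators are polynomials in the squares of the variables, so only even differences of
    exponents can be absorbed. *)
Definition tshift (m m0 : key) (p : poly3) : option poly3 :=
  match halfdiff m m0 with
  | [:: a; b; c] =>
    if keqb m (kadd m0 (kscale 2 [:: a; b; c])) && [&& Z.leb Z0 a, Z.leb Z0 b & Z.leb Z0 c] then
      Some (shift3 (Z.to_nat a) (Z.to_nat b) (Z.to_nat c) p)
    else None
  | _ => None
  end.

(** Keeps the numerators small. A quotient is accepted only if multiplying back returns the
    numerator, so soundness does not depend on [divbr]. *)
Fixpoint divide (ds : seq key) (r : frac) : option frac :=
  if ds is k :: ds' then
    let q := divbr k (fnum r) in
    if [&& size k == 3%N, ~~ keqb k (kzero 3), keys3_ok (ffac r) & iszero (sub3 (mulbr k q) (fnum r))] then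
      divide ds' (Frac (lmerge [:: (k, Zpos xH)] (ffac r)) (kadd (fmon r) (kabs k)) q)
    else None
  else Some r.

Definition fadd (r s : frac) (ds : seq nat) : option frac :=
  let f := fmin (ffac r) (ffac s) in
  match rebase f r, rebase f s with
  | Some (m, p), Some (m', p') =>
    let m0 := kmin m m' in
    match tshift m m0 p, tshift m' m0 p' with
    | Some p1, Some p2 => divide (map (nth [::] (map fst f)) ds) (Frac f m0 (add3 p1 p2))
    | _, _ => None
    end
  | _, _ => None
  end.

(* The order of summation; after an addition, the numerator is divided by the brackets with the given positions in the common factor. *)
Inductive mtree := Lf of nat | Nd of mtree & mtree & seq nat.

Fixpoint leaves (t : mtree) : seq nat :=
  match t with Lf i => [:: i] | Nd l r _ => leaves l ++ leaves r end.

Fixpoint evalt (ts : seq (Z * lau)) (t : mtree) : option frac :=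
  match t with
  | Lf i => let t := nth (Z0, [::]) ts i in Some (Frac t.2 (kzero 3) [:: [:: [:: t.1]]])
  | Nd l r ds =>
    match evalt ts l, evalt ts r with
    | Some a, Some b => fadd a b ds
    | _, _ => None
    end
  end.

Definition tree_ok (ts : seq (Z * lau)) (t : mtree) : bool :=
  if ts is [::] then true else
  perm_eq (leaves t) (iota 0%N (size ts)) &&
  (if evalt ts t is Some r then iszero (fnum r) else false).

(** * Values of nested coefficient lists and of fractions *)

Section Horner.
Variables (F : fieldType) (A : Type) (e : A -> F) (T : F).

Definition hl (s : seq A) : F := foldr (fun a r => e a + T * r) 0 s.

Lemma hl_add f s t : (forall a b, e (f a b) = e a + e b) -> hl (zipadd f s t) = hl s + hl t.
Proof.
move=> fE; elim: s t => [|a s IH] [|b t] /=; rewrite ?add0r ?addr0 // IH fE; ring.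
Qed.
Lemma hl_map (c : F) o s : (forall b, e (o b) = c * e b) -> hl (map o s) = c * hl s.
Proof. by move=> oE; elim: s => [|b s IH] /=; rewrite ?mulr0 // oE IH; ring. Qed.
Lemma hl_sub f o s t : (forall a b, e (f a b) = e a - e b) -> (forall b, e (o b) = - e b) ->
  hl (zipsub f o s t) = hl s - hl t.
Proof.
move=> fE oE; elim: s t => [|a s IH] [|b t] /=; rewrite ?subr0 //; last by rewrite IH fE; ring.
  have := hl_map (c := -1) (o := o) (b :: t) => /= ->; first by rewrite sub0r mulN1r.
  by move=> d; rewrite oE mulN1r.
Qed.
Lemma hl_shift z n s : e z = 0 -> hl (shift z n s) = T ^+ n * hl s.
Proof.
move=> z0; have E : hl (nseq n z ++ s) = T ^+ n * hl s.
  by elim: n => [|n IH] /=; rewrite ?expr0 ?mul1r // IH z0 add0r exprS mulrA.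
by rewrite /shift; case: s E => //= _; rewrite mulr0.
Qed.
Lemma hl_zero (z : pred A) s : (forall a, z a -> e a = 0) -> all z s -> hl s = 0.
Proof. by move=> zE; elim: s => [|a s IH] //= /andP[/zE -> /IH ->]; rewrite mulr0 addr0. Qed.
End Horner.

Section Trees.
Variables (F : fieldType) (a b c : F).
Hypotheses (a0 : a != 0) (b0 : b != 0) (c0 : c != 0).
Local Notation x := [:: a; b; c].
Hypothesis nz3 : forall k, size k = 3%N -> k != kzero 3 -> bra x k != 0.

Definition ev1 : seq Z -> F := hl (fun z => (zi z)%:~R) (c ^+ 2).
Definition ev2 : seq (seq Z) -> F := hl ev1 (b ^+ 2).
Definition ev3 : poly3 -> F := hl ev2 (a ^+ 2).

Lemma ev3_add p q : ev3 (add3 p q) = ev3 p + ev3 q.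
Proof. by do 3!apply: hl_add => ? ?; rewrite ziD intrD. Qed.
Lemma ev1_opp p : ev1 (opp1 p) = - ev1 p.
Proof. by rewrite -mulN1r; apply: hl_map => z; rewrite ziN rmorphN mulN1r. Qed.
Lemma ev2_opp p : ev2 (opp2 p) = - ev2 p.
Proof. by rewrite -mulN1r; apply: hl_map => z; rewrite ev1_opp mulN1r. Qed.
Lemma ev3_sub p q : ev3 (sub3 p q) = ev3 p - ev3 q.
Proof.
apply: hl_sub; last exact: ev2_opp.
move=> {}p {}q; apply: hl_sub => [|z]; last by rewrite -ev1_opp.
by move=> {}p {}q; apply: hl_sub => [z w|z]; rewrite ?ziN ?rmorphN // -rmorphB -ziN -ziD.
Qed.
Lemma ev3_shift i j k p : ev3 (shift3 i j k p) = a ^+ 2 ^+ i * (b ^+ 2 ^+ j * (c ^+ 2 ^+ k * ev3 p)).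
Proof.
rewrite /ev3 /shift3 hl_shift // mulrA mulrA -[_ * hl _ _ p]mulrA -mulrA; congr (_ * _).
rewrite mulrA; apply: hl_map => q; rewrite /ev2 /shift2 hl_shift // -mulrA; congr (_ * _).
by apply: hl_map => z; rewrite /ev1 hl_shift.
Qed.
Lemma ev3_zero p : iszero p -> ev3 p = 0.
Proof. by do 3!(apply: hl_zero => ?); move/Z.eqb_eq <-. Qed.

Lemma exp_abs (y : F) z : y != 0 -> y ^ zi z = y ^ zi (Z.opp (Z.abs z)) * y ^+ 2 ^+ npos z.
Proof.
move=> y0; rewrite -exprM [X in _ * X]exprnP -expfzDr //; congr (_ ^ _).
by case: z => [|p|p] /=; lia.
Qed.
Lemma exp_absN (y : F) z : y != 0 -> (y ^ zi z)^-1 = y ^ zi (Z.opp (Z.abs z)) * y ^+ 2 ^+ nneg z.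
Proof.
move=> y0; rewrite -exprM [X in _ * X]exprnP -expfzDr // invr_expz; congr (_ ^ _).
by case: z => [|p|p] /=; lia.
Qed.

Lemma ev3_mulbr k p : size k = 3%N -> evk x (kneg (kabs k)) * ev3 (mulbr k p) = bra x k * ev3 p.
Proof.
case: k => [|i [|j [|k [|]]]] // _; rewrite /mulbr ev3_sub !ev3_shift /bra /=.
rewrite !invfM invr1 !mulr1 (exp_absN i a0) (exp_absN j b0) (exp_absN k c0) (exp_abs i a0) (exp_abs j b0) (exp_abs k c0).
ring.
Qed.

Lemma x_neq0 : all (predC1 0) x. Proof. by rewrite /= a0 b0 c0. Qed.

Definition mval (mn : key * poly3) : F := evk x mn.1 * ev3 mn.2.

Lemma mvalE m p : mval (m, p) = evk x m * ev3 p. Proof. by []. Qed.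

Lemma mulpow_val k n mn : size k = 3%N -> mval (mulpow k n mn) = bra x k ^+ n * mval mn.
Proof.
move=> sk; elim: n mn => [|n IH] mn /=; first by rewrite mul1r.
rewrite IH /mval; set m := mn.1; set p := mn.2.
rewrite [fst _]/(kadd m _) [snd _]/(mulbr k p) evkD ?x_neq0 // -[evk x m * _ * _]mulrA ev3_mulbr // exprSr.
by rewrite -[RHS]mulrA [bra x k * (evk x m * _)]mulrCA.
Qed.
Lemma mulfac_val g mn : keys3_ok g -> all (fun kc => Z.leb Z0 kc.2) g -> mval (mulfac g mn) = pval x g * mval mn.
Proof.
elim: g mn => [|[k e] g IH] mn /=; first by rewrite pval_nil mul1r.
move=> /andP[/andP[/eqP sk _] okg] /andP[/= e0 pg]; rewrite IH // mulpow_val // pval_cons mulrA [pval x g * _]mulrC.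
by congr (_ * _ * _); rewrite exprnP; congr (_ ^ _); lia.
Qed.

Lemma keys3_bra f : keys3_ok f -> forall k, k \in map fst f -> bra x k != 0.
Proof.
move=> ok k /mapP[kc kcf ->]; have /andP[/eqP s3 /keqbP k0] := allP ok kc kcf.
by apply: nz3 => //; apply/eqP.
Qed.

Definition fval (r : frac) : F := pval x (ffac r) * mval (fmon r, fnum r).

Lemma coef_lmerge f g k : coef (lmerge f g) k = coef f k + coef g k.
Proof. exact: suml_merge. Qed.

Lemma rebase_val f r mn : rebase f r = Some mn -> fval r = pval x f * mval mn.
Proof.
rewrite /rebase; case: ifP => // /and4P[okg okr okf pos] [<-]; rewrite mulfac_val // mulrA -pval_cat; congr (_ * _).
apply: pval_coef => [k|k]; last by rewrite coefD coef_lmerge coef_opp addrC subrK.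
by rewrite map_cat !mem_cat => /or3P[]; apply: keys3_bra.
Qed.

Lemma tshift_val m m0 p q : tshift m m0 p = Some q -> mval (m, p) = mval (m0, q).
Proof.
rewrite /tshift; case: halfdiff => [|i [|j [|k [|]]]] //; case: ifP => // /andP[/keqbP e /and3P[i0 j0 k0]] [<-].
rewrite /mval e evkD ?x_neq0 // evk_scale /= ev3_shift mulr1.
have E (y : F) z : Z.leb Z0 z -> y ^+ 2 ^+ Z.to_nat z = (y ^ zi z) ^ zi 2.
  by move=> z0; rewrite exprz_exp -exprM exprnP; congr (_ ^ _); lia.
move: (evk x m0) => u; rewrite !E // -!exprnP; ring.
Qed.

Lemma dividE k ds r (q := divbr k (fnum r)) : divide (k :: ds) r =
  if [&& size k == 3%N, ~~ keqb k (kzero 3), keys3_ok (ffac r) & iszero (sub3 (mulbr k q) (fnum r))]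
  then divide ds (Frac (lmerge [:: (k, Zpos xH)] (ffac r)) (kadd (fmon r) (kabs k)) q) else None.
Proof. by []. Qed.

Lemma divide_val ds r s : divide ds r = Some s -> fval r = fval s.
Proof.
elim: ds r => [|k ds IH] r; first by case=> ->.
rewrite dividE; case: ifP => // /and4P[/eqP sk k0 okr z] /IH <-.
rewrite /fval; cbn [ffac fmon fnum]; rewrite !mvalE evkD ?x_neq0 //.
have -> : pval x (lmerge [:: (k, Zpos xH)] (ffac r)) = bra x k * pval x (ffac r).
  have <- : pval x ((k, Zpos xH) :: ffac r) = bra x k * pval x (ffac r) by rewrite pval_cons expr1z.
  apply: pval_coef => [k'|k']; last by rewrite coef_lmerge -coefD.
  have H : {subset (map fst ((k, Zpos xH) :: ffac r)) <= [pred k | bra x k != 0]}.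
    move=> k''; rewrite inE => /orP[/eqP -> /=|/(keys3_bra okr)//].
    by rewrite inE nz3 //; apply/eqP => /eqP e; move: k0; rewrite (eqP e).
  by rewrite mem_cat => /orP[/lmerge_keys|]; apply: H.
have /eqP := ev3_zero z; rewrite ev3_sub subr_eq0 => /eqP <-.
have -> : ev3 (mulbr k (divbr k (fnum r))) = evk x (kabs k) * (bra x k * ev3 (divbr k (fnum r))).
  by rewrite -ev3_mulbr // evkN mulrA divff ?mul1r // evk_neq0 // x_neq0.
ring.
Qed.

Lemma fadd_val r s ds t : fadd r s ds = Some t -> fval t = fval r + fval s.
Proof.
rewrite /fadd; set f := fmin _ _; case Er: (rebase f r) => [[m p]|] //; case Es: (rebase f s) => [[m' p']|] //.
case E1: tshift => [p1|] //; case E2: tshift => [p2|] // /divide_val <-.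
rewrite (rebase_val Er) (rebase_val Es) (tshift_val E1) (tshift_val E2) -mulrDr; congr (_ * _).
by rewrite !mvalE ev3_add mulrDr.
Qed.

Lemma evalt_val ts t r : evalt ts t = Some r -> fval r = \sum_(i <- leaves t) tval x (nth (Z0, [::]) ts i).
Proof.
elim: t r => [i|l IHl d IHd ds] r.
  case=> <-; rewrite big_seq1 /fval mvalE; cbn [ffac fmon fnum]; rewrite /tval mulrC; congr (_ * _).
  by rewrite /= !expr0z !mul1r /ev3 /ev2 /ev1 /= !mulr0 !addr0.
have -> : evalt ts (Nd l d ds) = if (evalt ts l, evalt ts d) is (Some a, Some b) then fadd a b ds else None.
  by rewrite /=; case: (evalt ts l) => //; case: (evalt ts d).
case El: (evalt ts l) => [u|] //; case Ed: (evalt ts d) => [v|] // /fadd_val ->.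
by rewrite (IHl _ El) (IHd _ Ed) big_cat.
Qed.

(** The leaves are a permutation of the positions of all terms, so a zero numerator at the root of
    the tree means that the whole sum is zero. *)
Lemma tree_ok_sum ts t : tree_ok ts t -> tsum x ts = 0.
Proof.
case: ts => [|t0 ts0]; first by rewrite tsum_nil.
rewrite [tree_ok _ _]/(perm_eq _ (iota 0%N (size (t0 :: ts0))) && _); move: (t0 :: ts0) => ts /andP[pl].
case E: evalt => [r|] // /ev3_zero z.
have -> : tsum x ts = \sum_(i <- leaves t) tval x (nth (Z0, [::]) ts i).
  by rewrite (perm_big _ pl) /tsum (big_nth (Z0, [::])) /index_iota subn0.
by rewrite -(evalt_val E) /fval mvalE z !mulr0.
Qed.

End Trees.

Lemma tree_ok_sound ts t : tree_ok ts t -> tsum H3 ts = 0.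
Proof. by have [a b c _] := H3_neq0; exact: (tree_ok_sum a b c bra_neq03). Qed.

(** * Certificates *)

(* Division of Laurent polynomials by the 1 - t_a, up to terms that lie outside of the support of the quotients needed here. *)
Definition ldiv1 (M : Z) (a : nat) (l : lau) : lau :=
  lnorm (flatten (map (fun kc => map (fun z => (setk kc.1 a z, kc.2))
    (krange (nth Z0 kc.1 a) (Z.to_nat (Z.sub M (nth Z0 kc.1 a))))) l)).
Definition ldivP (l : lau) : lau := foldr (ldiv1 8%zz) l [:: 3; 2; 1; 0]%N.
Definition vroot0 (O : seq (seq (bool * Z))) : lau := ldivP (lnorm (numV O)).
Definition wroot0 (O : seq (seq (bool * Z))) : lau := ldivP (lnorm (numW O)).

(* The positions of the negative signs in the coefficient of q^n of both
   series, and values of y at which the difference of the two sides is summed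
   in the given order. *)
Record level := Level { negD : seq nat; negP : seq nat; points : seq (key * mtree) }.

Definition signs (s : seq nat) (m : nat) : seq bool := map (fun i => i \in s) (iota 0%N m).

Section Certificate.
Variables (K : nat) (O : seq (seq (bool * Z))) (muP : nat -> key -> bool) (cert : seq level).
Let N := size cert.
Local Notation q0 := (QJ O none4).
Local Notation levD n := (klevel (nbDT O) (UDT K O n) n).
Local Notation levP n := (klevel (nbPT K O) (UPT K O n) n).
Definition lev n := nth (Level [::] [::] [::]) cert n.
Definition sgD n := signs (negD (lev n)) (size (levD n)).
Definition sgP n := signs (negP (lev n)) (size (levP n)).
Definition cfgD n := let l := levD n in zip l (signs (negD (lev n)) (size l)).
Definition cfgP n := let l := levP n in zip l (signs (negP (lev n)) (size l)).

Definition base_ok : bool :=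
  [&& wf_cells K O, dims_ok K O, top_ok K O & let v0 := vroot0 O in let w0 := wroot0 O in
   [&& nilp (lnorm (lmul P4 v0 ++ lopp (numV O))), nilp (lnorm (lmul P4 w0 ++ lopp (numW O))),
       size4 v0, size4 w0 & root_ok O v0 w0]].

(** The rays of the cells are compared with the mu_a on [0, K]^4; clamping extends the agreement to
    all boxes. *)
Definition mu_ok : bool :=
  all (fun a => all (fun k => farA K O k a == muP a k) (kbox (krange 0 K.+1))) (iota 0%N 4%N).

(** Checks the vanishing sums together with the side conditions of the reduction: no trivial
    brackets, y-degree n, and n + 1 different values of y. *)
Definition level_ok (P : seq (seq (seq key * bool))) (n : nat) : bool :=
  let D := cfgD n in
  [&& cfg_ok O D, all (cfg_ok O) P &
   let raw := idraw q0 D (nth [::] P) n in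
   all (fun t => keys_ok t.2) raw &&
   let ts := map (canon kpos) raw in
   let vts := points (lev n) in
   [&& all (yterm_ok n) ts, uniq (map fst vts), size vts == n.+1, all (fun vt => size vt.1 == 3%N) vts &
       all (fun vt => tree_ok (flatten (map (tspec vt.1) ts)) vt.2) vts]].

(** No signs are allowed at n = 0, so that both leading coefficients are the same root; N is at most
    4 because [mterms] is given up to order 3. *)
Definition cert_ok : bool :=
  [&& base_ok, mu_ok, (N <= 4)%N, negD (lev 0) == [::], negP (lev 0) == [::] &
   let P := map cfgP (iota 0%N N) in
   all (fun n => level_ok (take n.+1 P) n) (iota 0%N N)].

Section Sound.
Variables (R : realType) (mu : 'I_4 -> set box) (V0 : int -> halffun).
Hypothesis muE : forall (a : 'I_4) w, cylinder [set a]%SET (mu a) w <-> muP a (kv (vb w)).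
Hypothesis mu_clamp : forall a k, (a < 4)%N -> size k = 4%N -> muP a (kclamp (Z.of_nat K) k) = muP a k.
Hypothesis V0E : forall n : nat, V0 n%:Z = magnificent_series n.

Lemma cert_Zmu : wf_cells K O -> dims_ok K O -> mu_ok -> is_Zmu R mu (pset O).
Proof.
move=> wfO dims mok; apply: (is_Zmu_pset wfO) => a w; rewrite muE.
rewrite -(farA_clamp wfO dims (size_kv (vb w)) (ltn_ord a)) -mu_clamp // ?ltn_ord //.
have ai : val a \in iota 0%N 4%N by rewrite mem_iota ltn_ord.
have /allP H := allP mok _ ai.
rewrite (eqP (H _ _)) //; apply/kboxP; rewrite size_kclamp; split=> // z /mapP[y yk ->].
apply/krangeP; apply: Zclamp_bounds; move: yk => /(nthP Z0)[j j4 <-].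
have := kv_nth (vb w) j4; rewrite vbE; move: (nth Z0 (kv (vb w)) j) => u ue.
by change (Z.le Z0 u); lia.
Qed.

Lemma cert_sound : cert_ok -> DT_PT0_mod R V0 mu N.
Proof.
case/and5P=> /and4P[wfO dims top]; set v0 := vroot0 O; set w0 := wroot0 O.
case/and5P=> /nilP Hv /nilP Hw sv sw rok mok N4 /eqP nD /andP[/eqP nP /allP ok].
have HZ := cert_Zmu wfO dims mok; have sq := size4_Q wfO.
have szs s m : size (signs s m) = m by rewrite size_map size_iota.
have sm0 : summand O v0 w0 ([::], false) = vroot O v0 w0 [::] by rewrite /summand expr0 mul1r.
apply: (@case_correspondence K O v0 w0 wfO dims top Hv Hw sv sw R mu HZ N sgD sgP) => //.
- by move=> n _; rewrite szs.
- by move=> n _; rewrite szs.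
- by rewrite /sumDT /sgD nD big_seq1.
- by rewrite /sumPT /sgP nP big_seq1.
- by rewrite (vroot_nil sv sw sq rok) (root0_neq0 rok).
move=> n nN; have nN' : n \in iota 0 N by rewrite mem_iota.
have /and3P[okD okP] := ok n nN'; set raw := idraw _ _ _ _; case/andP=> okr /and5P[oky uv sv' s3 trees].
have n3 : (n <= 3)%N by rewrite -ltnS; apply: leq_trans N4.
have nthP k : (k <= n)%N -> nth [::] (take n.+1 (map cfgP (iota 0%N N))) k = cfgP k.
  move=> kn; rewrite nth_take // (nth_map 0%N) ?size_iota ?nth_iota //; exact: leq_ltn_trans nN.
have okPk k : (k <= n)%N -> cfg_ok O (cfgP k).
  move=> kn; rewrite -nthP //; apply: (allP okP); apply: mem_nth.
  by rewrite size_take size_map size_iota; case: ifP => // _; apply: leq_ltn_trans nN.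
have er : raw = idraw q0 (cfgD n) cfgP n.
  rewrite /raw /idraw; congr (_ ++ flatten _); apply/eq_in_map => k; rewrite mem_iota => /andP[_ kn].
  by rewrite nthP.
have sum0 : tsum H4 (idterms q0 (cfgD n) cfgP n) = 0.
  rewrite /idterms -er; apply: (eliminate_yhalf oky uv); first by rewrite size_map (eqP sv').
    by rewrite all_map.
  elim: (points _) trees => //= -[v t] vts IH /andP[ok_t /IH{}IH] v'; rewrite inE => /orP[/eqP ->|]; last exact: IH.
  exact: tree_ok_sound ok_t.
rewrite er in okr; rewrite /sumDT (sum_identity sv sw sq rok n3 okD okPk okr sum0).
by apply: eq_bigr => k _; congr (_ * _); apply/esym/V0E.
Qed.
End Sound.
End Certificate.

(** * The partitions mu_a *)

Section Mu.
Variable K : nat.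

Lemma incell_fixed u k : size u = size k -> incell (map (fun z => (false, z)) u) k = (u == k).
Proof.
elim: u k => [|y u IH] [|z k] //= [sz]; by rewrite eqseq_cons IH.
Qed.

Definition natkey (u : key) : bool := (size u == 4%N) && all (Z.leb Z0) u.
Definition bxk (u : key) : box := bx (vk u).

Definition boxcells (l : seq key) : seq (seq (bool * Z)) := map (map (fun z => (false, z))) l.
Definition raycell (i : nat) : seq (bool * Z) := map (fun j => (j == i, Z0)) (iota 0%N 4%N).

Lemma boxcellsP l w : all natkey l -> boxes (map bxk l) w <-> inp (boxcells l) (kv (vb w)).
Proof.
move=> /allP nl; split=> [/mapP[u ul ->]|/inpP[c /mapP[u ul ->]]].
  have /andP[/eqP su /allP u0] := nl u ul; rewrite bxK ?vkK //; last first.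
    by apply/nnP => i; rewrite vkE; have := u0 (nth Z0 u i); rewrite mem_nth ?su // => /(_ isT); lia.
  apply/inpP; exists (map (fun z => (false, z)) u); first exact: map_f.
  by rewrite incell_fixed // eqxx.
have /andP[/eqP su _] := nl u ul; rewrite incell_fixed // => /eqP e.
by rewrite /boxes /=; apply/mapP; exists u; rewrite // e /bxk kvK vbK.
Qed.

Lemma raycellP (i : 'I_4) w : ray i w <-> inp [:: raycell i] (kv (vb w)).
Proof.
have E j : (j < 4)%N -> nth (false, Z0) (raycell i) j = (j == val i, Z0).
  by move=> j4; rewrite (nth_map 0%N) ?size_iota // nth_iota.
split=> [[n ->]|/inpP[c]].
  apply/inpP; exists (raycell i); rewrite ?mem_head //; apply/incellP => // j j4; rewrite E //=.
  have := kv_nth (vb (U_(i) *+ n)%MM) j4; rewrite vbE mulmnE mnm1E -val_eqE /= inordK // eq_sym.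
  by case: eqP => _; lia.
rewrite inE => /eqP -> /incellP H; exists (w i); apply/mnmP => j; rewrite mulmnE mnm1E.
have := H erefl j; rewrite size_map size_iota ltn_ord E ?ltn_ord // => /(_ isT) /=; have := kvE (vb w) j; rewrite vbE.
rewrite eq_sym val_eqE; case: eqP => [->|_]; first by rewrite mul1n.
by rewrite mul0n; lia.
Qed.

Lemma inp_cat A B k : inp (A ++ B) k = inp A k || inp B k.
Proof. by elim: A => //= c A ->; case: ifP. Qed.

Lemma kv_erase1 (a : 'I_4) w : kv (vb (erase [set a]%SET w)) = setk (kv (vb w)) a Z0.
Proof.
rewrite -(kv_setw _ _ Z0); congr kv; apply/rowP => j; rewrite vbE setwE vbE mnmE inE.
by case: eqP.
Qed.
Lemma kv_erase2 (a b : 'I_4) w : kv (vb (erase [set a; b]%SET w)) = setk (setk (kv (vb w)) a Z0) b Z0.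
Proof.
rewrite -!(kv_setw _ _ Z0); congr kv; apply/rowP => j; rewrite vbE !setwE vbE mnmE !inE.
by case: (j == b); case: (j == a).
Qed.

Lemma setk_clamp k a : size k = 4%N -> (a < 4)%N -> setk (kclamp (Z.of_nat K) k) a Z0 = kclamp (Z.of_nat K) (setk k a Z0).
Proof.
move=> sk a4; apply: (@eq_from_nth _ Z0); rewrite ?size_setk !size_kclamp ?size_setk ?sk // => j j4.
rewrite nth_setk ?size_kclamp ?sk // nth_kclamp ?sk // nth_kclamp ?size_setk ?sk // nth_setk ?sk //.
by case: eqP => _; lia.
Qed.

Definition muP_planes (M : seq (seq (seq (bool * Z)))) (a : nat) (k : key) : bool :=
  inp (nth [::] M a) (setk k a Z0).

Lemma planesP (M : seq (seq (seq (bool * Z)))) (m1 m2 m3 m4 : set box) (a : 'I_4) w :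
  (forall v, m1 v <-> inp (nth [::] M 0) (kv (vb v))) -> (forall v, m2 v <-> inp (nth [::] M 1) (kv (vb v))) ->
  (forall v, m3 v <-> inp (nth [::] M 2) (kv (vb v))) -> (forall v, m4 v <-> inp (nth [::] M 3) (kv (vb v))) ->
  cylinder [set a]%SET (planes m1 m2 m3 m4 a) w <-> muP_planes M a (kv (vb w)).
Proof.
move=> h1 h2 h3 h4; rewrite /muP_planes -kv_erase1 /cylinder /planes.
by elim/ord4P: a => /=.
Qed.

Lemma planes_clamp M a k : all (bounded_cells K) M -> (a < 4)%N -> size k = 4%N ->
  muP_planes M a (kclamp (Z.of_nat K) k) = muP_planes M a k.
Proof.
move=> bM a4 sk; rewrite /muP_planes setk_clamp // inp_clampW ?size_setk //.
by have [lt|ge] := ltnP a (size M); [apply: (allP bM); apply: mem_nth|rewrite nth_default].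
Qed.

Definition kleg (L : seq (seq key)) (a b : nat) : seq key :=
  match minn a b, maxn a b with
  | 0, 1 => nth [::] L 0 | 0, 2 => nth [::] L 1 | 0, 3 => nth [::] L 2
  | 1, 2 => nth [::] L 3 | 1, 3 => nth [::] L 4 | 2, 3 => nth [::] L 5
  | _, _ => [::]
  end%N.
Definition muP_min (L : seq (seq key)) (a : nat) (k : key) : bool :=
  has (fun b => (b != a) && inp (boxcells (kleg L a b)) (setk (setk k a Z0) b Z0)) (iota 0%N 4%N).

Lemma mu_minP (L : seq (seq key)) (a : 'I_4) w : all (all natkey) L ->
  let l i := map bxk (nth [::] L i) in
  cylinder [set a]%SET (mu_min (legs (l 0%N) (l 1%N) (l 2%N) (l 3%N) (l 4%N) (l 5%N)) a) w <-> muP_min L a (kv (vb w)).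
Proof.
move=> nL l; have nl i : all natkey (nth [::] L i).
  by have [lt|ge] := ltnP i (size L); [apply: (allP nL); apply: mem_nth|rewrite nth_default].
have nk b c : all natkey (kleg L b c).
  by rewrite /kleg; case: (minn b c) => [|[|[|m]]]; case: (maxn b c) => [|[|[|[|p]]]].
have E (b : 'I_4) : legs (l 0%N) (l 1%N) (l 2%N) (l 3%N) (l 4%N) (l 5%N) a b = boxes (map bxk (kleg L a b)).
  by rewrite /legs /kleg; case: (minn a b) => [|[|[|m]]]; case: (maxn a b) => [|[|[|[|p]]]].
have er (b : 'I_4) v : erase [set a; b]%SET (erase [set a]%SET v) = erase [set a; b]%SET v.
  by apply/mnmP => j; rewrite !mnmE !inE; case: eqP.
split=> [[_ [b ba]]|/hasP[b]].
  rewrite E /cylinder /= er => /(boxcellsP _ (nk a b)); rewrite kv_erase2 => H.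
  by apply/hasP; exists (val b); rewrite ?mem_iota ?ltn_ord //= H andbT val_eqE.
rewrite mem_iota => b4 /andP[ba H]; split; first by rewrite mnmE inE eqxx.
exists (Ordinal b4); first by rewrite -val_eqE.
by rewrite E /cylinder /= er; apply/(boxcellsP _ (nk a _)); rewrite kv_erase2.
Qed.

Lemma mu_min_clamp L a k : all (fun l => bounded_cells K (boxcells l)) L -> (a < 4)%N -> size k = 4%N ->
  muP_min L a (kclamp (Z.of_nat K) k) = muP_min L a k.
Proof.
move=> bL a4 sk; have bl i : bounded_cells K (boxcells (nth [::] L i)).
  by have [lt|ge] := ltnP i (size L); [apply: (allP bL); apply: mem_nth|rewrite nth_default].
have bk b c : bounded_cells K (boxcells (kleg L b c)).
  by rewrite /kleg; case: (minn b c) => [|[|[|m]]]; case: (maxn b c) => [|[|[|[|p]]]].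
apply: eq_in_has => b; rewrite mem_iota => /andP[_ b4].
by rewrite !setk_clamp ?size_setk // inp_clampW ?size_setk.
Qed.

End Mu.

Lemma bxk_mone : mone = bxk [:: 0; 0; 0; 0]%zz.
Proof. by apply/mnmP => i; rewrite bxE vkE mnm0E; elim/ord4P: i. Qed.
Lemma bxk_t3 : t3 = bxk [:: 0; 0; 1; 0]%zz.
Proof. by apply/mnmP => i; rewrite bxE vkE mnm1E; elim/ord4P: i. Qed.
Lemma bxk_t4 : t4 = bxk [:: 0; 0; 0; 1]%zz.
Proof. by apply/mnmP => i; rewrite bxE vkE mnm1E; elim/ord4P: i. Qed.
Lemma bxk_t23 : (t2 + t3)%MM = bxk [:: 0; 1; 1; 0]%zz.
Proof. by apply/mnmP => i; rewrite bxE vkE mnmDE !mnm1E; elim/ord4P: i. Qed.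
Lemma bxk_t33 : (t3 + t3)%MM = bxk [:: 0; 0; 2; 0]%zz.
Proof. by apply/mnmP => i; rewrite bxE vkE mnmDE !mnm1E; elim/ord4P: i. Qed.

Lemma cert_min K O L cert (R : realType) (V0 : int -> halffun) : (forall n : nat, V0 n%:Z = magnificent_series n) ->
  all (all natkey) L && all (fun l => bounded_cells K (boxcells l)) L && cert_ok K O (muP_min L) cert ->
  let l i := map bxk (nth [::] L i) in
  DT_PT0_mod R V0 (mu_min (legs (l 0%N) (l 1%N) (l 2%N) (l 3%N) (l 4%N) (l 5%N))) (size cert).
Proof.
move=> V0E /andP[/andP[nL bL] ok] l.
apply: (@cert_sound K O _ cert R _ V0 _ _ V0E ok) => [a w|a k a4 sk]; first exact: mu_minP.
exact: mu_min_clamp.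
Qed.

Lemma cert_planes K O M cert (R : realType) (V0 : int -> halffun) (m1 m2 m3 m4 : set box) :
  (forall n : nat, V0 n%:Z = magnificent_series n) ->
  (forall v, m1 v <-> inp (nth [::] M 0) (kv (vb v))) -> (forall v, m2 v <-> inp (nth [::] M 1) (kv (vb v))) ->
  (forall v, m3 v <-> inp (nth [::] M 2) (kv (vb v))) -> (forall v, m4 v <-> inp (nth [::] M 3) (kv (vb v))) ->
  all (bounded_cells K) M && cert_ok K O (muP_planes M) cert ->
  DT_PT0_mod R V0 (planes m1 m2 m3 m4) (size cert).
Proof.
move=> V0E h1 h2 h3 h4 /andP[bM ok].
apply: (@cert_sound K O _ cert R _ V0 _ _ V0E ok) => [a w|a k a4 sk]; first exact: planesP.
exact: planes_clamp.
Qed.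

Lemma setU_cells (m m' : set box) A B : (forall v, m v <-> inp A (kv (vb v))) -> (forall v, m' v <-> inp B (kv (vb v))) ->
  forall v, (m `|` m') v <-> inp (A ++ B) (kv (vb v)).
Proof.
move=> hA hB v; rewrite inp_cat; split=> [[/hA ->//|/hB ->]|/orP[/hA|/hB]]; rewrite ?orbT //; [left|right] => //.
Qed.
Lemma set0_cells v : (set0 : set box) v <-> inp [::] (kv (vb v)).
Proof. by []. Qed.

(** * The fifteen cases *)

Coercion Lf : nat >-> mtree.
(** Stands for y = t_1^a t_2^b t_3^c. At (0, 0, 0) this is y = 1, where every term with a factor [y]
    vanishes; at (-1, -1, -1) it is y = t_4. *)
Definition pt (a b c : Z) : key := [:: a; b; c].
Arguments pt (a b c)%_Z_scope.

Section Cases.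
Variables (R : realType) (V0 : int -> halffun).
Hypothesis V0E : forall n : nat, V0 n%:Z = magnificent_series n.

(* The signs were found by solving the linear equations given by evaluation at random points of a finite field, the orders of summation by a greedy search. *)
Definition cells1 : seq (seq (bool * Z)) :=
  [:: [:: (true, 0); (true, 0); (false, 0); (false, 0)]]%zz.
Definition cert1 : seq level :=
 [:: Level [::] [::] [:: (pt 0 0 0, Nd 0 1 [::])];
  Level [::] [::]
    [:: (pt (-1) (-1) (-1), Nd 0 1 [::]);
        (pt 0 0 0, Nd 0 1 [::])];
  Level [:: 5; 6] [::]
    [:: (pt (-1) (-1) (-1), Nd 4 (Nd 1 (Nd 2 (Nd 0 (Nd 3 5 [:: 6]) [:: 0]) [:: 6; 7]) [:: 2; 6; 0; 3; 3; 7]) [::]);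
        (pt 0 0 1, Nd 4 (Nd 0 (Nd 1 (Nd 2 (Nd 3 5 [:: 0]) [:: 3]) [:: 3; 0]) [:: 7; 9; 6; 6; 0; 3]) [::]);
        (pt 0 0 0, Nd (Nd 2 6 [:: 9]) (Nd 3 (Nd (Nd 1 5 [:: 11]) (Nd 0 4 [:: 7]) [:: 11; 0]) [::]) [::])];
  Level [:: 5; 12; 13; 15; 16] [::]
    [:: (pt (-1) (-1) (-1), Nd 7 (Nd (Nd 1 2 [:: 5]) (Nd (Nd 4 5 [:: 10]) (Nd (Nd 9 (Nd 10 (Nd 6 8 [:: 6]) [::]) [:: 0; 2; 5]) (Nd 0 3 [:: 8]) [:: 1; 0]) [:: 13; 14; 10]) [::]) [::]);
        (pt 0 0 1, Nd 7 (Nd (Nd (Nd 9 (Nd 10 (Nd 6 8 [:: 0]) [::]) [:: 6; 0; 3]) (Nd 1 (Nd 2 4 [:: 4]) [:: 10; 12]) [:: 2; 0]) (Nd 0 (Nd 3 5 [:: 13; 4]) [:: 14; 10]) [:: 12; 11; 8; 7; 7; 9]) [::]);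
        (pt (-2) (-2) (-2), Nd (Nd (Nd 16 (Nd (Nd 17 19 [:: 6; 6]) (Nd 15 18 [::]) [:: 8; 0; 2; 5]) [:: 9; 0]) (Nd 6 (Nd 12 (Nd 7 9 [:: 3]) [:: 8; 7]) [:: 16; 17; 19; 13; 0]) [:: 2; 1]) (Nd (Nd 2 14 [::]) (Nd (Nd (Nd 1 13 [:: 12]) (Nd 0 10 [:: 18]) [:: 8]) (Nd (Nd 5 8 [:: 6; 14; 0]) (Nd 4 (Nd 3 11 [:: 17; 0]) [:: 20; 13]) [:: 18]) [:: 21; 20; 11; 15]) [::]) [::]);
        (pt 0 0 0, Nd (Nd 15 (Nd 5 18 [:: 19]) [:: 23; 0]) (Nd (Nd (Nd 3 8 [:: 11]) (Nd 1 9 [:: 11]) [:: 25]) (Nd (Nd (Nd 4 17 [:: 11]) (Nd 12 (Nd 2 14 [:: 6]) [:: 22; 0]) [:: 23; 7]) (Nd (Nd 0 6 [:: 21; 8; 0]) (Nd (Nd 7 16 [:: 0]) (Nd 10 (Nd 11 13 [:: 1]) [:: 17; 18; 14; 0; 2]) [:: 17; 12; 6; 5]) [:: 18; 17]) [:: 25; 5]) [::]) [::])]]%N.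

Lemma case1 : DT_PT0_mod R V0 (mu_min (legs [:: mone] [::] [::] [::] [::] [::])) 4%N.
Proof.
rewrite bxk_mone; apply: (@cert_min 1 cells1 [:: [:: [:: 0; 0; 0; 0]]]%zz cert1 R V0 V0E).
by vm_compute.
Qed.

Definition cells2 : seq (seq (bool * Z)) :=
  [:: [:: (true, 0); (true, 0); (false, 0); (false, 0)];
      [:: (true, 0); (true, 0); (false, 1); (false, 0)]]%zz.
Definition cert2 : seq level :=
 [:: Level [::] [::] [:: (pt 0 0 0, Nd 0 1 [::])];
  Level [::] [::]
    [:: (pt (-1) (-1) (-1), Nd 0 1 [::]);
        (pt 0 0 0, Nd 0 1 [::])];
  Level [:: 6; 7] [::]
    [:: (pt (-1) (-1) (-1), Nd 4 (Nd 1 (Nd 2 (Nd 0 (Nd 3 5 [:: 6]) [:: 0]) [:: 6; 7]) [:: 2; 6; 0; 3; 3; 7]) [::]);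
        (pt 0 0 2, Nd 5 (Nd (Nd 1 (Nd 4 6 [:: 0; 0]) [::]) (Nd 0 (Nd 2 3 [:: 6]) [:: 12; 14]) [:: 10; 9; 9; 1; 5; 2; 2; 6; 6]) [::]);
        (pt 0 0 0, Nd 0 (Nd (Nd 3 7 [:: 11]) (Nd (Nd 2 6 [:: 13; 0]) (Nd 4 (Nd 1 5 [:: 12]) [:: 13; 12; 0; 0]) [:: 13; 9; 4]) [::]) [::])]]%N.

Lemma case2 : DT_PT0_mod R V0 (mu_min (legs [:: mone; t3] [::] [::] [::] [::] [::])) 3%N.
Proof.
rewrite bxk_mone bxk_t3; apply: (@cert_min 2 cells2 [:: [:: [:: 0; 0; 0; 0]; [:: 0; 0; 1; 0]]]%zz cert2 R V0 V0E).
by vm_compute.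
Qed.

Definition cells3 : seq (seq (bool * Z)) :=
  [:: [:: (true, 0); (true, 0); (false, 0); (false, 0)];
      [:: (true, 0); (true, 0); (false, 1); (false, 0)];
      [:: (true, 0); (true, 0); (false, 0); (false, 1)]]%zz.
Definition cert3 : seq level :=
 [:: Level [::] [::] [:: (pt 0 0 0, Nd 0 1 [::])];
  Level [::] [::]
    [:: (pt 0 0 2, Nd 2 (Nd 0 1 [:: 6]) [::]);
        (pt (-2) (-2) (-2), Nd 2 (Nd 0 1 [:: 6]) [::])];
  Level [:: 9; 10] [::]
    [:: (pt 0 0 2, Nd (Nd 7 (Nd 6 8 [:: 0; 0]) [::]) (Nd 0 (Nd (Nd 2 5 [:: 9]) (Nd 3 (Nd 1 4 [:: 11]) [:: 12; 8; 10; 0; 1]) [:: 12; 2; 4; 5]) [:: 12; 7; 8; 10]) [::]);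
        (pt (-2) (-2) (-2), Nd 7 (Nd (Nd 3 (Nd 6 8 [:: 6; 6]) [:: 9; 0]) (Nd (Nd 1 5 [:: 10]) (Nd 2 (Nd 0 4 [:: 12]) [:: 13; 9; 11; 0; 2]) [:: 13; 4; 6]) [:: 10; 2; 6]) [::]);
        (pt (-1) (-1) 0, Nd (Nd 0 (Nd 4 (Nd 8 (Nd 7 9 [::]) [:: 5; 0; 2; 4]) [:: 1]) [:: 10]) (Nd 3 (Nd (Nd 1 5 [:: 15]) (Nd 2 6 [:: 15]) [:: 5]) [::]) [::])]]%N.

Lemma case3 : DT_PT0_mod R V0 (mu_min (legs [:: mone; t3; t4] [::] [::] [::] [::] [::])) 3%N.
Proof.
rewrite bxk_mone bxk_t3 bxk_t4; apply: (@cert_min 2 cells3 [:: [:: [:: 0; 0; 0; 0]; [:: 0; 0; 1; 0]; [:: 0; 0; 0; 1]]]%zz cert3 R V0 V0E).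
by vm_compute.
Qed.

(** The planes share the x_1-axis, which is counted with the first one; hence the corner at x_3 = 1.
    In every case [K] is the least bound above all corners. *)
Definition cells4 : seq (seq (bool * Z)) :=
  [:: [:: (true, 0); (true, 0); (false, 0); (false, 0)];
      [:: (true, 0); (false, 0); (true, 1); (false, 0)]]%zz.
Definition cert4 : seq level :=
 [:: Level [::] [::] [:: (pt 0 0 0, Nd 0 1 [::])];
  Level [::] [::]
    [:: (pt (-1) (-1) (-1), Nd 0 1 [::]);
        (pt 0 0 0, Nd 0 1 [::])];
  Level [:: 2; 6; 7] [::]
    [:: (pt (-1) (-1) (-1), Nd 4 (Nd 1 (Nd 2 (Nd 0 (Nd 3 5 [:: 6]) [:: 0]) [:: 6; 7]) [:: 2; 6; 0; 3; 3; 7]) [::]);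
        (pt 0 1 1, Nd 5 (Nd (Nd 4 6 [::]) (Nd 0 (Nd 2 (Nd 1 3 [:: 6]) [:: 2; 6]) [:: 9; 10; 12]) [:: 8; 8]) [::]);
        (pt 0 0 0, Nd (Nd 3 7 [:: 10]) (Nd (Nd 0 (Nd 1 5 [:: 14]) [:: 9]) (Nd 4 (Nd 2 6 [:: 14]) [:: 14; 11; 4; 2]) [::]) [::])]]%N.

Lemma case4 : DT_PT0_mod R V0 (mu_min (legs [:: mone] [:: mone] [::] [::] [::] [::])) 3%N.
Proof.
rewrite bxk_mone; apply: (@cert_min 2 cells4 [:: [:: [:: 0; 0; 0; 0]]; [:: [:: 0; 0; 0; 0]]]%zz cert4 R V0 V0E).
by vm_compute.
Qed.

(** The planes share the origin only; the second one without it is a union of two orthants. *)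
Definition cells5 : seq (seq (bool * Z)) :=
  [:: [:: (true, 0); (true, 0); (false, 0); (false, 0)];
      [:: (false, 0); (false, 0); (true, 1); (true, 0)];
      [:: (false, 0); (false, 0); (false, 0); (true, 1)]]%zz.
Definition cert5 : seq level :=
 [:: Level [::] [::] [:: (pt 0 0 0, Nd 0 1 [::])];
  Level [:: 3] [::]
    [:: (pt 0 0 0, Nd 3 (Nd 0 (Nd 1 2 [:: 3]) [::]) [::]);
        (pt (-1) 0 (-1), Nd 2 (Nd (Nd 0 4 [:: 2]) (Nd 1 3 [:: 6]) [::]) [::])];
  Level [:: 4; 8; 9; 10; 11] [::]
    [:: (pt 0 (-1) (-1), Nd (Nd (Nd 10 (Nd 11 (Nd 9 12 [::]) [::]) [:: 5; 0; 2; 4]) (Nd 5 (Nd 6 (Nd 7 8 [:: 5]) [:: 7; 12; 0; 2; 8]) [:: 14; 15]) [::]) (Nd (Nd 0 1 [:: 8]) (Nd 2 (Nd 3 4 [:: 2]) [:: 13; 14; 11; 0; 2]) [::]) [::]);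
        (pt (-1) 0 (-1), Nd (Nd (Nd 10 (Nd 11 (Nd 9 12 [::]) [::]) [:: 5; 0; 2; 4]) (Nd 2 (Nd 5 (Nd 0 1 [:: 2]) [:: 8; 9; 0; 2; 12]) [:: 5; 6]) [::]) (Nd (Nd 3 4 [:: 11]) (Nd 6 (Nd 7 8 [:: 5]) [:: 11; 15; 9; 0; 7]) [::]) [::]);
        (pt 0 1 1, Nd 6 (Nd (Nd 2 (Nd 3 4 [:: 13]) [:: 2; 11; 0]) (Nd (Nd 5 (Nd 7 8 [:: 3]) [:: 12; 14]) (Nd (Nd 10 (Nd 11 (Nd 9 12 [::]) [::]) [:: 5; 0; 2; 4]) (Nd 0 1 [:: 8]) [:: 3]) [:: 14; 9; 1]) [::]) [::])]]%N.

Lemma case5 : DT_PT0_mod R V0 (mu_min (legs [:: mone] [::] [::] [::] [::] [:: mone])) 3%N.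
Proof.
rewrite bxk_mone; apply: (@cert_min 2 cells5 [:: [:: [:: 0; 0; 0; 0]]; [::]; [::]; [::]; [::]; [:: [:: 0; 0; 0; 0]]]%zz cert5 R V0 V0E).
by vm_compute.
Qed.

Definition cells6 : seq (seq (bool * Z)) :=
  [:: [:: (true, 0); (true, 0); (false, 0); (false, 0)];
      [:: (true, 0); (false, 0); (true, 1); (false, 0)];
      [:: (false, 0); (true, 1); (true, 1); (false, 0)]]%zz.
Definition cert6 : seq level :=
 [:: Level [::] [::] [:: (pt 0 0 0, Nd 0 1 [::])];
  Level [::] [::]
    [:: (pt (-1) (-1) (-1), Nd 0 1 [::]);
        (pt 1 1 1, Nd 0 1 [::])];
  Level [:: 2; 3; 6; 7] [::]
    [:: (pt (-1) (-1) (-1), Nd 4 (Nd 1 (Nd 2 (Nd 0 (Nd 3 5 [:: 6]) [:: 0]) [:: 6; 7]) [:: 2; 6; 0; 3; 3; 7]) [::]);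
        (pt 1 1 1, Nd 5 (Nd (Nd 3 (Nd 4 6 [:: 6]) [:: 5]) (Nd 2 (Nd 0 1 [:: 9]) [:: 11; 2]) [:: 11; 5; 6; 7]) [::]);
        (pt 0 0 0, Nd (Nd 3 7 [:: 15]) (Nd (Nd 0 (Nd 1 5 [:: 15]) [:: 10]) (Nd 4 (Nd 2 6 [:: 15]) [:: 15; 12]) [::]) [::])]]%N.

Lemma case6 : DT_PT0_mod R V0 (mu_min (legs [:: mone] [:: mone] [::] [:: mone] [::] [::])) 3%N.
Proof.
rewrite bxk_mone; apply: (@cert_min 2 cells6 [:: [:: [:: 0; 0; 0; 0]]; [:: [:: 0; 0; 0; 0]]; [::]; [:: [:: 0; 0; 0; 0]]]%zz cert6 R V0 V0E).
by vm_compute.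
Qed.

Definition cells7 : seq (seq (bool * Z)) :=
  [:: [:: (true, 0); (true, 0); (false, 0); (false, 0)];
      [:: (true, 0); (false, 0); (true, 1); (false, 0)];
      [:: (true, 0); (false, 0); (false, 0); (true, 1)];
      [:: (false, 0); (true, 1); (true, 1); (false, 0)];
      [:: (false, 0); (true, 1); (false, 0); (true, 1)];
      [:: (false, 0); (false, 0); (true, 1); (true, 1)]]%zz.
Definition cert7 : seq level :=
 [:: Level [::] [::] [:: (pt 0 0 0, Nd 0 1 [::])];
  Level [:: 1] [::]
    [:: (pt 1 1 1, Nd 3 (Nd 0 (Nd 1 2 [:: 1]) [::]) [::]);
        (pt 0 (-1) 0, Nd 2 (Nd 1 (Nd 0 3 [::]) [::]) [::])];
  Level [:: 2; 3; 4; 6; 8; 13; 16; 17] [::]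
    [:: (pt 0 (-1) 0, Nd 4 (Nd 5 (Nd (Nd (Nd 14 (Nd 12 13 [:: 2]) [:: 3; 0; 2]) (Nd (Nd 7 (Nd 0 (Nd 2 (Nd 1 3 [:: 7]) [:: 7; 2; 3]) [:: 12; 10]) [:: 20; 11; 13; 14; 0; 2]) (Nd 6 11 [:: 11]) [:: 19; 13]) [::]) (Nd 10 (Nd 8 9 [:: 11]) [:: 14; 2; 3]) [::]) [::]) [::]);
        (pt (-1) 0 0, Nd 4 (Nd 6 (Nd (Nd (Nd 14 (Nd 12 13 [:: 4]) [:: 4; 0; 2]) (Nd (Nd 7 (Nd 0 (Nd 2 (Nd 1 3 [:: 2]) [:: 6; 7; 8]) [:: 16; 11]) [:: 20; 12; 5; 13; 0; 6]) (Nd 5 10 [:: 14]) [:: 16; 5]) [::]) (Nd 11 (Nd 8 9 [:: 11]) [:: 16; 7; 8]) [::]) [::]) [::]);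
        (pt 1 1 1, Nd (Nd (Nd 13 (Nd 12 14 [:: 6]) [:: 0; 2; 4]) (Nd 6 11 [:: 1]) [::]) (Nd (Nd 3 7 [:: 1]) (Nd (Nd 0 (Nd 4 9 [:: 1]) [::]) (Nd (Nd 2 10 [::]) (Nd 8 (Nd 1 5 [::]) [:: 2]) [:: 5; 2]) [:: 25; 19; 21; 15; 20]) [::]) [::])]]%N.

Lemma case7 : DT_PT0_mod R V0 (mu_min (legs [:: mone] [:: mone] [:: mone] [:: mone] [:: mone] [:: mone])) 3%N.
Proof.
rewrite bxk_mone; apply: (@cert_min 2 cells7 [:: [:: [:: 0; 0; 0; 0]]; [:: [:: 0; 0; 0; 0]]; [:: [:: 0; 0; 0; 0]]; [:: [:: 0; 0; 0; 0]]; [:: [:: 0; 0; 0; 0]]; [:: [:: 0; 0; 0; 0]]]%zz cert7 R V0 V0E).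
by vm_compute.
Qed.

Definition cells8 : seq (seq (bool * Z)) :=
  [:: [:: (true, 0); (true, 0); (false, 0); (false, 0)];
      [:: (false, 0); (false, 0); (true, 1); (true, 0)];
      [:: (false, 0); (false, 0); (false, 0); (true, 1)];
      [:: (false, 0); (true, 1); (true, 1); (false, 0)]]%zz.
Definition cert8 : seq level :=
 [:: Level [::] [::] [:: (pt 0 0 0, Nd 0 1 [::])];
  Level [:: 1] [::]
    [:: (pt 1 0 1, Nd 1 (Nd 0 2 [::]) [::]);
        (pt 0 (-1) (-1), Nd 2 (Nd 0 1 [::]) [::])];
  Level [:: 2; 3; 4; 5; 7; 9; 10] [::]
    [:: (pt 1 0 1, Nd (Nd 7 (Nd 6 8 [::]) [::]) (Nd (Nd 3 (Nd 4 5 [:: 9]) [:: 3; 10; 11; 1; 7]) (Nd 0 (Nd 1 2 [:: 2]) [:: 12; 13]) [:: 5; 6; 13; 7]) [::]);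
        (pt (-1) 0 (-1), Nd (Nd 7 (Nd 6 8 [::]) [::]) (Nd (Nd 2 (Nd 0 1 [:: 8]) [:: 14; 3; 7; 4]) (Nd 4 (Nd 3 5 [:: 6]) [:: 2; 6]) [:: 10; 11; 13; 9]) [::]);
        (pt 0 (-1) (-1), Nd (Nd 0 (Nd 8 (Nd 7 9 [::]) [:: 5; 0; 2; 4]) [:: 9]) (Nd (Nd 6 (Nd 1 4 [:: 15]) [:: 6]) (Nd 3 (Nd 2 5 [:: 15]) [:: 11; 14; 2]) [::]) [::])]]%N.

Lemma case8 : DT_PT0_mod R V0 (mu_min (legs [:: mone] [::] [::] [:: mone] [::] [:: mone])) 3%N.
Proof.
rewrite bxk_mone; apply: (@cert_min 2 cells8 [:: [:: [:: 0; 0; 0; 0]]; [::]; [::]; [:: [:: 0; 0; 0; 0]]; [::]; [:: [:: 0; 0; 0; 0]]]%zz cert8 R V0 V0E).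
by vm_compute.
Qed.

(** From the last plane the x_3-axis and the boxes 1 and t_4 already belong to the other cells. *)
Definition cells9 : seq (seq (bool * Z)) :=
  [:: [:: (true, 0); (true, 0); (false, 0); (false, 0)];
      [:: (true, 0); (true, 0); (false, 0); (false, 1)];
      [:: (true, 0); (false, 0); (true, 1); (false, 0)];
      [:: (false, 0); (false, 0); (true, 1); (true, 1)];
      [:: (false, 0); (false, 0); (false, 0); (true, 2)]]%zz.
Definition cert9 : seq level :=
 [:: Level [::] [::] [:: (pt 0 0 0, Nd 0 1 [::])];
  Level [::] [::]
    [:: (pt 0 1 1, Nd (Nd 2 4 [:: 2]) (Nd 1 (Nd 0 3 [:: 1]) [::]) [::]);
        (pt 0 (-1) 0, Nd (Nd 3 4 [::]) (Nd 1 (Nd 0 2 [:: 1]) [::]) [::])];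
  Level [:: 5; 6; 15] [::]
    [:: (pt 0 1 1, Nd (Nd 0 1 [:: 8]) (Nd (Nd 4 (Nd 2 3 [:: 1; 7; 0; 4]) [:: 14; 10]) (Nd (Nd 10 (Nd 11 (Nd 9 12 [::]) [::]) [:: 5; 0; 2; 4]) (Nd 5 (Nd 7 (Nd 6 8 [:: 14; 8; 0; 6]) [:: 10; 5]) [:: 13; 15]) [::]) [::]) [::]);
        (pt (-2) (-1) (-2), Nd (Nd 2 (Nd 12 (Nd 13 (Nd 11 14 [::]) [::]) [:: 5; 2]) [::]) (Nd (Nd 3 (Nd 0 7 [:: 11]) [:: 19]) (Nd (Nd 5 (Nd 6 (Nd 8 10 [:: 15; 9; 0; 7]) [:: 1]) [:: 15; 13]) (Nd 4 (Nd 1 9 [::]) [:: 16; 15; 12; 3]) [:: 6; 13]) [::]) [::]);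
        (pt (-1) (-2) (-2), Nd (Nd (Nd 12 (Nd 13 (Nd 11 14 [::]) [::]) [:: 5; 0; 2; 4]) (Nd 7 (Nd 0 1 [:: 6]) [:: 14; 8]) [:: 10]) (Nd 2 (Nd (Nd 4 9 [:: 7; 14]) (Nd (Nd 6 10 [:: 3]) (Nd 5 (Nd 3 8 [::]) [:: 6; 12]) [:: 6; 12; 16; 7; 9]) [:: 11; 6; 10; 2; 7]) [::]) [::])]]%N.

Lemma case9 : DT_PT0_mod R V0 (mu_min (legs [:: mone; t4] [:: mone] [::] [::] [::] [:: mone])) 3%N.
Proof.
rewrite bxk_mone bxk_t4; apply: (@cert_min 3 cells9 [:: [:: [:: 0; 0; 0; 0]; [:: 0; 0; 0; 1]]; [:: [:: 0; 0; 0; 0]]; [::]; [::]; [::]; [:: [:: 0; 0; 0; 0]]]%zz cert9 R V0 V0E).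
by vm_compute.
Qed.

(** The last plane without the boxes 1 and t_3, which belong to the first two cells, splits into
    three orthants. *)
Definition cells10 : seq (seq (bool * Z)) :=
  [:: [:: (true, 0); (true, 0); (false, 0); (false, 0)];
      [:: (true, 0); (true, 0); (false, 1); (false, 0)];
      [:: (false, 0); (false, 0); (true, 2); (true, 0)];
      [:: (false, 0); (false, 0); (false, 1); (true, 1)];
      [:: (false, 0); (false, 0); (false, 0); (true, 1)]]%zz.
Definition cert10 : seq level :=
 [:: Level [::] [::] [:: (pt 0 0 0, Nd 0 1 [::])];
  Level [:: 3] [::]
    [:: (pt 0 0 1, Nd 3 (Nd 0 (Nd 4 (Nd 1 2 [:: 3]) [::]) [::]) [::]);
        (pt 0 (-1) (-1), Nd 1 (Nd 2 (Nd 3 (Nd 0 4 [:: 3]) [:: 4]) [::]) [::])];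
  Level [:: 5; 10; 11; 12; 13] [::]
    [:: (pt 0 (-1) (-1), Nd 3 (Nd (Nd (Nd (Nd 9 (Nd 7 8 [:: 7; 0; 2; 9]) [:: 12; 7]) (Nd 4 5 [:: 2]) [:: 4; 5; 6]) (Nd 12 (Nd 11 (Nd 14 (Nd 10 13 [:: 0]) [::]) [::]) [:: 7; 0; 2; 4]) [:: 6; 5; 11]) (Nd 6 (Nd 0 (Nd 1 2 [:: 1]) [:: 8; 10]) [:: 19; 12; 13; 6]) [::]) [::]);
        (pt (-1) 0 (-1), Nd (Nd 2 (Nd 10 13 [::]) [:: 0]) (Nd (Nd 1 (Nd 0 6 [:: 8; 0; 3; 11]) [:: 9; 2]) (Nd (Nd 11 12 [:: 5; 0; 2; 4]) (Nd (Nd 8 (Nd 7 9 [:: 15; 0; 6]) [:: 13; 7]) (Nd 3 (Nd 4 (Nd 5 14 [:: 0]) [:: 0; 6]) [:: 9; 13]) [:: 18; 13; 3; 12]) [:: 15; 14]) [::]) [::]);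
        (pt 0 1 2, Nd (Nd 7 (Nd 12 (Nd 15 (Nd 11 14 [:: 0]) [::]) [::]) [::]) (Nd (Nd 0 (Nd 1 2 [:: 1]) [:: 10; 11]) (Nd (Nd 3 13 [::]) (Nd (Nd 4 5 [:: 11]) (Nd (Nd 6 10 [::]) (Nd 8 9 [:: 11; 0]) [:: 18; 4; 7]) [:: 18; 10; 16; 6]) [:: 3; 4; 8; 12; 14; 9]) [::]) [::])]]%N.

Lemma case10 : DT_PT0_mod R V0 (mu_min (legs [:: mone; t3] [::] [::] [::] [::] [:: mone])) 3%N.
Proof.
rewrite bxk_mone bxk_t3; apply: (@cert_min 3 cells10 [:: [:: [:: 0; 0; 0; 0]; [:: 0; 0; 1; 0]]; [::]; [::]; [::]; [::]; [:: [:: 0; 0; 0; 0]]]%zz cert10 R V0 V0E).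
by vm_compute.
Qed.

Definition cells11 : seq (seq (bool * Z)) :=
  [:: [:: (true, 0); (true, 0); (false, 0); (false, 0)];
      [:: (true, 0); (false, 0); (false, 1); (false, 0)]]%zz.
Definition cert11 : seq level :=
 [:: Level [::] [::] [:: (pt 0 0 0, Nd 0 1 [::])];
  Level [:: 2] [::]
    [:: (pt (-1) (-1) (-1), Nd (Nd 2 3 [::]) (Nd 0 1 [::]) [::]);
        (pt 0 1 1, Nd 3 (Nd 1 (Nd 0 2 [:: 7; 1]) [::]) [::])];
  Level [:: 6; 7; 8] [::]
    [:: (pt (-1) (-1) (-1), Nd (Nd 6 (Nd 3 (Nd 4 9 [::]) [:: 5]) [::]) (Nd (Nd 0 1 [:: 6]) (Nd 2 (Nd 5 (Nd 7 8 [::]) [:: 6]) [::]) [:: 2; 7]) [::]);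
        (pt 0 0 2, Nd (Nd (Nd 3 (Nd 6 11 [::]) [:: 12; 5; 0]) (Nd 8 (Nd 9 (Nd 7 10 [::]) [:: 0; 0]) [:: 5; 0; 1; 4]) [::]) (Nd (Nd 5 (Nd 1 2 [:: 0]) [:: 11]) (Nd 0 4 [:: 15]) [:: 13]) [::]);
        (pt 0 1 1, Nd (Nd 8 (Nd 9 (Nd 7 10 [::]) [::]) [:: 6; 0; 2; 5]) (Nd 0 (Nd (Nd 4 (Nd 5 6 [:: 3]) [:: 12; 14; 0; 5]) (Nd (Nd 3 11 [:: 5; 0]) (Nd 1 2 [:: 0]) [:: 5; 6]) [:: 12; 5; 8; 11]) [::]) [::])];
  Level [:: 8; 15; 16; 18; 19; 20; 21; 22; 23; 28; 31; 32] [::]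
    [:: (pt (-1) (-1) (-1), Nd (Nd (Nd 4 5 [:: 0]) (Nd 6 (Nd 7 9 [:: 7]) [:: 7; 0; 2]) [:: 9; 2]) (Nd (Nd (Nd 2 20 [::]) (Nd 8 10 [:: 17; 2; 9]) [:: 7]) (Nd (Nd 12 (Nd (Nd 14 17 [::]) (Nd 11 (Nd (Nd 15 18 [::]) (Nd 13 (Nd 16 19 [::]) [:: 6]) [:: 3]) [:: 6]) [:: 0; 2]) [:: 0; 3]) (Nd 3 (Nd 0 1 [:: 8]) [:: 3; 9; 0; 6]) [:: 2; 1]) [::]) [::]);
        (pt 0 0 2, Nd (Nd (Nd 15 (Nd 16 17 [:: 9]) [:: 18; 11; 0]) (Nd (Nd (Nd (Nd 20 22 [:: 0; 0]) (Nd 23 25 [:: 0]) [:: 0]) (Nd 21 24 [:: 0]) [:: 7; 0; 1; 5]) (Nd 19 (Nd 27 (Nd 18 26 [:: 0]) [:: 4]) [:: 0]) [:: 6]) [::]) (Nd (Nd (Nd 4 14 [::]) (Nd 11 (Nd 3 10 [:: 11]) [:: 16; 1; 0]) [:: 18; 3; 12]) (Nd (Nd 8 (Nd 6 7 [:: 1]) [:: 21; 22; 0]) (Nd (Nd 12 13 [:: 6]) (Nd (Nd 0 9 [:: 23]) (Nd 2 (Nd 1 5 [:: 9]) [:: 1; 7]) [:: 15; 16; 20; 10; 11; 9]) [:: 23; 0]) [:: 5; 25; 21]) [::]) [::]);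
        (pt 0 1 1, Nd (Nd 19 (Nd (Nd 26 (Nd 18 23 [::]) [::]) (Nd (Nd 21 24 [::]) (Nd 22 (Nd 20 25 [::]) [::]) [:: 8; 0; 2; 6]) [::]) [:: 9; 0]) (Nd (Nd (Nd 2 (Nd 1 5 [:: 9]) [:: 1; 7]) (Nd 0 9 [:: 23; 0]) [:: 18; 21; 23; 4; 8; 11; 10]) (Nd (Nd (Nd 15 17 [:: 20; 0]) (Nd 13 (Nd 14 16 [:: 4]) [:: 16; 0]) [:: 16; 7; 8]) (Nd (Nd 7 (Nd 4 11 [:: 13]) [:: 9; 2]) (Nd (Nd 8 27 [:: 14]) (Nd (Nd 6 10 [:: 4; 13; 12; 0]) (Nd 3 12 [:: 14; 0]) [::]) [:: 8; 21]) [:: 14; 7; 23; 1; 11; 12; 13]) [:: 17; 24; 7; 12; 21; 23; 6]) [::]) [::]);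
        (pt (-2) (-2) (-2), Nd (Nd 16 (Nd (Nd 7 8 [:: 7; 6; 1]) (Nd 6 (Nd 5 10 [:: 21; 13]) [:: 23; 1]) [:: 17; 20; 9; 12]) [:: 18; 21; 1; 10; 0; 3; 3; 12]) (Nd (Nd (Nd 18 24 [:: 9; 3]) (Nd (Nd 11 (Nd 9 17 [:: 3; 6]) [:: 9; 0]) (Nd 12 19 [:: 16; 0]) [:: 21; 11]) [:: 13; 3; 11; 4]) (Nd (Nd (Nd 28 (Nd (Nd 33 35 [:: 11; 8]) (Nd (Nd 32 34 [:: 7; 7]) (Nd (Nd 27 31 [:: 6; 6; 6]) (Nd 29 30 [:: 8]) [:: 8; 0; 2]) [:: 6]) [::]) [:: 11; 0; 8]) (Nd 3 (Nd (Nd 4 36 [:: 18]) (Nd 2 15 [:: 18]) [:: 8; 20; 0]) [:: 19; 13]) [:: 13; 4]) (Nd (Nd 23 26 [:: 24]) (Nd (Nd 20 (Nd 25 (Nd 21 22 [:: 8; 0]) [:: 8; 13]) [:: 19; 21; 2]) (Nd (Nd 0 13 [:: 11; 1]) (Nd 1 14 [:: 16; 0; 2]) [:: 18; 0]) [:: 22]) [:: 27; 28; 24; 2; 16]) [:: 12; 5; 11; 13; 18]) [::]) [::])]]%N.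

Lemma case11 : DT_PT0_mod R V0 (planes (ray i2 `|` boxes [:: t3]) (ray i1) set0 set0) 4%N.
Proof.
rewrite bxk_t3; apply: (@cert_planes 2 cells11 [:: [:: raycell i2] ++ boxcells [:: [:: 0; 0; 1; 0]]; [:: raycell i1]; [::]; [::]]%zz cert11 R V0 _ _ _ _ V0E).
- apply: setU_cells => v; [exact: raycellP|exact: (@boxcellsP [:: [:: 0; 0; 1; 0]]%zz v isT)].
- exact: raycellP.
- exact: set0_cells.
- exact: set0_cells.
by vm_compute.
Qed.

Definition cells12 : seq (seq (bool * Z)) :=
  [:: [:: (true, 0); (true, 0); (false, 0); (false, 0)];
      [:: (true, 0); (false, 0); (false, 1); (false, 0)];
      [:: (true, 0); (false, 1); (false, 1); (false, 0)]]%zz.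
Definition cert12 : seq level :=
 [:: Level [::] [::] [:: (pt 0 0 0, Nd 0 1 [::])];
  Level [:: 2] [::]
    [:: (pt (-1) (-1) (-1), Nd 2 (Nd 1 (Nd 0 3 [:: 5]) [::]) [::]);
        (pt 0 0 2, Nd 3 (Nd 1 (Nd 0 2 [:: 8; 0]) [::]) [::])];
  Level [:: 6; 7; 8; 9] [::]
    [:: (pt (-1) (-1) (-1), Nd (Nd 7 (Nd 8 (Nd 6 9 [:: 7]) [::]) [:: 0; 2; 5]) (Nd (Nd 3 (Nd 4 5 [:: 5]) [:: 7; 11; 2; 9]) (Nd (Nd 2 (Nd 10 11 [::]) [:: 9; 1]) (Nd 0 1 [:: 2; 3]) [:: 7; 9]) [::]) [::]);
        (pt 0 0 2, Nd 0 (Nd (Nd 3 (Nd 8 (Nd (Nd 9 (Nd 7 10 [::]) [:: 0; 0]) (Nd 11 12 [:: 5]) [:: 5]) [:: 7; 0; 1]) [:: 6]) (Nd (Nd 1 2 [:: 1; 0]) (Nd 4 (Nd 5 6 [:: 3]) [:: 12; 14; 0; 1; 5]) [:: 13; 14]) [::]) [::]);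
        (pt 0 2 1, Nd (Nd (Nd 1 5 [:: 17]) (Nd 9 (Nd 11 (Nd 8 10 [::]) [::]) [:: 7; 0; 2; 6]) [:: 1]) (Nd (Nd 0 (Nd 2 (Nd 6 13 [::]) [:: 13; 4]) [:: 13]) (Nd 4 (Nd 3 (Nd 7 12 [:: 15]) [:: 5; 14]) [:: 18; 3; 8]) [::]) [::])]]%N.

Lemma case12 : DT_PT0_mod R V0 (planes (ray i2 `|` boxes [:: t3; (t2 + t3)%MM]) (ray i1) set0 set0) 3%N.
Proof.
rewrite bxk_t23 bxk_t3; apply: (@cert_planes 2 cells12 [:: [:: raycell i2] ++ boxcells [:: [:: 0; 0; 1; 0]; [:: 0; 1; 1; 0]]; [:: raycell i1]; [::]; [::]]%zz cert12 R V0 _ _ _ _ V0E).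
- apply: setU_cells => v; [exact: raycellP|exact: (@boxcellsP [:: [:: 0; 0; 1; 0]; [:: 0; 1; 1; 0]]%zz v isT)].
- exact: raycellP.
- exact: set0_cells.
- exact: set0_cells.
by vm_compute.
Qed.

Definition cells13 : seq (seq (bool * Z)) :=
  [:: [:: (true, 0); (true, 0); (false, 0); (false, 0)];
      [:: (true, 0); (false, 0); (false, 1); (false, 0)];
      [:: (true, 0); (false, 0); (false, 2); (false, 0)]]%zz.
Definition cert13 : seq level :=
 [:: Level [::] [::] [:: (pt 0 0 0, Nd 0 1 [::])];
  Level [:: 2] [::]
    [:: (pt (-1) (-1) (-1), Nd 2 (Nd 0 (Nd 1 3 [:: 6]) [::]) [::]);
        (pt 0 1 1, Nd 3 (Nd 1 (Nd 0 2 [:: 7; 1]) [::]) [::])];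
  Level [:: 6; 7; 8] [::]
    [:: (pt (-1) (-1) (-1), Nd (Nd 7 (Nd 8 (Nd 6 9 [:: 7]) [::]) [:: 0; 2; 4]) (Nd (Nd 2 (Nd 0 1 [:: 6]) [:: 2; 8; 0; 9]) (Nd (Nd 5 (Nd 10 11 [::]) [:: 10; 0]) (Nd 3 4 [:: 2; 0]) [:: 6; 7]) [::]) [::]);
        (pt 0 1 1, Nd (Nd 8 (Nd 9 (Nd 7 10 [::]) [::]) [:: 6; 0; 2; 5]) (Nd 0 (Nd (Nd 4 (Nd 5 6 [:: 3]) [:: 12; 14; 0; 5]) (Nd (Nd 3 (Nd 11 12 [::]) [:: 5; 0]) (Nd 1 2 [:: 1; 0]) [:: 5; 6]) [:: 13; 5; 8; 12]) [::]) [::]);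
        (pt 0 0 3, Nd (Nd (Nd 12 13 [:: 4; 0]) (Nd 11 (Nd 8 10 [::]) [:: 0; 0]) [:: 4]) (Nd (Nd (Nd 5 6 [:: 1; 0]) (Nd 7 9 [:: 1; 0]) [:: 2; 3]) (Nd (Nd 3 (Nd 1 2 [:: 1]) [:: 7; 8]) (Nd 0 4 [:: 17; 0]) [:: 12; 13; 18; 7]) [::]) [::])]]%N.

Lemma case13 : DT_PT0_mod R V0 (planes (ray i2 `|` boxes [:: t3; (t3 + t3)%MM]) (ray i1) set0 set0) 3%N.
Proof.
rewrite bxk_t33 bxk_t3; apply: (@cert_planes 3 cells13 [:: [:: raycell i2] ++ boxcells [:: [:: 0; 0; 1; 0]; [:: 0; 0; 2; 0]]; [:: raycell i1]; [::]; [::]]%zz cert13 R V0 _ _ _ _ V0E).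
- apply: setU_cells => v; [exact: raycellP|exact: (@boxcellsP [:: [:: 0; 0; 1; 0]; [:: 0; 0; 2; 0]]%zz v isT)].
- exact: raycellP.
- exact: set0_cells.
- exact: set0_cells.
by vm_compute.
Qed.

Definition cells14 : seq (seq (bool * Z)) :=
  [:: [:: (true, 0); (true, 0); (false, 0); (false, 0)];
      [:: (false, 0); (false, 0); (true, 1); (false, 0)]]%zz.
Definition cert14 : seq level :=
 [:: Level [::] [::] [:: (pt 0 0 0, Nd 0 1 [::])];
  Level [:: 2] [::]
    [:: (pt (-1) (-1) (-1), Nd (Nd 2 3 [::]) (Nd 0 1 [::]) [::]);
        (pt 1 0 1, Nd 3 (Nd 1 (Nd 0 2 [:: 6; 3]) [::]) [::])];
  Level [:: 2; 6; 7; 8] [::]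
    [:: (pt (-1) (-1) (-1), Nd (Nd 6 (Nd 1 (Nd 0 9 [::]) [:: 2]) [::]) (Nd (Nd 3 4 [:: 5]) (Nd 2 (Nd 5 (Nd 7 8 [::]) [:: 6]) [::]) [:: 7; 10]) [::]);
        (pt 1 0 1, Nd 3 (Nd (Nd 8 (Nd 7 (Nd 9 10 [::]) [::]) [:: 0; 2; 4]) (Nd 0 (Nd (Nd 5 (Nd 1 11 [:: 7]) [:: 11]) (Nd 4 (Nd 2 6 [:: 14; 10]) [:: 14; 2]) [:: 13; 2; 0]) [:: 14; 10; 11]) [::]) [::]);
        (pt 0 1 1, Nd 2 (Nd (Nd 8 (Nd 7 (Nd 9 10 [::]) [::]) [:: 0; 2; 4]) (Nd 0 (Nd (Nd 5 (Nd 1 11 [:: 7]) [:: 11]) (Nd 4 (Nd 3 6 [:: 14; 8]) [:: 14; 5]) [:: 13; 6; 0]) [:: 14; 8; 12]) [::]) [::])]]%N.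

Lemma case14 : DT_PT0_mod R V0 (planes (ray i2) (ray i1) (boxes [:: mone]) set0) 3%N.
Proof.
rewrite bxk_mone; apply: (@cert_planes 2 cells14 [:: [:: raycell i2]; [:: raycell i1]; boxcells [:: [:: 0; 0; 0; 0]]; [::]]%zz cert14 R V0 _ _ _ _ V0E).
- exact: raycellP.
- exact: raycellP.
- move=> v; exact: (@boxcellsP [:: [:: 0; 0; 0; 0]]%zz v isT).
- exact: set0_cells.
by vm_compute.
Qed.

(** The x_3-axis starts at x_3 = 2, since its boxes 1 and t_3 lie in the first two cells. *)
Definition cells15 : seq (seq (bool * Z)) :=
  [:: [:: (true, 0); (true, 0); (false, 0); (false, 0)];
      [:: (true, 0); (false, 0); (false, 1); (false, 0)];
      [:: (false, 0); (true, 0); (false, 0); (false, 1)];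
      [:: (false, 0); (false, 0); (true, 2); (false, 0)]]%zz.
Definition cert15 : seq level :=
 [:: Level [::] [::] [:: (pt 0 0 0, Nd 0 1 [::])];
  Level [:: 4] [::]
    [:: (pt 0 1 1, Nd (Nd 2 (Nd 5 (Nd 4 6 [::]) [:: 5]) [:: 2]) (Nd 0 (Nd 1 3 [:: 7]) [::]) [::]);
        (pt (-2) (-2) (-2), Nd 3 (Nd (Nd 5 (Nd 4 6 [::]) [:: 6; 5]) (Nd 2 (Nd 0 1 [:: 9; 8; 1]) [:: 3; 5]) [::]) [::])]]%N.

Lemma case15 : DT_PT0_mod R V0 (planes (ray i2 `|` boxes [:: t3]) (ray i1 `|` boxes [:: t4]) (boxes [:: mone]) set0) 2%N.
Proof.
rewrite bxk_mone bxk_t3 bxk_t4; apply: (@cert_planes 3 cells15 [:: [:: raycell i2] ++ boxcells [:: [:: 0; 0; 1; 0]]; [:: raycell i1] ++ boxcells [:: [:: 0; 0; 0; 1]]; boxcells [:: [:: 0; 0; 0; 0]]; [::]]%zz cert15 R V0 _ _ _ _ V0E).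
- apply: setU_cells => v; [exact: raycellP|exact: (@boxcellsP [:: [:: 0; 0; 1; 0]]%zz v isT)].
- apply: setU_cells => v; [exact: raycellP|exact: (@boxcellsP [:: [:: 0; 0; 0; 1]]%zz v isT)].
- move=> v; exact: (@boxcellsP [:: [:: 0; 0; 0; 0]]%zz v isT).
- exact: set0_cells.
by vm_compute.
Qed.

End Cases.

Theorem proposition6p19 (R : realType) (s0 : set box -> halffun)
  (s0_choice : sqrt_choice (DTset R mu_empty) (zetaDT R mu_empty) s0)
  (s0_fixed : forall n : nat, VDT R mu_empty s0 n%:Z = magnificent_series n) :
  let holds_mod := DT_PT0_mod R (VDT R mu_empty s0) in
  let lambda l12 l13 l14 l23 l24 l34 :=
    mu_min (legs l12 l13 l14 l23 l24 l34) in
  (* (1) *)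
  holds_mod (lambda [:: mone] [::] [::] [::] [::] [::]) 4%N /\
  (* (2) *)
  holds_mod (lambda [:: mone; t3] [::] [::] [::] [::] [::]) 3%N /\
  (* (3) *)
  holds_mod (lambda [:: mone; t3; t4] [::] [::] [::] [::] [::]) 3%N /\
  (* (4) *)
  holds_mod (lambda [:: mone] [:: mone] [::] [::] [::] [::]) 3%N /\
  (* (5) *)
  holds_mod (lambda [:: mone] [::] [::] [::] [::] [:: mone]) 3%N /\
  (* (6) *)
  holds_mod (lambda [:: mone] [:: mone] [::] [:: mone] [::] [::]) 3%N /\
  (* (7) *)
  holds_mod (lambda [:: mone] [:: mone] [:: mone] [:: mone] [:: mone] [:: mone]) 3%N /\
  (* (8) *)
  holds_mod (lambda [:: mone] [::] [::] [:: mone] [::] [:: mone]) 3%N /\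
  (* (9) *)
  holds_mod (lambda [:: mone; t4] [:: mone] [::] [::] [::] [:: mone]) 3%N /\
  (* (10) *)
  holds_mod (lambda [:: mone; t3] [::] [::] [::] [::] [:: mone]) 3%N /\
  (* (11) *)
  holds_mod (planes (ray i2 `|` boxes [:: t3]) (ray i1) set0 set0) 4%N /\
  (* (12) *)
  holds_mod
    (planes (ray i2 `|` boxes [:: t3; (t2 + t3)%MM]) (ray i1) set0 set0) 3%N /\
  (* (13) *)
  holds_mod
    (planes (ray i2 `|` boxes [:: t3; (t3 + t3)%MM]) (ray i1) set0 set0) 3%N /\
  (* (14) *)
  holds_mod (planes (ray i2) (ray i1) (boxes [:: mone]) set0) 3%N /\
  (* (15) *)
  holds_mod
    (planes (ray i2 `|` boxes [:: t3]) (ray i1 `|` boxes [:: t4])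
            (boxes [:: mone]) set0) 2%N.
Proof.
move=> holds_mod lambda.
by do !split; [
  exact: (case1 R s0_fixed) | exact: (case2 R s0_fixed) | exact: (case3 R s0_fixed) |
  exact: (case4 R s0_fixed) | exact: (case5 R s0_fixed) | exact: (case6 R s0_fixed) |
  exact: (case7 R s0_fixed) | exact: (case8 R s0_fixed) | exact: (case9 R s0_fixed) |
  exact: (case10 R s0_fixed) | exact: (case11 R s0_fixed) | exact: (case12 R s0_fixed) |
  exact: (case13 R s0_fixed) | exact: (case14 R s0_fixed) | exact: (case15 R s0_fixed)].
Qed.
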